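(* Let $n\ge1$, $s\in\{1,\dots,1+n\}$ and let $\hbar\in\mathbb C\setminus\{1/k: k\in\mathbb N, k\ge1\}$. The product $\star_{\mathrm{red},\hbar}$ on $\mathcal P(M_{\mathrm{red}})$, obtained by replacing the formal parameter $\lambda$ by $\hbar$ in $$f\star_{\mathrm{red}} g=\sum_{r=0}^\infty \frac{1}{r!}\,\frac{\lambda^r}{(1-\lambda)(1-2\lambda)\cdots(1-(r-1)\lambda)}\,\big\langle (D^{\mathrm{sym}}_{\mathrm{red}})^r f\otimes (D^{\mathrm{sym}}_{\mathrm{red}})^r g\,,\,H_{\mathrm{red}}^r\big\rangle ,$$ is continuous with respect to the topology of locally uniform convergence of the holomorphic extensions to $\hat M_{\mathrm{red}}$. It therefore extends uniquely to a continuous product on $\mathcal A(M_{\mathrm{red}})$.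
   Context: Setting. Let $\nu_k=+1$ for $0\le k\le s-1$ and $\nu_k=-1$ for $s\le k\le n$. On $\mathbb C^{1+n}$ with standard coordinates $z^0,\dots,z^n$ put $J=\sum_{k=0}^n\nu_k z^k\bar z^k$, $Z=J^{-1}(\{1\})$, $M_{\mathrm{red}}=Z/U(1)$, identified with the open complex submanifold $\{[\rho]: J(\rho)>0\}$ of $\mathbb{CP}^n$; on the dense open subset $\{\rho^0\neq0\}$ use coordinates $w^k([\rho])=\rho^k/\rho^0$, $k=1,\dots,n$. Functions and tensors are complex-valued. Polynomials. $\mathcal P(M_{\mathrm{red}})$ is the algebra of functions of the form $[\rho]\mapsto p(\rho)$ ($\rho\in Z$) with $p$ a $U(1)$-invariant polynomial in $z^0,\dots,z^n,\bar z^0,\dots,\bar z^n$. Analytic functions. Let $\hat J(\xi,\eta)=\sum_{k=0}^n\nu_k\xi^k\eta^k$ on $\mathbb C^{1+n}\times\mathbb C^{1+n}$, $\hat Z=\hat J^{-1}(\{1\})$ and $\hat M_{\mathrm{red}}=\hat Z/\mathbb C^*$, where $\alpha\in\mathbb C^*$ acts by $(\xi,\eta)\mapsto(\alpha\xi,\alpha^{-1}\eta)$; this is a complex manifold, identified with the open subset $\{([\xi],[\eta]):\hat J(\xi,\eta)\neq0\}$ of $\mathbb{CP}^n\times\mathbb{CP}^n$. Let $\Delta_{\mathrm{red}}:M_{\mathrm{red}}\to\hat M_{\mathrm{red}}$, $[\rho]\mapsto[(\rho,\bar\rho)]$ for $\rho\in Z$. Then $\mathcal A(M_{\mathrm{red}})=\{\hat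 g\circ\Delta_{\mathrm{red}}:\hat g\in\mathcal O(\hat M_{\mathrm{red}})\}$; the holomorphic extension $\hat g$ of $g=\hat g\circ\Delta_{\mathrm{red}}$ is unique, and $\mathcal A(M_{\mathrm{red}})$ carries the Fréchet topology of locally uniform convergence of the extensions $\hat g$ on $\hat M_{\mathrm{red}}$. One has $\mathcal P(M_{\mathrm{red}})\subseteq\mathcal A(M_{\mathrm{red}})$ with the subspace topology. The formula. $H_{\mathrm{red}}$ is the smooth section of $T^{(0,1)}M_{\mathrm{red}}\otimes T^{(1,0)}M_{\mathrm{red}}$ given in the coordinates $w$ by $$H_{\mathrm{red}}=\Big(1+\sum_{k}\nu_k\bar w^kw^k\Big)\Big(\sum_{k,\ell=1}^n\bar w^kw^\ell\frac{\partial}{\partial\bar w^k}\otimes\frac{\partial}{\partial w^\ell}+\sum_{k=1}^n\nu_k\frac{\partial}{\partial\bar w^k}\otimes\frac{\partial}{\partial w^k}\Big).$$ $D^{\mathrm{sym}}_{\mathrm{red}}\omega=\sum_i dx^i\vee\nabla_{\partial/\partial x^i}\omega$ (local coordinates), acting on symmetric covariant tensor fields with $\alpha\vee\beta=\mathrm{Sym}(\alpha\otimes\beta)$ ($\mathrm{Sym}$ the averaging projection), where $\nabla$ is the Levi-Civita connection of the (not necessarily definite) metric $$g_{\mathrm{red}}=\frac{\sum_k\nu_k\,d\bar w^k\vee dw^k}{1+\sum_k\nu_k\bar w^kw^k}-\frac{\sum_{k,\ell}\nu_k\nu_\ell\,\bar w^\ell w^k\,d\bar w^k\vee dw^\ell}{(1+\sum_k\nu_k\bar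 w^kw^k)^2}.$$ If $H=\sum H^{ab}\partial_a\otimes\partial_b$, then $\langle\alpha\otimes\beta,H^r\rangle=\sum H^{a_1b_1}\cdots H^{a_rb_r}\alpha_{a_1\dots a_r}\beta_{b_1\dots b_r}$ for symmetric $r$-fold covariant tensors $\alpha,\beta$. For $f,g\in\mathcal P(M_{\mathrm{red}})$ only finitely many terms of the sum over $r$ are non-zero, and the result lies in $\mathcal P(M_{\mathrm{red}})$ after replacing $\lambda$ by $\hbar$. *)

(* Defs.v *)
From HB Require Import structures.
From mathcomp Require Import all_boot all_order all_algebra perm.
From mathcomp Require Import all_classical all_reals all_analysis.
From mathcomp Require Import complex.
From mathcomp Require Import zify ring.
From mathcomp Require mpoly.
Import -(notations) mpoly.

Set Implicit Arguments.
Unset Strict Implicit.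
Unset Printing Implicit Defensive.

Import Order.TTheory GRing.Theory Num.Theory.
Import numFieldNormedType.Exports.

Local Open Scope classical_set_scope.
Local Open Scope ring_scope.
Local Open Scope quotient_scope.

(* The complex numbers over R, packed as a numClosedFieldType so that the
   topology and normed-module structures of numeric fields apply. *)
Definition Cplx (R : realType) : numClosedFieldType := R[i].

Lemma near_eq_differentiable (K : numFieldType) (U U' : normedModType K)
    (f g : U -> U') (x : U) :
  (\forall y \near x, f y = g y) -> differentiable f x -> differentiable g x.
Proof.
move=> fg /diff_locallyP[dfc dfE].
have gE : g \o shift x = cst (g x) + 'd f x +o_ 0 id.
  apply/eqaddoP => e e0; move/eqaddoP: dfE => /(_ e e0).
  have fgx : f x = g x by exact: (nbhs_singleton fg).
  move: fg; rewrite (near_shift 0) subr0 => fg.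
  apply: filterS2 fg => y /= fgy; rewrite !fctE /= fgx fgy; exact.
by apply/diff_locallyP; rewrite (diff_unique dfc gE).
Qed.

Lemma unit_circle_poly0 (K : numClosedFieldType) (q : {poly K}) :
  (forall a : K, `|a| = 1 -> root q a) -> q = 0.
Proof.
move=> qr; apply/eqP/negP => /negP q0.
pose c (k : nat) : K := 1 + 'i * k%:R.
have cJ k : (c k)^* = 1 - 'i * k%:R.
  by rewrite /c rmorphD rmorph1 rmorphM /= conjCi rmorph_nat mulNr.
have c0 k : c k != 0.
  apply/eqP => ck; have := cJ k; rewrite ck rmorph0 => ck'.
  have : c k + (1 - 'i * k%:R) = 2 by rewrite /c; ring.
  by rewrite ck -ck' addr0 => /eqP; rewrite eq_sym pnatr_eq0.
pose u k := c k / (c k)^*.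
have u1 k : `|u k| = 1 by rewrite normf_div norm_conjC divff // normr_eq0.
have uinj : injective u.
  move=> k l /eqP; rewrite eqr_div ?conjC_eq0 // !cJ /c => /eqP e.
  have : 'i * (2 * k%:R) = 'i * (2 * l%:R) :> K.
    apply/eqP; rewrite -subr_eq0; apply/eqP; transitivity
      ((1 + 'i * k%:R) * (1 - 'i * l%:R) - (1 + 'i * l%:R) * (1 - 'i * k%:R) : K).
      by ring.
    by rewrite e subrr.
  move=> /(mulfI (neq0Ci _)) /(mulfI _) h.
  by apply/eqP; rewrite -(eqr_nat K) h // pnatr_eq0.
have := @max_poly_roots _ q [seq u k | k <- iota 0 (size q)] q0.
rewrite map_inj_uniq // iota_uniq size_map size_iota ltnn.
suff -> : all (root q) [seq u k | k <- iota 0 (size q)] by move=> /(_ isT isT).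
by apply/allP => _ /mapP[k _ ->]; exact: qr.
Qed.

Section ReducedSpace.
Variables (R : realType) (n s : nat).
Local Notation C := (Cplx R).
Local Notation V := 'rV[C]_n.+1.

Definition nu (k : nat) : C := if (k < s)%N then 1 else - 1.

Definition J (z : V) : C := \sum_(k < n.+1) nu k * z 0 k * (z 0 k)^*.

Definition Jhat (x : V * V) : C := \sum_(k < n.+1) nu k * x.1 0 k * x.2 0 k.

Definition Z : set V := [set z | J z = 1].
Definition Zhat : set (V * V) := [set x | Jhat x = 1].

Definition U1_rel (z1 z2 : Z) : bool :=
  `[< exists2 a : C, `|a| = 1 & set_val z2 = a *: set_val z1 >].

Definition Cstar_rel (x1 x2 : Zhat) : bool :=
  `[< exists2 a : C, a != 0 &
      set_val x2 = (a *: (set_val x1).1, a^-1 *: (set_val x1).2) >].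

Lemma U1_rel_equiv : equiv_class_of U1_rel.
Proof.
split.
- by move=> z; apply/asboolP; exists 1; rewrite ?normr1 ?scale1r.
- suff H z1 z2 : U1_rel z1 z2 -> U1_rel z2 z1 by move=> z1 z2; apply/idP/idP; exact: H.
  move=> /asboolP[a a1 e]; apply/asboolP; exists a^-1; first by rewrite normfV a1 invr1.
  by rewrite e scalerA mulVf ?scale1r // -normr_gt0 a1.
- move=> z2 z1 z3 /asboolP[a a1 e] /asboolP[b b1 e']; apply/asboolP.
  by exists (b * a); rewrite ?normrM ?a1 ?b1 ?mulr1 // e' e scalerA.
Qed.

Lemma Cstar_rel_equiv : equiv_class_of Cstar_rel.
Proof.
split.
- move=> x; apply/asboolP; exists 1; rewrite ?oner_eq0 //.
  by rewrite invr1 !scale1r -surjective_pairing.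
- suff H x1 x2 : Cstar_rel x1 x2 -> Cstar_rel x2 x1.
    by move=> x1 x2; apply/idP/idP; exact: H.
  move=> /asboolP[a a0 e]; apply/asboolP; exists a^-1; first by rewrite invr_eq0.
  by rewrite e /= !scalerA !mulVf ?invr_eq0 // !scale1r -surjective_pairing.
- move=> x2 x1 x3 /asboolP[a a0 e] /asboolP[b b0 e']; apply/asboolP.
  by exists (b * a); rewrite ?mulf_neq0 // e' e /= !scalerA invfM.
Qed.

Canonical U1_equiv := EquivRelPack U1_rel_equiv.
Canonical Cstar_equiv := EquivRelPack Cstar_rel_equiv.

Definition Mred : Type := {eq_quot U1_equiv}.
HB.instance Definition _ := Choice.copy Mred {eq_quot U1_equiv}.

Definition Mhat : Type := quotient_topology {eq_quot Cstar_equiv}.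
HB.instance Definition _ :=
  Topological.copy Mhat (quotient_topology {eq_quot Cstar_equiv}).

Definition cls (z : Z) : Mred := \pi_({eq_quot U1_equiv}) z.
Definition clshat (x : Zhat) : Mhat := \pi_({eq_quot Cstar_equiv}) x.

(* f([z]) when J(z) > 0, i.e. f viewed on an open subset of CP^n; otherwise
   z / sqrt(J(z)) is not in Z and the value is 0. *)
Definition eval_cone (f : Mred -> C) (z : V) : C :=
  oapp (f \o cls) 0 (insub ((sqrtC (J z))^-1 *: z)).

(* g([xi], [eta]) when Jhat(xi, eta) is nonzero, and 0 otherwise. *)
Definition eval_conehat (g : Mhat -> C) (x : V * V) : C :=
  oapp (g \o clshat) 0 (insub ((Jhat x)^-1 *: x.1, x.2)).

(* Homogeneous coordinates, with i-th entry 1, of the point with affine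
   coordinates u in the i-th standard chart of CP^n. *)
Definition affine (i : 'I_n.+1) (u : 'rV[C]_n) : V :=
  \row_k oapp (u 0) 1 (unlift i k).

(* Complex (Frechet) differentiability in all products of standard charts. *)
Definition holomorphic (g : Mhat -> C) : Prop :=
  forall (i j : 'I_n.+1) (u v : 'rV[C]_n), Jhat (affine i u, affine j v) != 0 ->
  differentiable (fun uv : 'rV[C]_n * 'rV[C]_n =>
    eval_conehat g (affine i uv.1, affine j uv.2)) (u, v).

Definition cconj (z : V) : V := map_mx Num.conj z.

Lemma Jhat_diag (z : V) : Jhat (z, cconj z) = J z.
Proof. by apply: eq_bigr => k _; rewrite mxE. Qed.

Lemma diag_subproof (z : Z) : (set_val z, cconj (set_val z)) \in Zhat.
Proof. by apply/mem_set; rewrite /Zhat /= Jhat_diag; exact: (set_mem (valP z)). Qed.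

Definition diag (z : Z) : Zhat := SigSub (diag_subproof z).

Definition Delta (x : Mred) : Mhat :=
  clshat (diag (repr (x : {eq_quot U1_equiv}))).

Lemma Delta_cls (z : Z) : Delta (cls z) = clshat (diag z).
Proof.
rewrite /Delta /cls /clshat; apply/eqquotP => /=.
case: piP => z' /eqquotP /= /asboolP[a a1 e].
have a0 : a != 0 by rewrite -normr_gt0 a1.
apply/asboolP; exists a^-1; first by rewrite invr_eq0.
rewrite /diag /= /set_val /= in e *; rewrite e scalerA mulVf // scale1r invrK.
congr pair; apply/rowP => k; rewrite !mxE rmorphM mulrA.
by rewrite -normCK a1 expr1n mul1r.
Qed.

Definition analytic : {pred (Mred -> C)} :=
  [pred f | `[< exists2 fhat : Mhat -> C,
                  holomorphic fhat & f = fhat \o Delta >]].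

Lemma analytic_submod_closed : submod_closed analytic.
Proof.
split=> [|a f g]; first apply/asboolP.
  exists (fun=> 0) => // i j u v _.
  rewrite [X in differentiable X _](_ : _ = cst 0); first exact: differentiable_cst.
  by apply/funext => uv; rewrite /eval_conehat; case: insub.
move=> /asboolP[fh fhol fE] /asboolP[gh ghol gE]; apply/asboolP.
exists (fun x => a * fh x + gh x) => [i j u v h|]; last by rewrite fE gE.
rewrite [X in differentiable X _](_ : _ = a *: (fun uv : 'rV[C]_n * 'rV[C]_n =>
    eval_conehat fh (affine i uv.1, affine j uv.2)) +
  (fun uv : 'rV[C]_n * 'rV[C]_n =>
    eval_conehat gh (affine i uv.1, affine j uv.2))).
  by apply: differentiableD; [apply: differentiableZ; exact: fhol|exact: ghol].
apply/funext => uv; rewrite /eval_conehat !fctE /=.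
by case: insub => //=; rewrite scaler0 addr0.
Qed.

HB.instance Definition _ := GRing.isSubmodClosed.Build C (Mred -> C) analytic
  analytic_submod_closed.

Definition AMred : Type := {f : Mred -> C | f \in analytic}.
HB.instance Definition _ := [isSub of AMred for (@sval _ _ : AMred -> _)].
HB.instance Definition _ := [Choice of AMred by <:].
HB.instance Definition _ := [SubChoice_isSubLmodule of AMred by <:].

(* The holomorphic extension of f to Mhat. *)
Definition hol_ext (f : AMred) : {family compact, Mhat -> C} :=
  s2val (cid2 (asboolW (valP f))).

(* Mhat is locally compact, so locally uniform convergence is convergence in
   the topology of uniform convergence on compact subsets. *)
HB.instance Definition _ := Topological.copy AMred (initial_topology hol_ext).

Local Notation poly2 := (mpoly (n.+1 + n.+1) C).

(* Polynomials in z^0, ..., z^n (first n+1 variables) and their conjugates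
   (last n+1 variables); the latter are evaluated at x.2. *)
Definition peval (p : poly2) (x : V * V) : C :=
  meval
    (fun i => match fintype.split i with inl k => x.1 0 k | inr k => x.2 0 k end) p.

Definition U1_invariant (p : poly2) : Prop :=
  forall (a : C) (z : V), `|a| = 1 ->
  peval p (a *: z, cconj (a *: z)) = peval p (z, cconj z).

Definition polynomial : {pred (Mred -> C)} :=
  [pred f | `[< exists2 p : poly2, U1_invariant p &
     forall z : Z, f (cls z) = peval p (set_val z, cconj (set_val z)) >]].

Let mono (m : multinom (n.+1 + n.+1)) (x : V * V) : C :=
  \prod_k x.1 0 k ^+ fun_of_multinom m (lshift n.+1 k) *
  \prod_k x.2 0 k ^+ fun_of_multinom m (rshift n.+1 k).
Let deg1 (m : multinom (n.+1 + n.+1)) : nat :=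
  (\sum_k fun_of_multinom m (lshift n.+1 k))%N.
Let deg2 (m : multinom (n.+1 + n.+1)) : nat :=
  (\sum_k fun_of_multinom m (rshift n.+1 k))%N.
(* The part of p whose degrees in z and in conj(z) agree. *)
Let balanced (p : poly2) (x : V * V) : C :=
  \sum_(m <- msupp p | deg1 m == deg2 m) mcoeff m p * mono m x.

Let monoZ m (a b : C) x : mono m (a *: x.1, b *: x.2) =
  a ^+ deg1 m * b ^+ deg2 m * mono m x.
Proof.
rewrite /mono /deg1 /deg2 /= -!prodrXr mulrACA -!big_split /=.
by apply: eq_bigr => k _; rewrite !mxE !exprMn.
Qed.

Let pevalE (p : poly2) x :
  peval p x = \sum_(m <- msupp p) mcoeff m p * mono m x.
Proof.
rewrite /peval mevalE; apply: eq_bigr => m _; congr (_ * _).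
rewrite big_split_ord /=; congr (_ * _); apply: eq_bigr => k _.
  by rewrite (unsplitK (inl k)).
by rewrite (unsplitK (inr k)).
Qed.

Let balancedZ p (a : C) x : a != 0 -> balanced p (a *: x.1, a^-1 *: x.2) = balanced p x.
Proof.
move=> a0; apply: eq_bigr => m /eqP e; rewrite monoZ e -exprMn divff //.
by rewrite expr1n mul1r.
Qed.

Let balancedE p (z : V) : U1_invariant p -> peval p (z, cconj z) = balanced p (z, cconj z).
Proof.
move=> pU; set x := (z, cconj z).
pose c m : C := mcoeff m p * mono m x.
pose D := (\sum_(m <- msupp p) deg2 m)%N.
have leD m : m \in msupp p -> (deg2 m <= D)%N.
  by move=> mp; rewrite /D (big_rem m mp) leq_addr.
pose q : {poly C} := \sum_(m <- msupp p) c m *: 'X^(D + deg1 m - deg2 m)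
  - peval p x *: 'X^D.
have q0 : q = 0.
  apply: unit_circle_poly0 => a a1; have a0 : a != 0 by rewrite -normr_gt0 a1.
  have aV : a^* = a^-1 by rewrite -[a^*](mulKf a0) -normCK a1 expr1n mulr1.
  apply/eqP; rewrite /q hornerD hornerN hornerZ hornerXn horner_sum.
  apply/eqP; rewrite subr_eq0; apply/eqP; rewrite -(pU a z a1) pevalE big_distrl /=.
  apply: eq_big_seq => m mp; rewrite hornerZ hornerXn /c.
  have -> : cconj (a *: z) = a^-1 *: cconj z.
    by apply/rowP => k; rewrite !mxE rmorphM /= aV.
  rewrite (monoZ m a a^-1 x) exprB ?unitfE ?ltn_addr ?leq_addr // ?(leq_trans (leD m mp)) ?leq_addr //.
  have aux (A B E c' M : C) : c' * M * (A * B * E) = c' * (B * E * M) * A by ring.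
  by rewrite exprD exprVn; exact: aux.
have := congr1 (fun r : {poly C} => r`_D) q0; rewrite coef0 coefB coefZ coefXn eqxx mulr1.
move=> /eqP; rewrite subr_eq0 => /eqP <-; rewrite coef_sum /balanced [RHS]big_mkcond /=.
apply: eq_big_seq => m mp; rewrite coefZ coefXn.
have -> : (D == D + deg1 m - deg2 m)%N = (deg1 m == deg2 m).
  by have := leD m mp; lia.
by case: eqP; rewrite ?mulr1 ?mulr0.
Qed.


Local Notation U := ('rV[C]_n * 'rV[C]_n)%type.

Let diffM' (f g : U -> C) x : differentiable f x -> differentiable g x ->
  differentiable (fun y => f y * g y) x.
Proof. exact: differentiableM. Qed.

Let diffX' (f : U -> C) k x : differentiable f x ->
  differentiable (fun y => f y ^+ k) x.
Proof.
move=> df; elim: k => [|k IH]; first exact: differentiable_cst.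
rewrite [X in differentiable X _](_ : _ = fun y => f y * f y ^+ k); first exact: diffM'.
by apply/funext => y; rewrite exprS.
Qed.

Let diff_big (T : Type) (op : C -> C -> C) (e : C) (r : seq T) (P : pred T)
    (F : T -> U -> C) x :
  (forall f g : U -> C, differentiable f x -> differentiable g x ->
     differentiable (fun y => op (f y) (g y)) x) ->
  (forall t, differentiable (F t) x) ->
  differentiable (fun y => \big[op/e]_(t <- r | P t) F t y) x.
Proof.
move=> dop dF; elim: r => [|t r IH].
  rewrite [X in differentiable X _](_ : _ = cst e); first exact: differentiable_cst.
  by apply/funext => y; rewrite big_nil.
under eq_fun do rewrite big_cons.
by case: (P t) => //; exact: dop.
Qed.

Let diff_fst i k (x : U) : differentiable (fun y : U => affine i y.1 0 k) x.
Proof.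
under eq_fun do rewrite mxE.
case: unliftP => [l _|_] /=; last exact: differentiable_cst.
apply: (@differentiable_comp _ _ _ _ fst (fun u : 'rV[C]_n => u 0 l)).
  by apply: linear_differentiable => y; exact: cvg_fst.
exact: differentiable_coord.
Qed.

Let diff_snd i k (x : U) : differentiable (fun y : U => affine i y.2 0 k) x.
Proof.
under eq_fun do rewrite mxE.
case: unliftP => [l _|_] /=; last exact: differentiable_cst.
apply: (@differentiable_comp _ _ _ _ snd (fun u : 'rV[C]_n => u 0 l)).
  by apply: linear_differentiable => y; exact: cvg_snd.
exact: differentiable_coord.
Qed.

Let diff_Jhat i j (x : U) :
  differentiable (fun y : U => Jhat (affine i y.1, affine j y.2)) x.
Proof.
apply: diff_big => [f g|k]; first exact: differentiableD.
apply: diffM' => //=; apply: diffM' => //; exact: differentiable_cst.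
Qed.

Lemma polynomial_analytic : {subset polynomial <= analytic}.
Proof.
move=> f /asboolP[p pU fE]; apply/asboolP.
pose g (x : Mhat) : C :=
  balanced p (set_val (repr (x : {eq_quot (Cstar_equiv)}))).
have gE x : g (clshat x) = balanced p (set_val x).
  rewrite /g /clshat; case: piP => x' /eqquotP /= /asboolP[a a0 ->].
  by rewrite balancedZ.
exists g; last first.
  apply/funext => x /=; elim/quotW: (x : {eq_quot (U1_equiv)}) => z.
  by rewrite -[\pi z]/(cls z) Delta_cls gE fE balancedE.
move=> i j u v J0.
apply: (@near_eq_differentiable _ _ _ (fun y : U =>
  balanced p ((Jhat (affine i y.1, affine j y.2))^-1 *: affine i y.1, affine j y.2))).
  have /differentiable_continuous/cvgr_neq0 := diff_Jhat i j (u, v).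
  move=> /(_ J0); apply: filterS => y Jy0; rewrite /eval_conehat.
  case: insubP => [x _ xE|/negP[]] /=; first by rewrite gE -xE.
  apply/mem_set; rewrite /Zhat /= -[RHS](mulVf Jy0) /Jhat mulr_sumr.
  by apply: eq_bigr => k _; rewrite mxE /=; ring.
apply: diff_big => [f1 f2|m]; first exact: differentiableD.
apply: diffM'; first exact: differentiable_cst.
apply: diffM'; apply: diff_big => [f1 f2|k]; try exact: diffM'; apply: diffX' => //=.
under eq_fun do rewrite mxE.
by apply: diffM' => //; apply: differentiableV.
Qed.

Definition PMred : Type := {f : Mred -> C | f \in polynomial}.
HB.instance Definition _ := [isSub of PMred for (@sval _ _ : PMred -> _)].
HB.instance Definition _ := [Choice of PMred by <:].

Definition PMred_AMred (f : PMred) : AMred :=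
  exist _ (val f) (polynomial_analytic (valP f)).

HB.instance Definition _ := Topological.copy PMred (initial_topology PMred_AMred).


Local Notation W := 'rV[C]_n.

(* J(1, w^1, ..., w^n), see J_affine. The coordinates w identify the chart with
   the set of w such that 0 < rho w. Here w 0 k is w^{k+1}. *)
Definition rho (w : W) : C :=
  1 + \sum_(k < n) nu k.+1 * (w 0 k)^* * w 0 k.

Lemma J_affine (w : W) : (0 < s)%N -> J (affine ord0 w) = rho w.
Proof.
move=> s0; rewrite /J big_ord_recl; congr (_ + _).
  by rewrite mxE unlift_none /= /nu s0 rmorph1 !mulr1.
apply: eq_bigr => k _; rewrite mxE liftK /=.
by rewrite -!mulrA [w 0 k * _]mulrC.
Qed.

Definition in_chart (f : Mred -> C) (w : W) : C := eval_cone f (affine ord0 w).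

Definition ofR (t : R) : C := (t%:C)%C.

(* Derivative at w along the real line through w directed by v. *)
Definition Rderive (v : W) (f : W -> C) (w : W) : C :=
  lim ((ofR t)^-1 * (f (w + ofR t *: v) - f w) @[t --> (0 : R)^']).

Definition d_w (k : 'I_n) (f : W -> C) (w : W) : C :=
  2^-1 * (Rderive (delta_mx 0 k) f w - 'i * Rderive ('i *: delta_mx 0 k) f w).

Definition d_wbar (k : 'I_n) (f : W -> C) (w : W) : C :=
  2^-1 * (Rderive (delta_mx 0 k) f w + 'i * Rderive ('i *: delta_mx 0 k) f w).

(* Frame indices a : 'I_(n + n) of the complexified tangent bundle: lshift n k
   stands for d/dw^k and dw^k, rshift n k for d/dwbar^k and dwbar^k. *)
Definition partial (a : 'I_(n + n)) (f : W -> C) : W -> C :=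
  match fintype.split a with inl k => d_w k f | inr k => d_wbar k f end.

(* Components of sum_{k,l} T k l dwbar^k (x) dw^l, or of
   sum_{k,l} T k l d/dwbar^k (x) d/dw^l. *)
Definition mixed (T : 'I_n -> 'I_n -> C) (a b : 'I_(n + n)) : C :=
  match fintype.split a, fintype.split b with
  | inr k, inl l => T k l
  | _, _ => 0
  end.

Definition H_red (w : W) : 'I_(n + n) -> 'I_(n + n) -> C :=
  mixed (fun k l =>
    rho w * ((w 0 k)^* * w 0 l + (k == l)%:R * nu k.+1)).

(* dwbar^k \/ dw^l = (dwbar^k (x) dw^l + dw^l (x) dwbar^k) / 2. *)
Definition g_red (w : W) : 'M[C]_(n + n) :=
  let h := mixed (fun k l =>
    (k == l)%:R * nu k.+1 / rho w -
    nu k.+1 * nu l.+1 * (w 0 l)^* * w 0 k / rho w ^+ 2) in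
  \matrix_(a, b) (2^-1 * (h a b + h b a)).

Definition christoffel (c a b : 'I_(n + n)) (w : W) : C :=
  2^-1 * \sum_d invmx (g_red w) c d *
    (partial a (fun x => g_red x b d) w + partial b (fun x => g_red x a d) w
     - partial d (fun x => g_red x a b) w).

Lemma g_redC (w : W) (a b : 'I_(n + n)) : g_red w a b = g_red w b a.
Proof. by rewrite !mxE addrC. Qed.

Lemma g_red_unit (w : W) : rho w != 0 -> g_red w \in unitmx.
Proof.
move=> r0; pose u k : C := nu k.+1.
have uu k : u k * u k = 1 by rewrite /u /nu; case: ifP => _; ring.
have rE : \sum_(k < n) u k * (w 0 k)^* * w 0 k = rho w - 1.
  by rewrite /rho addrC addKr.
pose h (k l : 'I_n) := (k == l)%:R * u k / rho w -
  u k * u l * (w 0 l)^* * w 0 k / rho w ^+ 2.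
pose H (k l : 'I_n) := rho w * ((w 0 k)^* * w 0 l + (k == l)%:R * u k).
have delta (F : 'I_n -> C) k : \sum_(l < n) (k == l)%:R * F l = F k.
  rewrite (bigD1 k) //= eqxx mul1r big1 ?addr0 // => l lk.
  by rewrite eq_sym (negPf lk) mul0r.
have row k m : \sum_(l < n) h k l * H m l = (k == m)%:R.
  have -> : \sum_(l < n) h k l * H m l =
      u k * (w 0 m)^* * \sum_(l < n) (k == l)%:R * w 0 l
    + u k * \sum_(l < n) (k == l)%:R * ((m == l)%:R * u m)
    - u k * w 0 k * (w 0 m)^* / rho w * \sum_(l < n) u l * (w 0 l)^* * w 0 l
    - u k * w 0 k / rho w * u m * \sum_(l < n) (m == l)%:R * (u l * (w 0 l)^*).
    rewrite !mulr_sumr -big_split -!sumrB /=; apply: eq_bigr => l _.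
    by rewrite /h /H; field.
  rewrite !delta rE [m == k]eq_sym.
  have -> : u k * ((k == m)%:R * u m) = (k == m)%:R.
    by case: eqP => [->|]; rewrite ?mul0r ?mulr0 // mul1r uu.
  have -> : u k * w 0 k / rho w * u m * (u m * (w 0 m)^*) =
      u k * w 0 k / rho w * (w 0 m)^* * (u m * u m) by ring.
  by rewrite uu; field.
have col k m : \sum_(l < n) h l k * H l m = (k == m)%:R.
  have -> : \sum_(l < n) h l k * H l m =
      u k * w 0 m * \sum_(l < n) (k == l)%:R * (w 0 l)^*
    + u k * \sum_(l < n) (k == l)%:R * ((m == l)%:R * u m)
    - u k * (w 0 k)^* * w 0 m / rho w * \sum_(l < n) u l * (w 0 l)^* * w 0 l
    - u k * (w 0 k)^* / rho w * u m * \sum_(l < n) (m == l)%:R * (u l * w 0 l).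
    rewrite !mulr_sumr -big_split -!sumrB /=; apply: eq_bigr => l _.
    rewrite /h /H ![l == _]eq_sym.
    by case: (k =P l) => [->|_]; case: (m =P l) => [->|_]; rewrite /=; field.
  rewrite !delta rE [m == k]eq_sym.
  have -> : u k * ((k == m)%:R * u m) = (k == m)%:R.
    by case: eqP => [->|]; rewrite ?mul0r ?mulr0 // mul1r uu.
  have -> : u k * (w 0 k)^* / rho w * u m * (u m * w 0 m) =
      u k * (w 0 k)^* / rho w * w 0 m * (u m * u m) by ring.
  by rewrite uu; field.
have [] // := @mulmx1_unit _ _ (g_red w)
  (\matrix_(a, b) (2 * (H_red w a b + H_red w b a))).
have spl k : fintype.split (lshift n k) = inl k :> 'I_n + 'I_n by exact: (unsplitK (inl k)).
have spr k : fintype.split (rshift n k) = inr k :> 'I_n + 'I_n by exact: (unsplitK (inr k)).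
have half (x y : C) : 2^-1 * (x + 0) * (2 * (0 + y)) = x * y by field.
have half' (x y : C) : 2^-1 * (0 + x) * (2 * (y + 0)) = x * y by field.
apply/matrixP => a b; rewrite !mxE big_split_ord /=.
rewrite -[a]splitK -[b]splitK.
case: (fintype.split a) => k; case: (fintype.split b) => m /=.
- rewrite big1 => [|i _]; last by rewrite !mxE /H_red /mixed !spl !addr0 mulr0 mul0r.
  rewrite add0r eq_lshift -col; apply: eq_bigr => i _.
  by rewrite !mxE /H_red /mixed !spl !spr half'.
- rewrite big1 => [|i _]; last by rewrite !mxE /H_red /mixed !spl !addr0 mulr0 mul0r.
  rewrite big1 => [|i _]; first by rewrite addr0 eq_lrshift.
  by rewrite !mxE /H_red /mixed !spr !addr0 !mulr0.
- rewrite big1 => [|i _]; last by rewrite !mxE /H_red /mixed !spl !addr0 !mulr0.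
  rewrite big1 => [|i _]; first by rewrite addr0 eq_rlshift.
  by rewrite !mxE /H_red /mixed !spr !addr0 mulr0 mul0r.
rewrite [X in _ + X]big1 => [|i _]; last by rewrite !mxE /H_red /mixed !spr !addr0 mulr0 mul0r.
rewrite addr0 eq_rshift -row; apply: eq_bigr => i _.
by rewrite !mxE /H_red /mixed !spl !spr half.
Qed.

(* The connection with coefficients nabla_a d_b = sum_c Gamma^c_{ab} d_c is, at
   w, torsion-free and compatible with g_red. *)
Definition levi_civita (Gamma : 'I_(n + n) -> 'I_(n + n) -> 'I_(n + n) -> C)
    (w : W) : Prop :=
  (forall a b c, Gamma c a b = Gamma c b a) /\
  (forall a b c, partial a (fun x => g_red x b c) w =
     \sum_d (Gamma d a b * g_red w d c + Gamma d a c * g_red w b d)).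

(* christoffel is the Levi-Civita connection of g_red; see g_red_unit. *)
Lemma christoffelP (w : W) (Gamma : 'I_(n + n) -> 'I_(n + n) -> 'I_(n + n) -> C) :
  g_red w \in unitmx ->
  levi_civita Gamma w <-> forall a b c, Gamma c a b = christoffel c a b w.
Proof.
move=> gU; pose P a b c := partial a (fun x => g_red x b c) w.
have PC a b c : P a b c = P a c b.
  by rewrite /P; congr partial; apply/funext => x; exact: g_redC.
have chE c a b : christoffel c a b w =
    2^-1 * \sum_d invmx (g_red w) c d * (P a b d + P b a d - P d a b) by [].
have low a b c : \sum_d g_red w c d * christoffel d a b w =
    2^-1 * (P a b c + P b a c - P c a b).
  under eq_bigr do rewrite chE mulrCA.
  rewrite -mulr_sumr; congr (_ * _).
  under eq_bigr do rewrite mulr_sumr.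
  rewrite exchange_big /= (bigD1 c) //= [X in _ + X]big1 => [|d dc].
    rewrite addr0; under eq_bigr do rewrite mulrA.
    rewrite -mulr_suml; suff -> : \sum_i g_red w c i * invmx (g_red w) i c = 1.
      by rewrite mul1r.
    by have /matrixP/(_ c c) := mulmxV gU; rewrite !mxE eqxx.
  under eq_bigr do rewrite mulrA.
  rewrite -mulr_suml; suff -> : \sum_i g_red w c i * invmx (g_red w) i d = 0.
    by rewrite mul0r.
  by have /matrixP/(_ c d) := mulmxV gU; rewrite !mxE eq_sym (negPf dc).
split=> [[tf mc] a b c|GE].
  pose L a b c := \sum_d g_red w c d * Gamma d a b.
  have PE a' b' c' : P a' b' c' = L a' b' c' + L a' c' b'.
    rewrite /P mc big_split /=; congr (_ + _); apply: eq_bigr => d _.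
      by rewrite g_redC mulrC.
    by rewrite mulrC.
  have LC a' b' c' : L a' b' c' = L b' a' c'.
    by apply: eq_bigr => d _; rewrite tf.
  have LE d : L a b d = 2^-1 * (P a b d + P b a d - P d a b).
    by rewrite !PE (LC b a) (LC d a) (LC d b); field.
  rewrite chE mulr_sumr; under eq_bigr => d _ do rewrite mulrCA -LE /L mulr_sumr.
  rewrite exchange_big /= (bigD1 c) //= [X in _ + X]big1 => [|d dc].
    rewrite addr0; under eq_bigr do rewrite mulrA.
    rewrite -mulr_suml; suff -> : \sum_i invmx (g_red w) c i * g_red w i c = 1.
      by rewrite mul1r.
    by have /matrixP/(_ c c) := mulVmx gU; rewrite !mxE eqxx.
  under eq_bigr do rewrite mulrA.
  rewrite -mulr_suml; suff -> : \sum_i invmx (g_red w) c i * g_red w i d = 0.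
    by rewrite mul0r.
  by have /matrixP/(_ c d) := mulVmx gU; rewrite !mxE eq_sym (negPf dc).
split=> a b c.
  by rewrite !GE !chE; congr (_ * _); apply: eq_bigr => d _;
     rewrite [P a b d + _]addrC [P d a b]PC.
rewrite -[LHS]/(P a b c) big_split /=.
under eq_bigr do rewrite GE mulrC g_redC; rewrite low.
under [X in _ + X]eq_bigr do rewrite GE mulrC; rewrite low.
rewrite [P a c b]PC.
by field.
Qed.

Definition tensor (r : nat) : Type := {ffun 'I_r -> 'I_(n + n)} -> W -> C.

(* The new covariant index comes first: (nabla om)_{c b} = (nabla_{d_c} om)_b. *)
Definition nabla (r : nat) (om : tensor r) : tensor r.+1 := fun a w =>
  let c := a ord0 in
  let b := [ffun j => a (lift ord0 j)] in
  partial c (om b) w -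
  \sum_(j < r) \sum_(d < n + n)
    christoffel d c (b j) w * om [ffun i => if i == j then d else b i] w.

Definition Sym (r : nat) (om : tensor r) : tensor r := fun a w =>
  (r`!%:R)^-1 * \sum_(p : 'S_r) om [ffun j => a (p j)] w.

(* sum_i dx^i \/ nabla_{d_i} om = Sym (sum_i dx^i (x) nabla_{d_i} om). *)
Definition Dsym (r : nat) (om : tensor r) : tensor r.+1 := Sym (nabla om).

Fixpoint Dsym_iter (f : W -> C) (r : nat) : tensor r :=
  if r is r'.+1 then Dsym (@Dsym_iter f r') else fun _ => f.
Arguments Dsym_iter : clear implicits.

Definition pairing (r : nat) (al be : tensor r) (w : W) : C :=
  \sum_(a : {ffun 'I_r -> 'I_(n + n)}) \sum_(b : {ffun 'I_r -> 'I_(n + n)})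
    (\prod_(j < r) H_red w (a j) (b j)) * al a w * be b w.

Definition star_coef (hbar : C) (r : nat) : C :=
  (r`!%:R)^-1 * (hbar ^+ r / \prod_(1 <= j < r) (1 - j%:R * hbar)).

(* h is the product of f and g. The chart is dense in M_red and elements of
   P(M_red) are continuous, so the formula in the coordinates w determines h.
   B vanishes from rank N on, so the sum over all r is the sum over r < N. *)
Definition is_star (hbar : C) (f g h : PMred) : Prop :=
  let B r := pairing (Dsym_iter (in_chart (val f)) r) (Dsym_iter (in_chart (val g)) r) in
  exists N : nat,
    (forall r w, (N <= r)%N -> 0 < rho w -> B r w = 0) /\
    (forall w, 0 < rho w ->
       in_chart (val h) w = \sum_(r < N) star_coef hbar r * B r w).

(* Bilinear and associative. *)
Definition is_product (m : AMred -> AMred -> AMred) : Prop :=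
  [/\ forall (a : C) (f f' g : AMred), m (a *: f + f') g = a *: m f g + m f' g,
      forall (a : C) (f g g' : AMred), m f (a *: g + g') = a *: m f g + m f g' &
      forall f g h : AMred, m f (m g h) = m (m f g) h].


End ReducedSpace.

(* Main.v *)
From HB Require Import structures.
Require Import Defs.
From mathcomp Require Import all_boot all_order all_algebra.
From mathcomp Require Import perm cyclic separable cyclotomic.
From mathcomp Require Import all_classical all_reals all_analysis.
From mathcomp Require Import complex zify ring lra.
From mathcomp Require mpoly.
Import -(notations) mpoly.
Import Order.TTheory GRing.Theory Num.Theory.
Import numFieldNormedType.Exports.
Set Implicit Arguments.
Unset Strict Implicit.
Unset Printing Implicit Defensive.
Local Open Scope classical_set_scope.
Local Open Scope ring_scope.

(** A polynomial on M_red extends to a function on Zhat that is a sum of terms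
  c (a.xi)^m (b.eta)^m, for every large m. In the affine chart the covariant
  derivatives of such functions can be computed explicitly, and the r-th term
  of the star product of two generators is, with beta = sum_k nu_k b_k a'_k,
    (m^_r)^2 c c' (a.xi)^m (b.eta)^(m-r) (b'.eta)^m (a'.xi)^(m-r)
      (beta Jhat - (a'.xi)(b.eta))^r,
  so the series stops at r = m.

  On Zhat the same operator is the contraction of r directional derivatives
  in eta of the first factor with r directional derivatives in xi of the
  second one, along vectors tangent to Zhat. Writing these derivatives as
  averages over roots of unity on circles of radius T / r gives the Cauchy
  bound (n + 1)^r (r / T)^(2r), whereas the r-th coefficient is at most
  c B^r / r^(2r) because hbar is not of the form 1/k. For T large the
  product is therefore bounded on a compact set by a constant times the
  product of the suprema of the factors over a larger compact set.

  Associativity is a rational identity in hbar. For hbar = 1/k with k large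
  the coefficients are the binomials C(k, r) / (k^_r)^2, and the product is
  composition of kernels of degree k, so the identity holds for infinitely
  many values of hbar.

  P(M_red) is dense in A(M_red): a holomorphic function on the cone is
  approximated by polynomials on two polydiscs parametrizing the parts
  eta_0 <> 0 and xi_0 <> 0 of Zhat, and the two approximations are glued
  along the nonnegative and negative parts of a Laurent expansion. As A(M_red)
  is complete by Weierstrass' theorem, the product extends. *)

(** The number of terms in a product of polynomials grows with their degree, so continuity needs a
    bound that does not see the degree [m]. For fixed xi the function [Jhat] is affine in eta, so
    translating by tangent vectors never leaves [Zhat], and the radius T / r keeps the total
    displacement of r translations at T: one larger compact set serves all r. Averages over roots of
    unity compute derivatives of polynomials exactly, so the operator does not depend on the radius,
    which may be adapted to each r. The formula to be matched is given only at the points of a real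
    chart; an identity theorem on the cone over [Mhat] transports it to all of [Zhat], where
    estimates and associativity are proved. The values 1/k are excluded for hbar, yet they can be
    used for associativity, because there only coefficients with r <= k occur and their denominators
    do not vanish. In the density argument neither polydisc approximation descends to the cone:
    along an orbit of the multiplicative group each becomes a Laurent polynomial, and only exponents
    of one sign give polynomials on the cone, whence the gluing. *)

Section ComplexLimits.
Variable R : realType.
Local Notation C := (Cplx R).

Lemma Re_continuous : continuous (fun z : C => complex.Re z : R).
Proof.
move=> z; apply/(@cvgrPdist_le _ _ _ (nbhs z) (nbhs_filter z)) => e e0.
have e0' : 0 < ofR e by rewrite /ofR ltcR.
have := nbhsx_ballx (z : C) _ e0'.
apply: filterS => y zy; rewrite -lecR -raddfB.
exact: le_trans (normc_ge_Re _) (ltW zy).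
Qed.

Lemma ofR_continuous : continuous (@ofR R).
Proof.
move=> x; apply/cvgrPdist_le => /= e e0.
(* The order of [C] compares only numbers with equal imaginary parts, so [0 < e] makes [e] real.
   This is why radii and precisions can be taken in [C] throughout. *)
have er : e = ofR (complex.Re e) by rewrite /ofR RRe_real // gtr0_real.
have e0' : 0 < complex.Re e by move: e0; rewrite er /ofR ltcR.
have := nbhsx_ballx x _ e0'.
apply: filterS => y xy; rewrite er.
by rewrite -[ofR x - ofR y]rmorphB /= normc_def /= expr0n addr0 sqrtr_sqr lecR ltW.
Qed.

Lemma norm_ofR (x : R) : `|ofR x| = ofR `|x| :> C.
Proof. by rewrite /ofR normc_def /= expr0n addr0 sqrtr_sqr. Qed.

Lemma ofR_Re (x : C) : 0 <= x -> ofR (complex.Re x) = x.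
Proof. by move=> x0; rewrite /ofR RRe_real // ger0_real. Qed.

Lemma ltr_ofR (x y : R) : (ofR x < ofR y) = (x < y). Proof. exact: ltcR. Qed.
Lemma ler_ofR (x y : R) : (ofR x <= ofR y) = (x <= y). Proof. exact: lecR. Qed.
Lemma ofR0 : ofR 0 = 0 :> C. Proof. by rewrite /ofR rmorph0. Qed.
Lemma ofR1 : ofR 1 = 1 :> C. Proof. by rewrite /ofR rmorph1. Qed.
Lemma ofRX (x : R) k : ofR (x ^+ k) = ofR x ^+ k :> C. Proof. by rewrite /ofR rmorphXn. Qed.

Lemma real_cauchy (u : nat -> R) :
  (forall e : R, 0 < e ->
     exists N, forall m k, (N <= m)%N -> (N <= k)%N -> `|u m - u k| <= e) ->
  exists l : R, forall e : R, 0 < e -> exists N, forall m, (N <= m)%N -> `|u m - l| <= e.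
Proof.
move=> uc; have /cauchy_cvgP/cvg_ex[l /cvgrPdist_le ul] : cauchy (u @ \oo).
  apply/cauchyP => e e0; have e2 : 0 < e / 2 by rewrite divr_gt0.
  have [N NP] := uc _ e2.
  exists (u N); exists N => // k /= Nk; rewrite /ball /=.
  by apply: le_lt_trans (NP _ _ (leqnn N) Nk) _; rewrite ltr_pdivrMr // ltr_pMr // ltr1n.
exists l => e /ul[N _ NP]; exists N => m Nm; rewrite distrC; exact: NP.
Qed.

Lemma norm_le_Re_Im (z : C) : `|z| <= ofR (`|complex.Re z| + `|complex.Im z|).
Proof.
rewrite {1}[z]complexE; apply: le_trans (ler_normD _ _) _.
rewrite normrM complexiE normCi mul1r.
by rewrite -[(complex.Re z)%:C%C]/(ofR _) -[(complex.Im z)%:C%C]/(ofR _) !norm_ofR [leRHS]rmorphD.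
Qed.

Lemma normc_ge_Im (z : C) : ofR `|complex.Im z| <= `|z|.
Proof.
case: z => a b; rewrite /ofR normc_def lecR /=.
by rewrite -sqrtr_sqr ler_wsqrtr // lerDr sqr_ge0.
Qed.

Lemma complex_cauchy (u : nat -> C) :
  (forall e : C, 0 < e ->
     exists N, forall m k, (N <= m)%N -> (N <= k)%N -> `|u m - u k| <= e) ->
  exists l : C, forall e : C, 0 < e -> exists N, forall m, (N <= m)%N -> `|u m - l| <= e.
Proof.
move=> uc.
have [e e0|a aP] := @real_cauchy (fun m => complex.Re (u m)).
  have [|N NP] := uc (ofR e); first by rewrite /ofR ltcR.
  exists N => m k Nm Nk; rewrite -lecR -raddfB.
  exact: le_trans (normc_ge_Re _) (NP _ _ Nm Nk).
have [e e0|b bP] := @real_cauchy (fun m => complex.Im (u m)).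
  have [|N NP] := uc (ofR e); first by rewrite /ofR ltcR.
  exists N => m k Nm Nk; rewrite -lecR -raddfB.
  exact: le_trans (normc_ge_Im _) (NP _ _ Nm Nk).
exists (a +i* b)%C => e e0; pose d := complex.Re e / 2.
have eE : e = ofR (d + d) by rewrite -splitr ofR_Re // ltW.
have d0 : 0 < d.
  have : ofR 0 < ofR (d + d) by rewrite -eE.
  by rewrite /ofR ltcR; lra.
have [N NP] := aP _ d0; have [M MP] := bP _ d0.
exists (maxn N M) => m; rewrite geq_max => /andP[Nm Mm].
apply: le_trans (norm_le_Re_Im _) _; rewrite eE /ofR lecR.
by move: (NP _ Nm) (MP _ Mm); case: (u m) => x y /= *; exact: lerD.
Qed.

(** The disc is a closed subset of the image of a square under (x, y) |-> x + iy. *)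
Lemma complex_compact_disc (r : R) :
  compact [set z : C | `|z| <= ofR r].
Proof.
pose f (p : R * R) : C := ofR p.1 + 'i * ofR p.2.
have fc : continuous f.
  move=> p; apply: cvgD; [|apply: cvgMr];
    apply: continuous_comp; [exact: cvg_fst|exact: ofR_continuous|exact: cvg_snd|exact: ofR_continuous].
have fw : {within `[(- r), r] `*` `[(- r), r], continuous f}.
  exact: continuous_subspaceT.
have := continuous_compact fw
  (compact_setX (@segment_compact R (- r) r) (@segment_compact R (- r) r)).
move=> fK; apply: (subclosed_compact _ fK).
  rewrite (_ : [set z | _] = (fun z : C => complex.Re `|z|) @^-1` [set t | t <= r])%classic.
    apply: closed_comp; last exact: closed_le.
    move=> z _; apply: continuous_comp; first exact: norm_continuous.
    exact: Re_continuous.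
  by apply/seteqP; split=> z /=; rewrite -[X in X <= ofR _]ofR_Re // /ofR lecR.
move=> z /= zr; exists (complex.Re z, complex.Im z).
  rewrite /= !in_itv /= -!ler_norml; split; rewrite -lecR;
   apply: le_trans zr; [exact: normc_ge_Re|exact: normc_ge_Im].
by rewrite /f /= /ofR -complexiE -complexE.
Qed.

(** Compactness is used as a near-covering property for increments tending to 0, so only [x] has to
    lie in [K] and [y] may leave it. *)
Lemma compact_unif_continuous (U : normedModType C) (K : set U) (f : U -> C) :
  compact K -> (forall x, K x -> {for x, continuous f}) ->
  forall e : C, 0 < e -> exists2 d : C, 0 < d &
    forall x y, K x -> `|x - y| < d -> `|f x - f y| <= e.
Proof.
move=> /compact_near_coveringP Kc fc e e0.
have /nbhs_ballP[d /= d0 dP] : \forall h \near (0 : U),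
    K `<=` (fun x => `|f x - f (x + h)| <= e).
  apply: (Kc U (nbhs (0 : U)) (fun h x => `|f x - f (x + h)| <= e)) => x Kx.
  have e2 : 0 < e / 2 by rewrite divr_gt0.
  have /nbhs_ballP[d /= d0 dP] : nbhs x [set y | `|f x - f y| <= e / 2].
    by have /cvgrPdist_le := fc x Kx; apply.
  have d2 : 0 < d / 2 by rewrite divr_gt0.
  exists (ball x (d / 2), ball 0 (d / 2)).
    by split; apply: nbhsx_ballx.
  move=> [y h] /= []; rewrite -ball_normE /= sub0r normrN => xy hd.
  have yx : `|f x - f y| <= e / 2.
    apply: dP; rewrite -ball_normE /=; apply: lt_trans xy _.
    by rewrite ltr_pdivrMr // ltr_pMr // ltr1n.
  have yhx : `|f x - f (y + h)| <= e / 2.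
    apply: dP; rewrite -ball_normE /= opprD addrA (splitr d).
    apply: le_lt_trans (ler_normB _ _) _; exact: ltrD.
  have -> : f y - f (y + h) = (f x - f (y + h)) - (f x - f y) by ring.
  by apply: le_trans (ler_normB _ _) _; rewrite (splitr e); exact: lerD.
exists d => // x y Kx xy.
have := dP (y - x); rewrite -ball_normE /= sub0r normrN distrC => /(_ xy _ Kx).
by rewrite [x + _]addrC subrK.
Qed.
End ComplexLimits.

Section Differentiability.

Lemma differentiable_expansion (K : numFieldType) (U W : normedModType K) (f : U -> W) (x : U) :
  differentiable f x -> forall e : K, 0 < e -> exists2 d : K, 0 < d &
    forall y, `|y| < d -> `|f (x + y) - f x - 'd f x y| <= e * `|y|.
Proof.
move=> /diff_locallyP[dfc dfE] e e0; move/eqaddoP: dfE => /(_ e e0).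
move=> /nbhs_ballP[d /= d0 dP]; exists d => // y yd.
have := dP y; rewrite -ball_normE /= sub0r normrN => /(_ yd).
by rewrite !fctE /= [y + x]addrC opprD addrA.
Qed.

(** The bound [M] provides the continuity of [L] that a Frechet derivative must have. This is how
    differentiability is established for the exponential and for locally uniform limits. *)
Lemma expansion_differentiable (K : numFieldType) (U W : normedModType K) (f L : U -> W)
    (x : U) (M : K) :
  0 <= M -> linear L -> (forall h, `|L h| <= M * `|h|) ->
  (forall e : K, 0 < e -> exists2 d : K, 0 < d &
    forall y, `|y| < d -> `|f (x + y) - f x - L y| <= e * `|y|) ->
  differentiable f x.
Proof.
move=> M0 Llin LM fL.
pose Lm := GRing.isLinear.Build K U W _ L Llin.
pose L' : {linear U -> W} := HB.pack L Lm.
have Lc : continuous L'.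
  move=> y; apply/(@cvgrPdist_le _ _ _ (nbhs y) (nbhs_filter y)) => e e0.
  have M1 : 0 < M + 1 by rewrite ltr_wpDl.
  have := nbhsx_ballx y _ (divr_gt0 e0 M1).
  apply: filterS => z; rewrite -ball_normE /= => yz.
  rewrite -[L y - L z]/(L' y - L' z) -raddfB /=; apply: le_trans (LM _) _.
  apply: (@le_trans _ _ ((M + 1) * `|y - z|)).
    by apply: ler_wpM2r => //; rewrite lerDl.
  by rewrite mulrC -ler_pdivlMr // ltW.
have gE : f \o shift x = cst (f x) + L' +o_ 0 id.
  apply/eqaddoP => e e0; have [d d0 dP] := fL _ e0.
  apply/nbhs_ballP; exists d => //= y; rewrite -ball_normE /= sub0r normrN => yd.
  have := dP y yd; rewrite !fctE /= [y + x]addrC; congr (`|_| <= _).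
  by rewrite opprD addrA.
by apply/diff_locallyP; rewrite (diff_unique Lc gE).
Qed.

Lemma is_derive_expansion (K : numFieldType) (f : K -> K) (x l : K) :
  is_derive x 1 f l -> forall e : K, 0 < e -> exists2 d : K, 0 < d &
    forall y, `|y| < d -> `|f (x + y) - f x - l * y| <= e * `|y|.
Proof.
move=> [dfx fl] e e0.
have df : differentiable f x by apply/derivable1_diffP.
have [d d0 dP] := differentiable_expansion df e0; exists d => // y /dP.
have -> : 'd f x y = l * y.
  rewrite -[y in LHS]mulr1 -[y * 1]/(y *: 1) linearZ /= -deriveE // fl.
  by rewrite mulrC.
by [].
Qed.
End Differentiability.

(** * The complex exponential: differentiability, period and logarithms *)

Section ComplexExponential.
Variable R : realType.
Local Notation C := (Cplx R).

Definition cexp (z : C) : C :=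
  ofR (expR (complex.Re z)) * (ofR (cos (complex.Im z)) + 'i * ofR (sin (complex.Im z))).

Lemma cexpE (a b : R) : cexp (a +i* b)%C = ofR (expR a) * (cos b +i* sin b)%C.
Proof. by rewrite /cexp [in RHS](complexE (_ +i* _)%C) /= complexiE. Qed.

Lemma cexpD (z1 z2 : C) : cexp (z1 + z2) = cexp z1 * cexp z2.
Proof.
rewrite /cexp !raddfD /= expRD cosD sinD /ofR !(rmorphM, rmorphD, rmorphB) /=.
set a := (expR _)%:C%C; set b := (expR _)%:C%C; set c := (cos _)%:C%C; set d := (cos _)%:C%C.
set e := (sin _)%:C%C; set g := (sin _)%:C%C.
have i2 : 'i * 'i = -1 :> R[i] by rewrite -expr2 sqrCi.
transitivity (a * b * (c * d + ('i * 'i) * (e * g) + 'i * (e * d + c * g)) : R[i]).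
  by rewrite i2; ring.
by ring.
Qed.

Lemma cexp0 : cexp 0 = 1.
Proof. by rewrite /cexp /= expR0 cos0 sin0 /ofR rmorph0 rmorph1 mulr0 addr0 mulr1. Qed.

Lemma cexp_neq0 z : cexp z != 0.
Proof.
apply/eqP => z0; have := cexpD z (- z); rewrite subrr cexp0 z0 mul0r => /eqP.
by rewrite oner_eq0.
Qed.

Lemma norm_cis (b : R) : `|(ofR (cos b) + 'i * ofR (sin b) : C)| = 1.
Proof.
have -> : ofR (cos b) + 'i * ofR (sin b) = (cos b +i* sin b)%C :> R[i].
  by rewrite [RHS]complexE /= complexiE.
by rewrite normc_def /= cos2Dsin2 sqrtr1.
Qed.

Lemma norm_cexp z : `|cexp z| = ofR (expR (complex.Re z)).
Proof. by rewrite /cexp normrM norm_cis mulr1 norm_ofR ger0_norm ?expR_ge0. Qed.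

(** [acos] of the real part of z / |z| gives the angle up to sign, and the sign of the imaginary
    part selects it. The logarithms obtained here turn an annulus into a parallelogram in
    [mean_cst]. *)
Lemma cexp_surj (z : C) : z != 0 -> exists y, cexp y = z.
Proof.
move=> z0; have [r0 [r rE]] : 0 < `|z| /\ exists r : R, `|z| = ofR r.
  by split; rewrite ?normr_gt0 //; exists (complex.Re `|z|); rewrite ofR_Re.
have {}r0 : 0 < r by rewrite -ltcR -[r%:C%C]/(ofR r) -rE.
have [x xr] := expR_total r0.
pose u : R[i] := z / `|z|.
have u1 : `|u| = 1 by rewrite normf_div normr_id divff // normr_eq0.
have [b bu] : exists b : R, (cos b +i* sin b)%C = u.
  case: (u) u1 => c d; rewrite normc_def /= => -[] cd1.
  have {}cd1 : c ^+ 2 + d ^+ 2 = 1.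
    rewrite -[LHS]sqr_sqrtr ?addr_ge0 ?sqr_ge0 //.
    by rewrite -[Num.sqrt _]/(complex.Re (Num.sqrt (c ^+ 2 + d ^+ 2))%:C%C) cd1 expr1n.
  have c1 : -1 <= c <= 1.
    by rewrite -ler_norml -(@ler_pXn2r _ 2) ?nnegrE // expr1n real_normK ?num_real // -cd1 lerDl sqr_ge0.
  have sc : Num.sqrt (1 - c ^+ 2) = `|d| by rewrite -cd1 addrC addKr sqrtr_sqr.
  have [d0|d0] := leP 0 d.
    exists (acos c); rewrite acosK ?in_itv //= sin_acos // sc ger0_norm //.
  by exists (- acos c); rewrite cosN sinN acosK ?in_itv //= sin_acos // sc ltr0_norm // opprK.
exists (x +i* b)%C; rewrite cexpE xr bu -rE /u mulrC divfK // normr_eq0 //.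
Qed.

Definition iper : C := 'i * ofR (pi *+ 2).

Lemma iperE : iper = (0 +i* (pi *+ 2))%C.
Proof. by rewrite /iper [RHS]complexE /= add0r complexiE. Qed.

Lemma cexp_iper : cexp iper = 1.
Proof.
by rewrite iperE cexpE expR0 cos2pi sin2pi /ofR rmorph1 mul1r complexr0 rmorph1.
Qed.

Lemma norm_cexp_iper (t : C) : t \is Num.real -> `|cexp (t * iper)| = 1.
Proof.
move=> tr; rewrite norm_cexp iperE.
have -> : complex.Re (t * (0 +i* (pi *+ 2))%C : R[i]) = 0.
  by have /complex_realP[u ->] := tr; rewrite /= mulr0 mul0r subrr.
by rewrite expR0.
Qed.

Lemma cexp_expansion0 (e : C) : 0 < e -> exists2 d : C, 0 < d &
  forall h, `|h| < d -> `|cexp h - 1 - h| <= e * `|h|.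
Proof.
move=> e0; pose r := complex.Re e; have er : e = ofR r by rewrite /r ofR_Re // ltW.
have r0 : 0 < r by rewrite -ltcR -[r%:C%C]/(ofR r) -er.
(* With y = |h| the error is at most [x * y + 2 * (x * y + x * y) + x * y], hence the sixth of [r].
   The bound [x <= 1] gives the factor 2 as an estimate of [1 + a]. *)
pose x := Num.min (r / 6) 1.
have x0 : 0 < x by rewrite lt_min ltr01 divr_gt0.
have x1 : x <= 1 by rewrite ge_min lexx orbT.
have x6 : 6 * x <= r by rewrite mulrC -ler_pdivlMr // ge_min lexx.
clearbody x.
have [da da0 daP] := is_derive_expansion (is_derive_expR (0 : R)) x0.
have [db db0 dbP] := is_derive_expansion (is_derive_sin (0 : R)) x0.
have [dc dc0 dcP] := is_derive_expansion (is_derive_cos (0 : R)) x0.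
pose d := Num.min (Num.min da db) (Num.min dc x).
exists (ofR d); first by rewrite /ofR ltcR !lt_min da0 db0 dc0 x0.
move=> h hd; set a := complex.Re h; set b := complex.Im h.
have hE : h = ofR a + 'i * ofR b :> R[i] by rewrite {1}[h]complexE complexiE.
have [y y0 hy] : exists2 y : R, 0 <= y & `|h| = ofR y.
  exists (complex.Re `|h|); last by rewrite ofR_Re.
  by rewrite -ler0c -[X in 0 <= X]/(ofR _) ofR_Re.
have ay : `|a| <= y by rewrite -lecR -[y%:C%C]/(ofR y) -hy; exact: normc_ge_Re.
have by' : `|b| <= y by rewrite -lecR -[y%:C%C]/(ofR y) -hy; exact: normc_ge_Im.
have : y < d by rewrite -ltcR -[y%:C%C]/(ofR y) -hy.
rewrite !lt_min => /andP[/andP[yda ydb] /andP[ydc yx]].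
have := daP a (le_lt_trans ay yda); rewrite add0r expR0 mul1r => A.
have := dbP b (le_lt_trans by' ydb); rewrite add0r sin0 cos0 mul1r subr0 => B.
have := dcP b (le_lt_trans by' ydc); rewrite add0r sin0 cos0 oppr0 mul0r subr0 => D.
have -> : cexp h - 1 - h = ofR (expR a - 1 - a) * (ofR (cos b) + 'i * ofR (sin b))
    + ofR (1 + a) * (ofR (cos b - 1) + 'i * ofR (sin b - b)) + 'i * ofR (a * b).
  rewrite {2}hE /cexp -/a -/b /ofR !(rmorphM, rmorphD, rmorphN, rmorph1) /=.
  by move: (expR a)%:C%C (cos b)%:C%C (sin b)%:C%C a%:C%C b%:C%C => ? ? ? ? ?; ring.
have i1 (u : R) : `|'i * ofR u| = ofR `|u| :> C by rewrite normrM normCi mul1r norm_ofR.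
have c2 : `|(ofR (cos b - 1) + 'i * ofR (sin b - b) : C)| <= ofR (x * y + x * y).
  apply: le_trans (ler_normD _ _) _; rewrite i1 norm_ofR /ofR rmorphD.
  by apply: lerD; rewrite lecR; [apply: le_trans D _|apply: le_trans B _]; rewrite ler_wpM2l // ltW.
rewrite er hy /ofR -rmorphM -/(ofR (r * y)).
have : 6 * x * y <= r * y by rewrite ler_wpM2r.
rewrite -lecR -[(r * y)%:C%C]/(ofR (r * y)); apply: le_trans.
have -> : 6 * x * y = x * y + 2 * (x * y + x * y) + x * y by ring.
have -> : (x * y + 2 * (x * y + x * y) + x * y)%:C%C =
    (x * y)%:C%C + (2 * (x * y + x * y))%:C%C + (x * y)%:C%C :> R[i] by rewrite !rmorphD.
apply: le_trans (ler_normD _ _) _; apply: lerD.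
  apply: le_trans (ler_normD _ _) _; apply: lerD.
    rewrite normrM norm_cis mulr1 norm_ofR /ofR lecR; apply: le_trans A _.
    by rewrite ler_wpM2l // ltW.
  rewrite normrM rmorphM; apply: ler_pM => //.
  rewrite norm_ofR /ofR lecR; apply: le_trans (ler_normD _ _) _.
  by rewrite normr1 -[2]/(1 + 1 : R) lerD2l; apply: le_trans ay _; exact: le_trans (ltW yx) x1.
rewrite i1 /ofR lecR normrM; apply: ler_pM => //.
exact: le_trans ay (ltW yx).
Qed.

Lemma cexp_differentiable (z : C) : differentiable (@cexp : C -> C) z.
Proof.
apply: (@expansion_differentiable C C C _ (fun h => cexp z * h) z `|cexp z|) => //.
- by move=> a u v; rewrite mulrDr -![_ *: _]/(_ * _) mulrCA.
- by move=> h; rewrite normrM.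
move=> e e0; have c0 : 0 < `|cexp z| by rewrite normr_gt0 cexp_neq0.
have [d d0 dP] := cexp_expansion0 (divr_gt0 e0 c0); exists d => // y /dP yP.
have -> : cexp (z + y) - cexp z - cexp z * y = cexp z * (cexp y - 1 - y).
  by rewrite cexpD; ring.
rewrite normrM; apply: le_trans (ler_wpM2l (ltW c0) yP) _.
by rewrite mulrA mulrCA divff ?mulr1 // gt_eqF.
Qed.

Lemma iper_neq0 : iper != 0.
Proof.
by rewrite /iper mulf_neq0 ?neq0Ci // /ofR fmorph_eq0 mulrn_eq0 /= gt_eqF ?pi_gt0.
Qed.

(** The modulus of the exponential depends only on the real part, which on a segment does not exceed
    its larger endpoint value. *)
Lemma norm_cexp_segment (r z1 z2 s : C) : `|cexp z1| < r -> `|cexp z2| < r ->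
  0 <= s <= 1 -> `|cexp (z1 + s * (z2 - z1))| < r.
Proof.
rewrite !norm_cexp => z1r z2r s01; have /andP[s0 s1] := s01.
pose u := complex.Re s; have su : s = ofR u by rewrite ofR_Re.
have u0 : 0 <= u by rewrite -ler0c -[X in 0 <= X]/(ofR u) -su.
have u1 : u <= 1 by rewrite -lecR -[u%:C%C]/(ofR u) -su.
have -> : complex.Re (z1 + s * (z2 - z1)) =
    complex.Re z1 + u * (complex.Re z2 - complex.Re z1).
  rewrite su /ofR; case: z1 {z1r} => a b; case: z2 {z2r} => c d /=.
  by rewrite mul0r subr0.
have [le12|/ltW le21] := leP (complex.Re z1) (complex.Re z2).
  apply: le_lt_trans z2r; rewrite /ofR lecR ler_expR -lerBrDl.
  by rewrite ler_piMl // subr_ge0.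
apply: le_lt_trans z1r; rewrite /ofR lecR ler_expR gerDl.
by rewrite mulr_ge0_le0 // subr_le0.
Qed.
End ComplexExponential.

Opaque Cplx cexp iper.

(** * A dyadic integral over the unit segment *)

Section DyadicIntegral.
Variable R : realType.
Local Notation C := (Cplx R).

(** Left Riemann sums at dyadic nodes. With these nodes cutting the segment in two is an exact
    identity between sums ([dsumS]), which is what the subdivision in Goursat's theorem needs. *)
Definition dsum (g : C -> C) (N : nat) : C :=
  2^-1 ^+ N * \sum_(j < 2 ^ N) g (j%:R * 2^-1 ^+ N).

Definition dint (g : C -> C) : C := lim (dsum g N @[N --> \oo]).

Definition cont01 (g : C -> C) : Prop :=
  forall t : C, 0 <= t <= 1 -> {for t, continuous g}.

Lemma dsum0 g : dsum g 0 = g 0.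
Proof. by rewrite /dsum expr0 mul1r expn0 big_ord1 mul0r. Qed.

Lemma dsumS g N : dsum g N.+1 =
  2^-1 * (dsum (fun t => g (t / 2)) N + dsum (fun t => g ((1 + t) / 2)) N).
Proof.
rewrite /dsum -mulrDr mulrA -exprS; congr (_ * _).
have e2 : (2 ^ N.+1 = 2 ^ N + 2 ^ N)%N by rewrite expnS mul2n addnn.
rewrite -(big_mkord predT (fun j => g (j%:R * 2^-1 ^+ N.+1))) e2 big_mkord.
rewrite big_split_ord /=; congr (_ + _); apply: eq_bigr => j _; congr (g _).
  by rewrite exprSr mulrA.
have -> : (2 ^ N + j)%:R = 2 ^+ N + j%:R :> C by rewrite natrD natrX.
by rewrite mulrDl exprSr !mulrA -exprMn divff ?expr1n ?pnatr_eq0 // mulrDl.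
Qed.

Lemma node01 (j N : nat) : (j <= 2 ^ N)%N -> 0 <= (j%:R * 2^-1 ^+ N : C) <= 1.
Proof.
move=> jN; rewrite mulr_ge0 ?exprn_ge0 ?invr_ge0 //=.
by rewrite exprVn ler_pdivrMr ?exprn_gt0 // mul1r -natrX ler_nat.
Qed.

Lemma dsum_le (g h : C -> C) N : (forall t, 0 <= t <= 1 -> `|g t| <= h t) ->
  `|dsum g N| <= dsum h N.
Proof.
move=> gh; rewrite /dsum normrM ger0_norm ?exprn_ge0 ?invr_ge0 //.
rewrite ler_wpM2l ?exprn_ge0 ?invr_ge0 //.
by apply: le_trans (ler_norm_sum _ _ _) _; apply: ler_sum => j _; apply: gh; exact/node01/ltnW.
Qed.

Lemma dsum_cst (c : C) N : dsum (fun=> c) N = c.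
Proof.
rewrite /dsum sumr_const card_ord -[c *+ _]mulr_natl natrX mulrA -exprMn.
by rewrite mulVf ?expr1n ?mul1r ?pnatr_eq0.
Qed.

Lemma dsum_norm_le (g : C -> C) (B : C) N : (forall t, 0 <= t <= 1 -> `|g t| <= B) ->
  `|dsum g N| <= B.
Proof. by move=> gB; rewrite -[leRHS](dsum_cst _ N); exact: dsum_le. Qed.

Lemma dsumD g h N : dsum (fun t => g t + h t) N = dsum g N + dsum h N.
Proof. by rewrite /dsum big_split mulrDr. Qed.

Lemma dsumZ c g N : dsum (fun t => c * g t) N = c * dsum g N.
Proof. by rewrite /dsum -mulr_sumr mulrCA. Qed.

Lemma eq_dsum g h N : (forall t, 0 <= t <= 1 -> g t = h t) -> dsum g N = dsum h N.
Proof.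
by move=> gh; congr (_ * _); apply: eq_bigr => j _; apply: gh; exact/node01/ltnW.
Qed.

Lemma half01 (t : C) : 0 <= t <= 1 -> 0 <= t / 2 <= 1.
Proof.
move=> /andP[t0 t1]; rewrite divr_ge0 //= ler_pdivrMr // mul1r.
by apply: le_trans t1 _; rewrite ler1n.
Qed.

Lemma half01' (t : C) : 0 <= t <= 1 -> 0 <= (1 + t) / 2 <= 1.
Proof.
move=> /andP[t0 t1]; rewrite divr_ge0 ?addr_ge0 //= ler_pdivrMr // mul1r.
by rewrite lerD.
Qed.

(** Induction on [N] through [dsumS]: stretching each half to the unit segment doubles the
    admissible distance of the arguments. At [N = 0] the value [g 0] is compared with an average of
    values of [g]. *)
Lemma dsum_modulus (g : C -> C) (e : C) N k :
  (forall t t', 0 <= t <= 1 -> 0 <= t' <= 1 -> `|t - t'| <= 2^-1 ^+ N -> `|g t - g t'| <= e) ->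
  `|dsum g N - dsum g (N + k)| <= e.
Proof.
elim: N g => [|N IH] g gm.
  rewrite add0n dsum0 -[g 0](dsum_cst _ k) -[X in _ - X]mul1r -mulNr -dsumZ -dsumD.
  apply: dsum_norm_le => t t01; rewrite mulN1r; apply: gm => //.
    by rewrite lexx ler01.
  by rewrite sub0r normrN expr0; case/andP: t01 => t0 t1; rewrite ger0_norm.
rewrite addSn !dsumS -mulrBr normrM.
have h2 : `|2^-1| = 2^-1 :> C by rewrite ger0_norm ?invr_ge0.
rewrite h2 mulrC ler_pdivrMr // mulr_natr [e *+ _]mulr2n opprD addrACA.
apply: le_trans (ler_normD _ _) _; apply: lerD; apply: IH => t t' t01 t01' tt'.
  apply: gm; try exact: half01.
  rewrite -mulrBl normrM h2 exprSr.
  by rewrite ler_wpM2r ?invr_ge0.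
apply: gm; try exact: half01'.
rewrite -mulrBl [1 + t]addrC addrKA normrM h2 exprSr.
by rewrite ler_wpM2r ?invr_ge0.
Qed.

Lemma compact_unit_segment : compact [set t : C | 0 <= t <= 1].
Proof.
have fw : {within `[(0 : R), 1], continuous (@ofR R)}.
  by apply: continuous_subspaceT; exact: ofR_continuous.
have := continuous_compact fw (@segment_compact R 0 1).
rewrite (_ : [set _ | _ in _] = [set t : C | 0 <= t <= 1]) //.
apply/seteqP; split=> [_ [t /= + <-]|t /= /andP[t0 t1]].
  by rewrite in_itv /= /ofR ler0c -(lecR t 1).
exists (complex.Re t); last exact: ofR_Re.
have := t1; rewrite -(ofR_Re t0) => t1'.
by rewrite /= in_itv /= -(lecR _ 1) -[X in _ && (X <= _)]/(ofR _) t1' -ler0c -[X in 0 <= X]/(ofR _) ofR_Re // t0.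
Qed.

Lemma half_pow_small (e : C) : 0 < e -> exists N, 2^-1 ^+ N < e.
Proof.
move=> e0; pose d := complex.Re e.
have eE : e = ofR d by rewrite /d ofR_Re // ltW.
have d0 : 0 < d by rewrite -ltcR -[d%:C%C]/(ofR d) -eE.
have [N dN] : exists N, 2^-1 ^+ N < d.
  have := near_infty_natSinv_lt (PosNum d0); case=> N _ /(_ N (leqnn _)) /= Nd.
  exists N; apply: le_lt_trans Nd; rewrite exprVn lef_pV2 ?posrE ?exprn_gt0 //.
  by rewrite -natrX ler_nat ltn_expl.
exists N; rewrite eE /ofR; move: dN; rewrite -ltcR; congr (_ < _).
by rewrite rmorphXn fmorphV rmorph_nat.
Qed.

Lemma cont01_modulus (g : C -> C) (e : C) : cont01 g -> 0 < e -> exists N,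
  forall t t', 0 <= t <= 1 -> 0 <= t' <= 1 -> `|t - t'| <= 2^-1 ^+ N -> `|g t - g t'| <= e.
Proof.
move=> gc e0; have [d d0 dP] := compact_unif_continuous compact_unit_segment gc e0.
have [N Nd] := half_pow_small d0; exists N => t t' t01 t01' tt'.
by apply: dP => //; exact: le_lt_trans tt' Nd.
Qed.

Lemma cvgn_eps (u : nat -> C) (l : C) : (u @ \oo --> l) <->
  (forall e : C, 0 < e -> exists N, forall m, (N <= m)%N -> `|u m - l| <= e).
Proof.
split=> [/cvgrPdist_le ul e /ul[N _ NP]|ul].
  by exists N => m Nm; rewrite distrC; exact: NP.
apply/cvgrPdist_le => e /ul[N NP]; exists N => // m Nm.
by rewrite distrC; exact: NP.
Qed.

Lemma dint_cvg (g : C -> C) : cont01 g -> dsum g N @[N --> \oo] --> dint g.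
Proof.
move=> gc; apply/cvg_ex => /=.
have [e e0|l lP] := @complex_cauchy R (dsum g); last first.
  by exists l; apply/cvgn_eps.
have e2 : 0 < e / 2 by rewrite divr_gt0.
have [N NP] := cont01_modulus gc e2; exists N => m k Nm Nk.
rewrite -(subnKC Nm) -(subnKC Nk) (splitr e).
rewrite -(subrKA (dsum g N)) ; apply: le_trans (ler_normD _ _) _.
by apply: lerD; rewrite ?[`|dsum _ (_ + _) - _|]distrC; exact: dsum_modulus.
Qed.

Lemma dint_unique (g : C -> C) (l : C) : cont01 g -> dsum g N @[N --> \oo] --> l -> dint g = l.
Proof. by move=> gc gl; apply: cvg_unique gl; [exact: norm_hausdorff|exact: dint_cvg]. Qed.

Lemma dintD g h : cont01 g -> cont01 h -> dint (fun t => g t + h t) = dint g + dint h.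
Proof.
move=> gc hc; apply: dint_unique.
  by move=> t t01; apply: (@continuousD _ _ _ g h); [exact: gc|exact: hc].
under eq_fun do rewrite dsumD; apply: cvgD; exact: dint_cvg.
Qed.

Lemma dintZ c g : cont01 g -> dint (fun t => c * g t) = c * dint g.
Proof.
move=> gc; apply: dint_unique.
  by move=> t t01; apply: (@continuousM _ _ (fun=> c) g); [exact: cst_continuous|exact: gc].
under eq_fun do rewrite dsumZ; apply: cvgMr; exact: dint_cvg.
Qed.

Lemma dint_cst c : dint (fun=> c) = c.
Proof.
apply: dint_unique; first by move=> t _; exact: cst_continuous.
by under eq_fun do rewrite dsum_cst; exact: cvg_cst.
Qed.

Lemma eq_dint g h : (forall t, 0 <= t <= 1 -> g t = h t) -> dint g = dint h.
Proof.
by move=> gh; rewrite /dint; under eq_fun do rewrite (eq_dsum _ gh).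
Qed.

Lemma dint_half g : cont01 g ->
  dint g = 2^-1 * (dint (fun t => g (t / 2)) + dint (fun t => g ((1 + t) / 2))).
Proof.
move=> gc; apply: dint_unique => //; rewrite -(cvg_shiftS (dsum g)).
under eq_fun do rewrite dsumS; apply: cvgMr; apply: cvgD; apply: dint_cvg => t t01.
  apply: (@continuous_comp C C C (fun t : C => t / 2) g); last by apply: gc; exact: half01.
  by apply: (@continuousM _ C id (fun=> 2^-1)); [exact: cvg_id|]; exact: cst_continuous.
apply: (@continuous_comp C C C (fun t : C => (1 + t) / 2) g); last by apply: gc; exact: half01'.
apply: (@continuousM _ C (fun t : C => 1 + t) (fun=> 2^-1)); last exact: cst_continuous.
by apply: (@continuousD _ _ _ (fun _ : C => 1 : C) (fun x : C => x)); [exact: cst_continuous|exact: cvg_id].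
Qed.

Lemma cvgn_norm_le (u : nat -> C) (l B : C) : u @ \oo --> l ->
  (forall N, `|u N| <= B) -> `|l| <= B.
Proof.
move=> /cvgn_eps ul uB; have B0 : 0 <= B by exact: le_trans (uB 0%N).
rewrite real_leNgt ?ger0_real //; apply/negP => Bl.
have d0 : 0 < `|l| - B by rewrite subr_gt0.
have [N /(_ N (leqnn _)) NP] := ul _ (divr_gt0 d0 (ltr0n C 2)).
suff : `|l| - B <= (`|l| - B) / 2.
  by rewrite real_leNgt ?ger0_real ?divr_ge0 ?(ltW d0) // ltr_pdivrMr // ltr_pMr // ltr1n.
rewrite lerBlDr -[l in leLHS](subrK (u N)); apply: le_trans (ler_normD _ _) _.
by apply: lerD => //; rewrite distrC.
Qed.

Lemma dint_norm_le g B : cont01 g -> (forall t, 0 <= t <= 1 -> `|g t| <= B) -> `|dint g| <= B.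
Proof.
move=> gc gB; apply: cvgn_norm_le (dint_cvg gc) _ => N; exact: dsum_norm_le.
Qed.

(** The rate depends on the modulus of continuity alone, so one [N] serves a whole equicontinuous
    family; [poly_approx] uses this uniformly in parameters. *)
Lemma dint_modulus (g : C -> C) (e : C) N : cont01 g ->
  (forall t t', 0 <= t <= 1 -> 0 <= t' <= 1 -> `|t - t'| <= 2^-1 ^+ N -> `|g t - g t'| <= e) ->
  `|dsum g N - dint g| <= e.
Proof.
move=> gc gm.
apply: (@cvgn_norm_le (fun k => dsum g N - dsum g (N + k))) => [|k]; last exact: dsum_modulus.
apply: cvgB; first exact: cvg_cst.
have /cvgn_eps gl := dint_cvg gc; apply/cvgn_eps => d /gl[M MP]; exists M => m Mm.
by apply: MP; exact: leq_trans Mm (leq_addl _ _).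
Qed.
End DyadicIntegral.

Opaque dint.

(** * Goursat's theorem *)

Section Goursat.
Variable R : realType.
Local Notation C := (Cplx R).

(* The integral of h along the boundary of the parallelogram with vertex p and
   sides d1, d2. *)
Definition par (h : C -> C) (p d1 d2 : C) : C :=
  d1 * dint (fun s => h (p + s * d1)) + d2 * dint (fun t => h (p + d1 + t * d2))
  - d1 * dint (fun s => h (p + d2 + s * d1)) - d2 * dint (fun t => h (p + t * d2)).

Definition in_par (p d1 d2 z : C) : Prop :=
  exists s t : C, [/\ 0 <= s <= 1, 0 <= t <= 1 & z = p + s * d1 + t * d2].

Lemma affine_continuous (q d t : C) : {for t, continuous (fun t : C => q + t * d)}.
Proof.
apply: (@continuousD _ _ _ (fun _ : C => q) (fun t : C => t * d)); first exact: cst_continuous.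
by apply: (@continuousM _ _ (fun t : C => t) (fun=> d)); [exact: cvg_id|exact: cst_continuous].
Qed.

Lemma cont01_line (h : C -> C) (q d : C) :
  (forall t, 0 <= t <= 1 -> {for q + t * d, continuous h}) ->
  cont01 (fun t => h (q + t * d)).
Proof.
move=> hc t t01; apply: (@continuous_comp C C C (fun t : C => q + t * d) h).
  exact: affine_continuous.
exact: hc.
Qed.

Lemma edge_half (h : C -> C) (q d : C) :
  (forall t, 0 <= t <= 1 -> {for q + t * d, continuous h}) ->
  d * dint (fun t => h (q + t * d)) =
  d / 2 * dint (fun t => h (q + t * (d / 2))) + d / 2 * dint (fun t => h (q + d / 2 + t * (d / 2))).
Proof.
move=> hc; rewrite dint_half; last exact: cont01_line.
rewrite mulrA mulrDr; congr (_ * _ + _ * _); apply: eq_dint => t _; congr h; by field.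
Qed.

Lemma unit0 : 0 <= (0 : C) <= 1. Proof. by rewrite lexx ler01. Qed.
Lemma unit1 : 0 <= (1 : C) <= 1. Proof. by rewrite lexx ler01. Qed.

Lemma par_split (h : C -> C) (p d1 d2 : C) :
  (forall z, in_par p d1 d2 z -> {for z, continuous h}) ->
  let e1 := d1 / 2 in let e2 := d2 / 2 in
  par h p d1 d2 = par h p e1 e2 + par h (p + e1) e1 e2 + par h (p + e2) e1 e2
    + par h (p + e1 + e2) e1 e2.
Proof.
move=> hc e1 e2; rewrite {1}/par.
rewrite (edge_half (q := p) (d := d1)) => [|t t01]; last first.
  by apply: hc; exists t, 0; split; rewrite ?unit0 // mul0r addr0.
rewrite (edge_half (q := p + d1) (d := d2)) => [|t t01]; last first.
  by apply: hc; exists 1, t; split; rewrite ?unit1 // mul1r.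
rewrite (edge_half (q := p + d2) (d := d1)) => [|t t01]; last first.
  by apply: hc; exists t, 1; split; rewrite ?unit1 // mul1r addrAC.
rewrite (edge_half (q := p) (d := d2)) => [|t t01]; last first.
  by apply: hc; exists 0, t; split; rewrite ?unit0 // mul0r addr0.
rewrite -/e1 -/e2 /par.
have -> : p + d1 = p + e1 + e1 by rewrite /e1; field.
have -> : p + d2 = p + e2 + e2 by rewrite /e2; field.
rewrite [p + e2 + e1]addrAC [p + e1 + e2 + e1]addrAC.
have -> : p + e2 + e2 + e1 = p + e1 + e2 + e2 by ring.
ring.
Qed.

Lemma par_affine (a b p d1 d2 : C) : par (fun z => a + b * z) p d1 d2 = 0.
Proof.
have idc : cont01 (fun t : C => t) by move=> t _; exact: cvg_id.
have E q d : dint (fun t => a + b * (q + t * d)) = a + b * q + b * d * dint (fun t : C => t).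
  rewrite -dintZ //.
  have bc : cont01 (fun t : C => b * d * t).
    move=> t _; apply: (@continuousM _ _ (fun _ : C => b * d) (fun t : C => t)).
      exact: cst_continuous.
    exact: cvg_id.
  have ac : cont01 (fun _ : C => a + b * q) by move=> t _; exact: cst_continuous.
  rewrite -[in RHS](dint_cst (a + b * q)) -(dintD ac bc).
  by apply: eq_dint => t _; ring.
rewrite /par !E; ring.
Qed.

Lemma par_norm_le (h : C -> C) (p d1 d2 B : C) :
  (forall z, in_par p d1 d2 z -> {for z, continuous h}) ->
  (forall z, in_par p d1 d2 z -> `|h z| <= B) ->
  `|par h p d1 d2| <= 2 * (`|d1| + `|d2|) * B.
Proof.
move=> hc hB.
have E1 t : 0 <= t <= 1 -> in_par p d1 d2 (p + t * d1).
  by move=> t01; exists t, 0; rewrite unit0 mul0r addr0.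
have E2 t : 0 <= t <= 1 -> in_par p d1 d2 (p + d1 + t * d2).
  by move=> t01; exists 1, t; rewrite unit1 mul1r.
have E3 t : 0 <= t <= 1 -> in_par p d1 d2 (p + d2 + t * d1).
  by move=> t01; exists t, 1; rewrite unit1 mul1r addrAC.
have E4 t : 0 <= t <= 1 -> in_par p d1 d2 (p + t * d2).
  by move=> t01; exists 0, t; rewrite unit0 mul0r addr0.
have key q d : (forall t, 0 <= t <= 1 -> in_par p d1 d2 (q + t * d)) ->
    `|d * dint (fun t => h (q + t * d))| <= `|d| * B.
  move=> E; rewrite normrM ler_wpM2l //; apply: dint_norm_le => [|t t01].
    by apply: cont01_line => t t01; apply: hc; exact: E.
  by apply: hB; exact: E.
have -> : 2 * (`|d1| + `|d2|) * B = `|d1| * B + `|d2| * B + `|d1| * B + `|d2| * B by ring.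
apply: le_trans (ler_normB _ _) _; apply: lerD; last exact: key.
apply: le_trans (ler_normB _ _) _; apply: lerD; last exact: key.
by apply: le_trans (ler_normD _ _) _; apply: lerD; exact: key.
Qed.

(** Bisection in both coordinates at once: [(s', t')] is the lower corner of a bad dyadic square of
    side 2^-k, and these corners converge to [(s, t)]. *)
Lemma nested_cells (bad : nat -> C -> C -> Prop) :
  bad 0 0 0 ->
  (forall k s t, bad k s t -> exists a b : bool,
     bad k.+1 (s + a%:R * 2^-1 ^+ k.+1) (t + b%:R * 2^-1 ^+ k.+1)) ->
  exists s t : C, [/\ 0 <= s <= 1, 0 <= t <= 1 & forall k, exists s' t',
    [/\ bad k s' t', `|s' - s| <= 2 * 2^-1 ^+ k, `|t' - t| <= 2 * 2^-1 ^+ k,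
        0 <= s' /\ s' + 2^-1 ^+ k <= 1 & 0 <= t' /\ t' + 2^-1 ^+ k <= 1]].
Proof.
move=> bad0 badS.
(* Dependent choice: bad corners are bundled with their level, a successor function is chosen, and
   it is iterated from the unit square. *)
pose T := {x : nat * (C * C) | bad x.1 x.2.1 x.2.2}.
pose next (x y : T) := exists a b : bool, sval y =
  ((sval x).1.+1, ((sval x).2.1 + a%:R * 2^-1 ^+ (sval x).1.+1,
                  (sval x).2.2 + b%:R * 2^-1 ^+ (sval x).1.+1)).
have nextP x : exists y, next x y.
  case: x => -[k [s t]] /= bx; have [a [b bab]] := badS _ _ _ bx.
  by exists (exist _ (k.+1, (_, _)) bab), a, b.
have [f fP] := choice nextP.
pose u k := iter k f (exist _ (0%N, (0, 0)) bad0).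
pose su k := (sval (u k)).2.1; pose tu k := (sval (u k)).2.2.
have uk k : (sval (u k)).1 = k.
  by elim: k => //= k IH; have [a [b ->]] := fP (u k); rewrite /= IH.
have badu k : bad k (su k) (tu k) by have := svalP (u k); rewrite uk.
have step k : exists a b : bool, su k.+1 = su k + a%:R * 2^-1 ^+ k.+1
    /\ tu k.+1 = tu k + b%:R * 2^-1 ^+ k.+1.
  have [a [b e]] := fP (u k); exists a, b; rewrite /su /tu /= e /= uk; by split.
have h0 : 0 < 2^-1 :> C by rewrite invr_gt0.
have limP (v : nat -> C) : v 0%N = 0 ->
    (forall k, exists a : bool, v k.+1 = v k + a%:R * 2^-1 ^+ k.+1) ->
    (forall k, 0 <= v k /\ v k + 2^-1 ^+ k <= 1) /\
    exists l : C, 0 <= l <= 1 /\ forall k, `|v k - l| <= 2 * 2^-1 ^+ k.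
  move=> v0 vS.
  have hk k : 0 <= 2^-1 ^+ k :> C by rewrite exprn_ge0 // ltW.
  have half k : 2^-1 ^+ k = 2^-1 ^+ k.+1 + 2^-1 ^+ k.+1 :> C.
    by rewrite exprS; field.
  have vb k : 0 <= v k /\ v k + 2^-1 ^+ k <= 1.
    elim: k => [|k [IH1 IH2]]; first by rewrite v0 expr0 add0r.
    have [a ->] := vS k; split; first by rewrite addr_ge0 ?mulr_ge0.
    apply: le_trans IH2; rewrite -addrA lerD2l (half k).
    by case: a; rewrite ?mul1r // mul0r add0r lerDl.
  have vd k m : `|v (k + m)%N - v k| <= 2^-1 ^+ k - 2^-1 ^+ (k + m)%N.
    elim: m => [|m IH]; first by rewrite addn0 !subrr normr0.
    rewrite addnS; have [a ->] := vS (k + m)%N; rewrite addrAC.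
    apply: le_trans (ler_normD _ _) _; rewrite normrM (half (k + m)%N) in IH *.
    rewrite normr_nat [`|_ ^+ _|]ger0_norm //.
    set x := 2^-1 ^+ (k + m).+1 in IH *.
    have -> : 2^-1 ^+ k - x = 2^-1 ^+ k - (x + x) + x by ring.
    by apply: lerD => //; case: a; rewrite ?mul1r // mul0r; exact: hk.
  split => //.
  have [e e0|l lP] := @complex_cauchy R v.
    have [N Ne] := half_pow_small (divr_gt0 e0 (ltr0n C 2)); exists N => m k Nm Nk.
    rewrite -(subnKC Nm) -(subnKC Nk) -(subrKA (v N)); apply: le_trans (ler_normD _ _) _.
    rewrite (splitr e); apply: lerD; rewrite ?[`|v N - _|]distrC;
      apply: le_trans (vd _ _) _; apply: le_trans (ltW Ne); by rewrite gerBl.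
  have vl : v @ \oo --> l by apply/cvgn_eps.
  exists l; split.
    have cl : closed [set t : C | 0 <= t <= 1].
      by apply: compact_closed; [exact: norm_hausdorff|exact: compact_unit_segment].
    have D01 : \forall k \near \oo, [set t : C | 0 <= t <= 1] (v k).
      exists 0%N => // k _ /=; by have [-> vk1] := vb k; rewrite (le_trans _ vk1) // lerDl.
    exact: (@closed_cvg _ _ _ _ v _ cl D01 l vl).
  move=> k; apply: (@cvgn_norm_le _ (fun m => v k - v (k + m)%N)) => [|m].
    apply: cvgB; first exact: cvg_cst.
    apply/cvgn_eps => e /lP[N NP]; exists N => m Nm; apply: NP.
    exact: leq_trans Nm (leq_addl _ _).
  rewrite distrC; apply: le_trans (vd _ _) _; apply: (@le_trans _ _ (2^-1 ^+ k)).
    by rewrite gerBl.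
  by rewrite ler_peMl // ler1n.
have [sb [s [s01 sl]]] := limP su erefl (fun k => let: ex_intro a (ex_intro _ (conj e _)) := step k in ex_intro _ a e).
have [tb [t [t01 tl]]] := limP tu erefl (fun k => let: ex_intro _ (ex_intro b (conj _ e)) := step k in ex_intro _ b e).
by exists s, t; split=> // k; exists (su k), (tu k); split.
Qed.

Lemma parD (g h : C -> C) (p d1 d2 : C) :
  (forall z, in_par p d1 d2 z -> {for z, continuous g}) ->
  (forall z, in_par p d1 d2 z -> {for z, continuous h}) ->
  par (fun z => g z + h z) p d1 d2 = par g p d1 d2 + par h p d1 d2.
Proof.
move=> gc hc.
have key q d : (forall t, 0 <= t <= 1 -> in_par p d1 d2 (q + t * d)) ->
    d * dint (fun t => g (q + t * d) + h (q + t * d)) =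
    d * dint (fun t => g (q + t * d)) + d * dint (fun t => h (q + t * d)).
  move=> E; rewrite -mulrDr; congr (_ * _).
  by apply: dintD; apply: cont01_line => t t01; [apply: gc|apply: hc]; exact: E.
rewrite /par (key p d1) => [|t t01]; last first.
  by exists t, 0; rewrite unit0 mul0r addr0.
rewrite (key (p + d1) d2) => [|t t01]; last by exists 1, t; rewrite unit1 mul1r.
rewrite (key (p + d2) d1) => [|t t01]; last first.
  by exists t, 1; rewrite unit1 mul1r addrAC.
rewrite (key p d2) => [|t t01]; last by exists 0, t; rewrite unit0 mul0r addr0.
ring.
Qed.

Lemma diff1E (h : C -> C) (q y : C) : 'd h q y = 'd h q 1 * y.
Proof. by rewrite -[y in LHS]mulr1 -[y * 1]/(y *: 1) linearZ /= mulrC. Qed.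

(** If the integral had modulus [c > 0], some quarter would carry at least c/4, and so on down to a
    point [q]. There [h] is affine up to a small relative error, the affine part integrates to 0,
    and the remainder over a cell of scale 2^-k is o(4^-k). *)
Theorem goursat (h : C -> C) (p d1 d2 : C) :
  (forall z, in_par p d1 d2 z -> differentiable h z) -> par h p d1 d2 = 0.
Proof.
move=> hd; apply/eqP; rewrite -normr_eq0 -[_ == 0]negbK; apply/negP => c0.
set c := `|_| in c0; have {}c0 : 0 < c by rewrite lt_def c0 normr_ge0.
have hc z : in_par p d1 d2 z -> {for z, continuous h}.
  by move=> /hd; exact: differentiable_continuous.
pose x (k : nat) : C := 2^-1 ^+ k.
have x0 k : 0 < x k by rewrite exprn_gt0 // invr_gt0.
have xS k : x k = x k.+1 + x k.+1 by rewrite /x exprS; field.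
pose inside k (s t : C) := [/\ 0 <= s, s + x k <= 1, 0 <= t & t + x k <= 1].
pose cell k s t := par h (p + s * d1 + t * d2) (x k * d1) (x k * d2).
have sub k s t z : inside k s t ->
    in_par (p + s * d1 + t * d2) (x k * d1) (x k * d2) z -> in_par p d1 d2 z.
  move=> [s0 s1 t0 t1] [a [b [/andP[a0 a1] /andP[b0 b1] ->]]].
  exists (s + a * x k), (t + b * x k); split; last by ring.
    rewrite addr_ge0 ?mulr_ge0 ?(ltW (x0 k)) //= (le_trans _ s1) // lerD2l.
    by rewrite ler_piMl // ltW.
  rewrite addr_ge0 ?mulr_ge0 ?(ltW (x0 k)) //= (le_trans _ t1) // lerD2l.
  by rewrite ler_piMl // ltW.
pose bad k s t := inside k s t /\ c * x k * x k <= `|cell k s t|.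
have bad0 : bad 0%N 0 0.
  split; first by rewrite /inside /x expr0 add0r lexx.
  by rewrite /cell /x expr0 !mulr1 !mul0r !addr0 !mul1r.
have badS k s t : bad k s t -> exists a b : bool,
    bad k.+1 (s + a%:R * x k.+1) (t + b%:R * x k.+1).
  move=> [[s0 s1 t0 t1] cb].
  have ins (a b : bool) : inside k.+1 (s + a%:R * x k.+1) (t + b%:R * x k.+1).
    have hk : 0 <= x k.+1 by exact: ltW.
    have aux (u : C) (e : bool) : u + x k <= 1 -> u + e%:R * x k.+1 + x k.+1 <= 1.
      move=> ux; apply: le_trans ux; rewrite -addrA lerD2l (xS k).
      by case: e; rewrite ?mul1r // mul0r add0r lerDl.
    by split; rewrite ?addr_ge0 ?mulr_ge0 //; exact: aux.
  apply: contrapT => nb.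
  have lt4 (a b : bool) : `|cell k.+1 (s + a%:R * x k.+1) (t + b%:R * x k.+1)| <
      c * x k.+1 * x k.+1.
    rewrite real_ltNge ?normr_real ?rpredM ?gtr0_real //; apply/negP => ge.
    by apply: nb; exists a, b.
  have E : cell k s t = cell k.+1 (s + false%:R * x k.+1) (t + false%:R * x k.+1)
      + cell k.+1 (s + true%:R * x k.+1) (t + false%:R * x k.+1)
      + cell k.+1 (s + false%:R * x k.+1) (t + true%:R * x k.+1)
      + cell k.+1 (s + true%:R * x k.+1) (t + true%:R * x k.+1).
    rewrite {1}/cell par_split => [|z zin]; last by apply: hc; apply: sub zin.
    rewrite /cell /= !mul0r !addr0 !mul1r.
    have -> d : x k * d / 2 = x k.+1 * d by rewrite (xS k); move: (x k.+1) => X; field.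
    rewrite (_ : x k * d2 / 2 = x k.+1 * d2); last by rewrite (xS k); move: (x k.+1) => X; field.
    move: (x k.+1) => X.
    have -> : p + (s + X) * d1 + t * d2 = p + s * d1 + t * d2 + X * d1 by ring.
    have -> : p + s * d1 + (t + X) * d2 = p + s * d1 + t * d2 + X * d2 by ring.
    by have -> : p + (s + X) * d1 + (t + X) * d2 = p + s * d1 + t * d2 + X * d1 + X * d2 by ring.
  move: cb; rewrite E; apply/negP; rewrite -real_ltNge ?normr_real ?rpredM ?gtr0_real //.
  have -> : c * x k * x k = c * x k.+1 * x k.+1 + c * x k.+1 * x k.+1 +
     c * x k.+1 * x k.+1 + c * x k.+1 * x k.+1 by rewrite (xS k); move: (x k.+1) => X; ring.
  by do 3 (apply: le_lt_trans (ler_normD _ _) _; apply: ltrD => //).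
have [s [t [s01 t01 badk]]] := nested_cells bad0 badS.
pose q := p + s * d1 + t * d2.
have dq : differentiable h q by apply: hd; exists s, t.
pose D := `|d1| + `|d2|; have D0 : 0 <= D by rewrite addr_ge0.
(* At scale [x k] the perimeter is [2 * D * x k] and the distance to [q] at most [3 * D * x k],
   whence [6 * D * D]. Adding 1 makes the final inequality strict and keeps the divisor positive. *)
have K0 : 0 < 6 * D * D + 1 by rewrite ltr_wpDl // !mulr_ge0.
have [d d0 dP] := differentiable_expansion dq (divr_gt0 c0 K0).
have K3 : 0 < 3 * D + 1 by rewrite ltr_wpDl // mulr_ge0.
have [k kd] := half_pow_small (divr_gt0 d0 K3).
have [s' [t' [[ins cb] ss tt _ _]]] := badk k.
have D3 : x k * (3 * D) < d.
  rewrite ltr_pdivlMr // in kd; apply: le_lt_trans kd.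
  by apply: ler_wpM2l; [exact: ltW|rewrite lerDl].
pose l := 'd h q 1.
pose g (z : C) := (h q - l * q) + l * z.
pose r (z : C) := h z - g z.
(* The corner of the cell is within [2 * x k] of the limit parameters and the cell adds at most
   [x k], hence the factor 3. *)
have zq z : in_par (p + s' * d1 + t' * d2) (x k * d1) (x k * d2) z -> `|z - q| <= x k * (3 * D).
  move=> [a [b [/andP[a0 a1] /andP[b0 b1] ->]]].
  have -> : p + s' * d1 + t' * d2 + a * (x k * d1) + b * (x k * d2) - q =
     (s' - s + a * x k) * d1 + (t' - t + b * x k) * d2 by rewrite /q; move: (x k) => X; ring.
  have aux (u w v y : C) : `|u| <= 2 * x k -> 0 <= v -> v <= 1 ->
      `|(u + v * x k) * y| <= x k * (3 * `|y|).
    move=> u2 v0 v1; rewrite normrM mulrA; apply: ler_wpM2r => //.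
    have -> : x k * 3 = 2 * x k + x k by move: (x k) => X; ring.
    apply: le_trans (ler_normD _ _) _; apply: lerD => //.
    by rewrite normrM !ger0_norm ?(ltW (x0 k)) // ler_piMl // ltW.
  have -> : x k * (3 * D) = x k * (3 * `|d1|) + x k * (3 * `|d2|) by rewrite /D; move: (x k) => X; ring.
  by apply: le_trans (ler_normD _ _) _; apply: lerD; apply: aux.
have gc z : {for z, continuous g}.
  apply: (@continuousD _ _ _ (fun _ : C => h q - l * q) (fun z : C => l * z)).
    exact: cst_continuous.
  by apply: (@continuousM _ _ (fun _ : C => l) (fun z : C => z)); [exact: cst_continuous|exact: cvg_id].
have hcs z : in_par (p + s' * d1 + t' * d2) (x k * d1) (x k * d2) z -> {for z, continuous h}.
  by move=> zin; apply: hc; exact: sub zin.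
have rc z : in_par (p + s' * d1 + t' * d2) (x k * d1) (x k * d2) z -> {for z, continuous r}.
  by move=> zin; apply: (@continuousB _ _ _ h g); [exact: hcs|exact: gc].
have cE : cell k s' t' = par r (p + s' * d1 + t' * d2) (x k * d1) (x k * d2).
  have gA : par g (p + s' * d1 + t' * d2) (x k * d1) (x k * d2) = 0 by exact: par_affine.
  have hE : h = (fun z => g z + r z) by apply/funext => z; rewrite /r addrC subrK.
  by rewrite -[RHS]add0r -gA -(parD (fun z _ => gc z) rc) -hE.
move: cb; rewrite cE; apply/negP; rewrite -real_ltNge ?normr_real ?rpredM ?gtr0_real //.
apply: le_lt_trans (par_norm_le rc (B := c / (6 * D * D + 1) * (x k * (3 * D))) _) _ => [z zin|].
  have zq' := zq _ zin.
  have := dP (z - q) (le_lt_trans zq' D3); rewrite [q + _]addrC subrK diff1E => rz.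
  have -> : r z = h z - h q - l * (z - q) by rewrite /r /g; ring.
  apply: le_trans rz _; apply: ler_wpM2l => //; exact: ltW (divr_gt0 c0 K0).
rewrite !normrM [`|x k|]ger0_norm ?(ltW (x0 k)) // -mulrDr -/D.
have -> : 2 * (x k * D) * (c / (6 * D * D + 1) * (x k * (3 * D))) =
  c * x k * x k * (6 * D * D / (6 * D * D + 1)) by move: (x k) => X; field; rewrite gt_eqF.
by rewrite gtr_pMr ?mulr_gt0 // ltr_pdivrMr // mul1r ltrDl.
Qed.

Lemma parE (h : C -> C) (p d1 d2 : C) : par h p d1 d2 =
  d1 * dint (fun s => h (p + s * d1)) + d2 * dint (fun t => h (p + d1 + t * d2))
  - d1 * dint (fun s => h (p + d2 + s * d1)) - d2 * dint (fun t => h (p + t * d2)).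
Proof. by []. Qed.
End Goursat.

Opaque par.

(** * Taylor expansion of differentiable functions of one complex variable *)

Section Taylor.
Variable R : realType.
Local Notation C := (Cplx R).

Definition circ (t : C) : C := cexp (t * iper R).

Lemma circ0 : circ 0 = 1. Proof. by rewrite /circ mul0r cexp0. Qed.

Lemma circ_neq0 t : circ t != 0. Proof. exact: cexp_neq0. Qed.

Lemma norm_circ (t : C) : 0 <= t <= 1 -> `|circ t| = 1.
Proof. by move=> /andP[t0 _]; apply: norm_cexp_iper; exact: ger0_real. Qed.

Lemma circ_continuous : continuous (circ : C -> C).
Proof.
move=> t; apply: (@continuous_comp C C C (fun t : C => t * iper R) (@cexp R)).
  by apply: (@continuousM _ _ (fun t : C => t) (fun=> iper R)); [exact: cvg_id|exact: cst_continuous].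
exact/differentiable_continuous/cexp_differentiable.
Qed.

Lemma cont01_circ (g : C -> C) (z : C) :
  (forall t, 0 <= t <= 1 -> {for z * circ t, continuous g}) ->
  cont01 (fun t => g (z * circ t)).
Proof.
move=> gc t t01; apply: (@continuous_comp C C C (fun t : C => z * circ t) g); last exact: gc.
apply: (@continuousM _ _ (fun=> z) circ); first exact: cst_continuous.
exact: circ_continuous.
Qed.

Definition mean (g : C -> C) (z : C) : C := dint (fun t => g (z * circ t)).

(** Goursat's theorem for [g] composed with the exponential, on the parallelogram with sides
    [y2 - y1] and [iper]. By periodicity the two sides along [y2 - y1] cancel, and the other two are
    the means. Since the exponential has no zero, nothing is asked of [g] at 0. *)
Lemma mean_cst (g : C -> C) (r z1 z2 : C) :
  (forall z : C, 0 < `|z| -> `|z| < r -> differentiable g z) ->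
  z1 != 0 -> z2 != 0 -> `|z1| < r -> `|z2| < r -> mean g z1 = mean g z2.
Proof.
move=> gd z10 z20 z1r z2r.
have [y1 y1E] := cexp_surj z10; have [y2 y2E] := cexp_surj z20.
pose h z := g (cexp z).
have hd z : in_par y1 (y2 - y1) (iper R) z -> differentiable h z.
  move=> [s [t [s01 t01 ->]]]; apply: (@differentiable_comp _ _ _ _ (@cexp R) g).
    exact: cexp_differentiable.
  apply: gd; first by rewrite normr_gt0 cexp_neq0.
  have tr : t \is Num.real by apply: ger0_real; case/andP: t01.
  rewrite cexpD normrM (norm_cexp_iper tr) mulr1.
  by apply: norm_cexp_segment; rewrite ?y1E ?y2E.
have hper z : h (z + iper R) = h z by rewrite /h cexpD cexp_iper mulr1.
have := goursat hd; rewrite parE.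
have -> : dint (fun s => h (y1 + iper R + s * (y2 - y1))) = dint (fun s => h (y1 + s * (y2 - y1))).
  by apply: eq_dint => s _; rewrite addrAC hper.
have E (z y : C) : cexp y = z -> dint (fun t => h (y + t * iper R)) = mean g z.
  by move=> yz; apply: eq_dint => t _; rewrite /h cexpD yz.
rewrite (E _ _ y1E) [y1 + (y2 - y1)]addrC subrK (E _ _ y2E).
set a := (y2 - y1) * _; have -> (x y : C) : a + x - a - y = x - y by ring.
by move=> /eqP; rewrite -mulrBr mulf_eq0 (negPf (iper_neq0 R)) subr_eq0 => /eqP.
Qed.

Lemma differentiable_idfun (z : C) : differentiable (fun z : C => z) z.
Proof. exact: (@ex_diff _ _ _ _ _ _ _ (is_diff_id z)). Qed.

Lemma differentiable_add (U : normedModType C) (f g : U -> C) x :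
  differentiable f x -> differentiable g x -> differentiable (fun y => f y + g y) x.
Proof. exact: differentiableD. Qed.

Lemma differentiable_mul (U : normedModType C) (f g : U -> C) x :
  differentiable f x -> differentiable g x -> differentiable (fun y => f y * g y) x.
Proof. exact: differentiableM. Qed.

Lemma differentiable_inv (U : normedModType C) (f : U -> C) x :
  differentiable f x -> f x != 0 -> differentiable (fun y => (f y)^-1) x.
Proof. exact: differentiableV. Qed.

Lemma differentiable_expn (z : C) k : differentiable (fun z : C => z ^+ k) z.
Proof.
elim: k => [|k IH]; first exact: differentiable_cst.
rewrite [X in differentiable X _](_ : _ = (fun z : C => z) * (fun z => z ^+ k)).
  by apply: differentiableM => //; exact: differentiable_idfun.
by apply/funext => y; rewrite exprS.
Qed.

Lemma differentiable_expVn (z : C) k : z != 0 -> differentiable (fun z : C => z ^- k) z.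
Proof.
move=> z0; apply: (@differentiableV _ _ (fun z : C => z ^+ k)).
  exact: differentiable_expn.
by rewrite expf_neq0.
Qed.

(** The mean at [y] is a constant times [y ^+ k.+1], and it is the same at 1 and 2, so the constant
    vanishes. *)
Lemma mean_expn (z : C) k : z != 0 -> mean (fun z => z ^+ k.+1) z = 0.
Proof.
move=> z0; pose f (z : C) : C := z ^+ k.+1.
have E (y : C) : mean f y = y ^+ k.+1 * dint (fun t => circ t ^+ k.+1).
  rewrite -dintZ; first by apply: eq_dint => t _; rewrite /f exprMn.
  move=> t t01; apply: (@continuous_comp C C C circ f); first exact: circ_continuous.
  exact/differentiable_continuous/differentiable_expn.
have d0 : dint (fun t => circ t ^+ k.+1) = 0.
  have := @mean_cst f 3 1 2 (fun z _ _ => differentiable_expn z k.+1) (oner_neq0 _).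
  rewrite pnatr_eq0 normr1 normr_nat !ltr_nat ltr1n => /(_ isT isT isT).
  rewrite !E expr1n mul1r => /eqP; rewrite -subr_eq0 -[X in X - _]mul1r -mulrBl mulf_eq0.
  case/orP=> [|/eqP //]; rewrite subr_eq0 eq_sym -natrX -[1]/(1%:R) eqr_nat.
  by rewrite expnS => /eqP; have := expn_gt0 2 k; lia.
by rewrite E d0 mulr0.
Qed.

Lemma mean_expVn (z : C) k : z != 0 -> mean (fun z => z ^- k.+1) z = 0.
Proof.
move=> z0; pose f (z : C) : C := z ^- k.+1.
have fd (y : C) : y != 0 -> differentiable f y by exact: differentiable_expVn.
have E (y : C) : mean f y = y ^- k.+1 * dint (fun t => circ t ^- k.+1).
  rewrite -dintZ; first by apply: eq_dint => t _; rewrite /f exprMn invfM.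
  move=> t t01; apply: (@continuous_comp C C C circ f); first exact: circ_continuous.
  exact/differentiable_continuous/fd/circ_neq0.
have d0 : dint (fun t => circ t ^- k.+1) = 0.
  have fd' (y : C) : 0 < `|y| -> `|y| < 3 -> differentiable f y.
    by move=> y0 _; apply: fd; rewrite -normr_gt0.
  have := mean_cst fd' (oner_neq0 _) (_ : 2 != 0).
  rewrite pnatr_eq0 normr1 normr_nat !ltr_nat ltr1n => /(_ isT isT isT).
  rewrite !E expr1n invr1 mul1r => /eqP.
  rewrite -subr_eq0 -[X in X - _]mul1r -mulrBl mulf_eq0.
  case/orP=> [|/eqP //]; rewrite subr_eq0 eq_sym invr_eq1 -natrX -[1]/(1%:R) eqr_nat.
  by rewrite expnS => /eqP; have := expn_gt0 2 k; lia.
by rewrite E d0 mulr0.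
Qed.

(** Cauchy's integral for the [l]-th Taylor coefficient, over the circle of radius [r]. *)
Definition tcoef (f : C -> C) (r : C) (l : nat) : C := mean (fun z => f z * z ^- l) r.

Lemma cont01_expVn k : cont01 (fun t => circ t ^- k).
Proof.
move=> t t01; apply: (@continuous_comp C C C circ (fun z => z ^- k)); first exact: circ_continuous.
exact/differentiable_continuous/differentiable_expVn/circ_neq0.
Qed.

Lemma cont01_expn k : cont01 (fun t => circ t ^+ k).
Proof.
move=> t t01; apply: (@continuous_comp C C C circ (fun z => z ^+ k)); first exact: circ_continuous.
exact/differentiable_continuous/differentiable_expn.
Qed.

Lemma cont01M (g h : C -> C) : cont01 g -> cont01 h -> cont01 (fun t => g t * h t).
Proof. by move=> gc hc t t01; apply: (@continuousM _ _ g h); [exact: gc|exact: hc]. Qed.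

Lemma cont01_cst (c : C) : cont01 (fun=> c).
Proof. by move=> t _; exact: cst_continuous. Qed.

Lemma cont01_sum (I : Type) (s : seq I) (g : I -> C -> C) :
  (forall i, cont01 (g i)) -> cont01 (fun t => \sum_(i <- s) g i t).
Proof.
move=> gc; elim: s => [|i s IH].
  rewrite (_ : (fun t : C => _) = fun=> 0); first exact: cont01_cst.
  by apply/funext => t; rewrite big_nil.
rewrite (_ : (fun t : C => _) = fun t => g i t + \sum_(j <- s) g j t).
  by move=> t t01; apply: (@continuousD _ _ _ (g i)); [exact: gc|exact: IH].
by apply/funext => t; rewrite big_cons.
Qed.

Lemma dint_sum (I : Type) (s : seq I) (g : I -> C -> C) :
  (forall i, cont01 (g i)) ->
  dint (fun t => \sum_(i <- s) g i t) = \sum_(i <- s) dint (g i).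
Proof.
move=> gc; elim: s => [|i s IH].
  rewrite big_nil -[RHS](@dint_cst R 0).
  by apply: eq_dint => t _; rewrite big_nil.
rewrite big_cons -IH -(dintD (gc i) (@cont01_sum _ s _ gc)).
by apply: eq_dint => t _; rewrite big_cons.
Qed.

Lemma cont01B_cst (g : C -> C) c : cont01 g -> cont01 (fun t => g t - c).
Proof.
by move=> gc t t01; apply: (@continuousB _ _ _ g (fun=> c)); [exact: gc|exact: cst_continuous].
Qed.

Lemma dintB_cst (g : C -> C) c : cont01 g -> dint g - c = dint (fun t => g t - c).
Proof.
by move=> gc; have := dintD gc (@cont01_cst (- c)); rewrite (@dint_cst R (- c)) => ->.
Qed.

(* The positive kernel [((2 + w + w^-1) / 4) ^+ N] on the unit circle. *)
Definition kern (w : C) : C := (2 + w + w^-1) / 4.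

Lemma kernE (w : C) N : w != 0 ->
  kern w ^+ N = \sum_(k < N.*2.+1) 4^-1 ^+ N * 'C(N.*2, k)%:R * (w ^+ k * w ^- N).
Proof.
move=> w0; have -> : kern w = (1 + w) ^+ 2 * (4^-1 * w^-1).
  by rewrite /kern; field.
rewrite exprMn -exprM mul2n exprDn big_distrl /=; apply: eq_bigr => k _.
rewrite [1 ^+ _]expr1n mul1r -[_ *+ 'C(_, _)]mulr_natr [_ ^+ N]exprMn [w^-1 ^+ N]exprVn.
by move: (4^-1 ^+ N) (w ^+ k) (w ^- N) => a b c; ring.
Qed.

(** On the unit circle [kern w] is |1 + w|^2 / 4. The second identity lets [1 - kern w] control the
    distance of [w] from 1. *)
Lemma kern_ge0 (w : C) : `|w| = 1 -> 0 <= kern w /\ `|1 - w| ^+ 2 = 4 * (1 - kern w).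
Proof.
move=> w1; have w0 : w != 0 by rewrite -normr_gt0 w1.
have wJ : w^-1 = w^* by rewrite -[RHS](mulKf w0) -normCK w1 expr1n mulr1.
have E : `|1 + w| ^+ 2 = 4 * kern w.
  have -> : `|1 + w| ^+ 2 = (1 + w) * (1 + w^-1) by rewrite normCK wJ rmorphD rmorph1.
  by rewrite /kern; field.
split; first by rewrite -(pmulr_rge0 _ (_ : 0 < 4)) // -E exprn_ge0.
have -> : `|1 - w| ^+ 2 = (1 - w) * (1 - w^-1) by rewrite normCK wJ rmorphB rmorph1.
by rewrite /kern; field.
Qed.

Definition kmass (N : nat) : C := 4^-1 ^+ N * 'C(N.*2, N)%:R.

Lemma kmass_gt0 N : 0 < kmass N.
Proof.
by rewrite mulr_gt0 ?exprn_gt0 ?invr_gt0 // ltr0n bin_gt0 -addnn leq_addr.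
Qed.

(** Divided by [kmass N], this is the mean of [1 - kern] against the normalized kernel: the kernel
    concentrates at 1 at the rate 1 / (2N + 2). *)
Lemma kmassS N : kmass N - kmass N.+1 = kmass N / (N.*2.+2)%:R.
Proof.
have E : ('C(N.+1.*2, N.+1) * N.+1 = 2 * N.*2.+1 * 'C(N.*2, N))%N.
  have e1 := mul_bin_diag N.*2.+2 N; have e2 := mul_bin_diag N.*2.+1 N.
  rewrite /= in e1 e2.
  have e3 : 'C(N.*2.+1, N) = 'C(N.*2.+1, N.+1).
    by rewrite -[RHS]bin_sub; [congr 'C(_, _); lia|lia].
  have : (N.+1 * ('C(N.*2.+2, N.+1) * N.+1) = N.+1 * (2 * N.*2.+1 * 'C(N.*2, N)))%N.
    rewrite [('C(_, _) * _)%N]mulnC -e1 e3 mulnCA -e2.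
    by move: 'C(N.*2, N) => c; lia.
  by rewrite doubleS => /eqP; rewrite eqn_pmul2l // => /eqP.
have N1 : N.+1%:R != 0 :> C by rewrite pnatr_eq0.
have {}E : 'C(N.+1.*2, N.+1)%:R = 2 * N.*2.+1%:R * 'C(N.*2, N)%:R / N.+1%:R :> C.
  by apply: (mulIf N1); rewrite divfK // -!natrM E.
rewrite /kmass E exprS.
have -> : N.*2.+2%:R = 2 * N.+1%:R :> C by rewrite -doubleS -mul2n natrM.
have -> : N.*2.+1%:R = 2 * N.+1%:R - 1 :> C by rewrite -addn1 -mul2n natrD natrM -[N.+1%:R]natr1; ring.
by move: (4^-1 ^+ N) 'C(N.*2, N)%:R N.+1%:R N1 => a c m m0; field.
Qed.

Lemma dint_kern N : dint (fun t => kern (circ t) ^+ N) = kmass N.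
Proof.
pose g (k : 'I_N.*2.+1) (t : C) := 4^-1 ^+ N * 'C(N.*2, k)%:R * (circ t ^+ k * circ t ^- N).
have gc k : cont01 (fun t => circ t ^+ k * circ t ^- N).
  exact: (@cont01M (fun t => circ t ^+ k) (fun t => circ t ^- N) (@cont01_expn k) (@cont01_expVn N)).
transitivity (dint (fun t => \sum_(k < N.*2.+1) g k t)).
  by apply: eq_dint => t _; rewrite kernE ?circ_neq0.
rewrite dint_sum => [|k]; last by apply: (@cont01M (fun=> 4^-1 ^+ N * 'C(N.*2, k)%:R) _ _ (gc k)); exact: cont01_cst.
have gE k : dint (g k) = 4^-1 ^+ N * 'C(N.*2, k)%:R * dint (fun t => circ t ^+ k * circ t ^- N).
  exact: dintZ.
have Nlt : (N < N.*2.+1)%N by lia.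
rewrite (bigD1 (Ordinal Nlt)) //= big1 => [|k kN]; last first.
  rewrite gE; have [kN'|Nk|kN'] := ltngtP k N; last by case/negP: kN; apply/eqP/val_inj.
    rewrite -[X in _ * X = _](_ : mean (fun z => z ^- (N - k).-1.+1) 1 = _).
      by rewrite mean_expVn ?oner_neq0 // mulr0.
    apply: eq_dint => t _; rewrite mul1r prednK ?subn_gt0 // exprB ?(ltnW kN') ?unitfE ?circ_neq0 //.
    by rewrite invf_div.
  rewrite -[X in _ * X = _](_ : mean (fun z => z ^+ (k - N).-1.+1) 1 = _).
    by rewrite mean_expn ?oner_neq0 // mulr0.
  apply: eq_dint => t _; rewrite mul1r prednK ?subn_gt0 // exprB ?(ltnW Nk) ?unitfE ?circ_neq0 //.
rewrite addr0 gE /= (_ : dint (fun t => circ t ^+ N / circ t ^+ N) = 1).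
  by rewrite mulr1.
rewrite -[RHS](@dint_cst R 1).
by apply: eq_dint => t _; rewrite divff // expf_neq0 ?circ_neq0.
Qed.

Lemma dint_norm_le_dint (g h : C -> C) : cont01 g -> cont01 h ->
  (forall t, 0 <= t <= 1 -> `|g t| <= h t) -> `|dint g| <= `|dint h|.
Proof.
move=> gc hc gh; rewrite real_leNgt ?normr_real //; apply/negP => lt.
have d0 : 0 < (`|dint g| - `|dint h|) / 4 by rewrite divr_gt0 // subr_gt0.
have /cvgn_eps/(_ _ d0)[N1 N1P] := dint_cvg gc.
have /cvgn_eps/(_ _ d0)[N2 N2P] := dint_cvg hc.
set d := (_ / 4) in d0 N1P N2P.
have {}N1P := N1P (maxn N1 N2) (leq_maxl _ _); have {}N2P := N2P (maxn N1 N2) (leq_maxr _ _).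
set N := maxn N1 N2 in N1P N2P.
have gd : `|dint g| <= `|dint h| + 2 * d.
  have -> : 2 * d = d + d by ring.
  rewrite -[dint g](subKr (dsum g N)); apply: le_trans (ler_normB _ _) _.
  rewrite addrA; apply: lerD; last by [].
  have h1 : `|dsum g N| <= `|dsum h N|.
    have h0 : 0 <= dsum h N by exact: le_trans (normr_ge0 _) (dsum_le N gh).
    by rewrite [leRHS]ger0_norm //; exact: dsum_le.
  apply: le_trans h1 _; rewrite -[dsum h N](subrK (dint h)) addrC.
  by apply: le_trans (ler_normD _ _) _; apply: lerD.
have : `|dint g| - `|dint h| <= 2 * d by rewrite lerBlDl.
have {1}-> : `|dint g| - `|dint h| = 4 * d by rewrite /d; field.
by rewrite ler_pM2r // ler_nat.
Qed.

(** The normalized powers of [kern] are the de la Vallee Poussin kernels. They are nonnegative of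
    mass 1, and [kmassS] evaluates the contribution of the term [c * (1 - kern)]. *)
Lemma dint_kern_approx (g : C -> C) (a e c : C) N : cont01 g -> 0 <= e -> 0 <= c ->
  (forall t, 0 <= t <= 1 -> `|g t - a| <= e + c * (1 - kern (circ t))) ->
  `|dint (fun t => g t * kern (circ t) ^+ N) / kmass N - a| <= e + c / (N.*2.+2)%:R.
Proof.
move=> gc e0 c0 ga.
have kc k : cont01 (fun t => kern (circ t) ^+ k).
  move=> t t01; apply: (@continuous_comp C C C circ (fun w => kern w ^+ k)); first exact: circ_continuous.
  apply: differentiable_continuous; apply: (@differentiable_comp _ _ _ _ kern (fun z => z ^+ k)); last first.
    exact: differentiable_expn.
  apply: (@differentiable_mul _ (fun w : C => 2 + w + w^-1) (fun=> 4^-1)); last first.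
    exact: differentiable_cst.
  apply: (@differentiable_add _ (fun w : C => 2 + w) (fun w => w^-1)).
    apply: (@differentiable_add _ (fun w : C => 2) (fun w => w)); last exact: differentiable_idfun.
    exact: differentiable_cst.
  by apply: (@differentiable_inv _ (fun z : C => z)); [exact: differentiable_idfun|exact: circ_neq0].
have m0 := kmass_gt0 N.
have -> : dint (fun t => g t * kern (circ t) ^+ N) / kmass N - a =
    dint (fun t => (g t - a) * kern (circ t) ^+ N) / kmass N.
  have := dintD (@cont01M (fun t => g t - a) _ _ (kc N)) (@cont01M (fun=> a) _ (@cont01_cst a) (kc N)).
  have gac := @cont01B_cst g a gc.
  move=> /(_ gac); rewrite (dintZ a (kc N)) dint_kern => E.
  have -> : dint (fun t => g t * kern (circ t) ^+ N) =
      dint (fun t => (g t - a) * kern (circ t) ^+ N) + a * kmass N.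
    by rewrite -E; apply: eq_dint => t _; rewrite -mulrDl subrK.
  by rewrite mulrDl mulfK ?gt_eqF // addrK.
rewrite normrM normfV (gtr0_norm m0) ler_pdivrMr //.
have hE : dint (fun t => e * kern (circ t) ^+ N + (c * kern (circ t) ^+ N + - c * kern (circ t) ^+ N.+1))
    = (e + c / (N.*2.+2)%:R) * kmass N.
  have eZ (x : C) k : cont01 (fun t => x * kern (circ t) ^+ k).
    exact: (@cont01M (fun=> x) _ (@cont01_cst x) (kc k)).
  have cc : cont01 (fun t => c * kern (circ t) ^+ N + - c * kern (circ t) ^+ N.+1).
    by move=> t t01; apply: (@continuousD _ _ _ (fun t => c * kern (circ t) ^+ N)); exact: eZ.
  rewrite (dintD (eZ e N) cc) (dintD (eZ c N) (eZ (- c) N.+1)) !(dintZ _ (kc _)) !dint_kern.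
  rewrite mulNr -mulrBr kmassS; move: (kmass N) => k; ring.
have h0 : 0 <= (e + c / (N.*2.+2)%:R) * kmass N.
  by apply: mulr_ge0 (ltW m0); apply: addr_ge0 => //; exact: divr_ge0.
rewrite -[leRHS]ger0_norm // -hE; apply: dint_norm_le_dint.
- exact: (cont01M (@cont01B_cst g a gc) (kc N)).
- have eZ (x : C) k : cont01 (fun t => x * kern (circ t) ^+ k).
    exact: (@cont01M (fun=> x) _ (@cont01_cst x) (kc k)).
  move=> t t01; apply: (@continuousD _ _ _ (fun t => e * kern (circ t) ^+ N)); first exact: eZ.
  by apply: (@continuousD _ _ _ (fun t => c * kern (circ t) ^+ N)); exact: eZ.
move=> t t01; have [k0 _] := kern_ge0 (norm_circ t01).
rewrite normrM (ger0_norm (exprn_ge0 _ k0)) exprS.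
apply: le_trans (ler_wpM2r (exprn_ge0 _ k0) (ga t t01)) _.
have aux (x y : C) : (e + c * (1 - y)) * x = e * x + (c * x + - c * (y * x)) by ring.
by rewrite aux.
Qed.

(** The ratio of the [l]-th to the constant Laurent coefficient of [kern ^+ N]: the factor by which
    averaging against the normalized kernel damps the [l]-th Taylor term. *)
Definition lam (N l : nat) : C := 'C(N.*2, N - l)%:R / 'C(N.*2, N)%:R.

Lemma binN_neq0 N : 'C(N.*2, N)%:R != 0 :> C.
Proof. by rewrite pnatr_eq0 -lt0n bin_gt0 -addnn leq_addr. Qed.

Lemma lam0 N : lam N 0 = 1.
Proof. by rewrite /lam subn0 divff // binN_neq0. Qed.

Lemma lamS N l : (l < N)%N -> lam N l.+1 = lam N l * ((N - l)%:R / (N + l).+1%:R).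
Proof.
move=> lN; rewrite /lam.
have e1 := mul_bin_left N.*2 (N - l.+1).
have e2 : (N - l.+1).+1 = (N - l)%N by lia.
have e3 : (N.*2 - (N - l.+1) = (N + l).+1)%N by lia.
rewrite e2 e3 in e1.
have e4 : (N - l)%:R * 'C(N.*2, N - l)%:R = (N + l).+1%:R * 'C(N.*2, N - l.+1)%:R :> C.
  by rewrite -!natrM e1.
have n0 : (N + l).+1%:R != 0 :> C by rewrite pnatr_eq0.
have -> : 'C(N.*2, N - l.+1)%:R = (N - l)%:R * 'C(N.*2, N - l)%:R / (N + l).+1%:R :> C.
  by rewrite e4 mulrC mulKf.
move: ((N + l).+1%:R) (binN_neq0 N) n0 => m; move: 'C(N.*2, N)%:R => b b0 m0.
by move: (N - l)%:R 'C(N.*2, N - l)%:R => u v; field; rewrite b0 m0.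
Qed.

Lemma lam_ge0 N l : 0 <= lam N l.
Proof. by rewrite divr_ge0. Qed.

Lemma lam_le1 N l : (l <= N)%N -> lam N l <= 1.
Proof.
elim: l => [|l IH] lN; first by rewrite lam0.
rewrite lamS //; apply: mulr_ile1; rewrite ?lam_ge0 ?IH ?(ltnW lN) //.
by rewrite ler_pdivrMr ?ltr0n // mul1r ler_nat; lia.
Qed.

Lemma natV_small (e : C) : 0 < e -> exists N, forall k, (N <= k)%N -> k.+1%:R^-1 <= e.
Proof.
move=> e0; have [N Ne] := half_pow_small e0; exists (2 ^ N)%N => k Nk.
apply: le_trans (ltW Ne); rewrite exprVn lef_pV2 ?posrE ?exprn_gt0 ?ltr0n //.
by rewrite -natrX ler_nat; lia.
Qed.

Lemma lam_cvg l : lam N l @[N --> \oo] --> (1 : C).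
Proof.
elim: l => [|l IH].
  by under eq_fun do rewrite lam0; exact: cvg_cst.
apply/cvgn_eps => e e0; have e2 : 0 < e / 2 by rewrite divr_gt0.
have /cvgn_eps/(_ _ e2)[N1 N1P] := IH.
have l0 : 0 < (l.*2.+1)%:R :> C by rewrite ltr0n.
have [N2 N2P] := natV_small (divr_gt0 e2 l0).
exists (maxn N1 (maxn N2 l.+1)) => m; rewrite !geq_max => /and3P[m1 m2 ml].
rewrite lamS // (splitr e).
have -> : lam m l * ((m - l)%:R / (m + l).+1%:R) - 1 =
    lam m l - 1 - lam m l * (l.*2.+1%:R / (m + l).+1%:R).
  have n0 : (m + l).+1%:R != 0 :> C by rewrite pnatr_eq0.
  have -> : (m - l)%:R = (m + l).+1%:R - l.*2.+1%:R :> C by rewrite -natrB; [congr (_%:R); lia|lia].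
  by move: ((m + l).+1%:R) n0 (lam m l) (l.*2.+1%:R) => p p0 q u; field.
apply: le_trans (ler_normB _ _) _; apply: lerD; first exact: N1P.
rewrite normrM ger0_norm ?lam_ge0 // ger0_norm ?divr_ge0 //.
apply: (@le_trans _ _ (l.*2.+1%:R / (m + l).+1%:R)).
  by rewrite ler_piMl ?divr_ge0 // lam_le1 // ltnW.
rewrite mulrC -ler_pdivlMr //; apply: N2P.
exact: leq_trans m2 (leq_addr _ _).
Qed.
End Taylor.

Opaque circ.

(** * Taylor's formula on a disc, by averaging against the kernels *)

Section TaylorTheorem.
Variable R : realType.
Local Notation C := (Cplx R).
Variables (f : C -> C) (rho : C).
Hypothesis fd : forall z : C, `|z| < rho -> differentiable f z.

Let gd (z : C) l : 0 < `|z| -> `|z| < rho -> differentiable (fun z => f z * z ^- l) z.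
Proof.
move=> z0 zr; apply: differentiable_mul; first exact: fd.
by apply: differentiable_expVn; rewrite -normr_gt0.
Qed.

Lemma tcoef_indep (r1 r2 : C) l : r1 != 0 -> r2 != 0 -> `|r1| < rho -> `|r2| < rho ->
  tcoef f r1 l = tcoef f r2 l.
Proof. by apply: mean_cst => z; exact: gd. Qed.

Lemma cont01_fcirc (z : C) : `|z| < rho -> cont01 (fun t => f (z * circ t)).
Proof.
move=> zr; apply: cont01_circ => t t01; apply: differentiable_continuous; apply: fd.
by rewrite normrM norm_circ // mulr1.
Qed.

Lemma cont01_fcircV (z : C) l : z != 0 -> `|z| < rho ->
  cont01 (fun t => f (z * circ t) * (z * circ t) ^- l).
Proof.
move=> z0 zr; apply: (@cont01_circ _ (fun z => f z * z ^- l)) => t t01.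
apply: differentiable_continuous; apply: gd; rewrite normrM norm_circ // mulr1 //.
by rewrite normr_gt0.
Qed.

Lemma tcoef_le (r B : C) l : 0 < r -> r < rho ->
  (forall t, 0 <= t <= 1 -> `|f (r * circ t)| <= B) ->
  `|tcoef f r l| <= B * r ^- l.
Proof.
move=> r0 rr fB; apply: dint_norm_le => [|t t01].
  by apply: cont01_fcircV; rewrite ?gt_eqF // gtr0_norm.
have rc : `|r * circ t| = r by rewrite normrM norm_circ // mulr1 gtr0_norm.
rewrite normrM normfV normrX rc; apply: ler_wpM2r; last exact: fB.
by rewrite invr_ge0 exprn_ge0 // ltW.
Qed.

Lemma fbounded0 : 0 < rho -> exists d B : C, [/\ 0 < d, d < rho, 0 <= B &
  forall z, `|z| <= d -> `|f z| <= B].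
Proof.
move=> r0; have /differentiable_continuous : differentiable f 0 by apply: fd; rewrite normr0.
move=> /(@cvgrPdist_le _ _ _ (nbhs (0 : C)) (nbhs_filter (0 : C)))/(_ 1 ltr01).
move=> /nbhs_ballP[d /= d0 dP].
have dr : d \is Num.real by exact: gtr0_real.
have rr : rho \is Num.real by exact: gtr0_real.
pose m := (if d < rho then d else rho) / 2.
have m1 : [/\ 0 < m, m < d & m < rho].
  rewrite /m; case: ifPn => [dlt|]; last rewrite -real_leNgt // => led.
    have h : d / 2 < d by rewrite ltr_pdivrMr // ltr_pMr // ltr1n.
    by split; rewrite ?divr_gt0 //; exact: lt_trans dlt.
  have h : rho / 2 < rho by rewrite ltr_pdivrMr // ltr_pMr // ltr1n.
  by split; rewrite ?divr_gt0 //; exact: lt_le_trans led.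
case: m1 => m0 md mr; exists m, (`|f 0| + 1); split => //.
move=> z zm; have := dP z; rewrite -ball_normE /= sub0r normrN => /(_ (le_lt_trans zm md)) h.
rewrite -[f z](subKr (f 0)); apply: le_trans (ler_normB _ _) _.
exact: lerD.
Qed.

(** The mean does not depend on the radius, and it tends to 0 with the radius because [f] is bounded
    near 0 and is multiplied by a positive power. *)
Lemma mean_fexp0 (z : C) l : z != 0 -> `|z| < rho -> mean (fun z => f z * z ^+ l.+1) z = 0.
Proof.
move=> z0 zr; have r0 : 0 < rho by exact: le_lt_trans zr.
have [d [B [d0 dr B0 dB]]] := fbounded0 r0.
have hd (y : C) : `|y| < rho -> differentiable (fun z => f z * z ^+ l.+1) y.
  by move=> yr; apply: differentiable_mul; [exact: fd|exact: differentiable_expn].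
apply/eqP; rewrite -normr_eq0 -[_ == 0]negbK; apply/negP => nz.
set M := `|_| in nz; have M0 : 0 < M by rewrite lt_def nz normr_ge0.
have bound (e : C) : 0 < e -> e <= 1 -> M <= B * (d * e) ^+ l.+1.
  move=> e0 e1; have de0 : d * e != 0 by rewrite mulf_neq0 ?gt_eqF.
  have ded : `|d * e| <= d by rewrite normrM !gtr0_norm // ler_piMr // ltW.
  have der : `|d * e| < rho by exact: le_lt_trans dr.
  rewrite /M (@mean_cst _ _ rho z (d * e) (fun y _ yr => hd y yr)) //.
  apply: dint_norm_le => [|t t01].
    apply: (@cont01_circ _ (fun z => f z * z ^+ l.+1)) => t t01.
    apply: differentiable_continuous; apply: hd.
    by rewrite normrM norm_circ // mulr1.
  have nc : `|d * e * circ t| = d * e.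
    by rewrite normrM norm_circ // mulr1 gtr0_norm // mulr_gt0.
  rewrite normrM normrX nc; apply: ler_wpM2r.
    by rewrite exprn_ge0 // mulr_ge0 // ltW.
  by apply: dB; rewrite nc; move: ded; rewrite gtr0_norm // mulr_gt0.
(* [K > M] makes [e := M / K / 2] at most 1, and [K >= B * d ^+ l.+1] makes [B * (d * e) ^+ l.+1] at
   most [K * e], which is [M / 2]. *)
pose K := B * d ^+ l.+1 + M + 1.
have K0 : 0 < K by rewrite ltr_wpDl // addr_ge0 ?mulr_ge0 ?exprn_ge0 // ?(ltW d0) ?(ltW M0).
have MK : M < K by rewrite /K ltr_pwDr // lerDr mulr_ge0 // exprn_ge0 // ltW.
have e0 : 0 < M / K / 2 by rewrite !divr_gt0.
have e1 : M / K / 2 <= 1.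
  rewrite ler_pdivrMr // mul1r ler_pdivrMr //; apply: le_trans (ltW MK) _.
  by rewrite ler_peMl ?(ltW K0) // ler1n.
suff : B * (d * (M / K / 2)) ^+ l.+1 < M.
  by move=> /(le_lt_trans (bound _ e0 e1)); rewrite ltxx.
rewrite exprMn mulrA; apply: (@le_lt_trans _ _ (K * (M / K / 2))).
  apply: ler_pM => //.
  - by rewrite mulr_ge0 // exprn_ge0 // ltW.
  - by rewrite exprn_ge0 // ltW.
  - by rewrite /K -addrA lerDl addr_ge0 // ltW.
  by rewrite exprS ler_piMr ?(ltW e0) // exprn_ile1 // ltW.
have -> : K * (M / K / 2) = M / 2 by field; rewrite gt_eqF.
by rewrite ltr_pdivrMr // ltr_pMr // ltr1n.
Qed.

Lemma tcoef0 (r : C) : r != 0 -> `|r| < rho -> tcoef f r 0 = f 0.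
Proof.
move=> r0 rr; have rho0 : 0 < rho by exact: le_lt_trans rr.
apply/eqP; rewrite -subr_eq0 -normr_eq0 -[_ == 0]negbK; apply/negP => nz.
set M := `|_| in nz; have M0 : 0 < M by rewrite lt_def nz normr_ge0.
have /differentiable_continuous : differentiable f 0 by apply: fd; rewrite normr0.
have M2 : 0 < M / 2 by rewrite divr_gt0.
move=> /(@cvgrPdist_le _ _ _ (nbhs (0 : C)) (nbhs_filter (0 : C)))/(_ _ M2).
move=> /nbhs_ballP[d /= d0 dP].
have [e [B [e0 er _ _]]] := fbounded0 rho0.
pose m := d * e / (d + e).
have de0 : 0 < d + e by rewrite addr_gt0.
have m0 : 0 < m by rewrite divr_gt0 // mulr_gt0.
have md : m < d by rewrite /m ltr_pdivrMr // ltr_pM2l // ltrDr.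
have me : m < e by rewrite /m ltr_pdivrMr // mulrC ltr_pM2l // ltrDl.
have mr : `|m| < rho by rewrite gtr0_norm //; exact: lt_trans me er.
have : M <= M / 2.
  have m00 : m != 0 by rewrite gt_eqF.
  rewrite {1}/M (tcoef_indep _ r0 m00 rr mr).
  have gE : tcoef f m 0 = dint (fun t => f (m * circ t)).
    by apply: eq_dint => t _; rewrite expr0 invr1 mulr1.
  have fc := cont01_fcirc mr.
  rewrite gE (dintB_cst _ fc); apply: dint_norm_le => [|t t01]; first exact: cont01B_cst.
  rewrite distrC; apply: dP; rewrite -ball_normE /= sub0r normrN normrM norm_circ // mulr1.
  by rewrite gtr0_norm.
by apply/negP; rewrite -real_ltNge ?gtr0_real // ltr_pdivrMr // ltr_pMr // ltr1n.
Qed.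

(** Expanding the kernel produces the Laurent moments of [f] on the circle. Positive powers
    contribute 0 by [mean_fexp0], and the power [-l] gives the [l]-th Taylor coefficient. So [f] is
    compared with finite damped Taylor sums before any convergence of its series is known. *)
Lemma kern_mean (z r : C) N : z != 0 -> `|z| < rho -> r != 0 -> `|r| < rho ->
  dint (fun t => f (z * circ t) * kern (circ t) ^+ N) / kmass R N =
  \sum_(l < N.+1) lam R N l * tcoef f r l * z ^+ l.
Proof.
move=> z0 zr r0 rr.
pose g (k : 'I_(N.+1 + N)) (t : C) :=
  (4^-1 ^+ N * 'C(N.*2, k)%:R) * (f (z * circ t) * (circ t ^+ k * circ t ^- N)).
have fc := cont01_fcirc zr.
have gc (k : nat) : cont01 (fun t => f (z * circ t) * (circ t ^+ k * circ t ^- N)).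
  by apply: (cont01M fc); apply: cont01M; [exact: cont01_expn|exact: cont01_expVn].
have gcc k : cont01 (g k).
  by apply: (@cont01M _ (fun=> 4^-1 ^+ N * 'C(N.*2, k)%:R) _ _ (gc k)); exact: cont01_cst.
have eN : (N.*2.+1 = N.+1 + N)%N by lia.
have -> : dint (fun t => f (z * circ t) * kern (circ t) ^+ N) = \sum_k dint (g k).
  rewrite -dint_sum //; apply: eq_dint => t _.
  rewrite kernE ?circ_neq0 // eN big_distrr /=; apply: eq_bigr => k _.
  by rewrite /g mulrCA.
have gE k : dint (g k) = 4^-1 ^+ N * 'C(N.*2, k)%:R *
    dint (fun t => f (z * circ t) * (circ t ^+ k * circ t ^- N)) by exact: (dintZ _ (gc k)).
rewrite big_split_ord /= [X in _ + X]big1 ?addr0 => [|k _]; last first.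
  rewrite gE /=; have kE : (N.+1 + k = N + k.+1)%N by lia.
  have zk : z ^+ k.+1 != 0 by rewrite expf_neq0.
  have : z ^+ k.+1 * dint (fun t => f (z * circ t) * (circ t ^+ (N.+1 + k) * circ t ^- N)) = 0.
    rewrite -(dintZ _ (gc _)) -(@mean_fexp0 z k z0 zr); apply: eq_dint => t _.
    have cN : circ t ^+ N != 0 by rewrite expf_neq0 // circ_neq0.
    rewrite kE exprD [(z * circ t) ^+ _]exprMn; move: (circ t ^+ N) cN (circ t ^+ k.+1) (z ^+ k.+1) => u u0 v w.
    by field.
  by move=> /eqP; rewrite mulf_eq0 (negPf zk) /= => /eqP ->; rewrite mulr0.
rewrite (reindex_inj rev_ord_inj) /= big_distrl /=; apply: eq_bigr => l _.
rewrite gE /=; have lN : (l <= N)%N by rewrite -ltnS.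
have -> : (N.+1 - l.+1 = N - l)%N by lia.
have zl : z ^+ l != 0 by rewrite expf_neq0.
have -> : dint (fun t => f (z * circ t) * (circ t ^+ (N - l) * circ t ^- N)) = z ^+ l * tcoef f r l.
  rewrite (tcoef_indep l r0 z0 rr zr) /tcoef /mean -(dintZ _ (@cont01_fcircV z l z0 zr)).
  apply: eq_dint => t _; rewrite [(z * circ t) ^+ _]exprMn exprB ?unitfE ?circ_neq0 //.
  have cN : circ t ^+ N != 0 by rewrite expf_neq0 // circ_neq0.
  have cl : circ t ^+ l != 0 by rewrite expf_neq0 // circ_neq0.
  move: (circ t ^+ N) cN (circ t ^+ l) cl (z ^+ l) zl => u u0 v v0 w w0.
  by field; rewrite u0 v0 w0.
rewrite /kmass /lam; have q0 : 4^-1 ^+ N != 0 :> C by rewrite expf_neq0 // invr_eq0 pnatr_eq0.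
move: (binN_neq0 R N) q0; move: 'C(N.*2, N)%:R (4^-1 ^+ N) 'C(N.*2, N - l)%:R => b q a b0 q0.
by field; rewrite b0 q0.
Qed.

Lemma kernel_cvg (z r B : C) : z != 0 -> `|z| < rho -> r != 0 -> `|r| < rho -> 0 <= B ->
  (forall t, 0 <= t <= 1 -> `|f (z * circ t)| <= B) ->
  \sum_(l < N.+1) lam R N l * tcoef f r l * z ^+ l @[N --> \oo] --> f z.
Proof.
move=> z0 zr r0 rr B0 fB; apply/cvgn_eps => e e0.
have e2 : 0 < e / 2 by rewrite divr_gt0.
have /differentiable_continuous := fd zr.
move=> /(@cvgrPdist_le _ _ _ (nbhs (z : C)) (nbhs_filter (z : C)))/(_ _ e2).
move=> /nbhs_ballP[d /= d0 dP].
have z1 : 0 < `|z| by rewrite normr_gt0.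
(* Where [z * circ t] is at distance at least [d] from [z], one has [d ^+ 2 <= 4 * |z| ^+ 2 * (1 -
   kern (circ t))]; this [c] then makes [c * (1 - kern (circ t))] at least [2 * B], a bound for the
   variation of [f]. *)
pose c := 8 * B * `|z| ^+ 2 / d ^+ 2.
have c0 : 0 <= c by rewrite divr_ge0 ?mulr_ge0 ?exprn_ge0 // ltW.
have c1 : 0 < c + 1 by rewrite ltr_wpDl.
have [N NP] := natV_small (divr_gt0 e2 c1).
have ga t : 0 <= t <= 1 -> `|f (z * circ t) - f z| <= e / 2 + c * (1 - kern (circ t)).
  move=> t01; have [k0 kE] := kern_ge0 (norm_circ t01).
  have k1 : 0 <= 1 - kern (circ t).
    by rewrite -(pmulr_rge0 _ (_ : 0 < 4)) // -kE exprn_ge0.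
  have zc : `|z - z * circ t| = `|z| * `|1 - circ t| by rewrite -normrM mulrBr mulr1.
  have [lt|] := boolP (`|z| * `|1 - circ t| < d).
    rewrite distrC -[leLHS]addr0; apply: lerD; last exact: mulr_ge0.
    by apply: dP; rewrite -ball_normE /= zc.
  rewrite -real_leNgt ?realM ?normr_real ?gtr0_real // => le.
  have h1 : d ^+ 2 <= `|z| ^+ 2 * (4 * (1 - kern (circ t))).
    rewrite -kE -exprMn; apply: lerXn2r; rewrite ?nnegrE //; exact: ltW.
  have h2 : 2 * B <= c * (1 - kern (circ t)).
    have -> : c * (1 - kern (circ t)) = 2 * B * (`|z| ^+ 2 * (4 * (1 - kern (circ t))) / d ^+ 2).
      by rewrite /c; field; rewrite gt_eqF.
    rewrite ler_peMr ?mulr_ge0 // ler_pdivlMr ?exprn_gt0 // mul1r //.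
  rewrite -[leLHS]add0r; apply: lerD; first exact: ltW.
  apply: le_trans h2; apply: le_trans (ler_normB _ _) _.
  have -> : 2 * B = B + B by ring.
  apply: lerD; first exact: fB.
  have := fB 0; rewrite circ0 mulr1; apply.
  by rewrite lexx ler01.
exists N => m Nm; rewrite -(kern_mean m z0 zr r0 rr).
apply: le_trans (dint_kern_approx m (cont01_fcirc zr) (ltW e2) c0 ga) _.
rewrite [leRHS](splitr e) lerD2l.
apply: (@le_trans _ _ ((c + 1) * m.*2.+2%:R^-1)).
  by rewrite ler_wpM2r ?invr_ge0 // lerDl.
rewrite mulrC -ler_pdivlMr //; apply: (NP m.*2.+1).
by apply: leq_trans Nm _; rewrite -addnn -addnS leq_addr.
Qed.

Lemma cont01_bounded (g : C -> C) : cont01 g -> exists2 B, 0 <= B &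
  forall t, 0 <= t <= 1 -> `|g t| <= B.
Proof.
move=> gc; have [N NP] := cont01_modulus gc ltr01.
exists (`|g 0| + (2 ^ N)%:R) => [|t t01]; first by rewrite addr_ge0.
have /andP[t0 t1] := t01.
have xk k : (k <= 2 ^ N)%N -> 0 <= k%:R * 2^-1 ^+ N * t <= 1.
  move=> kN; have /andP[h0 h1] := @node01 R k N kN.
  by rewrite mulr_ge0 //=; exact: mulr_ile1.
have := telescope_sumr (fun k => g (k%:R * 2^-1 ^+ N * t)) (leq0n (2 ^ N)).
have -> : (2 ^ N)%:R * 2^-1 ^+ N * t = t.
  by rewrite natrX -exprMn divff ?expr1n ?mul1r ?pnatr_eq0.
rewrite !mul0r => E; rewrite -[g t](subrK (g 0)) -E addrC.
apply: le_trans (ler_normD _ _) _; rewrite lerD2l.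
apply: le_trans (ler_norm_sum _ _ _) _.
have -> : (2 ^ N)%:R = \sum_(0 <= k < 2 ^ N) 1 :> C.
  by rewrite big_const_nat subn0 iter_addr addr0.
rewrite !big_mkord; apply: ler_sum => k _; apply: NP.
- by apply: xk; exact: ltn_ord.
- by apply: xk; exact: ltnW.
rewrite -mulrBl -mulrBl -natr1 addrC addKr mul1r normrM !ger0_norm // ?exprn_ge0 ?invr_ge0 //.
by rewrite ler_piMr // exprn_ge0 // invr_ge0.
Qed.

Lemma geometric_le (q : C) M N : 0 <= q -> q < 1 ->
  \sum_(M <= l < N) q ^+ l <= q ^+ M / (1 - q).
Proof.
move=> q0 q1; have q1' : 0 < 1 - q by rewrite subr_gt0.
have [NM|MN] := leqP N M.
  by rewrite big_geq // divr_ge0 ?exprn_ge0 // ltW.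
rewrite ler_pdivlMr // mulrC mulrBl mul1r big_distrr /=.
have -> : \sum_(M <= l < N) q * q ^+ l = \sum_(M <= l < N) q ^+ l.+1.
  by apply: eq_bigr => l _; rewrite exprS.
have -> : \sum_(M <= l < N) q ^+ l - \sum_(M <= l < N) q ^+ l.+1 = q ^+ M - q ^+ N.
  rewrite -sumrB -[RHS]opprB -(telescope_sumr (fun l => q ^+ l) (ltnW MN)) -sumrN.
  by apply: eq_bigr => l _; rewrite opprB.
by rewrite gerBl exprn_ge0.
Qed.

(** By [kernel_cvg] the damped sums converge to [f z]. The damping factors are at most 1, so
    Cauchy's inequality bounds the terms from [M] on by a geometric series, uniformly in [N]; each
    of the first [M] factors tends to 1. *)
Theorem taylor (r B z : C) M : 0 < r -> r < rho ->
  (forall t, 0 <= t <= 1 -> `|f (r * circ t)| <= B) -> `|z| < r ->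
  `|f z - \sum_(l < M) tcoef f r l * z ^+ l| <= B * ((`|z| / r) ^+ M / (1 - `|z| / r)).
Proof.
move=> r0 rr fB zr; have B0 : 0 <= B.
  by apply: le_trans (normr_ge0 _) (fB 0 _); rewrite lexx ler01.
have r0' : r != 0 by rewrite gt_eqF.
have rr' : `|r| < rho by rewrite gtr0_norm.
have al l : `|tcoef f r l| <= B * r ^- l by exact: tcoef_le.
have [->|z0] := eqVneq z 0.
  rewrite normr0 mul0r subr0 divr1; case: M => [|M].
    by rewrite big_ord0 subr0 expr0 mulr1 -(tcoef0 r0' rr'); have := al 0%N; rewrite expr0 invr1 mulr1.
  rewrite big_ord_recl big1 => [|i _]; last by rewrite expr0n mulr0.
  by rewrite expr0 mulr1 addr0 (tcoef0 r0' rr') subrr normr0 mulr_ge0 // exprn_ge0.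
have zrho : `|z| < rho by exact: lt_trans rr.
have [B' B'0 fB'] := cont01_bounded (cont01_fcirc zrho).
have zc := kernel_cvg z0 zrho r0' rr' B'0 fB'.
set q := `|z| / r.
have q0 : 0 <= q by rewrite divr_ge0 // ltW.
have q1 : q < 1 by rewrite ltr_pdivrMr // mul1r.
have hc : \sum_(l < M) lam R N l * tcoef f r l * z ^+ l @[N --> \oo] -->
    \sum_(l < M) tcoef f r l * z ^+ l.
  apply: cvg_big => [|l _]; first exact: add_continuous.
  have -> : tcoef f r l * z ^+ l = 1 * tcoef f r l * z ^+ l by rewrite mul1r.
  by apply: cvgMl; apply: cvgMl; exact: lam_cvg.
pose D N := \sum_(l < N.+1) lam R N l * tcoef f r l * z ^+ l -
  \sum_(l < M) lam R N l * tcoef f r l * z ^+ l.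
have Dc : D (N + M)%N @[N --> \oo] --> f z - \sum_(l < M) tcoef f r l * z ^+ l.
  have D0 : D N @[N --> \oo] --> f z - \sum_(l < M) tcoef f r l * z ^+ l.
    exact: (@cvgB _ _ _ _ _ _ _ _ _ zc hc).
  apply/cvgn_eps => e e0; have /cvgn_eps/(_ e e0)[N NP] := D0.
  exists N => m Nm; apply: NP; exact: leq_trans Nm (leq_addr _ _).
apply: (cvgn_norm_le Dc) => N; rewrite /D.
rewrite -!(big_mkord predT (fun l => lam R (N + M) l * tcoef f r l * z ^+ l)).
have MN : (M <= (N + M).+1)%N by rewrite (leq_trans (leq_addl N M)).
rewrite (@big_cat_nat _ _ _ M 0 (N + M).+1 _ _ (leq0n M) MN) /= [X in X - _]addrC addrK; apply: le_trans (ler_norm_sum _ _ _) _.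
apply: (@le_trans _ _ (\sum_(M <= l < (N + M).+1) B * q ^+ l)).
  rewrite big_seq [leRHS]big_seq; apply: ler_sum => l; rewrite mem_index_iota => /andP[Ml lN].
  rewrite -mulrA normrM; apply: (@le_trans _ _ (1 * (B * q ^+ l))); last by rewrite mul1r.
  apply: ler_pM => //; first by rewrite ger0_norm ?lam_ge0 // lam_le1.
  rewrite normrM normrX /q exprMn exprVn mulrCA mulrC.
  by apply: ler_wpM2l; [exact: exprn_ge0|exact: al].
by rewrite -big_distrr /=; apply: ler_wpM2l => //; exact: geometric_le.
Qed.
End TaylorTheorem.

(** * Small parameters and the identity theorem on a disc *)

Section TaylorConsequences.
Variable R : realType.
Local Notation C := (Cplx R).

Lemma small_half (x : C) : 0 < x -> x / 2 < x.
Proof. by move=> x0; rewrite ltr_pdivrMr // ltr_pMr // ltr1n. Qed.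

Lemma le_small_eq0 (x K d : C) : 0 < d -> 0 <= K ->
  (forall t, 0 < t -> t < d -> `|x| <= K * t) -> x = 0.
Proof.
move=> d0 K0 xK; apply/eqP; rewrite -normr_eq0 -[_ == 0]negbK; apply/negP => nz.
have M0 : 0 < `|x| by rewrite lt_def nz normr_ge0.
have Kd : 0 < K * d + `|x| by rewrite ltr_wpDl // mulr_ge0 // ltW.
pose t := d * (`|x| / (K * d + `|x|)) / 2.
have t0 : 0 < t by rewrite !(divr_gt0, mulr_gt0).
have q1 : `|x| / (K * d + `|x|) <= 1 by rewrite ler_pdivrMr // mul1r lerDr mulr_ge0 // ltW.
have td : t < d.
  rewrite /t; apply: le_lt_trans (small_half d0); rewrite -mulrA.
  rewrite ler_wpM2l ?(ltW d0) // ler_pdivrMr // mulVf ?pnatr_eq0 //.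
have := xK t t0 td; rewrite /t.
have -> : K * (d * (`|x| / (K * d + `|x|)) / 2) = `|x| * (K * d / (K * d + `|x|)) / 2.
  by field; rewrite gt_eqF.
move=> le; have : `|x| < `|x|; last by rewrite ltxx.
apply: le_lt_trans le _; apply: le_lt_trans (small_half M0).
rewrite ler_pM2r ?invr_gt0 // ler_piMr // ler_pdivrMr // mul1r.
by rewrite lerDl.
Qed.

Lemma pow_cvg0 (q e : C) : 0 <= q -> q < 1 -> 0 < e ->
  exists N, forall m, (N <= m)%N -> q ^+ m <= e.
Proof.
move=> q0 q1 e0; pose x := complex.Re q; have qx : q = ofR x by rewrite ofR_Re.
pose y := complex.Re e; have ey : e = ofR y by rewrite ofR_Re // ltW.
have x0 : 0 <= x by rewrite -ler_ofR ofR0 -qx.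
have x1 : x < 1 by rewrite -ltr_ofR ofR1 -qx.
have y0 : 0 < y by rewrite -ltr_ofR ofR0 -ey.
have xn : `|x| < 1 by rewrite ger0_norm.
have /cvgrPdist_le/(_ _ y0)[N _ NP] := @cvg_expr R x xn.
exists N => m /NP; rewrite sub0r normrN ger0_norm ?exprn_ge0 // => h.
by rewrite qx ey -ofRX ler_ofR.
Qed.

Lemma pow_small (q e B : C) : 0 <= q -> q < 1 -> 0 < e -> 0 <= B -> exists M, forall N,
  (M <= N)%N -> B * (q ^+ N / (1 - q)) <= e.
Proof.
move=> q0 q1 e0 B0; have q1' : 0 < 1 - q by rewrite subr_gt0.
have B1 : 0 < B + 1 by rewrite ltr_wpDl.
have [M MP] := pow_cvg0 q0 q1 (divr_gt0 (mulr_gt0 e0 q1') B1).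
exists M => N /MP; rewrite ler_pdivlMr // => h.
rewrite mulrA ler_pdivrMr //; apply: le_trans h; rewrite mulrC.
by rewrite ler_wpM2l ?exprn_ge0 // lerDl.
Qed.

Section Identity.
Variables (f : C -> C) (rho d : C).
Hypothesis fd : forall z : C, `|z| < rho -> differentiable f z.
Hypothesis d0 : 0 < d.
Hypothesis f0 : forall t, 0 < t -> t < d -> f t = 0.

(** Strong induction on [l]: at small [t > 0] the function and the lower terms vanish, so Taylor's
    formula with [l + 1] terms leaves [|a_l| t^l = O(t^(l+1))]. *)
Lemma tcoef_eq0 r l : 0 < r -> r < rho -> tcoef f r l = 0.
Proof.
move=> r0 rr; have rr' : `|r| < rho by rewrite gtr0_norm.
have [B B0 fB] := cont01_bounded (cont01_fcirc fd rr').
elim/ltn_ind: l => l IH.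
(* Small enough to be below [d], where [f] vanishes, and at most [r / 2], where [1 - t / r] is at
   least 1/2. *)
pose e := d * r / (d + r) / 2.
have dr : 0 < d + r by rewrite addr_gt0.
have e0 : 0 < e by rewrite !(divr_gt0, mulr_gt0).
have e2 : e + e = d * r / (d + r) by rewrite -splitr.
have ed : e < d.
  apply: (@le_lt_trans _ _ (d * r / (d + r))); first by rewrite -e2 lerDl ltW.
  by rewrite ltr_pdivrMr // ltr_pM2l // ltrDr.
have er : e <= r / 2.
  rewrite /e ler_pM2r ?invr_gt0 // ler_pdivrMr // mulrC ler_pM2l // lerDl ltW //.
apply: (@le_small_eq0 _ (2 * B * r ^- l.+1) e e0) => [|t t0 te].
  by rewrite mulr_ge0 ?mulr_ge0 // invr_ge0 exprn_ge0 // ltW.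
have tr : `|t| < r.
  by rewrite gtr0_norm //; apply: lt_le_trans te _; apply: le_trans er _; exact/ltW/small_half.
have := taylor fd l.+1 r0 rr fB tr.
rewrite f0 //; last exact: lt_trans ed.
rewrite big_ord_recr /= big1 ?add0r => [|i _]; last by rewrite IH ?mul0r.
rewrite normrN normrM (gtr0_norm t0) normrX (gtr0_norm t0) => h.
have tl : 0 < t ^+ l by rewrite exprn_gt0.
rewrite -(ler_pM2r tl); apply: le_trans h _.
have q2 : 2^-1 <= 1 - t / r.
  rewrite lerBrDr -lerBrDl; have -> : 1 - 2^-1 = 2^-1 :> C by field.
  by rewrite ler_pdivrMr // mulrC; apply: le_trans (ltW te) er.
have q0 : 0 < 1 - t / r by apply: lt_le_trans q2; rewrite invr_gt0.
have -> : 2 * B * r ^- l.+1 * t * t ^+ l = B * ((t / r) ^+ l.+1 * 2).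
  by rewrite expr_div_n [t ^+ l.+1]exprS; move: (r ^- l.+1) (t ^+ l) => u v; ring.
apply: ler_wpM2l => //; apply: ler_wpM2l.
  by rewrite exprn_ge0 // divr_ge0 // ltW.
by rewrite -[leRHS]invrK lef_pV2 ?posrE ?invr_gt0.
Qed.

Lemma identity_disc z : `|z| < rho -> f z = 0.
Proof.
move=> zr; have r0 : 0 < rho by exact: le_lt_trans zr.
pose r := (`|z| + rho) / 2.
have r1 : `|z| < r by rewrite /r midf_lt.
have r2 : r < rho by rewrite /r midf_lt.
have r3 : 0 < r by exact: le_lt_trans r1.
have r2' : `|r| < rho by rewrite gtr0_norm.
have [B B0 fB] := cont01_bounded (cont01_fcirc fd r2').
have h M := taylor fd M r3 r2 fB r1.
have q0 : 0 <= `|z| / r by rewrite divr_ge0 // ltW.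
have q1 : `|z| / r < 1 by rewrite ltr_pdivrMr // mul1r.
apply/eqP; rewrite -normr_eq0 -[_ == 0]negbK; apply/negP => nz.
have M0 : 0 < `|f z| by rewrite lt_def nz normr_ge0.
have [M MP] := pow_small q0 q1 (divr_gt0 M0 (ltr0n C 2)) B0.
have := h M; rewrite big1 ?subr0 => [|i _]; last by rewrite tcoef_eq0 ?mul0r.
move=> /le_trans /(_ (MP M (leqnn M))) le.
by have := le_lt_trans le (small_half M0); rewrite ltxx.
Qed.
End Identity.
End TaylorConsequences.

Lemma diffB_app (K : numFieldType) (U W : normedModType K) (f g : U -> W) x h :
  differentiable f x -> differentiable g x ->
  'd (f - g) x h = 'd f x h - 'd g x h.
Proof. by move=> df dg; rewrite diffB. Qed.

(** * Locally uniform limits and polynomial approximation *)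

Section Weierstrass.
Variable R : realType.
Local Notation C := (Cplx R).

(** The order of [C] is partial, so [a * b / (a + b)] takes the place of a minimum. *)
Lemma common_lt (a b : C) : 0 < a -> 0 < b -> exists m, [/\ 0 < m, m < a & m < b].
Proof.
move=> a0 b0; have ab : 0 < a + b by rewrite addr_gt0.
exists (a * b / (a + b)); split; first by rewrite divr_gt0 // mulr_gt0.
  by rewrite ltr_pdivrMr // ltr_pM2l // ltrDr.
by rewrite ltr_pdivrMr // mulrC ltr_pM2l // ltrDl.
Qed.

Section CauchyEstimates.
Variables (U : normedModType C) (phi : U -> C) (x : U) (d M : C).
Hypothesis d0 : 0 < d.
Hypothesis phid : forall y, `|y| < d -> differentiable phi (x + y).
Hypothesis phiM : forall y, `|y| < d -> `|phi (x + y)| <= M.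

Lemma line_differentiable (h : U) (t : C) : `|t *: h| < d ->
  differentiable (fun t : C => phi (x + t *: h)) t.
Proof.
move=> th; apply: (@differentiable_comp _ _ _ _ (fun t : C => x + t *: h) phi); last exact: phid.
apply: (@differentiableD _ _ _ (cst x) (fun t : C => t *: h)); first exact: differentiable_cst.
exact: (@differentiableZl _ _ _ (fun t : C => t) h t (@differentiable_idfun _ t)).
Qed.

(** On the line through [x] directed by [h] the derivative is the first Taylor coefficient of a
    function of one variable, so both estimates come from Cauchy's inequality and Taylor's formula
    there. *)
Lemma cauchy_diff (h : U) : `|'d phi x h| <= 2 * M / d * `|h| /\
  (`|h| <= d / 4 -> `|phi (x + h) - phi x - 'd phi x h| <= 8 * M / d ^+ 2 * `|h| ^+ 2).
Proof.
have phidx : differentiable phi x by rewrite -[x]addr0; apply: phid; rewrite normr0.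
have [->|h0] := eqVneq h 0.
  rewrite linear0 !normr0 mulr0 addr0 subrr subr0 normr0 expr0n mulr0; split => //.
have h1 : 0 < `|h| by rewrite normr_gt0.
pose f (t : C) := phi (x + t *: h).
(* The line stays in the ball of radius [d] for parameters below [rho]. Half of it, [r], carries the
   circle; the parameter 1 must satisfy [1 <= r / 2], which is the condition [|h| <= d / 4]. The
   constants 2 and 8 of the statement are read off from [r]. *)
pose rho := d / `|h|; pose r := rho / 2.
have rho0 : 0 < rho by rewrite divr_gt0.
have r0 : 0 < r by rewrite divr_gt0.
have rr : r < rho by exact: small_half.
have fd (t : C) : `|t| < rho -> differentiable f t.
  by move=> tr; apply: line_differentiable; rewrite normrZ -ltr_pdivlMr.
have fB t : 0 <= t <= 1 -> `|f (r * circ t)| <= M.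
  move=> t01; apply: phiM; rewrite normrZ normrM norm_circ // mulr1 gtr0_norm //.
  by rewrite -ltr_pdivlMr.
have M0 : 0 <= M by apply: le_trans (normr_ge0 _) (fB 0 _); rewrite lexx ler01.
have rn : `|r| < rho by rewrite gtr0_norm.
have a0 : tcoef f r 0 = phi x by rewrite (tcoef0 fd) ?gt_eqF // /f scale0r addr0.
have key (t : C) : `|t| <= r / 2 -> `|f t - (phi x + tcoef f r 1 * t)| <= 2 * M * (`|t| / r) ^+ 2.
  move=> tr; have tr' : `|t| < r by apply: le_lt_trans tr _; exact: small_half.
  have := taylor fd 2 r0 rr fB tr'.
  rewrite big_ord_recr big_ord1 /= expr0 expr1 mulr1 a0 => le; apply: le_trans le _.
  have -> : 2 * M * (`|t| / r) ^+ 2 = M * ((`|t| / r) ^+ 2 * 2) by ring.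
  have q2 : 2^-1 <= 1 - `|t| / r.
    rewrite lerBrDr -lerBrDl; have -> : 1 - 2^-1 = 2^-1 :> C by field.
    by rewrite ler_pdivrMr // mulrC.
  have q0 : 0 < 1 - `|t| / r by apply: lt_le_trans q2; rewrite invr_gt0.
  apply: ler_wpM2l => //; apply: ler_wpM2l; first by rewrite exprn_ge0 // divr_ge0 // ltW.
  by rewrite -[leRHS]invrK lef_pV2 ?posrE ?invr_gt0.
(* Both numbers are first-order coefficients of [f] at 0: the Taylor remainder is quadratic in [t]
   and the Frechet remainder is o(t). *)
have a1 : tcoef f r 1 = 'd phi x h.
  apply/eqP; rewrite -subr_eq0; apply/eqP.
  apply: (@le_small_eq0 _ _ (1 + `|h|) 1 ltr01) => [|e e0 _]; first by rewrite addr_ge0.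
  have [dd dd0 ddP] := differentiable_expansion phidx e0.
  have M1 : 0 < 2 * M + 1 by apply: ltr_pwDr => //; exact: mulr_ge0.
  have c0 : 0 < e * r ^+ 2 / (2 * M + 1).
    by apply: divr_gt0 M1; apply: mulr_gt0 => //; exact: exprn_gt0.
  have [m1 [m10 m1a m1b]] := common_lt (divr_gt0 r0 (ltr0n C 2)) c0.
  have [t [t0 t1 t2]] := common_lt m10 (divr_gt0 dd0 h1).
  have tn : `|t| = t by rewrite gtr0_norm.
  have := key t; rewrite tn => /(_ (ltW (lt_trans t1 m1a))) k1.
  have k2 := ddP (t *: h); rewrite normrZ tn -ltr_pdivlMr // in k2.
  have {}k2 := k2 t2; rewrite linearZ /= -[_ *: 'd phi x h]/(t * _) -/(f t) in k2.
  rewrite -(ler_pM2r t0) -{1}tn -normrM mulrBl.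
  have -> : tcoef f r 1 * t - 'd phi x h * t =
      (f t - phi x - t * 'd phi x h) - (f t - (phi x + tcoef f r 1 * t)) by ring.
  apply: le_trans (ler_normB _ _) _.
  have -> : (1 + `|h|) * e * t = e * (t * `|h|) + e * t by ring.
  apply: lerD => //; apply: le_trans k1 _.
  have -> : 2 * M * (t / r) ^+ 2 = 2 * M / r ^+ 2 * t * t.
    by rewrite expr_div_n; move: (r ^+ 2) => u; ring.
  rewrite ler_pM2r //; have := lt_trans t1 m1b; rewrite ltr_pdivlMr //.
  move=> h3; rewrite mulrAC ler_pdivrMr ?exprn_gt0 // mulrC; apply: le_trans (ltW h3).
  by apply: ler_wpM2l; [exact: ltW|rewrite lerDl].
split.
  rewrite -a1; have := tcoef_le fd 1 r0 rr fB; rewrite expr1 => le; apply: le_trans le _.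
  by rewrite /r /rho le_eqVlt; apply/orP; left; apply/eqP; field; rewrite !gt_eqF.
move=> hd; have := key 1; rewrite normr1 -a1 /f scale1r mulr1 opprD addrA.
have r2 : 1 <= r / 2.
  rewrite ler_pdivlMr // mul1r /r /rho ler_pdivlMr // ler_pdivlMr //.
  move: hd; rewrite ler_pdivlMr // => hd; apply: le_trans hd.
  by rewrite le_eqVlt; apply/orP; left; apply/eqP; ring.
move=> /(_ r2) le; apply: le_trans le _.
by rewrite /r /rho le_eqVlt; apply/orP; left; apply/eqP; field; rewrite !gt_eqF.
Qed.
End CauchyEstimates.

Lemma cvgn_const_le (K e0 : C) : 0 < e0 -> 0 <= K -> exists2 e, 0 < e & K * e <= e0.
Proof.
move=> e00 K0; exists (e0 / (K + 1)); first by rewrite divr_gt0 // ltr_pwDr.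
by rewrite mulrCA ler_piMr ?(ltW e00) // ler_pdivrMr ?ltr_pwDr // mul1r lerDl.
Qed.

(** Applied to differences of the [phi k], [cauchy_diff] makes the derivatives a Cauchy sequence.
    Applied to each [phi k], it bounds the limit form [L] and gives a quadratic remainder with a
    constant independent of [k], which survives in the limit. *)
Theorem weierstrass (U : normedModType C) (phi : nat -> U -> C) (g : U -> C) (x : U) (d M : C) :
  0 < d ->
  (forall k y, `|y| < d -> differentiable (phi k) (x + y)) ->
  (forall k y, `|y| < d -> `|phi k (x + y)| <= M) ->
  (forall e : C, 0 < e -> exists N, forall k, (N <= k)%N -> forall y, `|y| < d ->
     `|phi k (x + y) - g (x + y)| <= e) ->
  differentiable g x.
Proof.
move=> d0 phid phiM phig.
have M0 : 0 <= M by apply: le_trans (normr_ge0 _) (phiM 0%N 0 _); rewrite normr0.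
have phidx k : differentiable (phi k) x by rewrite -[x]addr0; apply: phid; rewrite normr0.
have Lex h : exists l : C, 'd (phi k) x h @[k --> \oo] --> l.
  have [e e0|l lP] := @complex_cauchy R (fun k => 'd (phi k) x h); last first.
    by exists l; apply/cvgn_eps.
  have K0 : 0 <= 2 * 2 / d * `|h| by rewrite mulr_ge0 // divr_ge0 // ltW.
  have [e1 e10 e1P] := cvgn_const_le e0 K0.
  have [N NP] := phig _ e10; exists N => m k Nm Nk.
  have -> : 'd (phi m) x h - 'd (phi k) x h = 'd (phi m - phi k) x h.
    by symmetry; exact (@diffB_app C U C (phi m) (phi k) x h (phidx m) (phidx k)).
  apply: le_trans e1P.
  have [||le _] := @cauchy_diff U (phi m - phi k) x d (e1 + e1) d0 _ _ h.
  - by move=> y yd; apply: differentiableB; exact: phid.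
  - move=> y yd; rewrite -[(phi m - phi k) _]/(phi m (x + y) - phi k (x + y)).
    rewrite -(subrKA (g (x + y))); apply: le_trans (ler_normD _ _) _.
    by apply: lerD; rewrite ?[`|g _ - _|]distrC; exact: NP.
  apply: le_trans le _; rewrite le_eqVlt; apply/orP; left; apply/eqP.
  by field; rewrite gt_eqF.
have [L LP] := choice Lex.
have Lu h (l : C) : 'd (phi k) x h @[k --> \oo] --> l -> L h = l.
  by move=> hl; apply: (@cvg_unique C _ _ _ _ _ (LP h) hl); exact: norm_hausdorff.
have gl y : `|y| < d -> phi k (x + y) @[k --> \oo] --> g (x + y).
  move=> yd; apply/cvgn_eps => e /phig[N NP]; exists N => k Nk; exact: NP.
apply: (@expansion_differentiable C U C g L x (2 * M / d)).
- by rewrite divr_ge0 ?mulr_ge0 // ltW.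
- move=> a u v; apply: Lu.
  have -> : (fun k => 'd (phi k) x (a *: u + v)) = (fun k => a * 'd (phi k) x u + 'd (phi k) x v).
    by apply/funext => k; rewrite linearP.
  by apply: cvgD; [apply: cvgMr; exact: LP|exact: LP].
- move=> h; apply: (cvgn_norm_le (LP h)) => k.
  by have [] := @cauchy_diff U (phi k) x d M d0 (phid k) (phiM k) h.
move=> e e0; have K0 : 0 <= 8 * M / d ^+ 2 by rewrite divr_ge0 ?mulr_ge0 ?exprn_ge0 // ltW.
have [e1 e10 e1P] := cvgn_const_le e0 K0.
have d4 : 0 < d / 4 by rewrite divr_gt0.
have [m [m0 m1 m2]] := common_lt e10 d4.
have dd4 : d / 4 < d by rewrite ltr_pdivrMr // ltr_pMr // ltr1n.
exists m => // h hm; have hd : `|h| < d by apply: lt_trans hm _; exact: lt_trans dd4.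
have c1 : phi k (x + h) - phi k x - 'd (phi k) x h @[k --> \oo] --> g (x + h) - g x - L h.
  apply: cvgB (LP h); apply: cvgB (gl _ hd) _.
  have := gl 0; rewrite addr0 normr0; exact.
apply: (cvgn_norm_le c1) => k.
have [_ /(_ (ltW (lt_trans hm m2))) le] := @cauchy_diff U (phi k) x d M d0 (phid k) (phiM k) h.
apply: le_trans le _; rewrite expr2 mulrA; apply: ler_wpM2r => //.
by apply: le_trans e1P; apply: ler_wpM2l => //; exact/ltW/(lt_trans hm).
Qed.
End Weierstrass.

(** * Polynomial approximation of entire functions of several variables on polydiscs *)

Section PolynomialApproximation.
Variable R : realType.
Local Notation C := (Cplx R).

Lemma natC_ge (x : C) : 0 <= x -> exists N, forall k : nat, (N <= k)%N -> x <= k%:R.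
Proof.
move=> x0; exists (Num.bound (complex.Re x)) => k Nk; rewrite -(ofR_Re x0).
rewrite [k%:R](_ : _ = ofR k%:R); last by rewrite /ofR (rmorph_nat (real_complex R)).
rewrite ler_ofR; apply: le_trans (ltW (archi_boundP _)) _.
  by rewrite -ler_ofR ofR0 ofR_Re.
by rewrite ler_nat.
Qed.

Lemma compact_bound (U : normedModType C) (K : set U) (f : U -> C) :
  compact K -> (forall x, K x -> {for x, continuous f}) ->
  exists2 B : C, 0 <= B & forall x, K x -> `|f x| <= B.
Proof.
move=> /compact_near_coveringP Kc fc.
have [N _ NP] : \forall k \near \oo, K `<=` (fun x => `|f x| <= (k : nat)%:R).
  apply: (Kc nat _ (fun k x => `|f x| <= (k : nat)%:R)) => x Kx.
  have [N NP] := natC_ge (addr_ge0 (normr_ge0 (f x)) (@ler01 C)).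
  have fx : nbhs x [set y | `|f x - f y| <= 1].
    by have /cvgrPdist_le := fc x Kx; apply.
  exists ([set y | `|f x - f y| <= 1], [set k | (N <= k)%N]).
    by split => //=; exists N.
  move=> [y k] /= [fxy Nk]; apply: le_trans (NP _ Nk).
  have -> : f y = f x - (f x - f y) by rewrite opprB addrCA subrr addr0.
  by apply: le_trans (ler_normB _ _) _; apply: lerD.
by exists N%:R => //; apply: NP => /=.
Qed.

Lemma rv_coord_le m (v : 'rV[C]_m) i : `|v 0 i| <= `|v|.
Proof.
have : `|v 0 i|%:nng <= \big[Order.max/0%:nng]_j `|v j.1 j.2|%:nng :> {nonneg C}.
  exact: (le_bigmax _ (fun j : 'I_1 * 'I_m => `|v j.1 j.2|%:nng) (0, i)).
by rewrite -num_le.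
Qed.

Lemma rv_norm_lt m (v : 'rV[C]_m) d : 0 < d -> (forall i, `|v 0 i| < d) -> `|v| < d.
Proof.
move=> d0 vd; have [v0|v0] := eqVneq (mx_norm v) 0; first by rewrite [`|v|]v0.
by have [[i j] e] := mx_norm_neq0 v0; rewrite [`|v|]e /= (ord1 i).
Qed.

Lemma rv_norm_le m (v : 'rV[C]_m) d : 0 <= d -> (forall i, `|v 0 i| <= d) -> `|v| <= d.
Proof.
move=> d0 vd; have [v0|v0] := eqVneq (mx_norm v) 0; first by rewrite [`|v|]v0.
by have [[i j] e] := mx_norm_neq0 v0; rewrite [`|v|]e /= (ord1 i).
Qed.

Lemma compact_polydisc m (r : C) : 0 <= r ->
  compact [set v : 'rV[C]_m | forall i, `|v 0 i| <= r].
Proof.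
move=> r0; have := @rV_compact C m (fun _ => [set z : C | `|z| <= r]); apply.
by move=> _; rewrite -(ofR_Re r0); exact: complex_compact_disc.
Qed.

Section Coordinate.
Variables (m : nat) (i : 'I_m).

Definition upd (x : 'rV[C]_m) (t : C) : 'rV[C]_m := x + (t - x 0 i) *: delta_mx 0 i.

Lemma updE x t j : upd x t 0 j = if j == i then t else x 0 j.
Proof.
by rewrite !mxE eqxx /=; case: eqP => [->|]; rewrite ?mulr1 ?mulr0 ?addr0 // addrC subrK.
Qed.

Lemma upd_id x : upd x (x 0 i) = x.
Proof. by rewrite /upd subrr scale0r addr0. Qed.

Lemma upd_norm x t t' : `|upd x t - upd x t'| <= `|t - t'|.
Proof.
apply: rv_norm_le => // j; have -> : (upd x t - upd x t') 0 j = upd x t 0 j - upd x t' 0 j by rewrite mxE [X in _ + X]mxE.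
rewrite !updE.
by case: eqP => // _; rewrite subrr normr0.
Qed.

Lemma upd_differentiable1 x t : differentiable (fun x => upd x t) x.
Proof.
rewrite /upd; apply: (@differentiableD C 'rV[C]_m 'rV[C]_m (fun x => x) (fun x => (t - x 0 i) *: delta_mx 0 i) x).
  exact: (@ex_diff _ _ _ _ _ _ _ (is_diff_id x)).
apply: (@differentiableZl _ _ _ (fun x : 'rV[C]_m => t - x 0 i) (delta_mx 0 i) x).
apply: (@differentiableB _ _ _ (cst t) (fun x : 'rV[C]_m => x 0 i)).
  exact: differentiable_cst.
exact: differentiable_coord.
Qed.

Lemma upd_differentiable2 x t : differentiable (fun t => upd x t) t.
Proof.
rewrite /upd; apply: (@differentiableD C C 'rV[C]_m (cst x) (fun t => (t - x 0 i) *: delta_mx 0 i) t).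
  exact: differentiable_cst.
apply: (@differentiableZl _ _ _ (fun t : C => t - x 0 i) (delta_mx 0 i) t).
apply: (@differentiableB _ _ _ (fun t : C => t) (cst (x 0 i))); first exact: differentiable_idfun.
exact: differentiable_cst.
Qed.
End Coordinate.

Definition poly_approximable m (G : 'rV[C]_m -> C) := forall r e : C, 0 < r -> 0 < e ->
  exists p : mpoly m C, forall x : 'rV[C]_m, (forall i, `|x 0 i| <= r) -> `|G x - meval (x 0) p| <= e.

Lemma poly_approximableP m (p : mpoly m C) : poly_approximable (fun x => meval (x 0) p).
Proof. by move=> r e r0 e0; exists p => x _; rewrite subrr normr0 ltW. Qed.

Lemma poly_approximableD m (F G : 'rV[C]_m -> C) :
  poly_approximable F -> poly_approximable G -> poly_approximable (fun x => F x + G x).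
Proof.
move=> Fa Ga r e r0 e0; have e2 : 0 < e / 2 by rewrite divr_gt0.
have [p pP] := Fa r _ r0 e2; have [q qP] := Ga r _ r0 e2; exists (p + q) => x xr.
rewrite mevalD opprD addrACA (splitr e); apply: le_trans (ler_normD _ _) _.
by apply: lerD; [exact: pP|exact: qP].
Qed.

Lemma poly_approximableM m (p : mpoly m C) (G : 'rV[C]_m -> C) :
  poly_approximable G -> poly_approximable (fun x => meval (x 0) p * G x).
Proof.
move=> Ga r e r0 e0.
have [B B0 BP] : exists2 B : C, 0 <= B & forall x : 'rV[C]_m, (forall i, `|x 0 i| <= r) -> `|meval (x 0) p| <= B.
  exists (\sum_(mm <- msupp p) `|mcoeff mm p| * \prod_i r ^+ mm i).
    by apply: sumr_ge0 => mm _; rewrite mulr_ge0 // prodr_ge0 // => i _; rewrite exprn_ge0 // ltW.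
  move=> x xr; rewrite mevalE; apply: le_trans (ler_norm_sum _ _ _) _.
  apply: ler_sum => mm _; rewrite normrM; apply: ler_wpM2l => //.
  rewrite normr_prod; apply: ler_prod => i _; rewrite normr_ge0 normrX /=.
  by apply: lerXn2r; rewrite ?nnegrE ?(ltW r0).
have [e1 e10 e1P] := cvgn_const_le e0 B0.
have [q qP] := Ga r _ r0 e10; exists (p * q) => x xr.
rewrite mevalM -mulrBr normrM; apply: le_trans e1P.
by apply: ler_pM => //; [exact: BP|exact: qP].
Qed.

Lemma poly_approximable_sum m (I : Type) (s : seq I) (G : I -> 'rV[C]_m -> C) :
  (forall i, poly_approximable (G i)) -> poly_approximable (fun x => \sum_(i <- s) G i x).
Proof.
move=> Ga; elim: s => [|i s IH].
  have := @poly_approximableP m 0; congr poly_approximable; apply/funext => x.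
  by rewrite big_nil meval0.
have := poly_approximableD (Ga i) IH; congr poly_approximable; apply/funext => x.
by rewrite big_cons.
Qed.

Lemma poly_approximableZ m (c : C) (G : 'rV[C]_m -> C) :
  poly_approximable G -> poly_approximable (fun x => c * G x).
Proof.
move=> /(poly_approximableM (mpolyC m c)); congr poly_approximable.
by apply/funext => x; rewrite mevalC.
Qed.

Lemma cexp_circ_modulus (g : C -> C) (e : C) N N' :
  (forall t t', 0 <= t <= 1 -> 0 <= t' <= 1 -> `|t - t'| <= 2^-1 ^+ N -> `|g t - g t'| <= e) ->
  (N <= N')%N ->
  (forall t t', 0 <= t <= 1 -> 0 <= t' <= 1 -> `|t - t'| <= 2^-1 ^+ N' -> `|g t - g t'| <= e).
Proof.
move=> gP NN t t' t01 t01' tt; apply: gP => //; apply: le_trans tt _.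
apply: ler_wiXn2l => //.
by rewrite invf_le1 // ler1n.
Qed.

(** Induction on the number of variables on which [G] depends. The Taylor coefficients in the last
    such variable are integrals; replacing them by dyadic sums leaves finite combinations of values
    of [G] with that variable frozen. The induction hypothesis applies to those, and
    differentiability of the coefficients is never at issue. *)
Theorem poly_approx m (G : 'rV[C]_m -> C) :
  (forall x, differentiable G x) -> poly_approximable G.
Proof.
move=> Gd.
suff H k : forall G : 'rV[C]_m -> C, (forall x, differentiable G x) ->
    (forall x y : 'rV[C]_m, (forall i : 'I_m, (i < k)%N -> x 0 i = y 0 i) -> G x = G y) ->
    poly_approximable G.
  by apply: (H m G Gd) => x y xy; congr G; apply/rowP => i; exact: xy.
elim: k => [|k IH] {Gd}G Gd Gk.
  have := @poly_approximableP m (mpolyC m (G 0)); congr poly_approximable.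
  by apply/funext => x; rewrite mevalC; apply: Gk.
have [km|mk] := ltnP k m; last first.
  apply: IH => // x y xy; apply: Gk => i _; apply: xy.
  exact: leq_trans (ltn_ord i) mk.
pose i := Ordinal km.
(* Twice the radius of the polydisc, so that the Taylor ratio is at most 1/2 and [M] can be chosen
   uniformly in [x]. *)
move=> r e r0 e0; pose r2 := r * 2.
have r20 : 0 < r2 by rewrite mulr_gt0.
have [B B0 BP] := @compact_bound _ _ G (@compact_polydisc m r2 (ltW r20))
  (fun x _ => differentiable_continuous (Gd x)).
pose f (x : 'rV[C]_m) (t : C) := G (upd i x t).
have fd x t : differentiable (f x) t.
  apply: (@differentiable_comp _ _ _ _ (fun t : C => upd i x t) G); last exact: Gd.
  exact: upd_differentiable2.
have updr (x : 'rV[C]_m) (t : C) : (forall j, `|x 0 j| <= r) -> 0 <= t <= 1 -> forall j, `|upd i x (r2 * circ t) 0 j| <= r2.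
  move=> xr t01 j; rewrite updE; case: eqP => _.
    by rewrite normrM norm_circ // mulr1 gtr0_norm.
  by apply: le_trans (xr j) _; rewrite /r2 ler_peMr ?(ltW r0) // ler1n.
have fB (x : 'rV[C]_m) (t : C) : (forall j, `|x 0 j| <= r) -> 0 <= t <= 1 -> `|f x (r2 * circ t)| <= B.
  by move=> xr t01; apply: BP => /=; exact: updr.
have e2 : 0 < e / 2 by rewrite divr_gt0.
have h0 : 0 <= 2^-1 :> C by rewrite invr_ge0.
have h1 : 2^-1 < 1 :> C by rewrite invf_lt1 // ltr1n.
have [M MP] := pow_small h0 h1 e2 B0.
have tay (x : 'rV[C]_m) : (forall j, `|x 0 j| <= r) ->
    `|G x - \sum_(l < M) tcoef (f x) r2 l * x 0 i ^+ l| <= e / 2.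
  move=> xr; apply: le_trans (MP M (leqnn _)).
  have r23 : r2 < r2 * 2 by rewrite ltr_pMr // ltr1n.
  have xr2 : `|x 0 i| < r2 by apply: le_lt_trans (xr i) _; rewrite /r2 ltr_pMr // ltr1n.
  have := taylor (fun t _ => fd x t) M r20 r23 (fun t t01 => fB x t xr t01) xr2.
  rewrite {1}/f upd_id => le; apply: le_trans le _; apply: ler_wpM2l => //.
  have q : `|x 0 i| / r2 <= 2^-1.
    by rewrite ler_pdivrMr // /r2 mulrCA mulVf // mulr1.
  apply: ler_pM; rewrite ?invr_ge0 ?subr_ge0 ?exprn_ge0 ?divr_ge0 ?(ltW r20) //.
  - by apply: le_trans q (ltW h1).
  - by apply: lerXn2r; rewrite ?nnegrE ?divr_ge0 ?(ltW r20).
  by rewrite lef_pV2 ?posrE ?subr_gt0 ?(le_lt_trans q) // lerD2l lerN2.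
pose gg (l : nat) (x : 'rV[C]_m) (t : C) := f x (r2 * circ t) * (r2 * circ t) ^- l.
(* One [N] for all [x] in the polydisc: the integrands share a modulus of continuity, coming from
   uniform continuity of [G] on the polydisc of radius [r2]. *)
have approx l (e' : C) : 0 < e' -> exists N, forall x : 'rV[C]_m, (forall j, `|x 0 j| <= r) ->
    `|dsum (gg l x) N - tcoef (f x) r2 l| <= e'.
  move=> e'0.
  have gc : cont01 (fun t : C => (r2 * circ t) ^- l).
    apply: (@cont01_circ _ (fun z => z ^- l)) => t t01.
    apply/differentiable_continuous/differentiable_expVn.
    by rewrite mulf_neq0 ?circ_neq0 // gt_eqF.
  have e'2 : 0 < e' / 2 by rewrite divr_gt0.
  have [e1 e10 e1P] := cvgn_const_le e'2 B0.
  have rl0 : 0 <= r2 ^- l by rewrite invr_ge0 exprn_ge0 // ltW.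
  have [e3 e30 e3P] := cvgn_const_le e'2 rl0.
  have [N1 N1P] := cont01_modulus gc e10.
  have [d d0 dP] := @compact_unif_continuous _ _ _ G (@compact_polydisc m r2 (ltW r20))
    (fun x _ => differentiable_continuous (Gd x)) _ e30.
  have cc : cont01 (fun t : C => r2 * circ t).
    by apply: (@cont01_circ _ (fun z => z)) => t t01; exact: cvg_id.
  have d20 : 0 < d / 2 by rewrite divr_gt0.
  have [N2 N2P] := cont01_modulus cc d20.
  exists (maxn N1 N2) => x xr; apply: dint_modulus.
    apply: (@cont01_fcircV R (f x) (r2 * 2) (fun t _ => fd x t) r2 l); rewrite ?gt_eqF //.
    by rewrite gtr0_norm // ltr_pMr // ltr1n.
  move=> t t' t01 t01' tt.
  have n1 := cexp_circ_modulus N1P (leq_maxl N1 N2) t01 t01' tt.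
  have n2 := cexp_circ_modulus N2P (leq_maxr N1 N2) t01 t01' tt.
  have -> : gg l x t - gg l x t' = f x (r2 * circ t) * ((r2 * circ t) ^- l - (r2 * circ t') ^- l)
     + (f x (r2 * circ t) - f x (r2 * circ t')) * (r2 * circ t') ^- l.
    by rewrite /gg mulrBr mulrBl addrA subrK.
  apply: le_trans (ler_normD _ _) _; rewrite (splitr e') !normrM.
  apply: lerD; first by apply: le_trans e1P; apply: ler_pM => //; exact: fB.
  rewrite mulrC; apply: le_trans e3P; apply: ler_pM => //.
    by rewrite normfV normrX normrM norm_circ // mulr1 gtr0_norm.
  apply: dP; first by move=> j; exact: updr.
  apply: le_lt_trans (upd_norm _ _ _ _) _; apply: le_lt_trans n2 _.
  by rewrite ltr_pdivrMr // ltr_pMr // ltr1n.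
have K0 : 0 <= \sum_(l < M) r ^+ l by apply: sumr_ge0 => l _; rewrite exprn_ge0 // ltW.
have e4 : 0 < e / 4 by rewrite divr_gt0.
have [e1 e10 e1P] := cvgn_const_le e4 K0.
have /choice[N NP] := fun l => approx l e1 e10.
(* At a fixed node the integrand is a constant times [G] with its [i]-th coordinate set to [c],
   which depends only on the coordinates below [k]. *)
have Ga (l : nat) : poly_approximable (fun x => dsum (gg l x) (N l)).
  apply: poly_approximableZ; apply: poly_approximable_sum => j.
  pose c := r2 * circ (j%:R * 2^-1 ^+ N l); have -> : (fun x => gg l x (j%:R * 2^-1 ^+ N l)) = (fun x => c ^- l * G (upd i x c)).
    by apply/funext => x; rewrite /gg mulrC.
  apply: poly_approximableZ; apply: IH.
    move=> x; apply: (@differentiable_comp _ _ _ _ (fun x => upd i x c) G); last exact: Gd.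
    exact: upd_differentiable1.
  move=> x y xy; apply: Gk => j' j'k; rewrite !updE; case: eqP => // j'i.
  apply: xy; move: j'k; rewrite ltnS leq_eqVlt => /orP[/eqP j'k|//].
  by case: j'i; apply/val_inj.
have Sa : poly_approximable (fun x => \sum_(l <- index_enum 'I_M) meval (x 0) (mpolyX C (mnm1 i) ^+ l) * dsum (gg l x) (N l)).
  by apply: poly_approximable_sum => l; apply: poly_approximableM.
have [p pP] := Sa r _ r0 e4; exists p => x xr.
rewrite -(subrKA (\sum_(l < M) tcoef (f x) r2 l * x 0 i ^+ l)).
apply: le_trans (ler_normD _ _) _; rewrite (splitr e); apply: lerD; first exact: tay.
rewrite -(subrKA (\sum_(l <- index_enum 'I_M) meval (x 0) (mpolyX C (mnm1 i) ^+ l) * dsum (gg l x) (N l))).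
apply: le_trans (ler_normD _ _) _.
have -> : e / 2 = e / 4 + e / 4 by field.
apply: lerD; last exact: pP.
apply: le_trans e1P; rewrite -sumrB; apply: le_trans (ler_norm_sum _ _ _) _.
rewrite mulr_suml; apply: ler_sum => l _.
rewrite rmorphXn /= mevalXU [X in _ - X]mulrC -mulrBl normrM mulrC; apply: ler_pM => //.
  by rewrite normrX; apply: lerXn2r; rewrite ?nnegrE ?(ltW r0).
by rewrite distrC; exact: NP.
Qed.
End PolynomialApproximation.

(** * Holomorphic functions on the reduced space *)

Section Differentiability.
Variable R : realType.
Local Notation C := (Cplx R).

Lemma differentiable_sumf (U : normedModType C) (I : Type) (r : seq I) (f : I -> U -> C) x :
  (forall i, differentiable (f i) x) -> differentiable (fun y => \sum_(i <- r) f i y) x.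
Proof.
move=> fd; elim: r => [|i r IH].
  by under eq_fun do rewrite big_nil; exact: differentiable_cst.
by under eq_fun do rewrite big_cons; exact: differentiable_add.
Qed.

Lemma differentiable_sub (U : normedModType C) (f g : U -> C) x :
  differentiable f x -> differentiable g x -> differentiable (fun y => f y - g y) x.
Proof. exact: differentiableB. Qed.

Lemma differentiable_row (U : normedModType C) m (f : U -> 'rV[C]_m) x :
  (forall k, differentiable (fun y => f y 0 k) x) -> differentiable f x.
Proof.
move=> fd.
have -> : f = (fun y => \sum_(k < m) f y 0 k *: delta_mx 0 k).
  by apply/funext => y; rewrite {1}(row_sum_delta (f y)).
elim: (index_enum _) => [|k r IH].
  by under eq_fun do rewrite big_nil; exact: differentiable_cst.
under eq_fun do rewrite big_cons.
apply: (@differentiableD C U 'rV[C]_m (fun y => f y 0 k *: delta_mx 0 k) _ x) IH.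
exact: (@differentiableZl C U 'rV[C]_m (fun y => f y 0 k) (delta_mx 0 k) x (fd k)).
Qed.

Lemma differentiable_coord1 m m' i (x : 'rV[C]_m * 'rV[C]_m') :
  differentiable (fun y : 'rV[C]_m * 'rV[C]_m' => y.1 0 i) x.
Proof.
apply: (@differentiable_comp _ _ _ _ fst (fun u : 'rV[C]_m => u 0 i)).
  by apply: linear_differentiable => y; exact: cvg_fst.
exact: differentiable_coord.
Qed.

Lemma differentiable_coord2 m m' i (x : 'rV[C]_m * 'rV[C]_m') :
  differentiable (fun y : 'rV[C]_m * 'rV[C]_m' => y.2 0 i) x.
Proof.
apply: (@differentiable_comp _ _ _ _ snd (fun u : 'rV[C]_m' => u 0 i)).
  by apply: linear_differentiable => y; exact: cvg_snd.
exact: differentiable_coord.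
Qed.

Lemma differentiable_congr (U W : normedModType C) (f g : U -> W) x :
  f =1 g -> differentiable f x -> differentiable g x.
Proof. by move=> /funext ->. Qed.

Lemma differentiable_near_neq0 (U : normedModType C) (f : U -> C) x :
  differentiable f x -> f x != 0 -> \forall y \near x, f y != 0.
Proof. by move=> /differentiable_continuous/cvgr_neq0 h f0; apply: h. Qed.
End Differentiability.

(** * Holomorphic functions on [Mhat] as functions of bidegree (0, 0) on its cone *)

Section HomogeneousFunctions.
Variables (R : realType) (n s : nat).
Local Notation C := (Cplx R).
Local Notation V := 'rV[C]_n.+1.
Local Notation Jhat := (@Jhat R n s).
Local Notation nu := (nu R s).

Lemma nu_sq k : nu k * nu k = 1.
Proof. by rewrite /Defs.nu; case: ifP => _; rewrite ?mulr1 // mulrN1 opprK. Qed.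

Lemma JhatZ (a b : C) (x : V * V) : Jhat (a *: x.1, b *: x.2) = a * b * Jhat x.
Proof.
rewrite /Defs.Jhat mulr_sumr; apply: eq_bigr => k _; rewrite !mxE.
by move: (nu k) (x.1 0 k) (x.2 0 k) => *; ring.
Qed.

Lemma Jhat_differentiable x : differentiable Jhat x.
Proof.
apply: differentiable_sumf => k; apply: differentiable_mul; last exact: differentiable_coord2.
apply: (@differentiable_mul _ _ (cst (nu k))); first exact: differentiable_cst.
exact: differentiable_coord1.
Qed.

Lemma Jhat_near (x : V * V) : Jhat x != 0 -> \forall y \near x, Jhat y != 0.
Proof. exact: differentiable_near_neq0 (Jhat_differentiable x). Qed.

(* Functions on the cone over Mhat, of bidegree (0, 0); the values where Jhat
   vanishes are irrelevant. *)
Definition homhol (T : V * V -> C) : Prop :=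
  (forall x, Jhat x != 0 -> differentiable T x) /\
  (forall (a b : C) (x : V * V), a != 0 -> b != 0 -> T (a *: x.1, b *: x.2) = T x).

Lemma Zhat_JhatP (y : @Zhat R n s) : Jhat (set_val y) = 1.
Proof. exact: (set_mem (valP y)). Qed.

Lemma ZhatP (x : V * V) : Jhat x = 1 -> exists y : @Zhat R n s, set_val y = x.
Proof. by move=> h; exists (SigSub (mem_set h : x \in @Zhat R n s)). Qed.

Lemma clshat_eq (y y' : @Zhat R n s) (a : C) : a != 0 ->
  set_val y' = (a *: (set_val y).1, a^-1 *: (set_val y).2) -> clshat y = clshat y'.
Proof. by move=> a0 e; apply/eqquotP => /=; apply/asboolP; exists a. Qed.

Lemma eval_conehatE (F : Mhat R n s -> C) (y : @Zhat R n s) (x : V * V) :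
  set_val y = ((Jhat x)^-1 *: x.1, x.2) -> eval_conehat F x = F (clshat y).
Proof. by move=> e; rewrite /eval_conehat -e /set_val valK. Qed.

Lemma eval_conehat_val (F : Mhat R n s -> C) (y : @Zhat R n s) :
  eval_conehat F (set_val y) = F (clshat y).
Proof.
by apply: eval_conehatE; rewrite Zhat_JhatP invr1 scale1r -surjective_pairing.
Qed.

(** As the inverse of 0 is 0, the normalized point is [(0, x.2)], where [Jhat] vanishes; so [insub]
    fails and the default 0 is returned. *)
Lemma eval_conehat_out (F : Mhat R n s -> C) x : Jhat x = 0 -> eval_conehat F x = 0.
Proof.
move=> J0; rewrite /eval_conehat insubF // J0 invr0 scale0r; apply/negP => /set_mem.
rewrite /Zhat /= -[X in (_, X)]scale1r.
have -> : 0 = (0 : C) *: x.1 by rewrite scale0r.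
by rewrite JhatZ !mul0r => /eqP; rewrite eq_sym oner_eq0.
Qed.

Lemma Zhat_normalize x : Jhat x != 0 -> exists y : @Zhat R n s, set_val y = ((Jhat x)^-1 *: x.1, x.2).
Proof.
move=> J0; apply: ZhatP; rewrite -[X in (_, X)]scale1r JhatZ.
by rewrite mulr1 mulVf.
Qed.

Lemma eval_conehatZ (F : Mhat R n s -> C) (a b : C) x : a != 0 -> b != 0 ->
  eval_conehat F (a *: x.1, b *: x.2) = eval_conehat F x.
Proof.
move=> a0 b0; have [J0|J0] := eqVneq (Jhat x) 0.
  by rewrite !eval_conehat_out // JhatZ J0 mulr0.
have J1 : Jhat (a *: x.1, b *: x.2) != 0 by rewrite JhatZ !mulf_neq0.
have [y ye] := Zhat_normalize J0; have [y' ye'] := Zhat_normalize J1.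
rewrite (eval_conehatE F ye) (eval_conehatE F ye'); congr (F _); symmetry.
(* Normalization divides the first component by [a * b * Jhat x], so the two normalized points
   differ by the action of [b^-1]. *)
apply: (@clshat_eq _ _ b^-1); first by rewrite invr_eq0.
rewrite ye ye' /= JhatZ !scalerA invrK; congr (_ *: _, _).
by rewrite -mulrA invfM mulrAC mulVf // mul1r invfM.
Qed.

Lemma affine_scale (i : 'I_n.+1) (x : V) : x 0 i != 0 ->
  affine i (\row_k (x 0 (lift i k) / x 0 i)) = (x 0 i)^-1 *: x.
Proof.
move=> x0; apply/rowP => k; rewrite [LHS]mxE [RHS]mxE.
by case: unliftP => [l ->|->] /=; rewrite ?mxE ?mulVf // mulrC.
Qed.

Lemma Jhat_coord_neq0 x : Jhat x != 0 -> exists i, x.1 0 i != 0 /\ x.2 0 i != 0.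
Proof.
move=> J0; have [|h] := pselect (exists i, x.1 0 i != 0 /\ x.2 0 i != 0) => //.
move: J0; rewrite /Defs.Jhat big1 ?eqxx // => i _; apply/eqP/negPn/negP => k0; apply: h; exists i.
by move: k0; rewrite !mulf_eq0 !negb_or => /andP[/andP[_ ->] ->].
Qed.

(** If [Jhat x] is nonzero, some index [i] has both of its coordinates nonzero, so near [x] the
    function can be read in a product of two charts with this same index. *)
Lemma holomorphic_homhol (F : Mhat R n s -> C) : holomorphic F -> homhol (eval_conehat F).
Proof.
move=> Fh; split=> [x J0|]; last by move=> a b x; exact: eval_conehatZ.
have [i [x1 x2]] := Jhat_coord_neq0 J0.
pose u (y : V * V) : 'rV[C]_n := \row_k (y.1 0 (lift i k) / y.1 0 i).
pose v (y : V * V) : 'rV[C]_n := \row_k (y.2 0 (lift i k) / y.2 0 i).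
apply: (@near_eq_differentiable _ _ _ (fun y => eval_conehat F (affine i (u y), affine i (v y)))).
  have := differentiable_near_neq0 (differentiable_coord1 i x) x1.
  have := differentiable_near_neq0 (differentiable_coord2 i x) x2.
  apply: filterS2 => y y2 y1; rewrite /u /v !affine_scale //.
  by rewrite eval_conehatZ // invr_eq0.
have J1 : Jhat (affine i (u x), affine i (v x)) != 0.
  by rewrite /u /v !affine_scale // JhatZ !mulf_neq0 // invr_eq0.
apply: (@differentiable_comp _ _ _ _ (fun y => (u y, v y))
  (fun uv : 'rV[C]_n * 'rV[C]_n => eval_conehat F (affine i uv.1, affine i uv.2))).
  apply: differentiable_pair; apply: differentiable_row => k.
    apply: (@differentiable_congr _ _ _ (fun y : V * V => y.1 0 (lift i k) * (y.1 0 i)^-1)).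
      by move=> y; rewrite mxE.
    by apply: differentiable_mul; [|apply: differentiable_inv => //]; exact: differentiable_coord1.
  apply: (@differentiable_congr _ _ _ (fun y : V * V => y.2 0 (lift i k) * (y.2 0 i)^-1)).
    by move=> y; rewrite mxE.
  by apply: differentiable_mul; [|apply: differentiable_inv => //]; exact: differentiable_coord2.
exact: Fh.
Qed.

Lemma affine_differentiable i (u : 'rV[C]_n) : differentiable (@affine R n i) u.
Proof.
apply: differentiable_row => k.
apply: (@differentiable_congr _ _ _ (fun u : 'rV[C]_n => oapp (u 0) 1 (unlift i k))).
  by move=> y; rewrite mxE.
by case: (unlift i k) => [l|] /=; [exact: differentiable_coord|exact: differentiable_cst].
Qed.

Lemma homhol_holomorphic (T : V * V -> C) : homhol T -> exists F : Mhat R n s -> C,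
  holomorphic F /\ forall x, Jhat x != 0 -> eval_conehat F x = T x.
Proof.
move=> [Td TZ]; exists (fun p : Mhat R n s => T (set_val (repr (p : {eq_quot (@Cstar_equiv R n s)}%qT)))).
set F := (X in holomorphic X).
have FE x : Jhat x != 0 -> eval_conehat F x = T x.
  move=> J0; have [y ye] := Zhat_normalize J0; rewrite (eval_conehatE F ye) /F /clshat.
  case: piP => y' /eqquotP /= /asboolP[a a0 e].
  by rewrite e ye /= scalerA; apply: TZ; rewrite ?mulf_neq0 ?invr_eq0.
split=> // i j u v J0; pose c (uv : 'rV[C]_n * 'rV[C]_n) := (affine i uv.1, affine j uv.2).
have d : differentiable c (u, v).
  apply: differentiable_pair.
    apply: (@differentiable_comp _ _ _ _ fst (@affine R n i)); last exact: affine_differentiable.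
    by apply: linear_differentiable => y; exact: cvg_fst.
  apply: (@differentiable_comp _ _ _ _ snd (@affine R n j)); last exact: affine_differentiable.
  by apply: linear_differentiable => y; exact: cvg_snd.
apply: (@near_eq_differentiable _ _ _ (T \o c)); last first.
  by apply: differentiable_comp => //; exact: Td.
have := differentiable_near_neq0 (differentiable_comp d (Jhat_differentiable (c (u, v)))) J0.
by apply: filterS => y J1 /=; rewrite FE.
Qed.
End HomogeneousFunctions.

(** * The identity theorem from the chart of [Mred] to the cone over [Mhat] *)

Section IdentityTheorem.
Variables (R : realType) (n s : nat).
Hypothesis s0 : (0 < s)%N.
Local Notation C := (Cplx R).
Local Notation V := 'rV[C]_n.+1.
Local Notation Jhat := (@Jhat R n s).
Local Notation nu := (nu R s).

(** Coordinates are freed one at a time: [identity_disc] extends the vanishing from the real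
    interval (0, d) to the disc in the coordinate [k], the earlier ones being already complex. *)
Lemma real_identity m (Psi : 'rV[C]_m -> C) (d : C) : 0 < d ->
  (forall x : 'rV[C]_m, (forall i, `|x 0 i| < d) -> differentiable Psi x) ->
  (forall x : 'rV[C]_m, (forall i, 0 < x 0 i < d) -> Psi x = 0) ->
  forall x : 'rV[C]_m, (forall i, `|x 0 i| < d) -> Psi x = 0.
Proof.
move=> d0 Pd P0.
suff H k : forall x : 'rV[C]_m, (forall i : 'I_m, (i < k)%N -> `|x 0 i| < d) ->
    (forall i : 'I_m, (k <= i)%N -> 0 < x 0 i < d) -> Psi x = 0.
  by move=> x xd; apply: (H m) => // i; rewrite leqNgt ltn_ord.
elim: k => [|k IH] x x1 x2; first by apply: P0 => i; exact: x2.
have [km|mk] := ltnP k m; last first.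
  apply: IH => i ki; first by apply: x1; exact: ltnW.
  by have := leq_trans mk ki; rewrite leqNgt ltn_ord.
pose i := Ordinal km.
have xd (j : 'I_m) : `|x 0 j| < d.
  have [jk|kj] := ltnP j k.+1; first exact: x1.
  by have /andP[? ?] := x2 j kj; rewrite gtr0_norm.
have fd (t : C) : `|t| < d -> differentiable (fun t => Psi (upd i x t)) t.
  move=> td; apply: (@differentiable_comp _ _ _ _ (fun t : C => upd i x t) Psi).
    exact: upd_differentiable2.
  by apply: Pd => j; rewrite updE; case: eqP.
rewrite -(upd_id i x); apply: (identity_disc fd d0) (xd i) => t t0 td.
apply: IH => j; rewrite updE; case: eqP => [->|ji]; rewrite ?ltnn ?t0 ?td //.
move=> kj; apply: x2; rewrite ltn_neqAle kj andbT; apply/negP => /eqP kj'.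
by case: ji; apply/val_inj.
Qed.

(** The parametrizations below reach only points with a nonzero zeroth coordinate; density and
    continuity give the rest. *)
Lemma generic_dense (x : V * V) (A : set (V * V)) : nbhs x A ->
  exists y, [/\ A y, y.1 0 0 != 0 & y.2 0 0 != 0].
Proof.
case: x => x1 x2 /nbhs_ballP[d /= d0 dA].
pose e (v : V) : C := if v 0 0 == 0 then d / 2 else 0.
have d20 : 0 < d / 2 by rewrite divr_gt0.
have en v : `|e v| < d.
  rewrite /e; case: ifP => _; last by rewrite normr0.
  by rewrite gtr0_norm // ltr_pdivrMr // ltr_pMr // ltr1n.
have e0 (v : V) : (v + e v *: delta_mx 0 0) 0 0 != 0.
  rewrite mxE [X in _ + X]mxE [X in _ * X]mxE /= mulr1 /e; case: ifPn => [/eqP ->|h].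
    by rewrite add0r gt_eqF.
  by rewrite addr0.
have bl (v : V) : ball v d (v + e v *: delta_mx 0 0).
  rewrite -ball_normE /= opprD addrA subrr sub0r normrN.
  apply: rv_norm_lt => // i; rewrite mxE [X in _ * X]mxE /= normrM.
  by apply: le_lt_trans (en v); case: (_ == _); rewrite ?normr1 ?normr0 ?mulr1 ?mulr0.
exists (x1 + e x1 *: delta_mx 0 0, x2 + e x2 *: delta_mx 0 0); split; rewrite ?e0 //.
by apply: dA; split; exact: bl.
Qed.

Definition consv (t : C) (u : 'I_n -> C) : V := \row_k oapp u t (unlift ord0 k).

Lemma consv0 t u : consv t u 0 0 = t.
Proof. by rewrite mxE unlift_none. Qed.

Lemma consvS t u k : consv t u 0 (lift ord0 k) = u k.
Proof. by rewrite mxE liftK. Qed.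

Lemma Jhat_consv t u t' u' :
  Jhat (consv t u, consv t' u') = t * t' + \sum_(k < n) nu k.+1 * u k * u' k.
Proof.
rewrite /Defs.Jhat big_ord_recl !consv0 /Defs.nu s0 mul1r; congr (_ + _).
by apply: eq_bigr => k _; rewrite !consvS.
Qed.

Lemma consvE (v : V) : v = consv (v 0 0) (fun k => v 0 (lift ord0 k)).
Proof.
apply/rowP => k; case: (unliftP ord0 k) => [l|] ->; by rewrite ?consv0 ?consvS.
Qed.

Lemma consvZ a t u : a *: consv t u = consv (a * t) (fun k => a * u k).
Proof.
by apply/rowP => k; rewrite mxE; case: (unliftP ord0 k) => [l|] ->; rewrite ?consv0 ?consvS.
Qed.

Lemma affine_consv (w : 'rV[C]_n) : affine ord0 w = consv 1 (w 0).
Proof. by []. Qed.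

Lemma consv_differentiable (U : normedModType C) (t : U -> C) (u : 'I_n -> U -> C) x :
  differentiable t x -> (forall k, differentiable (u k) x) ->
  differentiable (fun y => consv (t y) (fun k => u k y)) x.
Proof.
move=> td ud; apply: differentiable_row => k.
apply: (@differentiable_congr _ _ _ (fun y => oapp (fun l => u l y) (t y) (unlift ord0 k))).
  by move=> y; rewrite mxE.
by case: (unlift ord0 k) => [l|] /=.
Qed.

Definition lpart (p : 'rV[C]_(n + n)) k := p 0 (lshift n k).
Definition rpart (p : 'rV[C]_(n + n)) k := p 0 (rshift n k).
Definition cell_sum p := \sum_(k < n) nu k.+1 * lpart p k * rpart p k.
(** Parametrizations by a full affine space of the slices of [Zhat] where eta_0 = 1 ([cell1]) or
    xi_0 = 1 ([cell2]): the equation [Jhat = 1] is solved for the other zeroth coordinate, whose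
    sign is [nu 0 = 1]. Points with eta_0, respectively xi_0, nonzero are moved to the slice by the
    group action. *)
Definition cell1 p : V * V := (consv (1 - cell_sum p) (lpart p), consv 1 (rpart p)).
Definition cell2 p : V * V := (consv 1 (lpart p), consv (1 - cell_sum p) (rpart p)).

Lemma Jhat_cell1 p : Jhat (cell1 p) = 1.
Proof. by rewrite Jhat_consv mulr1 subrK. Qed.

Lemma Jhat_cell2 p : Jhat (cell2 p) = 1.
Proof. by rewrite Jhat_consv mul1r subrK. Qed.

Lemma cell_sum_differentiable p : differentiable cell_sum p.
Proof.
apply: differentiable_sumf => k; apply: differentiable_mul; last exact: differentiable_coord.
apply: (@differentiable_mul _ _ (cst (nu k.+1))); first exact: differentiable_cst.
exact: differentiable_coord.
Qed.

Lemma cell1_differentiable p : differentiable cell1 p.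
Proof.
apply: differentiable_pair; apply: consv_differentiable; try by move=> k; exact: differentiable_coord.
  apply: (@differentiable_sub _ _ (cst 1) cell_sum); first exact: differentiable_cst.
  exact: cell_sum_differentiable.
exact: differentiable_cst.
Qed.

Lemma cell2_differentiable p : differentiable cell2 p.
Proof.
apply: differentiable_pair; apply: consv_differentiable; try by move=> k; exact: differentiable_coord.
  exact: differentiable_cst.
apply: (@differentiable_sub _ _ (cst 1) cell_sum); first exact: differentiable_cst.
exact: cell_sum_differentiable.
Qed.

Definition cellp (u v : 'I_n -> C) : 'rV[C]_(n + n) := row_mx (\row_k u k) (\row_k v k).

Lemma lpart_cellp u v k : lpart (cellp u v) k = u k.
Proof. by rewrite /lpart /cellp row_mxEl mxE. Qed.

Lemma rpart_cellp u v k : rpart (cellp u v) k = v k.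
Proof. by rewrite /rpart /cellp row_mxEr mxE. Qed.

Lemma cell_sum_cellp u v : cell_sum (cellp u v) = \sum_(k < n) nu k.+1 * u k * v k.
Proof. by apply: eq_bigr => k _; rewrite lpart_cellp rpart_cellp. Qed.

Lemma cell1E (u v : 'I_n -> C) t t' : t' != 0 -> t * t' + \sum_(k < n) nu k.+1 * u k * v k = 1 ->
  cell1 (cellp (fun k => t' * u k) (fun k => t'^-1 * v k)) =
  (t' *: consv t u, t'^-1 *: consv t' v).
Proof.
move=> t0 J1; rewrite /cell1 !consvZ cell_sum_cellp mulVf //.
have -> : \sum_(k < n) nu k.+1 * (t' * u k) * (t'^-1 * v k) = \sum_(k < n) nu k.+1 * u k * v k.
  apply: eq_bigr => k _; have -> : nu k.+1 * (t' * u k) * (t'^-1 * v k) = t' * t'^-1 * (nu k.+1 * u k * v k) by ring.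
  by rewrite mulfV // mul1r.
rewrite -J1 addrK [t * t']mulrC; congr (consv _ _, consv _ _); apply/funext => k.
  by rewrite lpart_cellp.
by rewrite rpart_cellp.
Qed.

Lemma cell2E (u v : 'I_n -> C) t t' : t != 0 -> t * t' + \sum_(k < n) nu k.+1 * u k * v k = 1 ->
  cell2 (cellp (fun k => t^-1 * u k) (fun k => t * v k)) =
  (t^-1 *: consv t u, t *: consv t' v).
Proof.
move=> t0 J1; rewrite /cell2 !consvZ cell_sum_cellp mulVf //.
have -> : \sum_(k < n) nu k.+1 * (t^-1 * u k) * (t * v k) = \sum_(k < n) nu k.+1 * u k * v k.
  apply: eq_bigr => k _; have -> : nu k.+1 * (t^-1 * u k) * (t * v k) = t * t^-1 * (nu k.+1 * u k * v k) by ring.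
  by rewrite mulfV // mul1r.
rewrite -J1 addrK; congr (consv _ _, consv _ _); apply/funext => k.
  by rewrite lpart_cellp.
by rewrite rpart_cellp.
Qed.

Section Vanishing.
Variable T : V * V -> C.
Hypothesis Th : homhol s T.
Hypothesis T0 : forall w : 'rV[C]_n, 0 < rho s w -> T (affine ord0 w, cconj (affine ord0 w)) = 0.

(** [d + d] is 1 / (n + 1), so the [n] terms in [small_sum] add up to less than 1 and [Jhat] cannot
    vanish. *)
Let d : C := (2 * n.+1%:R)^-1.
Let d0 : 0 < d. Proof. by rewrite invr_gt0 mulr_gt0. Qed.

Let nu_norm k : `|nu k| = 1.
Proof. by rewrite /Defs.nu; case: ifP; rewrite ?normrN normr1. Qed.

Let small_sum (w w' : 'I_n -> C) : (forall k, `|w k| < d + d) -> (forall k, `|w' k| < d + d) ->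
  `|\sum_(k < n) nu k.+1 * w k * w' k| < 1.
Proof.
move=> wd wd'; have dd : d + d = n.+1%:R^-1.
  have N0 : n.+1%:R != 0 :> C by rewrite pnatr_eq0.
  by rewrite /d; move: n.+1%:R N0 => N N0; field.
apply: (@le_lt_trans _ _ (\sum_(k < n) n.+1%:R^-1)).
  apply: le_trans (ler_norm_sum _ _ _) _; apply: ler_sum => k _.
  rewrite !normrM nu_norm mul1r -[leRHS]mulr1; apply: ler_pM => //.
    by rewrite -dd; exact: ltW.
  apply: le_trans (ltW (wd' k)) _; rewrite dd invf_le1 // ler1n //.
rewrite sumr_const card_ord.
have -> : n.+1%:R^-1 *+ n = n%:R / n.+1%:R :> C by rewrite -[LHS]mulr_natr [LHS]mulrC.
by rewrite ltr_pdivrMr // mul1r ltr_nat.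
Qed.

(** Write the two points as p + iq and p - iq. For real p and q they are conjugate, so [T0] applies;
    [real_identity] then admits complex p and q, which give arbitrary pairs. *)
Let near_base (w w' : 'rV[C]_n) : (forall k, `|w 0 k| < d) -> (forall k, `|w' 0 k| < d) ->
  T (affine ord0 w, affine ord0 w') = 0.
Proof.
move=> wd wd'.
pose X (p : 'rV[C]_(n + n)) : 'rV[C]_n := \row_k (lpart p k + 'i * rpart p k).
pose X' (p : 'rV[C]_(n + n)) : 'rV[C]_n := \row_k (lpart p k - 'i * rpart p k).
pose Psi p := T (affine ord0 (X p), affine ord0 (X' p)).
have Xd (p : 'rV[C]_(n + n)) : (forall i, `|p 0 i| < d) -> (forall k, `|X p 0 k| < d + d) /\ (forall k, `|X' p 0 k| < d + d).
  move=> pd; split=> k; rewrite mxE.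
    apply: le_lt_trans (ler_normD _ _) _; rewrite normrM normCi mul1r.
    by apply: ltrD; exact: pd.
  apply: le_lt_trans (ler_normB _ _) _; rewrite normrM normCi mul1r.
  by apply: ltrD; exact: pd.
have J0 (p : 'rV[C]_(n + n)) : (forall i, `|p 0 i| < d) -> Jhat (affine ord0 (X p), affine ord0 (X' p)) != 0.
  move=> /Xd[X1 X2]; rewrite !affine_consv Jhat_consv mulr1.
  have := small_sum X1 X2; set S := \sum_(k < n) _ => S1.
  apply/eqP => e; have : `|S| = 1 by rewrite -[S](addKr 1) e addr0 normrN normr1.
  by move=> e1; rewrite e1 ltxx in S1.
have Psi0 (p : 'rV[C]_(n + n)) : (forall i, `|p 0 i| < d) -> Psi p = 0.
  apply: (real_identity d0) => [{}p pd|{}p pd].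
    apply: (@differentiable_comp _ _ _ _ (fun p => (affine ord0 (X p), affine ord0 (X' p))) T); last first.
      by apply: (proj1 Th); exact: J0.
    apply: differentiable_pair; apply: differentiable_comp (affine_differentiable _ _);
      apply: differentiable_row => k.
      apply: (@differentiable_congr _ _ _ (fun p => lpart p k + 'i * rpart p k)).
        by move=> y; rewrite mxE.
      apply: differentiable_add; first exact: differentiable_coord.
      apply: (@differentiable_mul _ _ (cst 'i)); first exact: differentiable_cst.
      exact: differentiable_coord.
    apply: (@differentiable_congr _ _ _ (fun p => lpart p k + (- 'i) * rpart p k)).
      by move=> y; rewrite mxE mulNr.
    apply: differentiable_add; first exact: differentiable_coord.
    apply: (@differentiable_mul _ _ (cst (- 'i))); first exact: differentiable_cst.
    exact: differentiable_coord.
  have pd' i : `|p 0 i| < d by have /andP[? ?] := pd i; rewrite gtr0_norm.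
  have pr i : (p 0 i)^* = p 0 i.
    by apply/CrealP; apply: gtr0_real; have /andP[] := pd i.
  have XX k : X' p 0 k = (X p 0 k)^*.
    by rewrite !mxE rmorphD rmorphM /= conjCi mulNr /lpart /rpart !pr.
  have [X1 X2] := Xd _ pd'.
  rewrite /Psi (_ : affine ord0 (X' p) = cconj (affine ord0 (X p))).
    apply: T0; rewrite /rho.
    set S := \sum_(k < n) _.
    have S1 : `|S| < 1.
      have := small_sum X2 X1; congr (`|_| < 1); apply: eq_bigr => k _.
      by rewrite XX.
    have Sr : S \is Num.real.
      apply: rpred_sum => k _; rewrite -mulrA mulrC -normCKC; apply: rpredM.
        by rewrite rpredX // normr_real.
      by rewrite /Defs.nu; case: ifP; rewrite ?rpredN rpred1.
    by move: S1; rewrite real_ltr_norml // => /andP[h _]; rewrite addrC -ltrBlDr sub0r.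
  apply/rowP => k; rewrite [RHS]mxE !affine_consv; case: (unliftP ord0 k) => [l|] ->.
    by rewrite !consvS.
  by rewrite !consv0 rmorph1.
(* The solution of p + iq = w, p - iq = w'. *)
pose p := cellp (fun k => (w 0 k + w' 0 k) / 2) (fun k => (w' 0 k - w 0 k) * 'i / 2).
have h2 (a b : C) : `|a| < d -> `|b| < d -> `|a + b| / 2 < d.
  move=> ad bd; rewrite ltr_pdivrMr // mulr_natr mulr2n.
  by apply: le_lt_trans (ler_normD _ _) _; exact: ltrD.
have pd i : `|p 0 i| < d.
  rewrite -(splitK i); case: (fintype.split i) => k /=.
    by rewrite -[p 0 _]/(lpart p k) lpart_cellp normf_div normr_nat h2.
  rewrite -[p 0 _]/(rpart p k) rpart_cellp !normrM normCi mulr1 normfV normr_nat.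
  by apply: h2 => //; rewrite normrN.
have := Psi0 p pd; rewrite /Psi.
have -> : X p = w.
  apply/rowP => k; rewrite mxE lpart_cellp rpart_cellp.
  have i2 := sqrCi C; move: (w 0 k) (w' 0 k) => a b.
  have -> : (a + b) / 2 + 'i * ((b - a) * 'i / 2) = (a + b) / 2 + ('i ^+ 2) * ((b - a) / 2) by ring.
  by rewrite i2; field.
have -> // : X' p = w'.
apply/rowP => k; rewrite mxE lpart_cellp rpart_cellp.
have i2 := sqrCi C; move: (w 0 k) (w' 0 k) => a b.
have -> : (a + b) / 2 - 'i * ((b - a) * 'i / 2) = (a + b) / 2 - ('i ^+ 2) * ((b - a) / 2) by ring.
by rewrite i2; field.
Qed.

Let d2 : d <= 2^-1.
Proof. by rewrite /d lef_pV2 ?posrE ?mulr_gt0 // ler_peMr // ler1n. Qed.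

(** On the ray through [p] the points with small positive parameter, rescaled to xi_0 = 1, fall into
    the polydisc of [near_base]. [identity_disc] carries the vanishing to the parameter 1, since
    [cell1] keeps the whole complex line in [Zhat]. *)
Let cell1_0 p : T (cell1 p) = 0.
Proof.
pose f (t : C) := T (cell1 (t *: p)).
have fd t : `|t| < 2 -> differentiable f t.
  move=> _; apply: (@differentiable_comp _ _ _ _ (fun t : C => cell1 (t *: p)) T); last first.
    by apply: (proj1 Th); rewrite Jhat_cell1 oner_eq0.
  apply: (@differentiable_comp _ _ _ _ (fun t : C => t *: p) cell1); last exact: cell1_differentiable.
  exact: (@differentiableZl C C _ (fun t : C => t) p t (differentiable_idfun t)).
pose S := cell_sum p; pose B : C := 1 + `|S| + `|p|.
have B1 : 1 <= B by rewrite /B -addrA lerDl addr_ge0.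
have B0 : 0 < B by apply: lt_le_trans B1.
pose e := d / (2 * B).
have e0 : 0 < e by rewrite divr_gt0 // mulr_gt0.
have -> : T (cell1 p) = f 1 by rewrite /f scale1r.
apply: (identity_disc fd e0); last by rewrite normr1 ltr1n.
move=> t t0 te.
have tB : t * B < d / 2.
  move: te; rewrite /e ltr_pdivlMr ?mulr_gt0 // => te.
  by rewrite ltr_pdivlMr // -mulrA [B * 2]mulrC.
have d21 : d / 2 <= 2^-1.
  by rewrite ler_pdivrMr // mulVf // (le_trans d2) // invf_le1 // ler1n.
have t1 : t <= 1.
  apply: le_trans (_ : t * B <= 1); first by rewrite ler_peMr // ltW.
  by apply: le_trans (ltW tB) _; apply: le_trans d21 _; rewrite invf_le1 // ler1n.
have cS : cell_sum (t *: p) = t * (t * S).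
  rewrite /cell_sum !mulr_sumr; apply: eq_bigr => k _; rewrite /lpart /rpart !mxE.
  by move: (nu _) (p 0 _) (p 0 (rshift n k)) => *; ring.
have qS : `|cell_sum (t *: p)| <= 2^-1.
  rewrite cS !normrM gtr0_norm //; apply: le_trans (_ : t * B <= _); last exact: le_trans (ltW tB) d21.
  apply: ler_wpM2l; first exact: ltW.
  by apply: le_trans (_ : `|S| <= _); [rewrite ler_piMl|rewrite /B addrAC lerDr addr_ge0].
have q2 : 2^-1 <= `|1 - cell_sum (t *: p)|.
  have := lerB_dist 1 (cell_sum (t *: p)); rewrite normr1; apply: le_trans.
  by rewrite lerBrDr; apply: le_trans (lerD (lexx _) qS) _; have -> : 2^-1 + 2^-1 = 1 :> C by field.
have pk i : `|(t *: p) 0 i| < d / 2.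
  rewrite mxE normrM gtr0_norm //; apply: le_lt_trans tB; apply: ler_wpM2l; first exact: ltW.
  by apply: le_trans (rv_coord_le _ _) _; rewrite /B lerDr addr_ge0.
have q0 : 1 - cell_sum (t *: p) != 0.
  by rewrite -normr_gt0; apply: lt_le_trans q2; rewrite invr_gt0.
rewrite /f -(proj2 Th (1 - cell_sum (t *: p))^-1 1) ?oner_eq0 ?invr_eq0 //= !consvZ.
rewrite mulVf // !mul1r.
have := @near_base (\row_k ((1 - cell_sum (t *: p))^-1 * lpart (t *: p) k)) (\row_k rpart (t *: p) k).
rewrite !affine_consv => nb; rewrite -[RHS]nb.
- by congr (T (consv _ _, consv _ _)); apply/funext => k; rewrite mxE ?mul1r.
- move=> k; rewrite mxE normrM normfV mulrC ltr_pdivrMr; last by rewrite normr_gt0.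
  apply: lt_le_trans (pk _) _; rewrite ler_pM2l //.
- move=> k; rewrite mxE; apply: lt_le_trans (pk _) _.
  by rewrite ler_pdivrMr // ler_peMr ?ltW // ltr1n.
Qed.

(** Homogeneity and [cell1] cover the points with eta_0 nonzero. A nonzero value elsewhere would
    persist on a neighbourhood, which contains such points. *)
Theorem homhol_identity x : Jhat x != 0 -> T x = 0.
Proof.
have H y : Jhat y != 0 -> y.2 0 0 != 0 -> T y = 0.
  move=> J0 y0; pose t' := y.2 0 0.
  have := cell1_0 (cellp (fun k => t' * ((Jhat y)^-1 *: y.1) 0 (lift ord0 k)) (fun k => t'^-1 * y.2 0 (lift ord0 k))).
  rewrite (@cell1E _ _ (((Jhat y)^-1 *: y.1) 0 0) t') //.
    rewrite -!consvE scalerA; have := proj2 Th (t' / Jhat y) t'^-1 y => -> //.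
      by rewrite mulf_neq0 ?invr_eq0.
    by rewrite invr_eq0.
  rewrite -Jhat_consv -(consvE ((Jhat y)^-1 *: y.1)) -(consvE y.2).
  by have := JhatZ s (Jhat y)^-1 1 y; rewrite scale1r mulr1 mulVf.
move=> J0; apply/eqP/negPn/negP => Tx0.
have /generic_dense[y [[/= J1 Ty] _ y0]] : nbhs x ([set y | Jhat y != 0] `&` [set y | T y != 0]).
  by apply: filterI; [exact: Jhat_near|exact: differentiable_near_neq0 (proj1 Th x J0) Tx0].
by rewrite H ?eqxx in Ty.
Qed.
End Vanishing.
End IdentityTheorem.

(** * Roots of unity and bihomogeneous functions *)

Section RootsOfUnity.
Variable K : numClosedFieldType.

Lemma prim_root_ex M : (0 < M)%N -> exists w : K, M.-primitive_root w.
Proof.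
move=> M0; pose p : {poly K} := 'X^M - 1.
have [r Dp] := closed_field_poly_normal p.
have sz_p : size p = M.+1 by rewrite size_XnsubC.
rewrite (monicP _) ?monicXnsubC // scale1r in Dp.
have rn1 : all M.-unity_root r by apply/allP => z; rewrite -root_prod_XsubC -Dp.
have sz_r : (size r >= M)%N by rewrite -ltnS -sz_p Dp size_prod_XsubC.
have [|w] := hasP (has_prim_root M0 rn1 _ sz_r); last by exists w.
by rewrite -separable_prod_XsubC -Dp separable_Xn_sub_1 // pnatr_eq0 -lt0n.
Qed.

(** A discrete form of the integral over the unit circle. It extracts Laurent coefficients exactly
    as long as the exponents to be separated are distinct modulo [M]. *)
Definition avg (M : nat) (w : K) (f : K -> K) : K := M%:R^-1 * \sum_(j < M) f (w ^+ j).

Section Average.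
Variables (M : nat) (w : K).
Hypotheses (M0 : (0 < M)%N) (wP : M.-primitive_root w).

Lemma prim_root_norm j : `|w ^+ j| = 1.
Proof.
have := prim_expr_order wP; move/(congr1 (fun x => `|x|)); rewrite normrX normr1 => e.
by rewrite normrX; move/eqP: e; rewrite pexpr_eq1 // => /eqP ->; rewrite expr1n.
Qed.

Lemma prim_root_neq0 j : w ^+ j != 0.
Proof. by rewrite -normr_gt0 prim_root_norm. Qed.

Lemma avg_pow p q : avg M w (fun z => z ^+ p * z ^- q) = (p == q %[mod M])%:R.
Proof.
pose y := w ^+ p / w ^+ q.
have -> : avg M w (fun z => z ^+ p * z ^- q) = M%:R^-1 * \sum_(j < M) y ^+ j.
  congr (_ * _); apply: eq_bigr => j _.
  by rewrite /y exprMn exprVn -!exprM ![(_ * j)%N]mulnC.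
have [pq|pq] := boolP (p == q %[mod M]).
  have -> : y = 1.
    by rewrite /y; move: pq; rewrite -(eq_prim_root_expr wP) => /eqP ->; rewrite divff ?prim_root_neq0.
  under eq_bigr do rewrite expr1n.
  by rewrite sumr_const card_ord mulVf // pnatr_eq0 -lt0n.
have y1 : 1 - y != 0.
  rewrite subr_eq0 eq_sym; apply: contra pq; rewrite -(eq_prim_root_expr wP) /y.
  by move=> /eqP e; rewrite -[w ^+ p](divfK (prim_root_neq0 q)) e mul1r.
have yM : y ^+ M = 1.
  by rewrite /y exprMn exprVn -!exprM ![(_ * M)%N]mulnC !exprM (prim_expr_order wP) !expr1n divr1.
have := subrX1 y M; rewrite yM subrr => /esym/eqP; rewrite mulf_eq0 subr_eq0 -subr_eq0 -opprB oppr_eq0.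
by rewrite (negPf y1) /= => /eqP ->; rewrite mulr0.
Qed.

Lemma avgD f g : avg M w (fun z => f z + g z) = avg M w f + avg M w g.
Proof. by rewrite /avg big_split mulrDr. Qed.

Lemma avgZ c f : avg M w (fun z => c * f z) = c * avg M w f.
Proof. by rewrite /avg -mulr_sumr mulrCA. Qed.

Lemma avg_sum (I : Type) (r : seq I) (F : I -> K -> K) :
  avg M w (fun z => \sum_(i <- r) F i z) = \sum_(i <- r) avg M w (F i).
Proof. by rewrite /avg exchange_big mulr_sumr. Qed.

Lemma eq_avg f g : (forall z, `|z| = 1 -> f z = g z) -> avg M w f = avg M w g.
Proof. by move=> fg; congr (_ * _); apply: eq_bigr => j _; apply: fg; exact: prim_root_norm. Qed.

Lemma avg_le f (B : K) : (forall z, `|z| = 1 -> `|f z| <= B) -> `|avg M w f| <= B.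
Proof.
move=> fB; rewrite /avg normrM normfV normr_nat ler_pdivrMl ?ltr0n //.
apply: le_trans (ler_norm_sum _ _ _) _; apply: le_trans (_ : \sum_(j < M) B <= _).
  by apply: ler_sum => j _; apply: fB; exact: prim_root_norm.
by rewrite sumr_const card_ord mulr_natl.
Qed.
End Average.

(** [X ^+ p * Y ^+ q] is, up to a binomial factor, the coefficient of z^q in (X + zY)^(p + q).
    Products of powers of linear forms thus become sums of powers of one linear form, the only kind
    of generator for which the star product is computed. *)
Lemma polarization (M p q : nat) (w X Y : K) : M.-primitive_root w -> (p + q < M)%N ->
  X ^+ p * Y ^+ q = 'C(p + q, q)%:R^-1 * avg M w (fun z => (X + z * Y) ^+ (p + q) * z ^- q).
Proof.
move=> wP pqM; have M0 : (0 < M)%N by apply: leq_trans pqM.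
have -> : avg M w (fun z => (X + z * Y) ^+ (p + q) * z ^- q) =
    avg M w (fun z => \sum_(i < (p + q).+1) ('C(p + q, i)%:R * X ^+ (p + q - i) * Y ^+ i) * (z ^+ i * z ^- q)).
  apply: (eq_avg M0 wP) => z _; rewrite exprDn mulr_suml; apply: eq_bigr => i _.
  by rewrite exprMn -mulr_natl; move: (z ^- q) (z ^+ i) => u v; ring.
rewrite avg_sum.
have qpq : (q < (p + q).+1)%N by rewrite ltnS leq_addl.
rewrite (bigD1 (Ordinal qpq)) //= avgZ (avg_pow M0 wP) eqxx mulr1 big1 => [|i iq].
  rewrite addr0 addnK -mulrA mulKf // pnatr_eq0 -lt0n bin_gt0 leq_addl //.
rewrite avgZ (avg_pow M0 wP) !modn_small; last 2 first.
- by apply: leq_trans pqM; rewrite ltnS leq_addl.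
- by apply: leq_ltn_trans pqM; rewrite -ltnS.
by case: eqP => e; rewrite ?mulr0 //; case/negP: iq; apply/eqP/val_inj.
Qed.
End RootsOfUnity.

(** * Sums of generators of a given bidegree *)

Section Bihomogeneous.
Variables (R : realType) (n s : nat).
Local Notation C := (Cplx R).
Local Notation V := 'rV[C]_n.+1.
Local Notation Jhat := (@Jhat R n s).
Local Notation nu := (nu R s).

Definition dot (a x : V) : C := \sum_k a 0 k * x 0 k.

Lemma dotDl a b x : dot (a + b) x = dot a x + dot b x.
Proof. by rewrite /dot -big_split; apply: eq_bigr => k _; rewrite mxE mulrDl. Qed.

Lemma dotZl c a x : dot (c *: a) x = c * dot a x.
Proof. by rewrite /dot mulr_sumr; apply: eq_bigr => k _; rewrite mxE mulrA. Qed.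

Lemma dotDr a x y : dot a (x + y) = dot a x + dot a y.
Proof. by rewrite /dot -big_split; apply: eq_bigr => k _; rewrite mxE mulrDr. Qed.

Lemma dotZr c a x : dot a (c *: x) = c * dot a x.
Proof. by rewrite /dot mulr_sumr; apply: eq_bigr => k _; rewrite mxE mulrCA. Qed.

Lemma dot_delta k x : dot (delta_mx 0 k) x = x 0 k.
Proof.
rewrite /dot (bigD1 k) //= big1 => [|j jk]; rewrite mxE /=.
  by rewrite eqxx mul1r addr0.
by rewrite (negPf jk) mul0r.
Qed.

(* The triple t = (c, a, b) stands for c (a.xi)^p (b.eta)^q. *)
Definition gen_ev (p q : nat) (t : C * V * V) (x : V * V) : C :=
  t.1.1 * dot t.1.2 x.1 ^+ p * dot t.2 x.2 ^+ q.

Definition ev (p q : nat) (L : seq (C * V * V)) (x : V * V) : C :=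
  \sum_(t <- L) gen_ev p q t x.

(** Equality is required on [Zhat] only: there [Jhat] is 1, and multiplying by it raises both
    degrees ([bev_raise]), so two polynomials can always be given a common bidegree. *)
Definition bev (p q : nat) (phi : V * V -> C) : Prop :=
  exists L, forall x, Jhat x = 1 -> phi x = ev p q L x.

Lemma bev_ext p q phi psi : (forall x, Jhat x = 1 -> phi x = psi x) -> bev p q phi -> bev p q psi.
Proof. by move=> e [L LP]; exists L => x J1; rewrite -e // LP. Qed.

Lemma bev0 p q : bev p q (fun=> 0).
Proof. by exists [::] => x _; rewrite /ev big_nil. Qed.

Lemma bevD p q phi psi : bev p q phi -> bev p q psi -> bev p q (fun x => phi x + psi x).
Proof.
move=> [L LP] [L' LP']; exists (L ++ L') => x J1.
by rewrite /ev big_cat LP // LP'.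
Qed.

Lemma bevZ p q c phi : bev p q phi -> bev p q (fun x => c * phi x).
Proof.
move=> [L LP]; exists [seq (c * t.1.1, t.1.2, t.2) | t <- L] => x J1.
rewrite LP // /ev big_map mulr_sumr; apply: eq_bigr => t _.
by rewrite /gen_ev !mulrA.
Qed.

Lemma bev_sum p q (I : Type) (r : seq I) (P : pred I) (phi : I -> V * V -> C) :
  (forall i, P i -> bev p q (phi i)) -> bev p q (fun x => \sum_(i <- r | P i) phi i x).
Proof.
move=> h; elim: r => [|i r IH].
  by apply: bev_ext (bev0 p q) => x _; rewrite big_nil.
have [Pi|Pi] := boolP (P i).
  by apply: bev_ext (bevD (h i Pi) IH) => x _; rewrite big_cons Pi.
by apply: bev_ext IH => x _; rewrite big_cons (negPf Pi).
Qed.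

Lemma bev_gen p q c a b : bev p q (gen_ev p q (c, a, b)).
Proof. by exists [:: (c, a, b)] => x _; rewrite /ev big_seq1. Qed.

Lemma bev_genM p q p' q' t t' : bev (p + p') (q + q') (fun x => gen_ev p q t x * gen_ev p' q' t' x).
Proof.
have [w wP] := @prim_root_ex C (p + p' + (q + q')).+1 isT; set M := (_.+1) in wP.
have h1 : (p + p' < M)%N by rewrite ltnS leq_addr.
have h2 : (q + q' < M)%N by rewrite ltnS leq_addl.
pose F (z z' : C) (x : V * V) := gen_ev (p + p') (q + q')
  (t.1.1 * t'.1.1 * ('C(p + p', p')%:R^-1 * M%:R^-1 * z ^- p') * ('C(q + q', q')%:R^-1 * M%:R^-1 * z' ^- q'),
   t.1.2 + z *: t'.1.2, t.2 + z' *: t'.2) x.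
apply: (@bev_ext _ _ (fun x => \sum_(j < M) \sum_(j' < M) F (w ^+ j) (w ^+ j') x)).
  move=> x _; rewrite /gen_ev.
  transitivity (t.1.1 * t'.1.1 * (dot t.1.2 x.1 ^+ p * dot t'.1.2 x.1 ^+ p')
      * (dot t.2 x.2 ^+ q * dot t'.2 x.2 ^+ q')).
    rewrite (polarization _ _ wP h1) (polarization _ _ wP h2) /avg !mulr_sumr exchange_big.
    apply: eq_bigr => j' _; rewrite mulr_suml; apply: eq_bigr => j _; rewrite /F /gen_ev /= !dotDl !dotZl.
    move: (_ ^+ (p + p')) (_ ^+ (q + q')) (_ ^- p') (_ ^- q') => u v u' v'.
    by move: (_^-1) (_^-1) (_^-1) => y1 y2 y3; ring.
  by move: (_ ^+ p) (_ ^+ p') (_ ^+ q) (_ ^+ q') => a b c d; ring.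
by apply: bev_sum => j _; apply: bev_sum => j' _; exact: bev_gen.
Qed.

Lemma bevM p q p' q' phi psi : bev p q phi -> bev p' q' psi ->
  bev (p + p') (q + q') (fun x => phi x * psi x).
Proof.
move=> [L LP] [L' LP'].
apply: (@bev_ext _ _ (fun x => \sum_(t <- L) \sum_(t' <- L') gen_ev p q t x * gen_ev p' q' t' x)).
  move=> x J1; rewrite LP // LP' // /ev mulr_suml; apply: eq_bigr => t _.
  by rewrite mulr_sumr.
by apply: bev_sum => t _; apply: bev_sum => t' _; exact: bev_genM.
Qed.

Lemma bev_cst c : bev 0 0 (fun=> c).
Proof. by apply: bev_ext (bev_gen 0 0 c 0 0) => x _; rewrite /gen_ev /= !mulr1. Qed.

Lemma bev_fst k : bev 1 0 (fun x => x.1 0 k).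
Proof.
by apply: bev_ext (bev_gen 1 0 1 (delta_mx 0 k) 0) => x _; rewrite /gen_ev /= mulr1 mul1r dot_delta.
Qed.

Lemma bev_snd k : bev 0 1 (fun x => x.2 0 k).
Proof.
by apply: bev_ext (bev_gen 0 1 1 0 (delta_mx 0 k)) => x _; rewrite /gen_ev /= !mul1r dot_delta.
Qed.

Lemma bevX p q phi k : bev p q phi -> bev (k * p) (k * q) (fun x => phi x ^+ k).
Proof.
move=> h; elim: k => [|k IH]; first exact: bev_cst.
by rewrite !mulSn; apply: bev_ext (bevM h IH) => x _; rewrite exprS.
Qed.

Lemma bev_prod (I : Type) (r : seq I) (p q : I -> nat) (phi : I -> V * V -> C) :
  (forall i, bev (p i) (q i) (phi i)) ->
  bev (\sum_(i <- r) p i) (\sum_(i <- r) q i) (fun x => \prod_(i <- r) phi i x).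
Proof.
move=> h; elim: r => [|i r IH].
  by rewrite !big_nil; apply: bev_ext (bev_cst 1) => x _; rewrite big_nil.
by rewrite !big_cons; apply: bev_ext (bevM (h i) IH) => x _; rewrite big_cons.
Qed.

Lemma bev_mono1 (I : Type) (r : seq I) (k : I -> 'I_n.+1) (e : I -> nat) :
  bev (\sum_(i <- r) e i) 0 (fun x => \prod_(i <- r) x.1 0 (k i) ^+ e i).
Proof.
have := @bev_prod I r e (fun=> 0%N) (fun i x => x.1 0 (k i) ^+ e i).
rewrite big1_eq; apply=> i; have := @bevX 1 0 (fun x => x.1 0 (k i)) (e i) (bev_fst _).
by rewrite muln1 muln0.
Qed.

Lemma bev_mono2 (I : Type) (r : seq I) (k : I -> 'I_n.+1) (e : I -> nat) :
  bev 0 (\sum_(i <- r) e i) (fun x => \prod_(i <- r) x.2 0 (k i) ^+ e i).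
Proof.
have := @bev_prod I r (fun=> 0%N) e (fun i x => x.2 0 (k i) ^+ e i).
rewrite big1_eq; apply=> i; have := @bevX 0 1 (fun x => x.2 0 (k i)) (e i) (bev_snd _).
by rewrite muln1 muln0.
Qed.

Lemma bev_raise m m' phi : (m <= m')%N -> bev m m phi -> bev m' m' phi.
Proof.
move=> /subnK <-; elim: (m' - m)%N => [|d IH] // h; have {}IH := IH h.
have J : bev 1 1 Jhat.
  apply: bev_sum => k _; apply: (@bev_ext _ _ (fun x => nu k * (x.1 0 k * x.2 0 k))).
    by move=> x _; rewrite mulrA.
  exact/bevZ/(bevM (bev_fst k) (bev_snd k)).
by rewrite addSn -add1n; apply: bev_ext (bevM J IH) => x J1; rewrite J1 mul1r.
Qed.

Lemma evZ p q L (a b : C) x : ev p q L (a *: x.1, b *: x.2) = a ^+ p * b ^+ q * ev p q L x.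
Proof.
rewrite /ev mulr_sumr; apply: eq_bigr => t _; rewrite /gen_ev /= !dotZr !exprMn.
by move: (a ^+ p) (b ^+ q) (_ ^+ p) (_ ^+ q) => *; ring.
Qed.

Lemma dot_differentiable1 a (x : V * V) : differentiable (fun x : V * V => dot a x.1) x.
Proof.
apply: differentiable_sumf => k; apply: (@differentiable_mul _ _ (cst (a 0 k))).
  exact: differentiable_cst.
exact: differentiable_coord1.
Qed.

Lemma dot_differentiable2 a (x : V * V) : differentiable (fun x : V * V => dot a x.2) x.
Proof.
apply: differentiable_sumf => k; apply: (@differentiable_mul _ _ (cst (a 0 k))).
  exact: differentiable_cst.
exact: differentiable_coord2.
Qed.

Lemma differentiable_pow (U : normedModType C) (f : U -> C) k x :
  differentiable f x -> differentiable (fun y => f y ^+ k) x.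
Proof.
move=> fd; exact: (@differentiable_comp _ _ _ _ f (fun z : C => z ^+ k) x fd (differentiable_expn _ _)).
Qed.

Lemma ev_differentiable p q L x : differentiable (ev p q L) x.
Proof.
apply: differentiable_sumf => t; apply: differentiable_mul.
  apply: (@differentiable_mul _ _ (cst t.1.1)); first exact: differentiable_cst.
  exact/differentiable_pow/dot_differentiable1.
exact/differentiable_pow/dot_differentiable2.
Qed.

(** Division by [Jhat ^+ m] gives bidegree (0, 0) and changes nothing on [Zhat]. *)
Lemma bev_homhol m phi : bev m m phi -> exists T, homhol s T /\ forall x, Jhat x = 1 -> T x = phi x.
Proof.
move=> [L LP]; exists (fun x => ev m m L x * (Jhat x ^+ m)^-1); split; last first.
  by move=> x J1; rewrite LP // J1 expr1n invr1 mulr1.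
split=> [x J0|a b x a0 b0].
  apply: differentiable_mul; first exact: ev_differentiable.
  apply: differentiable_inv; last by rewrite expf_neq0.
  exact/differentiable_pow/Jhat_differentiable.
rewrite evZ JhatZ -exprMn [(a * b * _) ^+ m]exprMn invfM mulrACA mulfV ?mul1r //.
by rewrite expf_neq0 // mulf_neq0.
Qed.
End Bihomogeneous.

(** * Extensions of analytic functions and of polynomials to the cone *)

Section HolomorphicExtensions.
Variables (R : realType) (n s : nat).
Hypothesis s0 : (0 < s)%N.
Local Notation C := (Cplx R).
Local Notation V := 'rV[C]_n.+1.
Local Notation Jhat := (@Jhat R n s).
Local Notation nu := (nu R s).
Local Notation AM := (AMred R n s).
Local Notation PM := (PMred R n s).

Lemma JZ (a : C) (z : V) : J s (a *: z) = a * a^* * J s z.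
Proof.
rewrite /J mulr_sumr; apply: eq_bigr => k _; rewrite !mxE rmorphM /=.
by move: (nu k) (z 0 k) ((z 0 k)^*) (a^*) => *; ring.
Qed.

Lemma Z_JP (z : @Z R n s) : J s (set_val z) = 1.
Proof. exact: (set_mem (valP z)). Qed.

Lemma cconjZ (a : C) (z : V) : cconj (a *: z) = a^* *: cconj z.
Proof. by apply/rowP => k; rewrite !mxE rmorphM. Qed.

Lemma sqrt_rho (w : 'rV[C]_n) : 0 < rho s w ->
  [/\ sqrtC (rho s w) != 0, (sqrtC (rho s w))^* = sqrtC (rho s w) & sqrtC (rho s w) ^+ 2 = rho s w].
Proof.
move=> r0; split; last exact: sqrtCK.
  by rewrite sqrtC_eq0 gt_eqF.
by apply/CrealP; apply: gtr0_real; rewrite sqrtC_gt0.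
Qed.

Lemma chart_point (w : 'rV[C]_n) : 0 < rho s w -> exists z : @Z R n s,
  set_val z = (sqrtC (rho s w))^-1 *: affine ord0 w.
Proof.
move=> r0; have [q0 qc q2] := sqrt_rho r0.
have Jz : J s ((sqrtC (rho s w))^-1 *: affine ord0 w) = 1.
  by rewrite JZ J_affine // rmorphV ?unitfE //= qc -invfM -expr2 q2 mulVf // gt_eqF.
by exists (SigSub (mem_set Jz : _ \in @Z R n s)).
Qed.

Lemma in_chart_cls (f : Mred R n s -> C) (w : 'rV[C]_n) (z : @Z R n s) :
  set_val z = (sqrtC (rho s w))^-1 *: affine ord0 w -> in_chart f w = f (cls z).
Proof. by move=> zE; rewrite /in_chart /eval_cone J_affine // -zE /set_val valK. Qed.

Lemma conehat_diag (F : Mhat R n s -> C) (z : @Z R n s) :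
  eval_conehat F (set_val z, cconj (set_val z)) = F (Delta (cls z)).
Proof. by rewrite Delta_cls -eval_conehat_val. Qed.

Lemma homhol_sub (T T' : V * V -> C) : homhol s T -> homhol s T' -> homhol s (fun x => T x - T' x).
Proof.
move=> [d1 z1] [d2 z2]; split=> [x J0|a b x a0 b0]; last by rewrite z1 ?z2.
by apply: differentiable_sub; [exact: d1|exact: d2].
Qed.

Lemma homholZD (a : C) (T T' : V * V -> C) : homhol s T -> homhol s T' ->
  homhol s (fun x => a * T x + T' x).
Proof.
move=> [d1 z1] [d2 z2]; split=> [x J0|c b x c0 b0]; last by rewrite z1 ?z2.
apply: differentiable_add; last exact: d2.
by apply: (@differentiable_mul _ _ (cst a)); [exact: differentiable_cst|exact: d1].
Qed.

Lemma homhol_eq (T T' : V * V -> C) : homhol s T -> homhol s T' ->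
  (forall z : @Z R n s, T (set_val z, cconj (set_val z)) = T' (set_val z, cconj (set_val z))) ->
  forall x, Jhat x != 0 -> T x = T' x.
Proof.
move=> Th Th' TT x J0; apply/eqP; rewrite -subr_eq0; apply/eqP.
apply: (homhol_identity s0 (homhol_sub Th Th')) J0 => w r0 /=.
have [z zE] := chart_point r0; have [q0 qc _] := sqrt_rho r0.
have q0' : (sqrtC (rho s w))^-1 != 0 by rewrite invr_eq0.
have := TT z; rewrite zE cconjZ rmorphV ?unitfE //= qc.
rewrite (proj2 Th _ _ (affine ord0 w, cconj (affine ord0 w)) q0' q0').
rewrite (proj2 Th' _ _ (affine ord0 w, cconj (affine ord0 w)) q0' q0') => ->.
by rewrite subrr.
Qed.

Definition hat (F : AM) : V * V -> C := eval_conehat (hol_ext F).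

Lemma hat_homhol F : homhol s (hat F).
Proof. apply: holomorphic_homhol; exact: (s2valP (cid2 (asboolW (valP F)))). Qed.

Lemma hat_diag (F : AM) (z : @Z R n s) : hat F (set_val z, cconj (set_val z)) = val F (cls z).
Proof.
rewrite /hat conehat_diag.
by have := s2valP' (cid2 (asboolW (valP F))); move/(congr1 (fun f => f (cls z))) => /= ->.
Qed.

Lemma hat_clshat (F : AM) (y : @Zhat R n s) : hol_ext F (clshat y) = hat F (set_val y).
Proof. by rewrite /hat eval_conehat_val. Qed.

Lemma hat_uniq (F : AM) T : homhol s T ->
  (forall z : @Z R n s, val F (cls z) = T (set_val z, cconj (set_val z))) ->
  forall x, Jhat x != 0 -> hat F x = T x.
Proof.
move=> Th FT; apply: homhol_eq (hat_homhol F) Th _ => z.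
by rewrite hat_diag FT.
Qed.

Lemma Mred_cls (p : Mred R n s) : exists z, p = cls z.
Proof. by elim/quotW: (p : {eq_quot (@U1_equiv R n s)}%qT) => z; exists z. Qed.

Lemma Mhat_clshat (p : Mhat R n s) : exists y, p = clshat y.
Proof. by elim/quotW: (p : {eq_quot (@Cstar_equiv R n s)}%qT) => z; exists z. Qed.

Lemma hat_inj (F G : AM) : (forall x, Jhat x = 1 -> hat F x = hat G x) -> F = G.
Proof.
move=> FG; apply/val_inj/funext => p; have [z ->] := Mred_cls p.
by rewrite -!hat_diag; apply: FG; rewrite Jhat_diag Z_JP.
Qed.

Lemma hat_exists T : homhol s T -> exists F : AM, forall x, Jhat x != 0 -> hat F x = T x.
Proof.
move=> Th; have [G [Gh GT]] := homhol_holomorphic Th.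
have Ga : G \o (@Delta R n s) \in @analytic R n s by apply/asboolP; exists G.
exists (exist (fun f => f \in @analytic R n s) _ Ga : AM); apply: hat_uniq => //= z.
by rewrite -conehat_diag GT // Jhat_diag Z_JP oner_eq0.
Qed.

Lemma hatZD (a : C) (F G : AM) x : Jhat x != 0 -> hat (a *: F + G) x = a * hat F x + hat G x.
Proof.
move: x; apply: hat_uniq; first exact: homholZD (hat_homhol F) (hat_homhol G).
by move=> z; rewrite !hat_diag.
Qed.

Let sep (p : mpoly (n.+1 + n.+1) C) (x : V * V) : peval p x =
  \sum_(m <- msupp p) mcoeff m p *
   (\prod_(k < n.+1) x.1 0 k ^+ fun_of_multinom m (lshift n.+1 k) *
    \prod_(k < n.+1) x.2 0 k ^+ fun_of_multinom m (rshift n.+1 k)).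
Proof.
rewrite /peval mevalE; apply: eq_bigr => m _; congr (_ * _).
rewrite big_split_ord /=; congr (_ * _); apply: eq_bigr => k _.
  by rewrite (unsplitK (inl k)).
by rewrite (unsplitK (inr k)).
Qed.

(** By invariance [p] equals its average over the action of roots of unity, which removes the
    monomials of unequal degrees in z and its conjugate. What remains is balanced, and [bev_raise]
    brings it to any large common degree. *)
Lemma peval_bev (p : mpoly (n.+1 + n.+1) C) : U1_invariant p -> exists m0, forall m, (m0 <= m)%N ->
  exists phi, bev s m m phi /\ forall z, J s z = 1 -> peval p (z, cconj z) = phi (z, cconj z).
Proof.
move=> pU.
pose d1 (m : multinom (n.+1 + n.+1)) := (\sum_(k < n.+1) fun_of_multinom m (lshift n.+1 k))%N.
pose d2 (m : multinom (n.+1 + n.+1)) := (\sum_(k < n.+1) fun_of_multinom m (rshift n.+1 k))%N.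
(* A bound for all degrees, so that roots of unity of order [D + 1] separate them. *)
pose D := (\sum_(m <- msupp p) (d1 m + d2 m))%N.
have leD m : m \in msupp p -> (d1 m <= D)%N /\ (d2 m <= D)%N.
  move=> mp; have : (d1 m + d2 m <= D)%N by rewrite /D (big_rem m mp) leq_addr.
  by move=> h; split; apply: leq_trans h; rewrite ?leq_addr ?leq_addl.
pose mono (m : multinom (n.+1 + n.+1)) (x : V * V) := \prod_(k < n.+1) x.1 0 k ^+ fun_of_multinom m (lshift n.+1 k) *
    \prod_(k < n.+1) x.2 0 k ^+ fun_of_multinom m (rshift n.+1 k).
exists D => m Dm.
exists (fun x => \sum_(m <- msupp p | (m \in msupp p) && (d1 m == d2 m)) mcoeff m p * mono m x); split.
  apply: bev_sum => mm /andP[mp /eqP e]; apply: bevZ; apply: (@bev_raise _ _ _ (d1 mm)).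
    by apply: leq_trans Dm; have [] := leD mm mp.
  have := bevM (@bev_mono1 R n s _ (index_enum 'I_n.+1) id (fun k => fun_of_multinom mm (lshift n.+1 k)))
     (@bev_mono2 R n s _ (index_enum 'I_n.+1) id (fun k => fun_of_multinom mm (rshift n.+1 k))).
  by rewrite addn0 add0n -/(d1 mm) -/(d2 mm) -e.
move=> z _; have [w wP] := @prim_root_ex C D.+1 isT.
have avc (c : C) : avg D.+1 w (fun=> c) = c.
  by rewrite /avg sumr_const card_ord -[c *+ _]mulr_natl mulKf // pnatr_eq0.
rewrite -[LHS]avc.
transitivity (avg D.+1 w (fun a => \sum_(m <- msupp p) mcoeff m p * mono m (z, cconj z) * (a ^+ d1 m * a ^- d2 m))).
  apply: (@eq_avg C D.+1 w isT wP (fun=> peval p (z, cconj z))) => a a1; rewrite -(pU a z a1) sep; apply: eq_bigr => mm _.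
  rewrite -mulrA; congr (_ * _); rewrite /mono /=.
  have aV : a^* = a^-1.
    have a0 : a != 0 by rewrite -normr_gt0 a1.
    by rewrite -[a^*](mulKf a0) -normCK a1 expr1n mulr1.
  rewrite [RHS]mulrACA; congr (_ * _); rewrite /d1 /d2.
    rewrite mulrC -prodrXr -big_split /=; apply: eq_bigr => k _.
    by rewrite mxE exprMn.
  rewrite mulrC -exprVn -prodrXr -big_split /=; apply: eq_bigr => k _.
  by rewrite !mxE rmorphM /= aV exprMn.
rewrite avg_sum [RHS]big_mkcond /=; apply: eq_big_seq => mm mp.
have [l1 l2] := leD mm mp.
by rewrite avgZ (avg_pow (ltn0Sn D) wP) mp !modn_small ?ltnS //=; case: eqP; rewrite ?mulr1 ?mulr0.
Qed.

Lemma PM_hat_bev (f : PM) : exists m0, forall m, (m0 <= m)%N -> bev s m m (hat (PMred_AMred f)).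
Proof.
have [p pU pE] : exists2 p, U1_invariant p & forall z : @Z R n s, val f (cls z) = peval p (set_val z, cconj (set_val z)).
  exact: asboolW (valP f).
have [m0 mP] := peval_bev pU; exists m0 => m /mP[phi [phib phiE]].
have [T [Th TE]] := bev_homhol phib.
apply: bev_ext phib => x J1; rewrite -TE //; symmetry; apply: hat_uniq; rewrite ?J1 ?oner_eq0 //.
move=> z; rewrite -[val _]/(val f) pE phiE ?Z_JP // TE //.
by rewrite Jhat_diag Z_JP.
Qed.

Lemma bev_PM m phi : bev s m m phi ->
  exists f : PM, forall x, Jhat x = 1 -> hat (PMred_AMred f) x = phi x.
Proof.
move=> phib; have [L LP] := phib.
pose la (a : V) : mpoly (n.+1 + n.+1) C := \sum_(k < n.+1) (a 0 k) *: mpolyX C (mnm1 (lshift n.+1 k)).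
pose lb (a : V) : mpoly (n.+1 + n.+1) C := \sum_(k < n.+1) (a 0 k) *: mpolyX C (mnm1 (rshift n.+1 k)).
pose p : mpoly (n.+1 + n.+1) C := \sum_(t <- L) t.1.1 *: (la t.1.2 ^+ m * lb t.2 ^+ m).
have pE x : peval p x = ev m m L x.
  rewrite /peval /p raddf_sum; apply: eq_bigr => t _.
  rewrite /= mevalZ rmorphM !rmorphXn /= /gen_ev mulrA; congr (_ * _ ^+ m * _ ^+ m).
    rewrite raddf_sum; apply: eq_bigr => k _; rewrite /= mevalZ mevalXU.
    by rewrite (unsplitK (inl k)).
  rewrite raddf_sum; apply: eq_bigr => k _; rewrite /= mevalZ mevalXU.
  by rewrite (unsplitK (inr k)).
have pU : U1_invariant p.
  move=> a z a1; rewrite !pE cconjZ (evZ m m L a a^* (z, cconj z)) -exprMn -normCK a1.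
  by rewrite !expr1n mul1r.
(* The value at the representative chosen by [repr] is the value at any point of the class, because
   [p] is invariant. *)
have fP : (fun q : Mred R n s => peval p (set_val (repr (q : {eq_quot (@U1_equiv R n s)}%qT)),
    cconj (set_val (repr (q : {eq_quot (@U1_equiv R n s)}%qT))))) \in @Defs.polynomial R n s.
  apply/asboolP; exists p => // z; rewrite /cls; case: piP => z' /eqquotP /= /asboolP[a a1 e].
  by rewrite e pU.
exists (exist (fun f => f \in @Defs.polynomial R n s) _ fP : PM) => x J1.
have [T [Th TE]] := bev_homhol phib; rewrite -TE //.
apply: hat_uniq => //; last by rewrite J1 oner_eq0.
move=> z /=; rewrite /cls; case: piP => z' /eqquotP /= /asboolP[a a1 e].
have -> : peval p (set_val z', cconj (set_val z')) = peval p (set_val z, cconj (set_val z)).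
  by rewrite e pU.
by rewrite pE TE ?LP // Jhat_diag Z_JP.
Qed.

Lemma PM_inj (f g : PM) : (forall x, Jhat x = 1 -> hat (PMred_AMred f) x = hat (PMred_AMred g) x) -> f = g.
Proof. by move=> /hat_inj/(congr1 val) e; exact/val_inj. Qed.
End HolomorphicExtensions.

(** * Parts of Laurent polynomials and their bounds *)

Section Laurent.
Variable R : realType.
Local Notation C := (Cplx R).
Implicit Type L : seq (C * nat * nat).

Definition laurent L (z : C) : C := \sum_(t <- L) t.1.1 * (z ^+ t.1.2 * z ^- t.2).
(** The part with exponents at least [k0]. The two values used are 0 and 1, so that [laurent_split]
    counts the constant term once. *)
Definition laurent_pos k0 L (z : C) : C :=
  \sum_(t <- L | (k0 + t.2 <= t.1.2)%N) t.1.1 * z ^+ (t.1.2 - t.2).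

(** Averaging over the circle of radius [r] bounds the normalized coefficients by [S]; at half the
    radius the geometric series sums to at most 2. Discarding terms is therefore a bounded
    operation. *)
Lemma laurent_pos_le k0 L (r S z : C) : 0 < r -> `|z| <= r / 2 ->
  (forall y, `|y| = r -> `|laurent L y| <= S) -> `|laurent_pos k0 L z| <= 2 * S.
Proof.
move=> r0 zr LS; have r0' : r != 0 by rewrite gt_eqF.
have S0 : 0 <= S by apply: le_trans (normr_ge0 _) (LS r _); rewrite gtr0_norm.
pose D := (\sum_(t <- L) (t.1.2 + t.2))%N.
have leD t : t \in L -> (t.1.2 <= D)%N /\ (t.2 <= D)%N.
  move=> tL; have : (t.1.2 + t.2 <= D)%N by rewrite /D (big_rem t tL) leq_addr.
  by move=> h; split; apply: leq_trans h; rewrite ?leq_addr ?leq_addl.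
(* The exponents compared are [t.1.2 <= D] and [t.2 + k <= D + D]; the order exceeds both. *)
have [w wP] := @prim_root_ex C (D + D).+1 isT; set M := (_.+1) in wP.
have M0 : (0 < M)%N by [].
pose A k := avg M w (fun a => laurent L (r * a) * a ^- k).
have AE k : (k <= D)%N -> A k = r ^+ k * \sum_(t <- L | t.1.2 == (t.2 + k)%N) t.1.1.
  move=> kD; rewrite /A.
  transitivity (avg M w (fun a => \sum_(t <- L) (t.1.1 * r ^+ t.1.2 * r ^- t.2) * (a ^+ t.1.2 * a ^- (t.2 + k)))).
    apply: (@eq_avg C M w M0 wP (fun a => laurent L (r * a) * a ^- k)) => a _.
    rewrite mulr_suml; apply: eq_bigr => t _; rewrite !exprMn exprD !invfM.
    by move: (r ^+ _) (a ^+ _) (r ^- _) (a ^- t.2) (a ^- k) => *; ring.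
  rewrite avg_sum mulr_sumr [RHS]big_mkcond /=; apply: eq_big_seq => t tL.
  have [l1 l2] := leD t tL.
  rewrite avgZ (avg_pow M0 wP) !modn_small; last 2 first.
  - by rewrite ltnS; exact: leq_add.
  - by rewrite ltnS; apply: leq_trans l1 _; exact: leq_addr.
  case: eqP => [->|_]; rewrite ?mulr0 // mulr1 exprD.
  by have := expf_neq0 t.2 r0'; move: (r ^+ t.2) (r ^+ k) => a b a0; field.
have AS k : `|A k| <= S.
  apply: (avg_le M0 wP) => a a1; rewrite normrM normfV normrX a1 expr1n invr1 mulr1.
  by apply: LS; rewrite normrM a1 mulr1 gtr0_norm.
have -> : laurent_pos k0 L z = \sum_(k0 <= k < D.+1) (z / r) ^+ k * A k.
  transitivity (\sum_(k0 <= k < D.+1) \sum_(t <- L | t.1.2 == (t.2 + k)%N) z ^+ k * t.1.1).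
    rewrite (exchange_big_dep predT) //= /laurent_pos [LHS]big_mkcond /=.
    apply: eq_big_seq => t tL; have [l1 l2] := leD t tL.
    case: leqP => h.
      have kk : (k0 <= t.1.2 - t.2 < D.+1)%N.
        by rewrite leq_subRL ?(leq_trans (leq_addl _ _) h) // [(t.2 + _)%N]addnC h ltnS (leq_trans (leq_subr _ _)).
      have e0 : (t.2 + (t.1.2 - t.2))%N = t.1.2 by rewrite subnKC // (leq_trans (leq_addl _ _) h).
      rewrite big_mkcond (bigD1_seq (t.1.2 - t.2)%N) ?mem_index_iota ?iota_uniq //= e0 eqxx.
      rewrite big1 ?addr0 1?mulrC // => k kn; case: eqP => // e; case/negP: kn.
      by rewrite e addKn.
    rewrite big_seq_cond big1 // => k /andP[]; rewrite mem_index_iota => /andP[k0k _] /eqP e.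
    by move: h; rewrite e [(k0 + _)%N]addnC ltn_add2l ltnNge k0k.
  apply: eq_big_nat => k /andP[_ kD]; rewrite AE // -mulr_sumr mulrA; congr (_ * _).
  by rewrite expr_div_n mulfVK // expf_neq0.
apply: le_trans (ler_norm_sum _ _ _) _.
have h0 : 0 <= 2^-1 :> C by rewrite invr_ge0.
have h1 : 2^-1 < 1 :> C by rewrite invf_lt1 // ltr1n.
apply: le_trans (_ : \sum_(k0 <= k < D.+1) 2^-1 ^+ k * S <= _).
  apply: ler_sum => k _; rewrite normrM; apply: ler_pM => //.
  rewrite normrX; apply: lerXn2r; rewrite ?nnegrE //.
  by rewrite normf_div (gtr0_norm r0) ler_pdivrMr // mulrC.
rewrite -mulr_suml; apply: ler_wpM2r => //; apply: le_trans (geometric_le _ _ h0 h1) _.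
have -> : 1 - 2^-1 = 2^-1 :> C by field.
by rewrite invrK ler_piMl // exprn_ile1 // ltW.
Qed.

Definition laurent_sub L L' := L ++ [seq (- t.1.1, t.1.2, t.2) | t <- L'].

Lemma laurent_subE L L' z : laurent (laurent_sub L L') z = laurent L z - laurent L' z.
Proof.
rewrite /laurent big_cat big_map -sumrN; congr (_ + _).
by apply: eq_bigr => t _; rewrite mulNr.
Qed.

Lemma laurent_pos_subE k0 L L' z :
  laurent_pos k0 (laurent_sub L L') z = laurent_pos k0 L z - laurent_pos k0 L' z.
Proof.
rewrite /laurent_pos big_cat big_map -sumrN; congr (_ + _).
by apply: eq_bigr => t _; rewrite mulNr.
Qed.

(* The Laurent polynomial z |-> L(q / z). *)
Definition laurent_inv (q : C) L := [seq (t.1.1 * (q ^+ t.1.2 * q ^- t.2), t.2, t.1.2) | t <- L].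

Lemma laurent_invE q L z : q != 0 -> z != 0 -> laurent (laurent_inv q L) z = laurent L (q / z).
Proof.
move=> q0 z0; rewrite /laurent big_map; apply: eq_bigr => t _ /=.
rewrite !expr_div_n invf_div.
by move: (q ^+ t.1.2) (q ^- t.2) (z ^+ t.2) (z ^- t.1.2) => *; ring.
Qed.

(** Negative powers of [z] become positive powers of [q / z]. In the application [z] and [q / z] are
    eta_0 and xi_0, so both parts are polynomial. *)
Lemma laurent_split q L z : q != 0 -> z != 0 ->
  laurent L z = laurent_pos 0 L z + laurent_pos 1 (laurent_inv q L) (q / z).
Proof.
move=> q0 z0; rewrite /laurent /laurent_pos big_map [X in X + _]big_mkcond [X in _ + X]big_mkcond -big_split.
apply: eq_bigr => t _ /=; rewrite add0n add1n.
case: leqP => h; first by rewrite addr0 exprB // unitfE.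
rewrite add0r -mulrA; congr (_ * _); rewrite expr_div_n exprB ?unitfE ?(ltnW h) //.
rewrite exprB ?unitfE ?(ltnW h) // invf_div [RHS]mulrA.
have -> : q ^+ t.1.2 / q ^+ t.2 * (q ^+ t.2 / q ^+ t.1.2) = 1.
  by rewrite mulrA divfK ?expf_neq0 // divff // expf_neq0.
by rewrite mul1r.
Qed.
End Laurent.

(** * Density of the polynomials: gluing the two approximations *)

Section Density.
Variables (R : realType) (n s : nat).
Hypothesis s0 : (0 < s)%N.
Local Notation C := (Cplx R).
Local Notation V := 'rV[C]_n.+1.
Local Notation Jhat := (@Jhat R n s).
Local Notation nu := (nu R s).
Local Notation P2 := (mpoly (n + n) C).

Definition ldeg (m : multinom (n + n)) := (\sum_(k < n) fun_of_multinom m (lshift n k))%N.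
Definition rdeg (m : multinom (n + n)) := (\sum_(k < n) fun_of_multinom m (rshift n k))%N.
Definition cmono (m : multinom (n + n)) (u v : 'I_n -> C) : C :=
  \prod_(k < n) u k ^+ fun_of_multinom m (lshift n k) * \prod_(k < n) v k ^+ fun_of_multinom m (rshift n k).

Definition lau1 (p : P2) u v := [seq (mcoeff m p * cmono m u v, ldeg m, rdeg m) | m <- msupp p].
Definition lau2 (p : P2) u v := [seq (mcoeff m p * cmono m u v, rdeg m, ldeg m) | m <- msupp p].

Lemma meval_cellp (p : P2) (a b : C) u v :
  meval (cellp (fun k => a * u k) (fun k => b * v k) 0) p =
  \sum_(m <- msupp p) mcoeff m p * cmono m u v * (a ^+ ldeg m * b ^+ rdeg m).
Proof.
rewrite mevalE; apply: eq_bigr => m _; rewrite -mulrA; congr (_ * _).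
rewrite big_split_ord /= /cmono [RHS]mulrACA; congr (_ * _);
  rewrite mulrC -prodrXr -big_split /=; apply: eq_bigr => k _; rewrite -exprMn; congr (_ ^+ _).
  exact: lpart_cellp.
exact: rpart_cellp.
Qed.

Lemma lau1E p u v a : laurent (lau1 p u v) a = meval (cellp (fun k => a * u k) (fun k => a^-1 * v k) 0) p.
Proof.
by rewrite meval_cellp /laurent big_map; apply: eq_bigr => m _; rewrite exprVn.
Qed.

Lemma lau2E p u v a : laurent (lau2 p u v) a = meval (cellp (fun k => a^-1 * u k) (fun k => a * v k) 0) p.
Proof.
rewrite meval_cellp /laurent big_map; apply: eq_bigr => m _ /=; rewrite exprVn.
by rewrite [X in _ = _ * X]mulrC.
Qed.

(** [p1] and [p2] are meant to approximate a function on the two slices. Along the orbit through a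
    point they are Laurent polynomials in eta_0 and in xi_0; the nonnegative powers of eta_0 are
    taken from the first and the positive powers of xi_0 from the second. *)
Definition cell_poly (p1 p2 : P2) (x : V * V) : C :=
  let u k := x.1 0 (lift ord0 k) in let v k := x.2 0 (lift ord0 k) in
  laurent_pos 0 (lau1 p1 u v) (x.2 0 0) + laurent_pos 1 (lau2 p2 u v) (x.1 0 0).

Lemma cmono_bev m : bev s (ldeg m) (rdeg m)
  (fun x => cmono m (fun k => x.1 0 (lift ord0 k)) (fun k => x.2 0 (lift ord0 k))).
Proof.
have := bevM (@bev_mono1 R n s _ (index_enum 'I_n) (lift ord0) (fun k => fun_of_multinom m (lshift n k)))
  (@bev_mono2 R n s _ (index_enum 'I_n) (lift ord0) (fun k => fun_of_multinom m (rshift n k))).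
by rewrite addn0 add0n.
Qed.

(** A monomial of degrees ([ldeg], [rdeg]) is balanced by [ldeg - rdeg] factors eta_0, or by
    [rdeg - ldeg] factors xi_0; the truncations keep exactly the monomials for which this number is
    nonnegative, respectively positive. *)
Lemma cell_poly_bev p1 p2 : exists m, bev s m m (cell_poly p1 p2).
Proof.
pose D := (\sum_(m <- msupp p1) ldeg m + \sum_(m <- msupp p2) rdeg m)%N.
exists D; apply: bevD.
  apply: (@bev_ext _ _ _ _ _ (fun x => \sum_(m <- msupp p1 | (m \in msupp p1) && (rdeg m <= ldeg m)%N)
     mcoeff m p1 * (cmono m (fun k => x.1 0 (lift ord0 k)) (fun k => x.2 0 (lift ord0 k)) * x.2 0 0 ^+ (ldeg m - rdeg m)))).
    move=> x _; rewrite /laurent_pos [RHS]big_map [RHS]big_seq_cond /=.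
    by apply: eq_bigr => m _; rewrite mulrA.
  apply: bev_sum => m /andP[mp dm]; apply: bevZ; apply: (@bev_raise _ _ _ (ldeg m)).
    by rewrite /D (big_rem m mp) -!addnA leq_addr.
  have := bevM (cmono_bev m) (@bevX R n s 0 1 (fun x => x.2 0 0) (ldeg m - rdeg m) (bev_snd _ _ _)).
  by rewrite muln0 muln1 addn0 subnKC.
apply: (@bev_ext _ _ _ _ _ (fun x => \sum_(m <- msupp p2 | (m \in msupp p2) && (1 + ldeg m <= rdeg m)%N)
     mcoeff m p2 * (cmono m (fun k => x.1 0 (lift ord0 k)) (fun k => x.2 0 (lift ord0 k)) * x.1 0 0 ^+ (rdeg m - ldeg m)))).
  move=> x _; rewrite /laurent_pos [RHS]big_map [RHS]big_seq_cond /=.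
  by apply: eq_bigr => m _; rewrite mulrA.
apply: bev_sum => m /andP[mp dm]; apply: bevZ; apply: (@bev_raise _ _ _ (rdeg m)).
  by rewrite /D (big_rem m mp) [X in (_ <= X)%N]addnCA leq_addr.
have := bevM (cmono_bev m) (@bevX R n s 1 0 (fun x => x.1 0 0) (rdeg m - ldeg m) (bev_fst _ _ _)).
by rewrite muln0 muln1 addn0 subnKC // ltnW.
Qed.

Definition in_K (r : C) (x : V * V) := (forall k, `|x.1 0 k| <= r) /\ (forall k, `|x.2 0 k| <= r).

Section Approximation.
Variable T : V * V -> C.
Hypothesis Th : homhol s T.

Lemma cell1_approx : poly_approximable (fun p => T (cell1 s p)).
Proof.
apply: poly_approx => p; apply: (@differentiable_comp _ _ _ _ (@cell1 R n s) T).
  exact: cell1_differentiable.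
by apply: (proj1 Th); rewrite Jhat_cell1 ?oner_eq0.
Qed.

Lemma cell2_approx : poly_approximable (fun p => T (cell2 s p)).
Proof.
apply: poly_approx => p; apply: (@differentiable_comp _ _ _ _ (@cell2 R n s) T).
  exact: cell2_differentiable.
by apply: (proj1 Th); rewrite Jhat_cell2 ?oner_eq0.
Qed.

Lemma seq_sum_ge (S : seq C) c : all (fun c : C => 0 <= c) S -> c \in S -> c <= \sum_(x <- S) x.
Proof.
move=> /allP S0 cS; rewrite (big_rem c cS) /= lerDl big_seq.
by apply: sumr_ge0 => x /mem_rem; exact: S0.
Qed.

Lemma cellp_le (u v : 'I_n -> C) B : (forall k, `|u k| <= B) -> (forall k, `|v k| <= B) ->
  forall i, `|cellp u v 0 i| <= B.
Proof.
move=> uB vB i; rewrite -(splitK i); case: (fintype.split i) => k /=.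
  by rewrite -[cellp u v 0 _]/(lpart _ k) lpart_cellp.
by rewrite -[cellp u v 0 _]/(rpart _ k) rpart_cellp.
Qed.

(** A third polynomial [l], which may depend on [x], approximates [T] on a polydisc containing all
    points involved, and [laurent_split] cuts it in two. Its halves are compared with those of [p1]
    and [p2] on circles of radius [2 * r], where all of them are close to [T]. The constant is 1 + 4
    + 4: the error of [l] at [x], and twice [e + e] for each half. *)
Lemma generic_approx (p1 p2 : P2) (r e : C) : 0 < r -> 0 < e ->
  (forall p : 'rV[C]_(n + n), (forall i, `|p 0 i| <= 2 * r ^+ 2 + 1) -> `|T (cell1 s p) - meval (p 0) p1| <= e) ->
  (forall p : 'rV[C]_(n + n), (forall i, `|p 0 i| <= 2 * r ^+ 2 + 1) -> `|T (cell2 s p) - meval (p 0) p2| <= e) ->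
  forall x, Jhat x = 1 -> in_K r x -> x.1 0 0 != 0 -> x.2 0 0 != 0 ->
  `|T x - cell_poly p1 p2 x| <= 9 * e.
Proof.
move=> r0 e0 p1P p2P x J1 [x1r x2r] x10 x20.
pose u k := x.1 0 (lift ord0 k); pose v k := x.2 0 (lift ord0 k).
pose t := x.2 0 0; pose q := x.1 0 0 * t.
have q0 : q != 0 by rewrite mulf_neq0.
have qt : q / t = x.1 0 0 by rewrite /q mulfK.
have Jq : q + \sum_(k < n) nu k.+1 * u k * v k = 1.
  by rewrite -Jhat_consv // -!consvE -surjective_pairing.
pose f a := T (consv (q / a) u, consv a v).
have fx : f t = T x by rewrite /f qt -!consvE -surjective_pairing.
have f1 a : a != 0 -> f a = T (cell1 s (cellp (fun k => a * u k) (fun k => a^-1 * v k))).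
  move=> a0; rewrite (@cell1E _ _ _ _ _ (q / a)) ?divfK //.
  by rewrite (proj2 Th a a^-1 (consv (q / a) u, consv a v)) ?invr_eq0.
have f2 a : a != 0 -> f (q / a) = T (cell2 s (cellp (fun k => a^-1 * u k) (fun k => a * v k))).
  move=> a0; rewrite (@cell2E _ _ _ _ _ a (q / a)) //; last by rewrite mulrC divfK.
  rewrite (proj2 Th a^-1 a (consv a u, consv (q / a) v)) ?invr_eq0 //.
  by rewrite /f invf_div mulrC divfK.
have r0' : r != 0 by rewrite gt_eqF.
(* The zeroth coordinates of [x] are at most half of this radius, as [laurent_pos_le] requires. On
   the circle, multiplying or dividing a coordinate by [a] gives at most [2 * r ^+ 2] or 1, hence
   the polydisc in the hypotheses. *)
pose r2 := 2 * r; have r20 : 0 < r2 by rewrite mulr_gt0.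
have rr2 : r <= r2 / 2 by rewrite /r2 mulrAC divff ?mul1r // pnatr_eq0.
have nz (a : C) : `|a| = r2 -> a != 0 by move=> ar; rewrite -normr_gt0 ar.
have ua k : `|u k| <= r by exact: x1r.
have va k : `|v k| <= r by exact: x2r.
have small1 a y : `|a| = r2 -> `|y| <= r -> `|a * y| <= 2 * r ^+ 2 + 1.
  move=> ar yr; rewrite normrM ar; apply: le_trans (_ : r2 * r <= _); first by rewrite ler_pM2l.
  by rewrite /r2 expr2 mulrA lerDl.
have small2 a y : `|a| = r2 -> `|y| <= r -> `|a^-1 * y| <= 2 * r ^+ 2 + 1.
  move=> ar yr; rewrite normrM normfV ar; apply: le_trans (_ : 1 <= _); last first.
    by rewrite lerDr mulr_ge0 // exprn_ge0 // ltW.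
  rewrite mulrC ler_pdivrMr // mul1r; apply: le_trans yr _; rewrite /r2 ler_peMl ?ler1n //.
  exact: ltW.
(* Large enough for [cell1] at the parameters [t], any [a] of modulus [r2], and [q / a]; each of
   them and its inverse has its modulus among the summands. *)
pose B := r * (1 + r2 + r2^-1 + `|t| + `|t|^-1 + r2 / `|q| + `|q| / r2).
have B0 : 0 < B.
  by rewrite mulr_gt0 // !ltr_pwDl ?addr_ge0 ?invr_ge0 ?divr_ge0 ?ltr01 // ltW.
have [l lP] := cell1_approx B0 e0.
have lB a : `|a| <= B / r -> `|a^-1| <= B / r -> a != 0 -> `|f a - laurent (lau1 l u v) a| <= e.
  move=> a1 a2 a0; rewrite f1 // lau1E; apply: lP; apply: cellp_le => k.
    by rewrite normrM -[B](divfK r0'); apply: ler_pM.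
  by rewrite normrM -[B](divfK r0'); apply: ler_pM.
have Bsum c : c \in [:: 1; r2; r2^-1; `|t|; `|t|^-1; r2 / `|q|; `|q| / r2] -> c <= B / r.
  have h2 : 0 <= r2 by exact: ltW.
  have -> : B / r = \sum_(c <- [:: 1; r2; r2^-1; `|t|; `|t|^-1; r2 / `|q|; `|q| / r2]) c.
    by rewrite /B mulrC mulKf // !big_cons big_nil addr0 !addrA.
  apply: seq_sum_ge; rewrite /= ler01 h2 !invr_ge0 h2 !normr_ge0 !divr_ge0 //.
have lt1 : `|f t - laurent (lau1 l u v) t| <= e.
  by apply: lB => //; rewrite ?normfV; apply: Bsum; rewrite !inE eqxx ?orbT.
have b1 : `|laurent_pos 0 (lau1 l u v) t - laurent_pos 0 (lau1 p1 u v) t| <= 4 * e.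
  rewrite -laurent_pos_subE; have -> : 4 * e = 2 * (e + e) by ring.
  apply: (laurent_pos_le 0 r20); first by apply: le_trans rr2; exact: x2r.
  move=> a ar; have a0 := nz a ar; rewrite laurent_subE.
  rewrite -(subrKA (f a)); apply: le_trans (ler_normD _ _) _; apply: lerD.
    by rewrite distrC; apply: lB => //; rewrite ?normfV ar; apply: Bsum; rewrite !inE eqxx ?orbT.
  rewrite (f1 _ a0) lau1E; apply: p1P => i.
  by apply: cellp_le => k; [exact: (small1 a (u k) ar (ua k))|exact: (small2 a (v k) ar (va k))].
have b2 : `|laurent_pos 1 (laurent_inv q (lau1 l u v)) (q / t) - laurent_pos 1 (lau2 p2 u v) (q / t)| <= 4 * e.
  rewrite -laurent_pos_subE; have -> : 4 * e = 2 * (e + e) by ring.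
  apply: (laurent_pos_le 1 r20); first by apply: le_trans rr2; rewrite qt; exact: x1r.
  move=> a ar; have a0 := nz a ar; rewrite laurent_subE laurent_invE //.
  rewrite -(subrKA (f (q / a))); apply: le_trans (ler_normD _ _) _; apply: lerD.
    rewrite distrC; apply: lB; last by rewrite mulf_neq0 ?invr_eq0.
      by rewrite normf_div ar; apply: Bsum; rewrite !inE eqxx ?orbT.
    by rewrite invf_div normf_div ar; apply: Bsum; rewrite !inE eqxx ?orbT.
  rewrite (f2 _ a0) lau2E; apply: p2P => i.
  by apply: cellp_le => k; [exact: (small2 a (u k) ar (ua k))|exact: (small1 a (v k) ar (va k))].
rewrite -fx /cell_poly -/u -/v -/t -qt.
rewrite -(subrKA (laurent (lau1 l u v) t)).
have -> : 9 * e = e + (4 * e + 4 * e) by ring.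
apply: le_trans (ler_normD _ _) _; apply: lerD => //.
rewrite (laurent_split (lau1 l u v) q0) // opprD addrACA.
apply: le_trans (ler_normD _ _) _; exact: lerD b1 b2.
Qed.

(** The polynomials [p1] and [p2] are fixed by [r] and [e] alone. A point with a vanishing zeroth
    coordinate is perturbed to a generic one and normalized back to [Zhat]; the radius [r + 1]
    leaves room for this. *)
Theorem bev_dense (r e : C) : 0 < r -> 0 < e -> exists m phi, bev s m m phi /\
  forall x, Jhat x = 1 -> in_K r x -> `|T x - phi x| <= e.
Proof.
move=> r0 e0; pose r1 := r + 1; have r10 : 0 < r1 by rewrite addr_gt0.
have e9 : 0 < e / 9 by rewrite divr_gt0.
have q0 : 0 < 2 * r1 ^+ 2 + 1 by rewrite addr_gt0 // mulr_gt0 // exprn_gt0.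
have [p1 p1P] := cell1_approx q0 e9; have [p2 p2P] := cell2_approx q0 e9.
have [m mb] := cell_poly_bev p1 p2; exists m, (cell_poly p1 p2); split => // x J1 [x1 x2].
have [L LP] := mb; rewrite LP //.
pose g (y : V * V) := T y - ev m m L y / Jhat y ^+ m.
pose N (y : V * V) := ((Jhat y)^-1 *: y.1, y.2).
have J0 : Jhat x != 0 by rewrite J1 oner_eq0.
have gd y : Jhat y != 0 -> differentiable g y.
  move=> Jy; apply: differentiable_sub; first exact: (proj1 Th).
  apply: differentiable_mul; first exact: ev_differentiable.
  apply: differentiable_inv; last by rewrite expf_neq0.
  exact/differentiable_pow/Jhat_differentiable.
have gx : T x - ev m m L x = g x by rewrite /g J1 expr1n divr1.
rewrite gx; apply/ler_addgt0Pl => d d0.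
have near1 : \forall y \near x, `|g x - g y| <= d.
  have /differentiable_continuous/cvgrPdist_le := gd x J0; exact.
have Nd : differentiable N x.
  apply: differentiable_pair; apply: differentiable_row => k; last exact: differentiable_coord2.
  apply: (@differentiable_congr _ _ _ (fun y : V * V => (Jhat y)^-1 * y.1 0 k)).
    by move=> y; rewrite mxE.
  apply: differentiable_mul; last exact: differentiable_coord1.
  by apply: (@differentiable_inv _ _ Jhat) => //; exact: Jhat_differentiable.
have Nx : N x = x by rewrite /N J1 invr1 scale1r -surjective_pairing.
have near2 : nbhs x [set y | in_K r1 (N y)].
  have Nc : N y @[y --> x] --> N x := differentiable_continuous Nd.
  have := Nc _ (nbhsx_ballx (N x) 1 ltr01); rewrite Nx; apply: filterS => y [].
  rewrite -!ball_normE /= => y1 y2; split=> k.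
    rewrite -[y.1 0 k](subKr (x.1 0 k)) /r1; apply: le_trans (ler_normB _ _) _.
    apply: lerD (x1 k) _; apply: le_trans (ltW y1).
    by have := rv_coord_le (x.1 - y.1) k; rewrite !mxE.
  rewrite -[y.2 0 k](subKr (x.2 0 k)) /r1; apply: le_trans (ler_normB _ _) _.
  apply: lerD (x2 k) _; apply: le_trans (ltW y2).
  by have := rv_coord_le (x.2 - y.2) k; rewrite !mxE.
have /generic_dense[y [[[/= Jy g1] Ky] y10 y20]] : nbhs x ([set y | Jhat y != 0] `&` [set y | `|g x - g y| <= d] `&`
  [set y | in_K r1 (N y)]).
  by apply: filterI => //; apply: filterI => //; exact: Jhat_near.
have JN : Jhat (N y) = 1.
  by have := JhatZ s (Jhat y)^-1 1 y; rewrite scale1r mulr1 mulVf.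
have gN : g y = T (N y) - cell_poly p1 p2 (N y).
  rewrite LP // /g /N; have JV : (Jhat y)^-1 != 0 by rewrite invr_eq0.
  have := proj2 Th _ 1 y JV (oner_neq0 _); rewrite scale1r => ->.
  have := evZ m m L (Jhat y)^-1 1 y; rewrite scale1r expr1n mulr1 exprVn => ->.
  by rewrite mulrC.
rewrite -[g x](subrK (g y)); apply: le_trans (ler_normD _ _) _; apply: lerD => //.
rewrite gN; have -> : e = 9 * (e / 9) by rewrite mulrC divfK // pnatr_eq0.
apply: (generic_approx r10 e9 p1P p2P) => //.
by rewrite mxE mulf_neq0 // invr_eq0.
Qed.
End Approximation.
End Density.

(** * The bidifferential operators in the affine chart *)

Section ChartCalculus.
Variables (R : realType) (n s : nat).
Local Notation C := (Cplx R).
Local Notation W := 'rV[C]_n.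
Local Notation idx := 'I_(n + n).
Local Notation nu := (nu R s).
Local Notation rho := (@rho R n s).

Definition line (w v : W) (t : R) : W := w + ofR t *: v.

Definition quot (f : W -> C) (w v : W) (t : R) : C := (ofR t)^-1 * (f (line w v t) - f w).

Definition dir (D : idx -> C) (v : W) : C :=
  \sum_(k < n) (D (lshift n k) * v 0 k + D (rshift n k) * (v 0 k)^*).

(** Difference quotients along real lines, as in [Rderive], with a real-linear derivative whose
    coefficients [D] are the Wirtinger derivatives ([hasD_partial]). *)
Definition hasD (f : W -> C) (D : idx -> C) (w : W) : Prop :=
  forall v, quot f w v t @[t --> (0 : R)^'] --> dir D v.

Lemma dir_delta D k : dir D (delta_mx 0 k) = D (lshift n k) + D (rshift n k).
Proof.
rewrite /dir (bigD1 k) //= big1 => [|j jk]; rewrite mxE /=.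
  by rewrite eqxx conjC1 !mulr1 addr0.
by rewrite (negPf jk) conjC0 !mulr0 addr0.
Qed.

Lemma dir_idelta D k : dir D ('i *: delta_mx 0 k) = 'i * D (lshift n k) - 'i * D (rshift n k).
Proof.
rewrite /dir (bigD1 k) //= big1 => [|j jk]; rewrite !mxE /=.
  by rewrite eqxx !mulr1 conjCi addr0 mulrN ![_ * 'i]mulrC.
by rewrite (negPf jk) !mulr0 conjC0 mulr0 addr0.
Qed.

Lemma hasD_Rderive f D w v : hasD f D w -> Rderive v f w = dir D v.
Proof. by move=> fD; apply: cvg_lim; [exact: norm_hausdorff|exact: fD]. Qed.

Lemma hasD_partial f D w a : hasD f D w -> partial a f w = D a.
Proof.
move=> fD; rewrite -{2}(splitK a) /partial; case: (fintype.split a) => k /=.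
  rewrite /d_w !(hasD_Rderive _ fD) dir_delta dir_idelta; have i2 := sqrCi C.
  move: (D _) (D _) => y x.
  have -> : x + y - 'i * ('i * x - 'i * y) = x + y - 'i ^+ 2 * (x - y) by ring.
  by rewrite i2; field.
rewrite /d_wbar !(hasD_Rderive _ fD) dir_delta dir_idelta; have i2 := sqrCi C.
move: (D _) (D _) => y x.
have -> : x + y + 'i * ('i * x - 'i * y) = x + y + 'i ^+ 2 * (x - y) by ring.
by rewrite i2; field.
Qed.

Lemma ofR_neq0 (t : R) : t != 0 -> ofR t != 0 :> C.
Proof. by move=> t0; rewrite -(ofR0 R) (inj_eq (@complexI R)). Qed.

Lemma eq_hasD f D D' w : D =1 D' -> hasD f D w -> hasD f D' w.
Proof. by move=> /funext ->. Qed.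

Lemma hasD_cont f D w v : hasD f D w -> f (line w v t) @[t --> (0 : R)^'] --> f w.
Proof.
move=> fD.
have h : f w + ofR t * quot f w v t @[t --> (0 : R)^'] --> f w + ofR 0 * dir D v.
  apply: (@cvgD _ C _ _ _ (fun=> f w)); first exact: cvg_cst.
  apply: (@cvgM C _ _ _ (fun t => ofR t)); last exact: fD.
  by apply: cvg_within_filter; exact: ofR_continuous.
move: h; rewrite ofR0 mul0r addr0; apply: cvg_trans; apply: near_eq_cvg.
near=> t; rewrite /quot mulVKf; first by rewrite addrC subrK.
by apply: ofR_neq0; near: t; exact: nbhs_dnbhs_neq.
Unshelve. all: by end_near.
Qed.

Lemma hasD_cst c w : hasD (fun=> c) (fun=> 0) w.
Proof.
move=> v; rewrite /dir big1 => [|k _]; last by rewrite !mul0r addr0.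
by rewrite (_ : quot _ w v = fun=> 0); [exact: cvg_cst|apply/funext => t; rewrite /quot subrr mulr0].
Qed.

Lemma hasD_ext f g D E w : f =1 g -> D =1 E -> hasD f D w -> hasD g E w.
Proof. by move=> /funext -> /funext ->. Qed.

Lemma hasDD f g D E w : hasD f D w -> hasD g E w -> hasD (fun x => f x + g x) (fun a => D a + E a) w.
Proof.
move=> fD gE v; have -> : dir (fun a => D a + E a) v = dir D v + dir E v.
  by rewrite /dir -big_split; apply: eq_bigr => k _ /=; ring.
have -> : quot (fun x => f x + g x) w v = (fun t => quot f w v t + quot g w v t).
  by apply/funext => t; rewrite /quot -mulrDr opprD addrACA.
exact: (@cvgD _ C _ _ _ (quot f w v) (quot g w v)).
Qed.

Lemma hasDM f g D E w : hasD f D w -> hasD g E w ->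
  hasD (fun x => f x * g x) (fun a => D a * g w + f w * E a) w.
Proof.
move=> fD gE v; have -> : dir (fun a => D a * g w + f w * E a) v = dir D v * g w + f w * dir E v.
  by rewrite /dir mulr_suml mulr_sumr -big_split; apply: eq_bigr => k _ /=; ring.
have -> : quot (fun x => f x * g x) w v = (fun t => quot f w v t * g (line w v t) + f w * quot g w v t).
  by apply/funext => t; rewrite /quot; move: (f _) (g _) (f _) (g _) (_^-1) => *; ring.
apply: (@cvgD _ C _ _ _ (fun t => quot f w v t * g (line w v t))).
  by apply: (@cvgM C _ _ _ (quot f w v)); [exact: fD|exact: hasD_cont gE].
by apply: (@cvgM C _ _ _ (fun=> f w)); [exact: cvg_cst|exact: gE].
Qed.

Lemma hasDZ c f D w : hasD f D w -> hasD (fun x => c * f x) (fun a => c * D a) w.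
Proof.
by move=> fD; apply: eq_hasD (hasDM (hasD_cst c w) fD) => a; rewrite mul0r add0r.
Qed.

Lemma hasDV f D w : f w != 0 -> hasD f D w -> hasD (fun x => (f x)^-1) (fun a => - (f w) ^- 2 * D a) w.
Proof.
move=> f0 fD v; have -> : dir (fun a => - (f w) ^- 2 * D a) v = - ((f w)^-1 * (f w)^-1 * dir D v).
  rewrite /dir mulr_sumr -sumrN; apply: eq_bigr => k _; rewrite -exprVn expr2.
  by move: (f w)^-1 (D _) (D _) => *; ring.
have key (y z q : C) : y != 0 -> z != 0 -> - (y^-1 / z * (q * (y - z))) = q * (y^-1 - z^-1).
  by move=> y0 z0; field; rewrite y0 z0.
have h : - ((f (line w v t))^-1 * (f w)^-1 * quot f w v t) @[t --> (0 : R)^'] --> - ((f w)^-1 * (f w)^-1 * dir D v).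
  apply: cvgN; apply: (@cvgM C _ _ _ (fun t => (f (line w v t))^-1 * (f w)^-1)); last exact: fD.
  apply: (@cvgM C _ _ _ (fun t => (f (line w v t))^-1)); last exact: cvg_cst.
  by apply: cvgV => //; exact: hasD_cont fD.
apply: cvg_trans h; apply: near_eq_cvg; near=> t.
have ft : f (line w v t) != 0.
  near: t; have := hasD_cont v fD => /cvgr_neq0; exact.
exact: key.
Unshelve. all: by end_near.
Qed.

Lemma hasDX f D w k : hasD f D w -> hasD (fun x => f x ^+ k) (fun a => k%:R * f w ^+ k.-1 * D a) w.
Proof.
move=> fD; elim: k => [|k IH].
  by apply: eq_hasD (hasD_cst 1 w) => a; rewrite !mul0r.
have := hasDM fD IH; rewrite (_ : (fun x => f x * f x ^+ k) = (fun x => f x ^+ k.+1)).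
  apply: eq_hasD => a /=; case: k {IH} => [|k]; first by rewrite mul0r mul0r mulr0 addr0 mul1r mulr1 mul1r.
  by rewrite -[k.+2%:R]natr1 /= exprS; move: (k.+1%:R : C) => N; ring.
by apply/funext => x; rewrite exprS.
Qed.

Lemma hasD_sum (I : Type) (r : seq I) (f : I -> W -> C) (D : I -> idx -> C) w :
  (forall i, hasD (f i) (D i) w) -> hasD (fun x => \sum_(i <- r) f i x) (fun a => \sum_(i <- r) D i a) w.
Proof.
move=> fD; elim: r => [|i r IH].
  by apply: hasD_ext (hasD_cst 0 w) => x; rewrite big_nil.
by apply: hasD_ext (hasDD (fD i) IH) => x; rewrite big_cons.
Qed.

Lemma hasD_prod r (f : 'I_r -> W -> C) (D : 'I_r -> idx -> C) w :
  (forall i, hasD (f i) (D i) w) ->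
  hasD (fun x => \prod_i f i x) (fun a => \sum_j D j a * \prod_(i | i != j) f i w) w.
Proof.
elim: r f D => [|r IH] f D fD.
  by apply: hasD_ext (hasD_cst 1 w) => x; rewrite big_ord0.
have := hasDM (fD ord0) (IH (fun i => f (lift ord0 i)) (fun i => D (lift ord0 i)) (fun i => fD _)).
rewrite (_ : (fun x => f ord0 x * _) = (fun x => \prod_i f i x)); last first.
  by apply/funext => x; rewrite big_ord_recl.
apply: eq_hasD => a; rewrite [RHS]big_ord_recl; congr (_ + _).
  rewrite [X in _ = _ * X]big_mkcond [X in _ = _ * X]big_ord_recl /= mul1r; congr (_ * _).
rewrite mulr_sumr; apply: eq_bigr => j _; rewrite mulrCA; congr (_ * _).
rewrite [RHS]big_mkcond [RHS]big_ord_recl /=; congr (_ * _).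
by rewrite [LHS]big_mkcond; apply: eq_bigr => i _; rewrite (inj_eq lift_inj).
Qed.

(** [true] marks the holomorphic indices. *)
Definition side (a : idx) : bool := if fintype.split a is inl _ then true else false.
Definition pos (a : idx) : 'I_n := match fintype.split a with inl k => k | inr k => k end.

Lemma side_l k : side (lshift n k) = true.
Proof. by rewrite /side (unsplitK (inl k)). Qed.
Lemma side_r k : side (rshift n k) = false.
Proof. by rewrite /side (unsplitK (inr k)). Qed.
Lemma pos_l k : pos (lshift n k) = k.
Proof. by rewrite /pos (unsplitK (inl k)). Qed.
Lemma pos_r k : pos (rshift n k) = k.
Proof. by rewrite /pos (unsplitK (inr k)). Qed.

Lemma idxP (a : idx) : {k | a = lshift n k} + {k | a = rshift n k}.
Proof. by rewrite -(splitK a); case: (fintype.split a) => k; [left|right]; exists k. Qed.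

Definition coordf (sg : bool) (k : 'I_n) (w : W) : C := if sg then w 0 k else (w 0 k)^*.

Lemma hasD_coordf sg k w : hasD (coordf sg k) (fun a => ((side a == sg) && (pos a == k))%:R) w.
Proof.
move=> v; have -> : dir (fun a => ((side a == sg) && (pos a == k))%:R) v = coordf sg k v.
  rewrite /dir (bigD1 k) //= big1 => [|j jk].
    by rewrite side_l side_r pos_l pos_r eqxx /coordf; case: sg; rewrite /= ?mul1r ?mul0r ?addr0 ?add0r.
  by rewrite side_l side_r pos_l pos_r (negPf jk) !andbF !mul0r addr0.
have : (fun=> coordf sg k v) t @[t --> (0 : R)^'] --> coordf sg k v by exact: cvg_cst.
apply: cvg_trans; apply: near_eq_cvg; near=> t.
have t0 : ofR t != 0 :> C by apply: ofR_neq0; near: t; exact: nbhs_dnbhs_neq.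
have tr : (ofR t)^* = ofR t :> C by apply/CrealP; rewrite realE -(ofR0 R) !ler_ofR le_total.
rewrite /quot /line /coordf !mxE; case: sg; first by rewrite addrAC subrr add0r mulKf.
by rewrite rmorphD rmorphM /= tr addrAC subrr add0r mulKf.
Unshelve. all: by end_near.
Qed.

(** [theta] is the gradient of [rho] and [eta] its constant matrix of second derivatives; see
    [hasD_rho] and [hasD_theta]. *)
Definition theta (a : idx) (w : W) : C := nu (pos a).+1 * coordf (~~ side a) (pos a) w.
Definition eta (a b : idx) : C := ((side a != side b) && (pos a == pos b))%:R * nu (pos b).+1.

Lemma hasD_theta b w : hasD (theta b) (fun a => eta a b) w.
Proof.
apply: hasD_ext (@hasDZ (nu (pos b).+1) _ _ _ (@hasD_coordf (~~ side b) (pos b) w)) => [x //|a].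
by rewrite /eta mulrC; case: (side a); case: (side b).
Qed.

Lemma rhoE w : rho w = 1 + \sum_(k < n) nu k.+1 * (coordf false k w * coordf true k w).
Proof. by rewrite /Defs.rho; congr (_ + _); apply: eq_bigr => k _; rewrite mulrA. Qed.

Lemma hasD_rho w : hasD rho (fun a => theta a w) w.
Proof.
have h : hasD (fun x => 1 + \sum_(k < n) nu k.+1 * (coordf false k x * coordf true k x))
   (fun a => 0 + \sum_(k < n) nu k.+1 * (((side a == false) && (pos a == k))%:R * coordf true k w +
       coordf false k w * ((side a == true) && (pos a == k))%:R)) w.
  apply: hasDD (hasD_cst 1 w) _; apply: hasD_sum => k; apply: hasDZ.
  by apply: hasDM; exact: hasD_coordf.
rewrite (_ : rho = fun x => 1 + \sum_(k < n) nu k.+1 * (coordf false k x * coordf true k x)); last first.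
  by apply/funext => x; exact: rhoE.
apply: eq_hasD h => a; rewrite add0r (bigD1 (pos a)) //= big1 => [|j ja].
  by rewrite eqxx /theta addr0; case: (side a); rewrite /= ?mul1r ?mul0r ?mulr0 ?mulr1 ?addr0 ?add0r.
by rewrite [pos a == j]eq_sym (negPf ja) !andbF mul0r mulr0 addr0 mulr0.
Qed.

Lemma rho_real w : (rho w)^* = rho w.
Proof.
rewrite /Defs.rho rmorphD rmorph1 rmorph_sum; congr (_ + _); apply: eq_bigr => k _.
rewrite !rmorphM /= conjCK (_ : (nu k.+1)^* = nu k.+1); last by rewrite /Defs.nu; case: ifP; rewrite ?rmorphN rmorph1.
by rewrite -!mulrA [w 0 k * _]mulrC.
Qed.

Lemma rho_near w v : 0 < rho w -> \forall t \near (0 : R)^', 0 < rho (line w v t).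
Proof.
move=> r0; have rR x : rho x \is Num.real by apply/CrealP; exact: rho_real.
have r2 : 0 < rho w / 2 by rewrite divr_gt0.
have /cvgrPdist_lt/(_ _ r2) := hasD_cont v (@hasD_rho w).
apply: filterS => t; rewrite real_ltr_norml ?rpredB // => /andP[_].
rewrite ltrBlDr -ltrBlDl => h; apply: lt_trans h.
by rewrite subr_gt0 ltr_pdivrMr // ltr_pMr // ltr1n.
Qed.

Lemma hasD_near f g D w : (forall x, 0 < rho x -> f x = g x) -> 0 < rho w -> hasD g D w -> hasD f D w.
Proof.
move=> fg r0 gD v; apply: cvg_trans (gD v); apply: near_eq_cvg.
by apply: filterS (rho_near v r0) => t rt; rewrite /quot !fg.
Qed.

(** For indices of different types this is half the second derivative of [log rho]: the metric has
    the potential [log rho]. *)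
Definition ggen (w : W) (b c : idx) : C :=
  2^-1 * (if side b == side c then 0 else eta b c * (rho w)^-1 - theta b w * theta c w * (rho w) ^- 2).

Lemma g_redE w b c : g_red s w b c = ggen w b c.
Proof.
have spl k : fintype.split (lshift n k) = inl k :> 'I_n + 'I_n by exact: (unsplitK (inl k)).
have spr k : fintype.split (rshift n k) = inr k :> 'I_n + 'I_n by exact: (unsplitK (inr k)).
rewrite mxE /ggen; congr (_ * _); rewrite /mixed.
case: (idxP b) => -[k ->]; case: (idxP c) => -[l ->]; rewrite ?spl ?spr ?side_l ?side_r /= ?addr0 ?add0r //.
  rewrite /eta /theta ?side_l ?side_r ?pos_l ?pos_r /= /coordf /=.
  by rewrite [l == k]eq_sym; case: eqP => [->|_]; rewrite /= ?mul1r ?mul0r; move: (w 0 _) ((w 0 _)^*) => *; ring.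
rewrite /eta /theta ?side_l ?side_r ?pos_l ?pos_r /= /coordf /=.
by case: eqP => [->|_]; rewrite /= ?mul1r ?mul0r; move: (w 0 _) ((w 0 _)^*) => *; ring.
Qed.

(* The Christoffel symbols: only those with three indices of the same type
   (holomorphic or antiholomorphic) are nonzero. *)
Definition Gam (w : W) (c a b : idx) : C :=
  if side a == side b then - ((c == a)%:R * theta b w + (c == b)%:R * theta a w) / rho w else 0.

Lemma sum_Gam w a b (F : idx -> C) : \sum_d Gam w d a b * F d =
  if side a == side b then - (theta b w * F a + theta a w * F b) / rho w else 0.
Proof.
rewrite /Gam; case: ifP => _; last by rewrite big1 // => d _; rewrite mul0r.
have delta (x : C) e : \sum_(d : idx) (d == e)%:R * x * F d = x * F e.
  rewrite (bigD1 e) //= eqxx mul1r big1 ?addr0 // => d de.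
  by rewrite (negPf de) !mul0r.
rewrite -!delta -big_split /= -sumrN mulr_suml; apply: eq_bigr => d _.
by move: (_%:R) (_%:R) (rho w)^-1 => *; ring.
Qed.

(** Uniqueness in [christoffelP] replaces the inversion of the metric: it suffices that [Gam] is
    symmetric and compatible with it. *)
Lemma christoffelE w a b c : 0 < rho w -> christoffel s c a b w = Gam w c a b.
Proof.
move=> r0; have r0' : rho w != 0 by rewrite gt_eqF.
symmetry; move: a b c; apply/(christoffelP _ (g_red_unit r0')); split=> a b c.
  by rewrite /Gam eq_sym; case: ifP => // _; rewrite addrC.
have -> : (fun x => g_red s x b c) = (fun x => ggen x b c) by apply/funext => x; exact: g_redE.
rewrite big_split /= sum_Gam.
under [X in _ + X]eq_bigr do rewrite g_redC.
rewrite sum_Gam !g_redE.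
have [bc|bc] := eqVneq (side b) (side c).
  rewrite (@hasD_partial _ (fun=> 0) w); last first.
    by apply: hasD_ext (hasD_cst 0 w) => x //; rewrite /ggen bc eqxx mulr0.
  rewrite bc; case: (eqVneq (side a) (side c)) => ac; last by rewrite addr0.
  by rewrite /ggen !bc ac !eqxx !mulr0 addr0 oppr0 mul0r addr0.
rewrite (hasD_partial (D := fun e => 2^-1 * (eta b c * (- (rho w) ^- 2 * theta e w) -
    ((eta e b * theta c w + theta b w * eta e c) * (rho w) ^- 2 + theta b w * theta c w *
      (- (rho w ^+ 2) ^- 2 * (2%:R * rho w ^+ 1 * theta e w)))))); last first.
  apply: (@hasD_ext (fun x => 2^-1 * (eta b c * (rho x)^-1 + (-1) * (theta b x * theta c x * (rho x ^+ 2)^-1)))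
    _ (fun e => 2^-1 * (eta b c * (- (rho w) ^- 2 * theta e w) + (-1) *
    ((eta e b * theta c w + theta b w * eta e c) * (rho w ^+ 2)^-1 + theta b w * theta c w *
      (- (rho w ^+ 2) ^- 2 * (2%:R * rho w ^+ 2.-1 * theta e w)))))).
  - by move=> x; rewrite /ggen (negPf bc) mulN1r.
  - by move=> e; rewrite mulN1r.
  apply: hasDZ; apply: hasDD; first exact/hasDZ/hasDV/hasD_rho.
  apply: hasDZ; apply: hasDM; first by apply: hasDM; exact: hasD_theta.
  by apply: hasDV; [rewrite expf_neq0|exact/hasDX/hasD_rho].
have etaC x y : eta x y = eta y x.
  rewrite /eta [side y == _]eq_sym [pos y == _]eq_sym.
  by case: (pos x =P pos y) => [->//|_]; rewrite !andbF !mul0r.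
have eta0 x y : side x = side y -> eta x y = 0 by move=> e; rewrite /eta e eqxx mul0r.
rewrite expr1 /ggen; have [ab|ab] := eqVneq (side a) (side b).
  have ac : side a != side c by rewrite ab.
  rewrite (negPf ac) (negPf bc) (eta0 a b ab).
  move: (theta _ _) (theta _ _) (theta _ _) (eta _ _) (eta _ _) (rho w) r0' => x y z e f r rr.
  by field.
have ac : side a = side c by move: ab bc; case: (side a); case: (side b); case: (side c).
rewrite ac eqxx [side c == side b]eq_sym (negPf bc) (eta0 a c ac) (etaC c b) add0r.
move: (theta _ _) (theta _ _) (theta _ _) (eta _ _) (eta _ _) (rho w) r0' => x y z e f r rr.
by field.
Qed.
End ChartCalculus.

(** * Iterated derivatives of generators in the chart and their contraction *)

Section ChartOperators.
Variables (R : realType) (n s : nat).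
Local Notation C := (Cplx R).
Local Notation V := 'rV[C]_n.+1.
Local Notation W := 'rV[C]_n.
Local Notation idx := 'I_(n + n).
Local Notation nu := (nu R s).
Local Notation rho := (@rho R n s).
Local Notation theta := (@theta R n s).
Local Notation eta := (@eta R n s).
Local Notation Gam := (@Gam R n s).
Implicit Type t : C * V * V.

Definition fac (sg : bool) t (w : W) : C :=
  if sg then dot t.1.2 (affine ord0 w) else dot t.2 (cconj (affine ord0 w)).

Definition alpha t (a : idx) : C :=
  if side a then t.1.2 0 (lift ord0 (pos a)) else t.2 0 (lift ord0 (pos a)).

Lemma facE sg t w : fac sg t w = (if sg then t.1.2 0 0 else t.2 0 0) +
  \sum_(k < n) (if sg then t.1.2 0 (lift ord0 k) else t.2 0 (lift ord0 k)) * coordf sg k w.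
Proof.
rewrite /fac /dot; case: sg; rewrite big_ord_recl; congr (_ + _);
  rewrite ?mxE ?unlift_none /= ?conjC1 ?mulr1 //.
  by apply: eq_bigr => k _; rewrite mxE liftK.
by apply: eq_bigr => k _; rewrite !mxE liftK.
Qed.

Lemma hasD_fac sg t w : hasD (fac sg t) (fun a => if side a == sg then alpha t a else 0) w.
Proof.
pose c k := if sg then t.1.2 0 (lift ord0 k) else t.2 0 (lift ord0 k).
have h : hasD (fun x => (if sg then t.1.2 0 0 else t.2 0 0) + \sum_(k < n) c k * coordf sg k x)
    (fun a => 0 + \sum_(k < n) c k * ((side a == sg) && (pos a == k))%:R) w.
  apply: hasDD (hasD_cst _ w) _; apply: hasD_sum => k; apply: hasDZ; exact: hasD_coordf.
apply: hasD_ext h => [x|a]; first by rewrite facE.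
rewrite add0r (bigD1 (pos a)) //= big1 => [|j ja].
  by rewrite eqxx andbT addr0 /c /alpha; case: eqP => [<-|_]; rewrite ?mulr1 ?mulr0.
by rewrite [pos a == j]eq_sym (negPf ja) andbF mulr0.
Qed.

(** [rho ^+ 2] times the derivative of [fac / rho] in the direction [a], with the factor of the same
    type as [a]. *)
Definition slope t (a : idx) (w : W) : C := rho w * alpha t a - fac (side a) t w * theta a w.

Lemma hasD_slope t b w : hasD (slope t b) (fun a => if side a == side b
  then theta a w * alpha t b - alpha t a * theta b w
  else theta a w * alpha t b - fac (side b) t w * eta a b) w.
Proof.
have h : hasD (fun x => rho x * alpha t b + (-1) * (fac (side b) t x * theta b x))
   (fun a => (theta a w * alpha t b + rho w * 0) + (-1) * ((if side a == side b then alpha t a else 0) * theta b w +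
      fac (side b) t w * eta a b)) w.
  apply: hasDD; first by apply: hasDM (@hasD_rho R n s w) (hasD_cst _ w).
  by apply: hasDZ; apply: hasDM (@hasD_fac (side b) t w) (@hasD_theta R n s b w).
apply: hasD_ext h => [x|a]; first by rewrite mulN1r.
rewrite /eta; case: eqP => /= _; rewrite mulN1r mulr0 addr0 ?mul0r ?mulr0 ?addr0 //.
by rewrite add0r.
Qed.

(* The components of the r-th symmetrized covariant derivative of
   c (a.z)^m (b.conj z)^m / rho^m on index tuples of type (r, 0) (sg = true)
   or (0, r) (sg = false). *)
Definition jet (sg : bool) m r t (a : 'I_r -> idx) (w : W) : C :=
  (t.1.1 * (m ^_ r)%:R * fac (~~ sg) t w ^+ m) * fac sg t w ^+ (m - r) *
  (rho w ^+ (m + r))^-1 * \prod_(j < r) slope t (a j) w.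

Lemma jet_eq sg m r t a a' w : (forall j, a j = a' j) -> jet sg m t a w = @jet sg m r t a' w.
Proof. by move=> e; rewrite /jet; congr (_ * _); apply: eq_bigr => j _; rewrite e. Qed.

(** Relative to the jet, the power of [fac] contributes [(m - r) * alpha / fac], the power of [rho]
    contributes [- (m + r) * theta / rho], and the slopes with the Christoffel terms
    [2 * r * theta / rho]. The sum is [(m - r) * slope / (fac * rho)], so jets reproduce themselves
    and [m ^_ r] becomes [m ^_ r.+1]. The factor of the opposite type is constant in the direction
    [c]. *)
Lemma jet_step sg m r t (b : 'I_r -> idx) c w : 0 < rho w -> side c = sg -> (forall j, side (b j) = sg) ->
  exists2 D, hasD (fun x => jet sg m t b x) D w &
  D c - \sum_(j < r) \sum_d Gam w d c (b j) * jet sg m t (fun i => if i == j then d else b i) w =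
  jet sg m t (fun i : 'I_r.+1 => if unlift ord0 i is Some j then b j else c) w.
Proof.
move=> r0 cs bs; have r0' : rho w != 0 by rewrite gt_eqF.
eexists.
  apply: hasDM; last by apply: hasD_prod => j; exact: hasD_slope.
  apply: hasDM; last by apply: hasDV; [rewrite expf_neq0|apply/hasDX/hasD_rho].
  apply: hasDM; last by apply/hasDX/hasD_fac.
  by apply: hasDZ; apply/hasDX/hasD_fac.
cbv beta.
have -> : (side c == ~~ sg) = false by rewrite cs; case: (sg).
rewrite cs eqxx.
set K := t.1.1 * _; set P := fac sg t w; set X := \prod_(j < r) slope t (b j) w.
pose Y j := \prod_(i < r | i != j) slope t (b i) w.
have XY j : slope t (b j) w * Y j = X by rewrite /X (bigD1 j).
have sl e : side e = sg -> slope t e w = rho w * alpha t e - P * theta e w.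
  by move=> es; rewrite /slope es.
set q := rho w; set th := theta c w; set al := alpha t c.
have -> : \sum_j (if sg == side (b j) then th * alpha t (b j) - al * theta (b j) w
    else th * alpha t (b j) - fac (side (b j)) t w * eta c (b j)) * \prod_(i | i != j) slope t (b i) w =
  \sum_j (th * alpha t (b j) - al * theta (b j) w) * Y j.
  by apply: eq_bigr => j _; rewrite bs eqxx.
have -> : \sum_(j < r) \sum_d Gam w d c (b j) * jet sg m t (fun i => if i == j then d else b i) w =
   \sum_(j < r) - (theta (b j) w * slope t c w + th * slope t (b j) w) / q * (K * fac (~~ sg) t w ^+ m * P ^+ (m - r) / q ^+ (m + r) * Y j).
  apply: eq_bigr => j _; have jE d : jet sg m t (fun i => if i == j then d else b i) w =
     slope t d w * (K * fac (~~ sg) t w ^+ m * P ^+ (m - r) / q ^+ (m + r) * Y j).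
    rewrite /jet (bigD1 j) //= eqxx mulrCA; congr (_ * (_ * _)).
    by apply: eq_bigr => i /negPf ->.
  under eq_bigr do rewrite jE mulrA.
  by rewrite -mulr_suml sum_Gam cs bs eqxx.
have -> : jet sg m t (fun i : 'I_r.+1 => if unlift ord0 i is Some j then b j else c) w =
    (t.1.1 * (m ^_ r.+1)%:R * fac (~~ sg) t w ^+ m) * P ^+ (m - r.+1) * (q ^+ (m + r.+1))^-1 *
    (slope t c w * X).
  rewrite /jet big_ord_recl unlift_none; congr (_ * (_ * _)).
  by apply: eq_bigr => j _; rewrite liftK.
set F := fac (~~ sg) t w ^+ m; set N := (m + r)%N; set d := (m - r)%N.
have S1 : (K * F * P ^+ d / q ^+ N) * (\sum_j (th * alpha t (b j) - al * theta (b j) w) * Y j) -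
   \sum_(j < r) - (theta (b j) w * slope t c w + th * slope t (b j) w) / q * (K * F * P ^+ d / q ^+ N * Y j) =
   r%:R * (2 * th / q * (K * F * P ^+ d / q ^+ N) * X).
  rewrite mulr_sumr -sumrB -[r in r%:R](card_ord r) mulr_natl -sumr_const.
  apply: eq_bigr => j _; rewrite -(XY j) !sl //.
  move: (K * F * P ^+ d / q ^+ N) (Y j) (alpha t (b j)) (theta (b j) w) => E y x z.
  have qn0 : q != 0 by [].
  by rewrite -/th -/al -/q; move: (P) (th) (al) (q) qn0 => p h l qq qq0; field.
rewrite -[X in X = _]addrA S1 subnS addnS -/d -/N [q ^+ N.+1]exprS ffactnSr natrM sl //.
(* [m - r] is truncated, so the relation m + r = 2r + (m - r) needs [r <= m]; beyond that the
   falling factorial is 0. *)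
have e1 : (m ^_ r)%:R * N%:R = (m ^_ r)%:R * (2 * r%:R + d%:R) :> C.
  rewrite /N /d; have [rm|mr] := leqP r m; last by rewrite ffact_small // !mul0r.
  by rewrite natrB // natrD; congr (_ * _); ring.
have e2 : d%:R * P ^+ d = d%:R * (P * P ^+ d.-1) :> C.
  by case: (d) => [|k]; rewrite ?mul0r // exprS.
have e3 : - (q ^+ N) ^- 2 * (N%:R * q ^+ N.-1 * th) = - N%:R * (q ^+ N)^-1 * q^-1 * th.
  case: (N) => [|k]; first by rewrite mul0r mul0r mulr0 oppr0 !mul0r.
  have qn0 : q != 0 by []; have := expf_neq0 k qn0; rewrite /= [q ^+ k.+1]exprS.
  by move: (q ^+ k) (k.+1%:R) (q) qn0 => u v qq qq0 u0; field; rewrite u0 qq0.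
rewrite e3 /K -/d -/al -/th -/q; have qN0 : q ^+ N != 0 by rewrite expf_neq0.
rewrite mulr0 mulr0 mul0r add0r [(q * _)^-1]invfM.
move: (q ^+ N)^-1 (P ^+ d) (P ^+ d.-1) e1 e2 => iq Pd Pd' e1 e2.
transitivity (t.1.1 * F * iq * X * ((m ^_ r)%:R * (d%:R * Pd' * al) -
   ((m ^_ r)%:R * N%:R) * (th / q * Pd) + (m ^_ r)%:R * (2 * r%:R) * (th / q * Pd))).
  by move: (m ^_ r)%:R (d%:R) (N%:R) (r%:R) => *; ring.
rewrite e1; transitivity (t.1.1 * F * iq * X * ((m ^_ r)%:R * (d%:R * Pd' * al) -
   (m ^_ r)%:R * (th / q) * (d%:R * Pd))).
  by move: (m ^_ r)%:R (d%:R) (r%:R) => *; ring.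
have qn0 : q != 0 by [].
by rewrite e2; move: (m ^_ r)%:R (d%:R) (q) qn0 => M dd qq qq0; field.
Qed.

(** Components of pure type suffice as induction data: for [c] and [b j] of the type [sg],
    [Gam w d c (b j)] vanishes unless [d] is one of them, so components of mixed type never
    enter. *)
Lemma nabla_jet sg m r (L : seq (C * V * V)) (om : tensor R n r) :
  (forall (a : {ffun 'I_r -> idx}) w, 0 < rho w -> (forall j, side (a j) = sg) ->
     om a w = \sum_(t <- L) jet sg m t a w) ->
  forall (a : {ffun 'I_r.+1 -> idx}) w, 0 < rho w -> (forall j, side (a j) = sg) ->
     nabla s om a w = \sum_(t <- L) jet sg m t a w.
Proof.
move=> omE a w r0 aS; rewrite /nabla; set c := a ord0; set b := [ffun j => a (lift ord0 j)].
have cS : side c = sg by exact: aS.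
have bS j : side (b j) = sg by rewrite ffunE; exact: aS.
have /choice[D DP] : forall t, exists D, hasD (fun x => jet sg m t b x) D w /\
  D c - \sum_(j < r) \sum_d Gam w d c (b j) * jet sg m t (fun i => if i == j then d else b i) w =
  jet sg m t (fun i : 'I_r.+1 => if unlift ord0 i is Some j then b j else c) w.
  by move=> t; have [D D1 D2] := @jet_step sg m r t b c w r0 cS bS; exists D.
have -> : partial c (om b) w = \sum_(t <- L) D t c.
  apply: (@hasD_partial R n _ (fun e => \sum_(t <- L) D t e)).
  apply: (@hasD_near R n s _ (fun x => \sum_(t <- L) jet sg m t b x)) => // [x x0|].
    by apply: omE.
  by apply: hasD_sum => t; have [] := DP t.
have -> : \sum_(j < r) \sum_(d < n + n) christoffel s d c (b j) w * om [ffun i => if i == j then d else b i] w =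
  \sum_(t <- L) \sum_(j < r) \sum_d Gam w d c (b j) * jet sg m t (fun i => if i == j then d else b i) w.
  rewrite [RHS]exchange_big /=; apply: eq_bigr => j _.
  rewrite [RHS]exchange_big /=; apply: eq_bigr => d _.
  rewrite (christoffelE _ _ _ r0) -mulr_sumr.
  have [dS|dS] := eqVneq (side d) sg.
    rewrite omE //; last by move=> i; rewrite ffunE; case: eqP.
    by congr (_ * _); apply: eq_bigr => t _; apply: jet_eq => i; rewrite ffunE.
  suff -> : Gam w d c (b j) = 0 by rewrite !mul0r.
  rewrite /Gam.
  have dc : (d == c) = false by apply/eqP => e; rewrite e cS eqxx in dS.
  have db : (d == b j) = false by apply/eqP => e; rewrite e bS eqxx in dS.
  by rewrite dc db !mul0r addr0 oppr0 mul0r; case: ifP.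
rewrite -sumrB; apply: eq_bigr => t _; have [_ ->] := DP t.
apply: jet_eq => j; case: (unliftP ord0 j) => [i|] ->; last by [].
by rewrite ffunE.
Qed.

(** A jet is a product over its indices, hence already symmetric, and symmetrizing averages equal
    terms. *)
Lemma Dsym_iter_jet sg m (L : seq (C * V * V)) (f : W -> C) :
  (forall w, 0 < rho w -> f w = \sum_(t <- L) t.1.1 * fac true t w ^+ m * fac false t w ^+ m / rho w ^+ m) ->
  forall r (a : {ffun 'I_r -> idx}) w, 0 < rho w -> (forall j, side (a j) = sg) ->
    @Dsym_iter R n s f r a w = \sum_(t <- L) jet sg m t a w.
Proof.
move=> fE; elim=> [|r IH] a w r0 aS.
  rewrite /= fE //; apply: eq_bigr => t _.
  rewrite /jet big_ord0 mulr1 subn0 addn0 ffactn0 mulr1; case: (sg) => //=.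
  by rewrite -!mulrA [X in _ * X]mulrCA.
rewrite /= /Dsym /Defs.Sym.
have -> : \sum_(p : 'S_r.+1) nabla s (@Dsym_iter R n s f r) [ffun j => a (p j)] w =
    \sum_(p : 'S_r.+1) \sum_(t <- L) jet sg m t a w.
  apply: eq_bigr => p _; rewrite (nabla_jet IH) //; last by move=> j; rewrite ffunE.
  apply: eq_bigr => t _; rewrite /jet; congr (_ * _).
  rewrite [RHS](reindex_inj (@perm_inj _ p)).
  by apply: eq_bigr => j _; rewrite ffunE.
rewrite sumr_const card_Sn -[X in _ * X]mulr_natl mulKf // pnatr_eq0 -lt0n fact_gt0 //.
Qed.

Definition beta t t' : C := \sum_(k < n.+1) nu k * t.2 0 k * t'.1.2 0 k.

(** The source of the factor (beta Jhat - (a'.xi)(b.eta))^r. Sums of coefficients against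
    coordinates collapse to [fac] minus its constant coefficient, and the norm sum to [rho - 1]; the
    zeroth coordinates complete [beta]. *)
Lemma sum_H_slope t t' w : (0 < s)%N ->
  \sum_a \sum_b H_red s w a b * slope t a w * slope t' b w =
  rho w ^+ 2 * (rho w * beta t t' - fac true t' w * fac false t w).
Proof.
have spl k : fintype.split (lshift n k) = inl k :> 'I_n + 'I_n by exact: (unsplitK (inl k)).
have spr k : fintype.split (rshift n k) = inr k :> 'I_n + 'I_n by exact: (unsplitK (inr k)).
rewrite big_split_ord /= big1 ?add0r => [|k _]; last first.
  by rewrite big1 // => b _; rewrite /H_red /mixed spl !mul0r.
move=> s0; pose Y (k : 'I_n) := rho w * t.2 0 (lift ord0 k) - fac false t w * (nu k.+1 * w 0 k).
pose X (k : 'I_n) := rho w * t'.1.2 0 (lift ord0 k) - fac true t' w * (nu k.+1 * (w 0 k)^*).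
transitivity (rho w * (\sum_(k < n) \sum_(l < n) ((w 0 k)^* * Y k * (w 0 l * X l)) + \sum_(k < n) nu k.+1 * Y k * X k)).
  rewrite mulrDr !mulr_sumr -big_split; apply: eq_bigr => k _.
  rewrite big_split_ord /= [X in _ + X]big1 ?addr0 => [|l _]; last first.
    by rewrite /H_red /mixed spr spr !mul0r.
  rewrite mulr_sumr [X in _ + X](_ : _ = \sum_(l < n) rho w * ((k == l)%:R * nu k.+1 * Y k * X l)); last first.
    rewrite (bigD1 k) //= eqxx mul1r big1 ?addr0 // => l lk.
    by rewrite eq_sym (negPf lk) !mul0r mulr0.
  rewrite -big_split; apply: eq_bigr => l _; rewrite /H_red /mixed spr spl /=.
  rewrite /slope /alpha /theta !side_l !side_r !pos_l !pos_r /= /coordf -/(Y k) -/(X l).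
  by move: (Y k) (X l) (rho w) (w 0 l) ((w 0 k)^*) (_%:R) (nu k.+1) => *; ring.
have sF : \sum_(k < n) t.2 0 (lift ord0 k) * (w 0 k)^* = fac false t w - t.2 0 0.
  by rewrite facE addrC addKr.
have sT : \sum_(k < n) t'.1.2 0 (lift ord0 k) * w 0 k = fac true t' w - t'.1.2 0 0.
  by rewrite facE addrC addKr.
have sR : \sum_(k < n) nu k.+1 * ((w 0 k)^* * w 0 k) = rho w - 1 by rewrite rhoE addrC addKr.
have wY : \sum_(k < n) (w 0 k)^* * Y k = fac false t w - rho w * t.2 0 0.
  transitivity (rho w * (\sum_(k < n) t.2 0 (lift ord0 k) * (w 0 k)^*) -
     fac false t w * (\sum_(k < n) nu k.+1 * ((w 0 k)^* * w 0 k))).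
    rewrite !mulr_sumr -sumrB; apply: eq_bigr => k _; rewrite /Y.
    by move: (fac _ _ _) (rho w) ((w 0 k)^*) (w 0 k) (nu _) => *; ring.
  by rewrite sF sR; move: (fac _ _ _) (rho w) => *; ring.
have wX : \sum_(k < n) w 0 k * X k = fac true t' w - rho w * t'.1.2 0 0.
  transitivity (rho w * (\sum_(k < n) t'.1.2 0 (lift ord0 k) * w 0 k) -
     fac true t' w * (\sum_(k < n) nu k.+1 * ((w 0 k)^* * w 0 k))).
    rewrite !mulr_sumr -sumrB; apply: eq_bigr => k _; rewrite /X.
    by move: (fac _ _ _) (rho w) ((w 0 k)^*) (w 0 k) (nu _) => *; ring.
  by rewrite sT sR; move: (fac _ _ _) (rho w) => *; ring.
have -> : \sum_(k < n) \sum_(l < n) ((w 0 k)^* * Y k * (w 0 l * X l)) =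
    (fac false t w - rho w * t.2 0 0) * (fac true t' w - rho w * t'.1.2 0 0).
  rewrite -wY -wX mulr_suml; apply: eq_bigr => k _; rewrite mulr_sumr.
  by apply: eq_bigr => l _.
have -> : \sum_(k < n) nu k.+1 * Y k * X k = rho w ^+ 2 * (beta t t' - t.2 0 0 * t'.1.2 0 0)
   - rho w * fac true t' w * (fac false t w - t.2 0 0) - rho w * fac false t w * (fac true t' w - t'.1.2 0 0)
   + fac false t w * fac true t' w * (rho w - 1).
  have -> : beta t t' - t.2 0 0 * t'.1.2 0 0 = \sum_(k < n) nu k.+1 * t.2 0 (lift ord0 k) * t'.1.2 0 (lift ord0 k).
    by rewrite /beta big_ord_recl /Defs.nu s0 mul1r addrC addKr.
  rewrite -sF -sT -sR /Y /X; move: (fac true t' w) (fac false t w) (rho w) => x y r.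
  rewrite !mulr_sumr -!sumrB -big_split; apply: eq_bigr => k _ /=.
  have uu := nu_sq R s k.+1.
  move: (w 0 k) ((w 0 k)^*) (t.2 0 _) (t'.1.2 0 _) (nu _) uu => ww wb b a u uu.
  have -> : u * (r * b - y * (u * ww)) * (r * a - x * (u * wb)) = r ^+ 2 * (u * b * a) -
    r * x * (b * wb) * (u * u) - r * y * (a * ww) * (u * u) + y * x * (u * (wb * ww)) * (u * u) by ring.
  by rewrite uu; ring.
rewrite -/(fac true t' w) -/(fac false t w).
by move: (fac true t' w) (fac false t w) (rho w) (t.2 0 0) (t'.1.2 0 0) (beta t t') => *; ring.
Qed.

(* The r-th term of the product of two generators of degree m; it vanishes for
   r > m because m ^_ r does. *)
Definition bgen r m t t' (x : V * V) : C :=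
  t.1.1 * t'.1.1 * (m ^_ r)%:R ^+ 2 * (dot t.1.2 x.1 ^+ m * dot t.2 x.2 ^+ (m - r)) *
  (dot t'.2 x.2 ^+ m * dot t'.1.2 x.1 ^+ (m - r)) *
  (beta t t' * Jhat s x - dot t'.1.2 x.1 * dot t.2 x.2) ^+ r.

Lemma Jhat_chart w : (0 < s)%N -> Jhat s (affine ord0 w, cconj (affine ord0 w)) = rho w.
Proof. by move=> s0; rewrite Jhat_diag J_affine. Qed.

(** The sum over index tuples of a product is a product of [r] equal sums, each given by
    [sum_H_slope]. Their [rho ^+ (2 * r)] reduces the denominators [rho ^+ (m + r)] of the two jets
    to [rho ^+ (m + m)]. *)
Lemma pairing_chart m (L L' : seq (C * V * V)) (f g : W -> C) r w : (0 < s)%N ->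
  (forall w, 0 < rho w -> f w = \sum_(t <- L) t.1.1 * fac true t w ^+ m * fac false t w ^+ m / rho w ^+ m) ->
  (forall w, 0 < rho w -> g w = \sum_(t <- L') t.1.1 * fac true t w ^+ m * fac false t w ^+ m / rho w ^+ m) ->
  0 < rho w ->
  pairing s (@Dsym_iter R n s f r) (@Dsym_iter R n s g r) w =
  \sum_(t <- L) \sum_(t' <- L') bgen r m t t' (affine ord0 w, cconj (affine ord0 w)) / rho w ^+ (m + m).
Proof.
move=> s0 fE gE r0; have r0' : rho w != 0 by rewrite gt_eqF.
transitivity (\sum_(t <- L) \sum_(t' <- L') \sum_(a : {ffun 'I_r -> idx}) \sum_(b : {ffun 'I_r -> idx})
   (\prod_(j < r) H_red s w (a j) (b j)) * jet false m t a w * jet true m t' b w).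
  under [RHS]eq_bigr => t _.
    rewrite exchange_big /=; under eq_bigr => a _ do rewrite exchange_big /=.
    over.
  rewrite [RHS]exchange_big /=; apply: eq_bigr => a _; rewrite [RHS]exchange_big /=; apply: eq_bigr => b _.
  (* [H_red] pairs only an antiholomorphic index with a holomorphic one, so all other tuples drop
     out and both tensors are of pure type. *)
  have [H0|H0] := eqVneq (\prod_(j < r) H_red s w (a j) (b j)) 0.
    rewrite H0 !mul0r; symmetry; apply: big1_seq => t _; apply: big1_seq => t' _.
    by rewrite !mul0r.
  have ab j : side (a j) = false /\ side (b j) = true.
    have : H_red s w (a j) (b j) != 0.
      by move: H0; rewrite (bigD1 j) //= mulf_eq0 negb_or => /andP[].
    rewrite /H_red /mixed /side.
    by case: (fintype.split (a j)) => [?|?]; case: (fintype.split (b j)) => [?|?]; rewrite ?eqxx.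
  rewrite (@Dsym_iter_jet false m L f fE) //; last by move=> j; have [] := ab j.
  rewrite (@Dsym_iter_jet true m L' g gE) //; last by move=> j; have [] := ab j.
  rewrite -mulrA mulr_suml mulr_sumr; apply: eq_bigr => t _.
  by rewrite mulrA mulr_sumr.
apply: eq_bigr => t _; apply: eq_bigr => t' _.
set K := (t.1.1 * (m ^_ r)%:R * fac true t w ^+ m) * fac false t w ^+ (m - r) * (rho w ^+ (m + r))^-1.
set K' := (t'.1.1 * (m ^_ r)%:R * fac false t' w ^+ m) * fac true t' w ^+ (m - r) * (rho w ^+ (m + r))^-1.
transitivity (K * K' * \prod_(j < r) (\sum_a \sum_b H_red s w a b * slope t a w * slope t' b w)).
  rewrite bigA_distr_bigA mulr_sumr; apply: eq_bigr => a _.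
  rewrite bigA_distr_bigA mulr_sumr; apply: eq_bigr => b _.
  by rewrite /jet -/K -/K' !big_split /=; move: K K' (\prod_(j < r) _) (\prod_(j < r) _) (\prod_(j < r) _) => *; ring.
rewrite sum_H_slope // prodr_const card_ord /bgen Jhat_chart // /K /K' -/(fac true t w) -/(fac false t w).
rewrite -/(fac true t' w) -/(fac false t' w) [beta t t' * _]mulrC.
rewrite [(_ ^+ 2 * _) ^+ r]exprMn -exprM mulnC !exprD exprM.
have rm := expf_neq0 m r0'; have rr := expf_neq0 r r0'.
move: (_ ^+ r) (rho w ^+ m) (rho w ^+ r) rm rr => B x y x0 y0.
by field; rewrite x0 y0.
Qed.
End ChartOperators.

(** * The operators on the complexified space and their estimates *)

Section DifferenceOperators.
Variables (R : realType) (n : nat).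
Local Notation C := (Cplx R).
Local Notation V := 'rV[C]_n.+1.
Variables (M : nat) (w : C) (rad : C).
Hypotheses (M1 : (1 < M)%N) (wP : M.-primitive_root w) (rad0 : 0 < rad).

Let M0 : (0 < M)%N := ltnW M1.

(* On polynomials of degree less than M this is the derivative along v. *)
Definition dlt (v : V) (g : V -> C) (y : V) : C :=
  rad^-1 * avg M w (fun z => g (y + (rad * z) *: v) * z^-1).

Fixpoint dlts (vs : seq V) (g : V -> C) : V -> C :=
  if vs is v :: vs' then dlt v (dlts vs' g) else g.

Definition shift (y : V) (zs : seq C) (vs : seq V) : V :=
  y + \sum_(p <- zip zs vs) (rad * p.1) *: p.2.

Definition on_circle (zs : seq C) (vs : seq V) : Prop :=
  size zs = size vs /\ forall z, z \in zs -> `|z| = 1.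

Lemma shift_cons y z zs v vs : shift y (z :: zs) (v :: vs) = shift (y + (rad * z) *: v) zs vs.
Proof. by rewrite /shift /= big_cons addrA. Qed.

Lemma on_circle_cons z zs v vs : `|z| = 1 -> on_circle zs vs -> on_circle (z :: zs) (v :: vs).
Proof.
move=> z1 [e zs1]; split=> [|y]; first by rewrite /= e.
by rewrite inE => /orP[/eqP -> //|]; exact: zs1.
Qed.

(** An iterated Cauchy inequality: each average costs a factor [rad^-1], and [g] is evaluated only
    at displacements by unimodular multiples of [rad], one for each vector. *)
Lemma dlts_le vs g y S : (forall zs, on_circle zs vs -> `|g (shift y zs vs)| <= S) ->
  `|dlts vs g y| <= rad ^- size vs * S.
Proof.
elim: vs y => [|v vs IH] y gS /=.
  have := gS [::]; rewrite /shift /= big_nil addr0 expr0 invr1 mul1r; apply.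
  by split.
have -> : rad ^- (size vs).+1 * S = rad^-1 * (rad ^- size vs * S) by rewrite exprS invfM mulrA.
rewrite /dlt normrM normfV (gtr0_norm rad0).
apply: ler_wpM2l; first by rewrite invr_ge0 ltW.
apply: (avg_le M0 wP) => z z1; rewrite normrM normfV z1 invr1 mulr1; apply: IH => zs zsP.
by rewrite -shift_cons; apply: gS; exact: on_circle_cons.
Qed.

Lemma dlts_eq vs g h y : (forall zs, on_circle zs vs -> g (shift y zs vs) = h (shift y zs vs)) ->
  dlts vs g y = dlts vs h y.
Proof.
elim: vs y => [|v vs IH] y gS /=.
  have := gS [::]; rewrite /shift /= big_nil addr0; apply.
  by split.
rewrite /dlt; congr (_ * _).
apply: (@eq_avg C M w M0 wP (fun z => dlts vs g (y + (rad * z) *: v) * z^-1)) => z z1; congr (_ * _).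
apply: IH => zs zsP.
by rewrite -shift_cons; apply: gS; exact: on_circle_cons.
Qed.

Lemma dlts_lin vs (a : C) g h y : dlts vs (fun y => a * g y + h y) y = a * dlts vs g y + dlts vs h y.
Proof.
elim: vs y => [|v vs IH] y //=; rewrite /dlt.
transitivity (rad^-1 * avg M w (fun z => a * (dlts vs g (y + (rad * z) *: v) * z^-1) +
    dlts vs h (y + (rad * z) *: v) * z^-1)).
  congr (_ * _); apply: (@eq_avg C M w M0 wP (fun z => dlts vs _ (y + (rad * z) *: v) * z^-1)) => z _.
  by rewrite IH mulrDl mulrA.
by rewrite avgD avgZ mulrDr mulrCA.
Qed.

Lemma dlts0 vs y : dlts vs (fun=> 0) y = 0.
Proof.
have := dlts_lin vs 1 (fun=> 0) (fun=> 0) y.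
rewrite (_ : (fun _ : V => 1 * 0 + 0) = (fun=> 0)); last by apply/funext => z; rewrite mulr0 addr0.
by rewrite mul1r => /eqP; rewrite addrC -subr_eq subrr eq_sym => /eqP.
Qed.

Lemma dlts_sum vs (I : Type) (r : seq I) (g : I -> V -> C) y :
  dlts vs (fun y => \sum_(i <- r) g i y) y = \sum_(i <- r) dlts vs (g i) y.
Proof.
elim: r => [|i r IH].
  rewrite big_nil -[RHS](dlts0 vs y).
  by rewrite (_ : (fun y => \sum_(i <- [::]) g i y) = fun=> 0) //; apply/funext => z; rewrite big_nil.
rewrite big_cons -IH -[X in X + _]mul1r -dlts_lin.
by rewrite (_ : (fun y => \sum_(j <- i :: r) g j y) = fun y => 1 * g i y + \sum_(j <- r) g j y) //;
  apply/funext => z; rewrite big_cons mul1r.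
Qed.

(** Among the powers of [z] up to [k < M] only the first is congruent to 1 modulo [M], so the
    average picks the linear term and no error remains. *)
Lemma dlt_pow c b k v y : (k < M)%N ->
  dlt v (fun y => c * dot b y ^+ k) y = c * k%:R * dot b v * dot b y ^+ k.-1.
Proof.
move=> kM; have rad0' : rad != 0 by rewrite gt_eqF.
rewrite /dlt.
transitivity (rad^-1 * avg M w (fun z => \sum_(i < k.+1)
   ('C(k, i)%:R * c * dot b y ^+ (k - i) * (rad * dot b v) ^+ i) * (z ^+ i * z ^- 1))).
  congr (_ * _); apply: (@eq_avg C M w M0 wP (fun z => c * dot b (y + (rad * z) *: v) ^+ k * z^-1)) => z _.
  rewrite dotDr dotZr exprDn mulr_sumr mulr_suml; apply: eq_bigr => i _.
  have -> : rad * z * dot b v = rad * dot b v * z by rewrite mulrAC.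
  rewrite [(rad * dot b v * z) ^+ i]exprMn expr1 -mulr_natl.
  by move: (_ ^+ (k - i)) ((rad * dot b v) ^+ i) (z ^+ i) (z^-1) ('C(k, i)%:R) => *; ring.
rewrite avg_sum; under eq_bigr => i _ do rewrite (avgZ M w _ (fun z => z ^+ i * z ^- 1)) (avg_pow M0 wP).
case: k kM => [|k] kM.
  by rewrite big_ord1 mod0n modn_small // mulr0 mulr0 mulr0 !mul0r.
rewrite 2!big_ord_recl big1 ?addr0 => [|i _].
  rewrite mod0n modn_small // eqxx mulr0 add0r mulr1 bin1 subn1 /= expr1.
  by field.
rewrite !modn_small //= ?mulr0 //.
by apply: leq_ltn_trans kM; rewrite /bump /= !add1n ltnS.
Qed.

Lemma dlts_pow c b k vs y : (k < M)%N ->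
  dlts vs (fun y => c * dot b y ^+ k) y =
  c * (k ^_ size vs)%:R * \prod_(v <- vs) dot b v * dot b y ^+ (k - size vs).
Proof.
move=> kM; elim: vs y => [|v vs IH] y; first by rewrite /= big_nil ffactn0 !mulr1 subn0.
rewrite /= (_ : dlts vs _ = fun y => c * (k ^_ size vs)%:R * \prod_(v <- vs) dot b v * dot b y ^+ (k - size vs)); last first.
  by apply/funext.
rewrite dlt_pow ?(leq_ltn_trans (leq_subr _ _)) // big_cons ffactnSr natrM subnS.
by move: ((k ^_ size vs)%:R) (\prod_(v <- vs) _) (_ ^+ _) ((k - size vs)%:R) (dot b v) => *; ring.
Qed.
End DifferenceOperators.
Opaque dlt dlts.

(** * Contraction of tangential derivatives on [Zhat] *)

Section StarOperators.
Variables (R : realType) (n s : nat).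
Local Notation C := (Cplx R).
Local Notation V := 'rV[C]_n.+1.
Local Notation Jhat := (@Jhat R n s).
Local Notation nu := (nu R s).

Lemma Jhat_addr (xi y z : V) (c : C) : Jhat (xi, y + c *: z) = Jhat (xi, y) + c * Jhat (xi, z).
Proof.
rewrite /Defs.Jhat mulr_sumr -big_split; apply: eq_bigr => k _; rewrite /= !mxE.
by move: (nu k) (xi 0 k) (y 0 k) (z 0 k) => *; ring.
Qed.

Lemma Jhat_addl (xi y z : V) (c : C) : Jhat (y + c *: z, xi) = Jhat (y, xi) + c * Jhat (z, xi).
Proof.
rewrite /Defs.Jhat mulr_sumr -big_split; apply: eq_bigr => k _; rewrite /= !mxE.
by move: (nu k) (xi 0 k) (y 0 k) (z 0 k) => *; ring.
Qed.

Lemma Jhat_deltar xi k : Jhat (xi, delta_mx 0 k) = nu k * xi 0 k.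
Proof.
rewrite /Defs.Jhat (bigD1 k) //= big1 => [|j jk]; rewrite mxE /= ?eqxx ?mulr1 ?addr0 //.
by rewrite (negPf jk) mulr0.
Qed.

Lemma Jhat_deltal xi k : Jhat (delta_mx 0 k, xi) = nu k * xi 0 k.
Proof.
rewrite /Defs.Jhat (bigD1 k) //= big1 => [|j jk]; rewrite mxE /= ?eqxx ?mulr1 ?addr0 //.
by rewrite (negPf jk) mulr0 mul0r.
Qed.

(** The basis vector projected along [x.2] to the kernel of [Jhat] with first argument [x.1].
    Translations of [x.2] by such vectors stay in [Zhat]; [udir] does the same for [x.1]. *)
Definition vdir (x : V * V) (k : 'I_n.+1) : V := delta_mx 0 k - (nu k * x.1 0 k) *: x.2.
Definition udir (x : V * V) (k : 'I_n.+1) : V := delta_mx 0 k - (nu k * x.2 0 k) *: x.1.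

Lemma Jhat_vdir x k : Jhat x = 1 -> Jhat (x.1, vdir x k) = 0.
Proof.
by move=> J1; rewrite /vdir -scaleNr Jhat_addr Jhat_deltar -surjective_pairing J1 mulr1 addrN.
Qed.

Lemma Jhat_udir x k : Jhat x = 1 -> Jhat (udir x k, x.2) = 0.
Proof.
by move=> J1; rewrite /udir -scaleNr Jhat_addl Jhat_deltal -surjective_pairing J1 mulr1 addrN.
Qed.

Definition vdirs x r (K : {ffun 'I_r -> 'I_n.+1}) := [seq vdir x (K j) | j <- index_enum 'I_r].
Definition udirs x r (K : {ffun 'I_r -> 'I_n.+1}) := [seq udir x (K j) | j <- index_enum 'I_r].

Lemma size_index_ord r : size (index_enum 'I_r) = r.
Proof. by rewrite -sum1_size big_const_ord iter_addn_0 mul1n. Qed.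

Lemma size_dirs r (K : {ffun 'I_r -> 'I_n.+1}) (f : 'I_n.+1 -> V) :
  size [seq f (K j) | j <- index_enum 'I_r] = r.
Proof. by rewrite size_map size_index_ord. Qed.

Lemma prod_dirs r (K : {ffun 'I_r -> 'I_n.+1}) (f : 'I_n.+1 -> V) b :
  \prod_(v <- [seq f (K j) | j <- index_enum 'I_r]) dot b v = \prod_(j < r) dot b (f (K j)).
Proof. by rewrite big_map. Qed.

Lemma Jhat_shift rad x r (K : {ffun 'I_r -> 'I_n.+1}) zs : Jhat x = 1 ->
  Jhat (x.1, shift rad x.2 zs (vdirs x K)) = 1.
Proof.
move=> J1; rewrite /shift /vdirs; elim: (index_enum _) zs => [|j js IH] [|z zs] /=;
  rewrite ?big_nil ?addr0 -?surjective_pairing //.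
rewrite big_cons /= addrCA addrC Jhat_addr Jhat_vdir // mulr0 addr0; exact: IH.
Qed.

Lemma Jhat_shiftl rad x r (K : {ffun 'I_r -> 'I_n.+1}) zs : Jhat x = 1 ->
  Jhat (shift rad x.1 zs (udirs x K), x.2) = 1.
Proof.
move=> J1; rewrite /shift /udirs; elim: (index_enum _) zs => [|j js IH] [|z zs] /=;
  rewrite ?big_nil ?addr0 -?surjective_pairing //.
rewrite big_cons /= addrCA addrC Jhat_addl Jhat_udir // mulr0 addr0; exact: IH.
Qed.

Lemma size_vdirs x r (K : {ffun 'I_r -> 'I_n.+1}) : size (vdirs x K) = r.
Proof. exact: size_dirs. Qed.
Lemma size_udirs x r (K : {ffun 'I_r -> 'I_n.+1}) : size (udirs x K) = r.
Proof. exact: size_dirs. Qed.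
Lemma prod_vdirs x r (K : {ffun 'I_r -> 'I_n.+1}) b :
  \prod_(v <- vdirs x K) dot b v = \prod_(j < r) dot b (vdir x (K j)).
Proof. exact: (prod_dirs K (vdir x)). Qed.
Lemma prod_udirs x r (K : {ffun 'I_r -> 'I_n.+1}) b :
  \prod_(v <- udirs x K) dot b v = \prod_(j < r) dot b (udir x (K j)).
Proof. exact: (prod_dirs K (udir x)). Qed.
Lemma vdirsP x r (K : {ffun 'I_r -> 'I_n.+1}) v : v \in vdirs x K -> exists k, v = vdir x k.
Proof. by move=> /mapP[j _ ->]; exists (K j). Qed.
Lemma udirsP x r (K : {ffun 'I_r -> 'I_n.+1}) v : v \in udirs x K -> exists k, v = udir x k.
Proof. by move=> /mapP[j _ ->]; exists (K j). Qed.
Opaque vdirs udirs.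

Definition BD M w rad r (F G : V * V -> C) (x : V * V) : C :=
  \sum_(K : {ffun 'I_r -> 'I_n.+1}) \prod_(j < r) nu (K j) *
    (dlts M w rad (vdirs x K) (fun y => F (x.1, y)) x.2 *
     dlts M w rad (udirs x K) (fun y => G (y, x.2)) x.1).

(** The counterpart on [Zhat] of [sum_H_slope]: it makes the tangential contraction and the chart
    formula the same operator on generators. *)
Lemma sum_dirs t t' x : Jhat x = 1 ->
  \sum_(k < n.+1) nu k * (dot t.2 (vdir x k) * dot t'.1.2 (udir x k)) =
  beta s t t' * Jhat x - dot t'.1.2 x.1 * dot t.2 x.2.
Proof.
move=> J1; rewrite J1 mulr1.
have dv k : dot t.2 (vdir x k) = t.2 0 k - nu k * x.1 0 k * dot t.2 x.2.
  rewrite /vdir -scaleNr dotDr dotZr mulNr; congr (_ - _).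
  rewrite /dot (bigD1 k) //= big1 => [|j jk]; rewrite mxE /= ?eqxx ?mulr1 ?addr0 //.
  by rewrite (negPf jk) mulr0.
have du k : dot t'.1.2 (udir x k) = t'.1.2 0 k - nu k * x.2 0 k * dot t'.1.2 x.1.
  rewrite /udir -scaleNr dotDr dotZr mulNr; congr (_ - _).
  rewrite /dot (bigD1 k) //= big1 => [|j jk]; rewrite mxE /= ?eqxx ?mulr1 ?addr0 //.
  by rewrite (negPf jk) mulr0.
under eq_bigr do rewrite dv du.
have e1 : \sum_k t.2 0 k * x.2 0 k = dot t.2 x.2 by [].
have e2 : \sum_k t'.1.2 0 k * x.1 0 k = dot t'.1.2 x.1 by [].
move: (dot t.2 x.2) (dot t'.1.2 x.1) e1 e2 => p q e1 e2.
transitivity (beta s t t' - q * (\sum_k t.2 0 k * x.2 0 k) - p * (\sum_k t'.1.2 0 k * x.1 0 k) + p * q * Jhat x).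
  rewrite /beta /Defs.Jhat !mulr_sumr -!sumrB -big_split; apply: eq_bigr => k _ /=.
  have uu := nu_sq R s k; move: (nu k) uu (t.2 0 k) (t'.1.2 0 k) (x.1 0 k) (x.2 0 k) => u uu b a z y.
  have -> : u * ((b - u * z * p) * (a - u * y * q)) = u * b * a - (u * u) * (q * (b * y)) -
     (u * u) * (p * (a * z)) + (u * u) * (p * q * (u * z * y)) by ring.
  by rewrite uu; ring.
by rewrite e1 e2 J1; ring.
Qed.

Section Root.
Variables (M : nat) (w rad : C).
Hypotheses (M1 : (1 < M)%N) (wP : M.-primitive_root w) (rad0 : 0 < rad).

(** All points at which the factors are evaluated lie in [Zhat], because the directions are
    tangent. *)
Lemma BD_eq r F F' G G' x : Jhat x = 1 ->
  (forall x, Jhat x = 1 -> F x = F' x) -> (forall x, Jhat x = 1 -> G x = G' x) ->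
  BD M w rad r F G x = BD M w rad r F' G' x.
Proof.
move=> J1 FF GG; apply: eq_bigr => K _; congr (_ * (_ * _)).
  by apply: (dlts_eq M1 wP) => zs _; apply: FF; exact: Jhat_shift.
by apply: (dlts_eq M1 wP) => zs _; apply: GG; exact: Jhat_shiftl.
Qed.

Lemma BD_linl r a F F' G x : BD M w rad r (fun x => a * F x + F' x) G x =
  a * BD M w rad r F G x + BD M w rad r F' G x.
Proof.
rewrite /BD mulr_sumr -big_split; apply: eq_bigr => K _ /=.
have h := @dlts_lin R n M w rad M1 wP (vdirs x K) a (fun y => F (x.1, y)) (fun y => F' (x.1, y)) x.2.
have aux (P b X Y Z D : C) : D = b * X + Y -> P * (D * Z) = b * (P * (X * Z)) + P * (Y * Z) by move=> ->; ring.
exact (@aux _ _ _ _ _ _ h).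
Qed.

Lemma BD_linr r a F G G' x : BD M w rad r F (fun x => a * G x + G' x) x =
  a * BD M w rad r F G x + BD M w rad r F G' x.
Proof.
rewrite /BD mulr_sumr -big_split; apply: eq_bigr => K _ /=.
have h := @dlts_lin R n M w rad M1 wP (udirs x K) a (fun y => G (y, x.2)) (fun y => G' (y, x.2)) x.1.
have aux (P b X Y Z D : C) : D = b * Y + Z -> P * (X * D) = b * (P * (X * Y)) + P * (X * Z) by move=> ->; ring.
exact (@aux _ _ _ _ _ _ h).
Qed.

Lemma dlts_vgen r m t x (K : {ffun 'I_r -> 'I_n.+1}) : (m < M)%N ->
  dlts M w rad (vdirs x K) (fun y => gen_ev m m t (x.1, y)) x.2 =
  t.1.1 * dot t.1.2 x.1 ^+ m * (m ^_ r)%:R * \prod_(j < r) dot t.2 (vdir x (K j)) * dot t.2 x.2 ^+ (m - r).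
Proof.
move=> mM; have := dlts_pow M1 wP rad0 (t.1.1 * dot t.1.2 x.1 ^+ m) t.2 (vdirs x K) x.2 mM.
by rewrite prod_vdirs size_vdirs.
Qed.

Lemma dlts_ugen r m t x (K : {ffun 'I_r -> 'I_n.+1}) : (m < M)%N ->
  dlts M w rad (udirs x K) (fun y => gen_ev m m t (y, x.2)) x.1 =
  t.1.1 * dot t.2 x.2 ^+ m * (m ^_ r)%:R * \prod_(j < r) dot t.1.2 (udir x (K j)) * dot t.1.2 x.1 ^+ (m - r).
Proof.
move=> mM; have := dlts_pow M1 wP rad0 (t.1.1 * dot t.2 x.2 ^+ m) t.1.2 (udirs x K) x.1 mM.
rewrite prod_udirs size_udirs => <-; congr (dlts _ _ _ _ _ _).
by apply/funext => y; rewrite /gen_ev /= mulrAC.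
Qed.

Lemma prod_dirs_split r (t t' : C * V * V) x (K : {ffun 'I_r -> 'I_n.+1}) :
  \prod_(j < r) (nu (K j) * (dot t.2 (vdir x (K j)) * dot t'.1.2 (udir x (K j)))) =
  \prod_(j < r) nu (K j) * (\prod_(j < r) dot t.2 (vdir x (K j)) * \prod_(j < r) dot t'.1.2 (udir x (K j))) :> C.
Proof. by rewrite big_split; congr (_ * _); rewrite big_split. Qed.

Lemma BD_gen r m t t' x (K : {ffun 'I_r -> 'I_n.+1}) : (m < M)%N ->
  \prod_(j < r) nu (K j) * (dlts M w rad (vdirs x K) (fun y => gen_ev m m t (x.1, y)) x.2 *
     dlts M w rad (udirs x K) (fun y => gen_ev m m t' (y, x.2)) x.1) =
  t.1.1 * t'.1.1 * (m ^_ r)%:R ^+ 2 * (dot t.1.2 x.1 ^+ m * dot t.2 x.2 ^+ (m - r)) *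
  (dot t'.2 x.2 ^+ m * dot t'.1.2 x.1 ^+ (m - r)) *
  \prod_(j < r) (nu (K j) * (dot t.2 (vdir x (K j)) * dot t'.1.2 (udir x (K j)))).
Proof.
move=> mM; have e1 := dlts_vgen t x K mM; have e2 := dlts_ugen t' x K mM.
have aux (A B D c c' f p1 p2 q1 q2 X Y Z : C) : X = c * p1 * f * B * q1 -> Y = c' * p2 * f * D * q2 ->
    Z = A * (B * D) -> A * (X * Y) = c * c' * f ^+ 2 * (p1 * q1) * (p2 * q2) * Z by move=> -> -> ->; ring.
exact (@aux _ _ _ _ _ _ _ _ _ _ _ _ _ e1 e2 (prod_dirs_split t t' x K)).
Qed.

Lemma dlts_vsum r m L x (K : {ffun 'I_r -> 'I_n.+1}) :
  dlts M w rad (vdirs x K) (fun y => ev m m L (x.1, y)) x.2 =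
  \sum_(t <- L) dlts M w rad (vdirs x K) (fun y => gen_ev m m t (x.1, y)) x.2.
Proof. exact: (@dlts_sum R n M w rad M1 wP (vdirs x K) _ L (fun t y => gen_ev m m t (x.1, y))). Qed.

Lemma dlts_usum r m L x (K : {ffun 'I_r -> 'I_n.+1}) :
  dlts M w rad (udirs x K) (fun y => ev m m L (y, x.2)) x.1 =
  \sum_(t <- L) dlts M w rad (udirs x K) (fun y => gen_ev m m t (y, x.2)) x.1.
Proof. exact: (@dlts_sum R n M w rad M1 wP (udirs x K) _ L (fun t y => gen_ev m m t (y, x.2))). Qed.

Lemma BD_ev r m L L' F G x : (m < M)%N -> Jhat x = 1 ->
  (forall x, Jhat x = 1 -> F x = ev m m L x) -> (forall x, Jhat x = 1 -> G x = ev m m L' x) ->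
  BD M w rad r F G x = \sum_(t <- L) \sum_(t' <- L') bgen s r m t t' x.
Proof.
move=> mM J1 FE GE; rewrite (BD_eq r J1 FE GE) /BD.
transitivity (\sum_(K : {ffun 'I_r -> 'I_n.+1}) \sum_(t <- L) \sum_(t' <- L')
   (t.1.1 * t'.1.1 * (m ^_ r)%:R ^+ 2 * (dot t.1.2 x.1 ^+ m * dot t.2 x.2 ^+ (m - r)) *
  (dot t'.2 x.2 ^+ m * dot t'.1.2 x.1 ^+ (m - r))) * \prod_(j < r) (nu (K j) * (dot t.2 (vdir x (K j)) * dot t'.1.2 (udir x (K j))))).
  apply: eq_bigr => K _.
  have aux (A X Y D D' : C) : D = X -> D' = Y -> A * (D * D') = A * (X * Y) by move=> -> ->.
  refine (etrans (@aux _ _ _ _ _ (dlts_vsum m L x K) (dlts_usum m L' x K)) _).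
  rewrite mulr_suml mulr_sumr.
  apply: eq_bigr => t _; rewrite mulr_sumr mulr_sumr; apply: eq_bigr => t' _; exact: BD_gen.
rewrite exchange_big; apply: eq_bigr => t _; rewrite exchange_big; apply: eq_bigr => t' _ /=.
rewrite -mulr_sumr /bgen -sum_dirs //; congr (_ * _).
by rewrite -(bigA_distr_bigA (fun (_ : 'I_r) (k : 'I_n.+1) => nu k * (dot t.2 (vdir x k) * dot t'.1.2 (udir x k)))) /= prodr_const card_ord.
Qed.

Lemma shift_le (y : V) zs vs (B r0 : C) l : on_circle zs vs ->
  (forall v : V, v \in vs -> `|v 0 l| <= B) -> `|y 0 l| <= r0 ->
  `|shift rad y zs vs 0 l| <= r0 + (size vs)%:R * rad * B.
Proof.
elim: vs zs y r0 => [|v vs IH] [|z zs] y r0 [] //.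
  by move=> _ _ _ yr; rewrite /shift big_nil addr0 !mul0r addr0.
move=> [e] zs1 vB yr; rewrite shift_cons.
have -> : r0 + (size (v :: vs))%:R * rad * B = (r0 + rad * B) + (size vs)%:R * rad * B.
  by rewrite [size (v :: vs)]/= -natr1; move: (size vs)%:R => N; ring.
apply: IH => [|u uvs|]; last 1 first.
- rewrite mxE [X in _ + X]mxE; apply: le_trans (ler_normD _ _) _; apply: lerD => //.
  rewrite !normrM (gtr0_norm rad0) zs1 ?mem_head // mulr1; apply: ler_wpM2l; first exact: ltW.
  by apply: vB; rewrite mem_head.
- by split=> // u uzs; apply: zs1; rewrite inE uzs orbT.
by apply: vB; rewrite inE uvs orbT.
Qed.

Lemma nu_norm1 k : `|nu k| = 1.
Proof. by rewrite /Defs.nu; case: ifP => _; rewrite ?normrN normr1. Qed.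

Lemma dir_le (x1 x2 : V) (r0 : C) k l : 0 <= r0 -> `|x1 0 k| <= r0 -> `|x2 0 l| <= r0 ->
  `|(delta_mx 0 k - (nu k * x1 0 k) *: x2 : V) 0 l| <= 1 + r0 ^+ 2.
Proof.
move=> r0p h1 h2; rewrite mxE [X in _ + X]mxE [X in _ - X]mxE [X in X - _]mxE.
apply: le_trans (ler_normB _ _) _; apply: lerD.
  by case: (_ && _); rewrite ?normr1 ?normr0 ?ler01.
by rewrite !normrM nu_norm1 mul1r expr2; apply: ler_pM.
Qed.

(** There are (n + 1)^r tuples and each factor costs rad^-r. A direction has entries at most
    [1 + r0 ^+ 2], so [r] translations move a coordinate by at most [r * rad * (1 + r0 ^+ 2)]. *)
Lemma BD_le r F G x (r0 r1 S S' : C) : Jhat x = 1 -> in_K r0 x -> 0 <= r0 ->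
  r0 + r%:R * rad * (1 + r0 ^+ 2) <= r1 ->
  (forall x, Jhat x = 1 -> in_K r1 x -> `|F x| <= S) ->
  (forall x, Jhat x = 1 -> in_K r1 x -> `|G x| <= S') ->
  `|BD M w rad r F G x| <= (n.+1%:R / rad ^+ 2) ^+ r * (S * S').
Proof.
move=> J1 [x1 x2] r0p r01 FS GS.
have r0r1 : r0 <= r1.
  by apply: le_trans r01; rewrite lerDl !mulr_ge0 ?addr_ge0 ?exprn_ge0 // ltW.
apply: le_trans (ler_norm_sum _ _ _) _.
apply: le_trans (_ : \sum_(K : {ffun 'I_r -> 'I_n.+1}) (rad ^- r * S) * (rad ^- r * S') <= _); last first.
  have -> (z : C) : \sum_(K : {ffun 'I_r -> 'I_n.+1}) z = n.+1%:R ^+ r * z.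
    by rewrite sumr_const card_ffun !card_ord -[LHS]mulr_natl natrX.
  rewrite expr_div_n exprAC -!exprVn expr2; have aux (y z : C) : y * (z * S * (z * S')) = y * (z * z) * (S * S') by ring.
  by rewrite aux.
apply: ler_sum => K _; rewrite !normrM normr_prod big1 => [|j _]; last exact: nu_norm1.
rewrite mul1r; apply: ler_pM => //.
  have := @dlts_le R n M w rad M1 wP rad0 (vdirs x K) (fun y => F (x.1, y)) x.2 S.
  rewrite size_vdirs; apply=> zs zsP; apply: FS; first exact: Jhat_shift.
  split=> l /=; first exact: le_trans r0r1.
  apply: le_trans r01; have := @shift_le x.2 zs (vdirs x K) (1 + r0 ^+ 2) r0 l zsP.
  rewrite size_vdirs; apply=> // v /vdirsP[k ->]; exact: dir_le.
have := @dlts_le R n M w rad M1 wP rad0 (udirs x K) (fun y => G (y, x.2)) x.1 S'.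
rewrite size_udirs; apply=> zs zsP; apply: GS; first exact: Jhat_shiftl.
split=> l /=; last exact: le_trans r0r1.
apply: le_trans r01; have := @shift_le x.1 zs (udirs x K) (1 + r0 ^+ 2) r0 l zsP.
rewrite size_udirs; apply=> // v /udirsP[k ->]; exact: dir_le.
Qed.
End Root.
End StarOperators.

(** * Growth of the coefficients in [r] *)

Section StarCoefficients.
Variable R : realType.
Local Notation C := (Cplx R).

(** [r ^ r] is at most [(r + r) ^_ r], which is a central binomial coefficient times [r!], and that
    coefficient is at most [4 ^ r]. *)
Lemma expn_self_le r : (r ^ r <= 4 ^ r * r`!)%N.
Proof.
have h1 : (r ^ r <= (r + r) ^_ r)%N.
  rewrite ffact_prod -[X in (_ ^ X <= _)%N](card_ord r) -prod_nat_const.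
  by apply: leq_prod => i _; have := ltn_ord i; lia.
apply: leq_trans h1 _; rewrite -bin_ffact leq_mul2r; apply/orP; right.
have -> : (4 ^ r = 2 ^ (r + r))%N by rewrite -[4%N]/(2 ^ 2)%N -expnM mul2n addnn.
rewrite -[2%N]/(1 + 1)%N expnDn.
have rr : (r < (r + r).+1)%N by rewrite ltnS leq_addr.
by rewrite (bigD1 (Ordinal rr)) //= !exp1n !muln1 leq_addr.
Qed.

Variable h : C.
Hypothesis hadm : forall k : nat, (1 <= k)%N -> h <> k%:R^-1.

Lemma admissible j : (1 <= j)%N -> 1 - j%:R * h != 0.
Proof.
move=> j1; apply/eqP => e; apply: (hadm j1).
have j0 : j%:R != 0 :> C by rewrite pnatr_eq0 -lt0n.
apply: (mulfI j0); rewrite mulfV //; apply/eqP; rewrite -subr_eq0 -opprB oppr_eq0.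
by apply/eqP.
Qed.

(** For [j] at least 2 / |h| the term [j * h] dominates and half of its modulus is a lower bound;
    the finitely many other [j] use that [h] is admissible. *)
Lemma denominator_ge : h != 0 -> exists2 c : C, 0 < c & forall j, (1 <= j)%N -> j%:R * c <= `|1 - j%:R * h|.
Proof.
move=> h0; have hp : 0 < `|h| by rewrite normr_gt0.
have [N NP] := natC_ge (divr_ge0 (ler0n C 2) (ltW hp)).
suff [c c0 cP] : exists2 c : C, 0 < c & forall j, (1 <= j < N)%N -> j%:R * c <= `|1 - j%:R * h|.
  have h2 : 0 < `|h| / 2 by rewrite divr_gt0.
  have [e [e0 ec eh]] := common_lt c0 h2; exists e => // j j1.
  have jp : 0 <= j%:R :> C by [].
  have [jN|Nj] := ltnP j N.
    by apply: le_trans (cP j _); [apply: ler_wpM2l => //; exact: ltW|rewrite j1].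
  have jh : 2 <= j%:R * `|h| by rewrite -ler_pdivrMr //; exact: NP.
  apply: le_trans (_ : j%:R * `|h| - 1 <= _); last first.
    by have := lerB_dist (j%:R * h) 1; rewrite normrM normr_nat normr1 distrC.
  apply: le_trans (_ : j%:R * (`|h| / 2) <= _); first by apply: ler_wpM2l => //; exact: ltW.
  rewrite mulrA lerBrDr; move: (j%:R * `|h|) jh => y y2.
  by rewrite [leRHS]splitr lerD2l ler_pdivlMr // mul1r.
elim: N {NP} => [|N [c c0 cP]]; first by exists 1 => // j; rewrite ltn0 andbF.
have [N0|N1] := posnP N; first by exists 1 => // j; rewrite N0 => /andP[j1]; rewrite ltnS leqNgt j1.
have Np : 0 < N%:R :> C by rewrite ltr0n.
have d0 : 0 < `|1 - N%:R * h| / N%:R by rewrite divr_gt0 // normr_gt0 admissible.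
have [e [e0 ec ed]] := common_lt c0 d0; exists e => // j /andP[j1]; rewrite ltnS leq_eqVlt => /orP[/eqP ->|jN].
  by rewrite mulrC -ler_pdivlMr //; exact: ltW.
apply: le_trans (cP j _); last by rewrite j1.
by apply: ler_wpM2l => //; exact: ltW.
Qed.

Lemma star_coef0 : star_coef h 0 = 1.
Proof. by rewrite /star_coef fact0 expr0 big_geq // invr1 !mulr1. Qed.

(** The denominator of the coefficient of index r + 1 is at least (r + 1)! c^r r!, and (r + 1)^(2r +
    2) is at most 16^(r + 1) (r + 1)!^2. There remains (r + 1) c (16 |h| / c)^(r + 1); the factor r
    + 1 is absorbed by 2^(r + 1), hence 32. The constant [c + 1] also covers index 0. *)
Lemma star_coef_bound : exists c B : C, [/\ 0 <= c, 0 <= B &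
  forall r, `|star_coef h r| * (r%:R ^+ r) ^+ 2 <= c * B ^+ r].
Proof.
have [h0|h0] := eqVneq h 0.
  exists 1, 1; split=> // -[|r]; first by rewrite star_coef0 normr1 expr0 expr1n.
  by rewrite /star_coef h0 expr0n /= mul0r mulr0 normr0 mul0r expr1n mulr1.
have [c c0 cP] := denominator_ge h0.
have B0 : 0 <= 32 * `|h| / c by rewrite divr_ge0 ?mulr_ge0 // ltW.
exists (c + 1), (32 * `|h| / c); split=> //; first by rewrite addr_ge0 // ltW.
move=> [|r]; first by rewrite star_coef0 normr1 !expr0 expr1n !mulr1 lerDr ltW.
have den : c ^+ r * r`!%:R <= `|\prod_(1 <= j < r.+1) (1 - j%:R * h)|.
  rewrite normr_prod; elim: r => [|r IH]; first by rewrite big_geq // fact0 expr0 mulr1.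
  rewrite big_nat_recr //= exprSr factS natrM.
  have -> : c ^+ r * c * (r.+1%:R * r`!%:R) = (c ^+ r * r`!%:R) * (r.+1%:R * c) by move: (r.+1%:R) (c ^+ r) (r`!%:R) => *; ring.
  apply: ler_pM; rewrite ?mulr_ge0 ?exprn_ge0 ?(ltW c0) //; exact: cP.
have fr0 : 0 < r`!%:R :> C by rewrite ltr0n fact_gt0.
have frS0 : 0 < r.+1`!%:R :> C by rewrite ltr0n fact_gt0.
have cr0 : 0 < c ^+ r by rewrite exprn_gt0.
have le1 : `|star_coef h r.+1| <= `|h| ^+ r.+1 / (r.+1`!%:R * (c ^+ r * r`!%:R)).
  rewrite /star_coef !normrM !normfV normrX normr_nat [leRHS]mulrC invfM -mulrA.
  apply: ler_wpM2l; first by rewrite invr_ge0 ltW.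
  rewrite [leRHS]mulrC; apply: ler_wpM2l; first by rewrite exprn_ge0.
  by rewrite lef_pV2 ?posrE ?mulr_gt0 //; apply: lt_le_trans den; rewrite mulr_gt0.
have le2 : (r.+1%:R ^+ r.+1 : C) ^+ 2 <= (4 ^+ r.+1 * r.+1`!%:R) ^+ 2.
  apply: lerXn2r; rewrite ?nnegrE ?exprn_ge0 ?mulr_ge0 ?exprn_ge0 //.
  by rewrite -!natrX -natrM ler_nat expn_self_le.
apply: le_trans (_ : `|h| ^+ r.+1 / (r.+1`!%:R * (c ^+ r * r`!%:R)) * (4 ^+ r.+1 * r.+1`!%:R) ^+ 2 <= _).
  by apply: ler_pM => //; rewrite exprn_ge0 // exprn_ge0.
have -> : `|h| ^+ r.+1 / (r.+1`!%:R * (c ^+ r * r`!%:R)) * (4 ^+ r.+1 * r.+1`!%:R) ^+ 2 =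
    r.+1%:R * (c * (16 * `|h| / c) ^+ r.+1) :> C.
  rewrite factS natrM exprMn [(16 * _ / c) ^+ _]exprMn [(16 * _) ^+ _]exprMn exprVn [c ^+ r.+1]exprS.
  have e16 : 4 ^+ 2 = 16 :> C by rewrite -natrX.
  rewrite -exprM mulnC exprM e16.
  have rS0 : r.+1%:R != 0 :> C by rewrite pnatr_eq0.
  move: (r.+1%:R) rS0 (`|h| ^+ r.+1) (r`!%:R) fr0 (c ^+ r) cr0 (16 ^+ r.+1) => N N0 H f f0 cr cr1 s.
  have f1 : f != 0 by rewrite gt_eqF.
  have cr2 : cr != 0 by rewrite gt_eqF.
  have c2 : c != 0 by rewrite gt_eqF.
  by field; rewrite ?N0 ?f1 ?cr2 ?c2.
have -> : 32 * `|h| / c = 2 * (16 * `|h| / c) by move: (`|h|) (c^-1) => *; ring.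
rewrite [(2 * _) ^+ _]exprMn; have q0 : 0 <= (16 * `|h| / c) ^+ r.+1.
  by rewrite exprn_ge0 // divr_ge0 ?mulr_ge0 // ltW.
move: (_ ^+ r.+1) q0 => q q0; rewrite mulrCA; apply: le_trans (_ : c * (2 ^+ r.+1 * q) <= _).
  apply: ler_wpM2l; first exact: ltW.
  by apply: ler_wpM2r => //; rewrite -natrX ler_nat ltnW // ltn_expl.
by apply: ler_wpM2r; [rewrite mulr_ge0 // exprn_ge0|rewrite lerDl].
Qed.
End StarCoefficients.

(** * The star product of bihomogeneous functions: bound and associativity *)

Section StarProduct.
Variables (R : realType) (n s : nat).
Local Notation C := (Cplx R).
Local Notation V := 'rV[C]_n.+1.
Local Notation Jhat := (@Jhat R n s).
Local Notation bev := (@bev R n s).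

Definition proot M : C := if M is M'.+1 then projT1 (cid (@prim_root_ex C M'.+1 isT)) else 1.

Lemma prootP M : (M.+1).-primitive_root (proot M.+1).
Proof. exact: (projT2 (cid (@prim_root_ex C M.+1 isT))). Qed.

(** The order [m.+2] exceeds both the degree [m] and 1, as exact differentiation requires. *)
Definition Bop m r (F G : V * V -> C) (x : V * V) : C := BD s m.+2 (proot m.+2) 1 r F G x.

(** The averages are exact derivatives on degrees below [M], whence the freedom in [M], [w] and
    [rad]; [starm_bound] takes a radius depending on [r]. *)
Lemma Bop_BD m r F G x M w rad : bev m m F -> bev m m G -> (m < M)%N -> (1 < M)%N -> M.-primitive_root w ->
  0 < rad -> Jhat x = 1 -> BD s M w rad r F G x = Bop m r F G x.
Proof.
move=> [L LP] [L' LP'] mM M1 wP rad0 J1.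
by rewrite (BD_ev M1 wP rad0 r mM J1 LP LP') /Bop (BD_ev _ (prootP m.+1) ltr01 r (leqnSn m.+1) J1 LP LP').
Qed.

Lemma Bop_gen m r L L' F G x : (forall x, Jhat x = 1 -> F x = ev m m L x) ->
  (forall x, Jhat x = 1 -> G x = ev m m L' x) -> Jhat x = 1 ->
  Bop m r F G x = \sum_(t <- L) \sum_(t' <- L') bgen s r m t t' x.
Proof.
by move=> LP LP' J1; rewrite /Bop (BD_ev _ (prootP m.+1) ltr01 r (leqnSn m.+1) J1 LP LP').
Qed.

Lemma Bop_raise m m' r F G x : (m <= m')%N -> bev m m F -> bev m m G -> Jhat x = 1 ->
  Bop m' r F G x = Bop m r F G x.
Proof.
move=> mm Fb Gb J1; apply: (Bop_BD r Fb Gb _ _ (prootP m'.+1) ltr01 J1) => //.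
by rewrite ltnS ltnW.
Qed.

Lemma Bop_gt m r F G x : (m < r)%N -> bev m m F -> bev m m G -> Jhat x = 1 -> Bop m r F G x = 0.
Proof.
move=> mr [L LP] [L' LP'] J1; rewrite (Bop_gen r LP LP' J1).
apply: big1 => t _; apply: big1 => t' _.
by rewrite /bgen ffact_small // expr0n mulr0 !mul0r.
Qed.

Lemma bev_Jhat : bev 1 1 Jhat.
Proof.
apply: bev_sum => k _; apply: (@bev_ext _ _ _ _ _ (fun x => nu R s k * (x.1 0 k * x.2 0 k))).
  by move=> x _; rewrite mulrA.
exact/bevZ/(bevM (bev_fst _ _ k) (bev_snd _ _ k)).
Qed.

Lemma bgen_bev r m t t' : (r <= m)%N -> bev (m + m) (m + m) (bgen s r m t t').
Proof.
move=> rm.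
have b1 := @bev_gen R n s m (m - r) 1 t.1.2 t.2.
have b2 := @bev_gen R n s (m - r) m 1 t'.1.2 t'.2.
have b3 : bev 1 1 (fun x => beta s t t' * Jhat x - dot t'.1.2 x.1 * dot t.2 x.2).
  apply: (@bev_ext _ _ _ _ _ (fun x => beta s t t' * Jhat x + gen_ev 1 1 (-1, t'.1.2, t.2) x)).
    by move=> x _; rewrite /gen_ev /= !expr1 mulN1r mulNr.
  by apply: bevD; [apply: bevZ; exact: bev_Jhat|exact: bev_gen].
have := bevM (bevM b1 b2) (bevX r b3); rewrite !muln1.
have -> : (m + (m - r) + r = m + m)%N by rewrite -addnA subnK.
have -> : (m - r + m + r = m + m)%N by rewrite -addnA [(m + r)%N]addnC addnA subnK.
move=> /(bevZ (t.1.1 * t'.1.1 * (m ^_ r)%:R ^+ 2)); apply: bev_ext => x _.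
have aux (k p q u v W : C) : k * (p * q * (u * v) * W) = k * (p * q) * (v * u) * W by ring.
by rewrite /gen_ev /bgen /= !mul1r; exact: aux.
Qed.

Lemma Bop_bev m r F G : bev m m F -> bev m m G -> bev (m + m) (m + m) (Bop m r F G).
Proof.
move=> Fb Gb; have [mr|rm] := ltnP m r.
  by apply: (bev_ext _ (@bev0 R n s (m + m) (m + m))) => x J1; rewrite Bop_gt.
have [L LP] := Fb; have [L' LP'] := Gb.
apply: (@bev_ext _ _ _ _ _ (fun x => \sum_(t <- L) \sum_(t' <- L') bgen s r m t t' x)).
  by move=> x J1; rewrite (Bop_gen r LP LP' J1).
by apply: bev_sum => t _; apply: bev_sum => t' _; exact: bgen_bev.
Qed.

Lemma Bop_linl m r a F F' G x : Bop m r (fun x => a * F x + F' x) G x = a * Bop m r F G x + Bop m r F' G x.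
Proof. exact: (@BD_linl R n s m.+2 (proot m.+2) 1 isT (prootP m.+1)). Qed.

Lemma Bop_linr m r a F G G' x : Bop m r F (fun x => a * G x + G' x) x = a * Bop m r F G x + Bop m r F G' x.
Proof. exact: (@BD_linr R n s m.+2 (proot m.+2) 1 isT (prootP m.+1)). Qed.

Lemma Bop_eq m r F F' G G' x : Jhat x = 1 ->
  (forall x, Jhat x = 1 -> F x = F' x) -> (forall x, Jhat x = 1 -> G x = G' x) ->
  Bop m r F G x = Bop m r F' G' x.
Proof. by move=> J1 FF GG; exact: (@BD_eq R n s m.+2 (proot m.+2) 1 isT (prootP m.+1)). Qed.

Lemma Bop_suml m r (I : Type) (q : seq I) (a : I -> C) (F : I -> V * V -> C) G x :
  Bop m r (fun x => \sum_(i <- q) a i * F i x) G x = \sum_(i <- q) a i * Bop m r (F i) G x.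
Proof.
have B0 : Bop m r (fun=> 0) G x = 0.
  have := Bop_linl m r 1 (fun=> 0) (fun=> 0) G x.
  rewrite (_ : (fun _ : V * V => 1 * 0 + 0) = (fun=> 0)); last by apply/funext => z; rewrite mulr0 addr0.
  by rewrite mul1r => /eqP; rewrite addrC -subr_eq subrr eq_sym => /eqP.
elim: q => [|i q IH].
  rewrite big_nil -[RHS]B0.
  by rewrite (_ : (fun x => \sum_(i <- [::]) a i * F i x) = fun=> 0) //; apply/funext => z; rewrite big_nil.
rewrite big_cons -IH -Bop_linl.
by rewrite (_ : (fun x => \sum_(j <- i :: q) a j * F j x) = fun x => a i * F i x + \sum_(j <- q) a j * F j x) //;
  apply/funext => z; rewrite big_cons.
Qed.

Lemma Bop_sumr m r (I : Type) (q : seq I) (a : I -> C) F (G : I -> V * V -> C) x :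
  Bop m r F (fun x => \sum_(i <- q) a i * G i x) x = \sum_(i <- q) a i * Bop m r F (G i) x.
Proof.
have B0 : Bop m r F (fun=> 0) x = 0.
  have := Bop_linr m r 1 F (fun=> 0) (fun=> 0) x.
  rewrite (_ : (fun _ : V * V => 1 * 0 + 0) = (fun=> 0)); last by apply/funext => z; rewrite mulr0 addr0.
  by rewrite mul1r => /eqP; rewrite addrC -subr_eq subrr eq_sym => /eqP.
elim: q => [|i q IH].
  rewrite big_nil -[RHS]B0.
  by rewrite (_ : (fun x => \sum_(i <- [::]) a i * G i x) = fun=> 0) //; apply/funext => z; rewrite big_nil.
rewrite big_cons -IH -Bop_linr.
by rewrite (_ : (fun x => \sum_(j <- i :: q) a j * G j x) = fun x => a i * G i x + \sum_(j <- q) a j * G j x) //;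
  apply/funext => z; rewrite big_cons.
Qed.
Opaque Bop.

(** By [starm_raise] the value does not depend on [m] once both factors have bidegree [(m, m)] on
    [Zhat]. *)
Definition starm (h : C) m (F G : V * V -> C) (x : V * V) : C :=
  \sum_(r < m.+1) star_coef h r * Bop m r F G x.

Lemma starm_bev h m F G : bev m m F -> bev m m G -> bev (m + m) (m + m) (starm h m F G).
Proof. by move=> Fb Gb; apply: bev_sum => r _; apply/bevZ/Bop_bev. Qed.

Lemma starm_eq h m F F' G G' x : Jhat x = 1 ->
  (forall x, Jhat x = 1 -> F x = F' x) -> (forall x, Jhat x = 1 -> G x = G' x) ->
  starm h m F G x = starm h m F' G' x.
Proof. by move=> J1 FF GG; apply: eq_bigr => r _; rewrite (Bop_eq _ _ J1 FF GG). Qed.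

Lemma starm_raise h m m' F G x : (m <= m')%N -> bev m m F -> bev m m G -> Jhat x = 1 ->
  starm h m' F G x = starm h m F G x.
Proof.
move=> mm Fb Gb J1; rewrite /starm -!(big_mkord xpredT (fun r => star_coef h r * Bop _ r F G x)).
rewrite (@big_cat_nat _ _ _ m.+1) //= [X in _ + X]big1_seq => [|r /andP[_]]; last first.
  rewrite mem_index_iota => /andP[mr _].
  by rewrite (Bop_raise r mm Fb Gb J1) Bop_gt // mulr0.
by rewrite addr0; apply: eq_bigr => r _; rewrite (Bop_raise r mm Fb Gb J1).
Qed.

Lemma starm_linl h m a F F' G x : starm h m (fun x => a * F x + F' x) G x =
  a * starm h m F G x + starm h m F' G x.
Proof.
rewrite /starm mulr_sumr -big_split; apply: eq_bigr => r _ /=.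
by rewrite Bop_linl mulrDr mulrCA.
Qed.

Lemma starm_linr h m a F G G' x : starm h m F (fun x => a * G x + G' x) x =
  a * starm h m F G x + starm h m F G' x.
Proof.
rewrite /starm mulr_sumr -big_split; apply: eq_bigr => r _ /=.
by rewrite Bop_linr mulrDr mulrCA.
Qed.

(** [r1] and [K] are found before [m], [F] and [G]; this uniformity in the degree is what carries
    the product to limits. The [r]-th term is bounded by a multiple of 2^-r. *)
Theorem starm_bound (h : C) : (forall k : nat, (1 <= k)%N -> h <> k%:R^-1) ->
  forall r0 : C, 0 < r0 -> exists r1 K : C, [/\ 0 < r1, 0 <= K &
  forall m F G (S S' : C), bev m m F -> bev m m G ->
    (forall x, Jhat x = 1 -> in_K r1 x -> `|F x| <= S) ->
    (forall x, Jhat x = 1 -> in_K r1 x -> `|G x| <= S') ->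
    forall x, Jhat x = 1 -> in_K r0 x -> `|starm h m F G x| <= K * (S * S')].
Proof.
move=> hadm r0 r00; have [c [B [c0 B0 cB]]] := star_coef_bound hadm.
(* At least 1 and at least [2 * (B * n.+1%:R)], so that [B * n.+1%:R / R0 ^+ 2] is at most 1/2. *)
pose R0 : C := 2 * (B * n.+1%:R) + 1.
have Bn0 : 0 <= B * n.+1%:R by rewrite mulr_ge0.
have R01 : 1 <= R0 by rewrite /R0 lerDr mulr_ge0.
have R00 : 0 < R0 by apply: lt_le_trans R01.
have q2 : B * n.+1%:R / R0 ^+ 2 <= 2^-1.
  rewrite ler_pdivrMr ?exprn_gt0 // ler_pdivlMl //; apply: le_trans (_ : R0 <= _).
    by rewrite /R0 lerDl.
  by rewrite expr2 ler_peMl // ltW.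
pose r1 := r0 + R0 * (1 + r0 ^+ 2).
have r10 : 0 < r1.
  by rewrite addr_gt0 // mulr_gt0 // ltr_pwDl // exprn_ge0 // ltW.
exists r1, (c * 2); split=> //; first by rewrite mulr_ge0.
move=> m F G S S' Fb Gb FS GS x J1 xK.
have S0 : 0 <= S * S'.
  have [k0 k1] : Jhat x = 1 /\ in_K r1 x.
    split=> //; case: xK => x1 x2; have rr : r0 <= r1.
      by rewrite lerDl mulr_ge0 ?(ltW R00) // addr_ge0 // exprn_ge0 // ltW.
    by split=> k; apply: le_trans rr.
  by apply: mulr_ge0; [apply: le_trans (FS x k0 k1)|apply: le_trans (GS x k0 k1)].
have term r : `|star_coef h r * Bop m r F G x| <= c * 2^-1 ^+ r * (S * S').
  (* The total displacement [r * rad] stays at [R0], while rad^(-2r) produces r^(2r), which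
     [star_coef_bound] compensates. *)
  pose rad : C := if r is 0 then 1 else R0 / r%:R.
  have rad0 : 0 < rad by rewrite /rad; case: (r) => // r'; rewrite divr_gt0.
  have rr : r0 + r%:R * rad * (1 + r0 ^+ 2) <= r1.
    rewrite lerD2l; apply: ler_wpM2r; first by rewrite addr_ge0 // exprn_ge0 // ltW.
    by rewrite /rad; case: (r) => [|r']; [rewrite mul0r ltW|rewrite mulrCA mulfV ?mulr1 // pnatr_eq0].
  have := BD_le (isT : (1 < m.+2)%N) (prootP m.+1) rad0 J1 xK (ltW r00) rr FS GS.
  rewrite (Bop_BD r Fb Gb _ _ (prootP m.+1) rad0 J1) // => le.
  rewrite normrM; apply: le_trans (ler_wpM2l (normr_ge0 _) le) _; rewrite [leLHS]mulrA; apply: ler_wpM2r => //.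
  have -> : (n.+1%:R / rad ^+ 2) ^+ r = (r%:R ^+ r) ^+ 2 * (n.+1%:R / R0 ^+ 2) ^+ r :> C.
    rewrite /rad; case: (r) => [|r']; first by rewrite !expr0 expr1n mulr1.
    rewrite exprAC -exprMn; congr (_ ^+ _); have rS : r'.+1%:R != 0 :> C by rewrite pnatr_eq0.
    by rewrite [X in _ / X]expr_div_n invf_div mulrCA.
  rewrite mulrA; apply: le_trans (_ : c * B ^+ r * (n.+1%:R / R0 ^+ 2) ^+ r <= _).
    by apply: ler_wpM2r => //; rewrite exprn_ge0 // divr_ge0 // exprn_ge0 // ltW.
  rewrite -mulrA -exprMn mulrA; apply: ler_wpM2l => //; apply: lerXn2r => //; rewrite nnegrE ?invr_ge0 //.
  by rewrite divr_ge0 // exprn_ge0 // ltW.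
apply: le_trans (ler_norm_sum _ _ _) _.
apply: le_trans (_ : \sum_(r < m.+1) c * 2^-1 ^+ r * (S * S') <= _); first by apply: ler_sum => r _; exact: term.
rewrite -mulr_suml; apply: ler_wpM2r => //; rewrite -mulr_sumr; apply: ler_wpM2l => //.
have h0 : 0 <= 2^-1 :> C by rewrite invr_ge0.
have h1 : 2^-1 < 1 :> C by rewrite invf_lt1 // ltr1n.
have := geometric_le 0 m.+1 h0 h1; rewrite big_mkord => le; apply: le_trans le _.
have -> : 1 - 2^-1 = 2^-1 :> C by field.
by rewrite expr0 invrK mul1r.
Qed.

(* At hbar = 1/k the product multiplies the kernels of degree k. *)
Definition comp k (L L' : seq (C * V * V)) : seq (C * V * V) :=
  [seq (t.1.1 * t'.1.1 * beta s t t' ^+ k, t.1.2, t'.2) | t <- L, t' <- L'].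

Lemma ev_comp k L L' x : ev k k (comp k L L') x =
  \sum_(t <- L) \sum_(t' <- L') gen_ev k k (t.1.1 * t'.1.1 * beta s t t' ^+ k, t.1.2, t'.2) x.
Proof. by rewrite /ev big_allpairs_dep. Qed.

(** [k ^_ r] is k^r times the denominator product at hbar = 1/k, which has no zero factor as long as
    [r <= k]. *)
Lemma star_coef_inv k r : (0 < k)%N -> (r <= k)%N ->
  star_coef (k%:R^-1 : C) r * (k ^_ r)%:R ^+ 2 = 'C(k, r)%:R.
Proof.
move=> k0 rk; have kn0 : k%:R != 0 :> C by rewrite pnatr_eq0 -lt0n.
pose P q : C := \prod_(1 <= j < q) (1 - j%:R * k%:R^-1).
have PE q : (q <= k)%N -> (k ^_ q)%:R = k%:R ^+ q * P q.
  elim: q => [|[|q] IH] qk; first by rewrite ffactn0 /P big_geq // mulr1.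
    by rewrite ffactn1 /P big_geq // mulr1 expr1.
  rewrite ffactnSr natrM natrB ?(ltnW qk) // IH ?(ltnW qk) // /P [in RHS]big_nat_recr //=.
  rewrite [k%:R ^+ q.+2]exprSr; move: (k%:R) kn0 (q.+1%:R) (k%:R ^+ q.+1) (\prod_(1 <= j < q.+1) _) => u u0 z x y.
  by field.
have f0 : (k ^_ r)%:R != 0 :> C by rewrite pnatr_eq0 -lt0n ffact_gt0.
have P0 : P r != 0 by apply: contra f0; rewrite PE // => /eqP ->; rewrite mulr0.
have kr0 : k%:R ^+ r != 0 :> C by rewrite expf_neq0.
have rf0 : r`!%:R != 0 :> C by rewrite pnatr_eq0 -lt0n fact_gt0.
have : 'C(k, r)%:R * r`!%:R = (k ^_ r)%:R :> C by rewrite -natrM bin_ffact.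
rewrite /star_coef -/(P r) exprVn; move=> e.
have -> : 'C(k, r)%:R = (k ^_ r)%:R / r`!%:R :> C by rewrite -e mulfK.
rewrite (PE r rk); move: (P r) P0 (k%:R ^+ r) kr0 (r`!%:R) rf0 => p p0 q q0 u u0.
by field; rewrite ?p0 ?q0 ?u0.
Qed.

(** With A = (a'.xi)(b.eta) the sum over [r] is the binomial expansion of (A + (beta - A))^k, which
    is beta^k. *)
Lemma starm_special k L L' F G x : (0 < k)%N -> (forall x, Jhat x = 1 -> F x = ev k k L x) ->
  (forall x, Jhat x = 1 -> G x = ev k k L' x) -> Jhat x = 1 ->
  starm (k%:R^-1) k F G x = ev k k (comp k L L') x.
Proof.
move=> k0 LP LP' J1; rewrite ev_comp /starm.
transitivity (\sum_(r < k.+1) \sum_(t <- L) \sum_(t' <- L') star_coef (k%:R^-1) r * bgen s r k t t' x).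
  apply: eq_bigr => r _; rewrite (Bop_gen r LP LP' J1) mulr_sumr; apply: eq_bigr => t _.
  by rewrite mulr_sumr.
rewrite exchange_big; apply: eq_bigr => t _; rewrite exchange_big; apply: eq_bigr => t' _ /=.
transitivity (t.1.1 * t'.1.1 * dot t.1.2 x.1 ^+ k * dot t'.2 x.2 ^+ k *
  ((dot t'.1.2 x.1 * dot t.2 x.2) + (beta s t t' - dot t'.1.2 x.1 * dot t.2 x.2)) ^+ k); last first.
  by rewrite addrC subrK /gen_ev /=; move: (beta s t t' ^+ k) (_ ^+ k) (_ ^+ k) => *; ring.
rewrite exprDn mulr_sumr; apply: eq_bigr => r _.
have rk : (r <= k)%N by rewrite -ltnS.
rewrite /bgen J1 mulr1 -[_ *+ 'C(k, r)]mulr_natl -(star_coef_inv k0 rk) [(_ * _) ^+ (k - r)]exprMn.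
have aux (c c' f S a b p q W : C) : S * (c * c' * f ^+ 2 * (a * q) * (b * p) * W) =
  c * c' * a * b * (S * f ^+ 2 * (p * q * W)) by ring.
exact: aux.
Qed.

Lemma comp_assoc k L L' L'' x : ev k k (comp k (comp k L L') L'') x = ev k k (comp k L (comp k L' L'')) x.
Proof.
rewrite !ev_comp /comp big_allpairs_dep; apply: eq_bigr => t _.
rewrite big_allpairs_dep; apply: eq_bigr => t' _; apply: eq_bigr => t'' _.
rewrite /gen_ev /=; congr (_ * _ * _); rewrite /beta /=.
by move: (_ ^+ k) (_ ^+ k) => *; ring.
Qed.

Lemma starm_assoc_special k m F G H x : (0 < k)%N -> (m + m <= k)%N ->
  bev m m F -> bev m m G -> bev m m H -> Jhat x = 1 ->
  starm (k%:R^-1) (m + m) (starm (k%:R^-1) m F G) H x = starm (k%:R^-1) (m + m) F (starm (k%:R^-1) m G H) x.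
Proof.
move=> k0 mk Fb Gb Hb J1; have m2 : (m <= m + m)%N by exact: leq_addr.
have mk' := leq_trans m2 mk.
have [L LP] := bev_raise mk' Fb; have [L' LP'] := bev_raise mk' Gb; have [L'' LP''] := bev_raise mk' Hb.
have e1 y : Jhat y = 1 -> starm (k%:R^-1) m F G y = ev k k (comp k L L') y.
  by move=> Jy; rewrite -(starm_raise _ mk' Fb Gb Jy); exact: starm_special.
have e2 y : Jhat y = 1 -> starm (k%:R^-1) m G H y = ev k k (comp k L' L'') y.
  by move=> Jy; rewrite -(starm_raise _ mk' Gb Hb Jy); exact: starm_special.
rewrite -(starm_raise _ mk (starm_bev _ Fb Gb) (bev_raise m2 Hb) J1).
rewrite -(starm_raise _ mk (bev_raise m2 Fb) (starm_bev _ Gb Hb) J1).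
by rewrite (starm_special k0 e1 LP'' J1) (starm_special k0 LP e2 J1) comp_assoc.
Qed.

(** * Associativity as a rational identity in hbar *)

Section Associativity.
Variables (N : nat).

Definition den (h : C) : C := \prod_(1 <= j < N.+1) (1 - j%:R * h).

(** The polynomial with value [star_coef h r * den h]. The lower bound [maxn r 1] accounts for the
    empty product in [star_coef] at [r = 0]. *)
Definition num (r : nat) : {poly C} :=
  (r`!%:R^-1)%:P * 'X^r * \prod_(maxn r 1 <= j < N.+1) (1 - j%:R%:P * 'X).

Lemma star_coef_num h r : (r <= N)%N -> den h != 0 -> star_coef h r * den h = (num r).[h].
Proof.
move=> rN d0; rewrite /num !hornerM hornerC hornerXn horner_prod.
have -> : \prod_(maxn r 1 <= j < N.+1) (1 - j%:R%:P * 'X : {poly C}).[h] =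
   \prod_(maxn r 1 <= j < N.+1) (1 - j%:R * h).
  by apply: eq_bigr => j _; rewrite !hornerE.
have e : den h = \prod_(1 <= j < r) (1 - j%:R * h) * \prod_(maxn r 1 <= j < N.+1) (1 - j%:R * h).
  rewrite /den; case: r rN => [|r] rN; first by rewrite [X in X * _]big_geq // mul1r.
  by rewrite (maxn_idPl _) // -big_cat_nat //= ltnW.
move: d0; rewrite e mulf_eq0 negb_or => /andP[p0 _].
rewrite /star_coef; move: (\prod_(1 <= j < r) _) p0 (\prod_(maxn r 1 <= j < N.+1) _) => p p0 q.
by rewrite -!mulrA; congr (_ * (_ * _)); rewrite mulKf.
Qed.

(** After multiplication by [den ^+ 2] the sum is a polynomial in [h] with the infinitely many roots
    1/k, k > N. *)
Lemma rational_identity (P : nat -> nat -> C) (h : C) :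
  (forall k, (N < k)%N -> \sum_(i < N.+1) \sum_(j < N.+1)
     star_coef (k%:R^-1) i * star_coef (k%:R^-1) j * P i j = 0) ->
  den h != 0 -> \sum_(i < N.+1) \sum_(j < N.+1) star_coef h i * star_coef h j * P i j = 0.
Proof.
move=> special d0; pose q : {poly C} := \sum_(i < N.+1) \sum_(j < N.+1) num i * num j * (P i j)%:P.
have qE y : den y != 0 -> q.[y] = den y ^+ 2 * (\sum_(i < N.+1) \sum_(j < N.+1) star_coef y i * star_coef y j * P i j).
  move=> y0; rewrite /q horner_sum mulr_sumr; apply: eq_bigr => i _.
  rewrite horner_sum mulr_sumr; apply: eq_bigr => j _.
  rewrite hornerM hornerM hornerC.
  have iN : (i <= N)%N by rewrite -ltnS.
  have jN : (j <= N)%N by rewrite -ltnS.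
  rewrite -(star_coef_num iN y0) -(star_coef_num jN y0).
  by move: (star_coef y i) (star_coef y j) (P i j) (den y) => *; ring.
have denk k : (N < k)%N -> den (k%:R^-1) != 0.
  move=> Nk; rewrite /den prodf_seq_neq0; apply/allP => j; rewrite mem_index_iota => /andP[j1 jN] /=.
  have k0 : k%:R != 0 :> C by rewrite pnatr_eq0 -lt0n (leq_ltn_trans _ Nk).
  rewrite subr_eq0; apply/eqP => e; have := congr1 (fun z => z * k%:R) e.
  rewrite mul1r divfK // => /eqP; rewrite eqr_nat => /eqP kj.
  by move: jN; rewrite ltnS -kj leqNgt Nk.
have q0 : q = 0.
  apply/eqP/negP => /negP qn0.
  have := @max_poly_roots _ q [seq k%:R^-1 | k <- iota N.+1 (size q)] qn0.
  rewrite map_inj_uniq ?iota_uniq ?size_map ?size_iota ?ltnn; last first.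
    by move=> k l /invr_inj/eqP; rewrite eqr_nat => /eqP.
  suff -> : all (root q) [seq k%:R^-1 | k <- iota N.+1 (size q)] by move=> /(_ isT isT).
  apply/allP => y /mapP[k]; rewrite mem_iota => /andP[Nk _] ->.
  by rewrite /root qE ?denk // special // mulr0.
have := qE h d0; rewrite q0 horner0 => /esym/eqP; rewrite mulf_eq0 expf_eq0 (negPf d0) /=.
by move=> /eqP.
Qed.
End Associativity.

(** The operators [Bop] do not involve hbar, so the associator is a fixed bilinear form in the
    coefficients and [rational_identity] applies to it. *)
Theorem starm_assoc (h : C) m F G H x : (forall k : nat, (1 <= k)%N -> h <> k%:R^-1) ->
  bev m m F -> bev m m G -> bev m m H -> Jhat x = 1 ->
  starm h (m + m) (starm h m F G) H x = starm h (m + m) F (starm h m G H) x.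
Proof.
move=> hadm Fb Gb Hb J1; have m2 : (m <= m + m)%N by exact: leq_addr.
pose N := (m + m)%N.
pose P i j := Bop N i (Bop N j F G) H x - Bop N i F (Bop N j G H) x.
have E g : starm g N (starm g m F G) H x - starm g N F (starm g m G H) x =
   \sum_(i < N.+1) \sum_(j < N.+1) star_coef g i * star_coef g j * P i j.
  have -> : starm g N (starm g m F G) H x = starm g N (starm g N F G) H x.
    by apply: starm_eq => // y Jy; rewrite (starm_raise _ m2 Fb Gb Jy).
  have -> : starm g N F (starm g m G H) x = starm g N F (starm g N G H) x.
    by apply: starm_eq => // y Jy; rewrite (starm_raise _ m2 Gb Hb Jy).
  rewrite /starm -sumrB; apply: eq_bigr => i _.
  rewrite (Bop_suml N i (index_enum 'I_N.+1) (fun j => star_coef g j) (fun j => Bop N j F G) H x).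
  rewrite (Bop_sumr N i (index_enum 'I_N.+1) (fun j => star_coef g j) F (fun j => Bop N j G H) x).
  rewrite -mulrBr -sumrB mulr_sumr; apply: eq_bigr => j _.
  by rewrite /P -mulrBr mulrA.
apply/eqP; rewrite -subr_eq0 -/N E; apply/eqP.
apply: rational_identity => [k Nk|].
  by rewrite -E starm_assoc_special ?subrr //; [exact: leq_ltn_trans Nk|exact: ltnW].
rewrite /den prodf_seq_neq0; apply/allP => j; rewrite mem_index_iota => /andP[j1 _] /=.
exact: (@admissible R h hadm j j1).
Qed.
End StarProduct.

(** * The topology of locally uniform convergence of the extensions *)

Section LocallyUniformTopology.
Variables (R : realType) (n s : nat).
Hypothesis s0 : (0 < s)%N.
Local Notation C := (Cplx R).
Local Notation V := 'rV[C]_n.+1.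
Local Notation Jhat := (@Jhat R n s).
Local Notation AM := (AMred R n s).
Local Notation PM := (PMred R n s).
Local Notation Zh := (@Zhat R n s).

Definition KK (r : C) : set (Mhat R n s) := [set p | exists y : Zh, p = clshat y /\ in_K r (set_val y)].

Lemma set_val_nbhs (y : Zh) (N : set (V * V)) : nbhs (set_val y) N -> nbhs y (set_val @^-1` N).
Proof. exact: (@initial_continuous _ _ (set_val : Zh -> V * V) y). Qed.

Lemma nbhs_set_val (y : Zh) (N : set Zh) : nbhs y N ->
  exists2 N' : set (V * V), nbhs (set_val y) N' & forall y', N' (set_val y') -> N y'.
Proof.
move=> [_ [[N' N'o <-] N'y N'N]]; exists N'; first by apply: open_nbhs_nbhs; split.
by move=> y' h; exact: N'N.
Qed.

Lemma compact_K (r : C) : 0 <= r -> compact [set x : V * V | Jhat x = 1 /\ in_K r x].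
Proof.
move=> r0; have cK := compact_setX (@compact_polydisc R n.+1 r r0) (@compact_polydisc R n.+1 r r0).
apply: (subclosed_compact _ cK); last by move=> x [_ [x1 x2]]; split.
have -> : [set x : V * V | Jhat x = 1 /\ in_K r x] =
   (Jhat @^-1` [set 1]) `&` ([set v : V | forall i, `|v 0 i| <= r] `*` [set v : V | forall i, `|v 0 i| <= r]).
  by apply/seteqP; split=> x [? [? ?]]; split.
apply: closedI.
  apply: closed_comp; last by apply: compact_closed (@compact_set1 _ (1 : C)); exact: norm_hausdorff.
  by move=> x _; exact/differentiable_continuous/Jhat_differentiable.
by apply: compact_closed cK; exact: norm_hausdorff.
Qed.

Lemma compact_Zhat (r : C) : 0 <= r -> compact [set y : Zh | in_K r (set_val y)].
Proof.
move=> r0 F FF FA.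
pose F' : set_system (V * V) := (set_val : Zh -> V * V) @ F.
have F'P : ProperFilter F' by exact: fmap_proper_filter.
have F'A : F' [set x : V * V | Jhat x = 1 /\ in_K r x].
  apply: (@filterS Zh F _ [set y : Zh | in_K r (set_val y)] _ _ FA) => y yK.
  by split; [exact: (@Zhat_JhatP R n s y)|exact: yK].
have [a [[Ja aK] aC]] := @compact_K r r0 F' F'P F'A.
have [y ye] := ZhatP Ja; exists y; split; first by rewrite /= ye.
move=> P N FP /nbhs_set_val[N' N'y N'N].
rewrite ye in N'y.
have F'im : F' [set x | exists2 p : Zh, P p & set_val p = x].
  by apply: (@filterS Zh F _ P _ _ FP) => p Pp; exists p.
have [b [[p Pp pb] N'b]] := aC _ N' F'im N'y.
by exists p; split => //; apply: N'N; rewrite pb.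
Qed.

Lemma compact_KK (r : C) : 0 <= r -> compact (KK r).
Proof.
move=> r0; have -> : KK r = (@clshat R n s) @` [set y : Zh | in_K r (set_val y)].
  by apply/seteqP; split=> [p [y [-> yK]]|_ [y yK <-]]; exists y.
apply: continuous_compact (compact_Zhat r0).
by apply: continuous_subspaceT; exact: pi_continuous.
Qed.

Lemma KK_le (r r' : C) : r <= r' -> KK r `<=` KK r'.
Proof.
by move=> rr p [y [-> [y1 y2]]]; exists y; split => //; split=> k; apply: le_trans rr.
Qed.

Lemma norm_nbhs (U : normedModType C) (v : U) (a c : C) : a != 0 -> `|a *: v| < c ->
  nbhs v [set u | `|a *: u| < c].
Proof.
move=> a0 vc; have ap : 0 < `|a| by rewrite normr_gt0.
have d0 : 0 < (c - `|a *: v|) / `|a| by rewrite divr_gt0 // subr_gt0.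
apply/nbhs_ballP; exists ((c - `|a *: v|) / `|a|) => //= u.
rewrite -ball_normE /= ltr_pdivlMr // => h.
have -> : a *: u = a *: v - a *: (v - u) by rewrite scalerBr opprB addrC subrK.
apply: le_lt_trans (ler_normB _ _) _.
by rewrite [`|a *: (v - u)|]normrZ mulrC addrC -ltrBrDr.
Qed.

Lemma nbhs_pair (T T' : topologicalType) (x : T * T') (A : set T) (B : set T') :
  nbhs x.1 A -> nbhs x.2 B -> nbhs x [set y | A y.1 /\ B y.2].
Proof. by move=> nA nB; exists (A, B). Qed.

(** An open set of the quotient is the image of a saturated open set, so [O] asks only that some
    point of the orbit be small; that point is then the representative in the polydisc. *)
Lemma KK_nbhs (p : Mhat R n s) : exists N : nat, nbhs p (KK N%:R).
Proof.
have [y ->] := Mhat_clshat p.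
have [N NP] := natC_ge (addr_ge0 (normr_ge0 (set_val y).1) (normr_ge0 (set_val y).2)).
pose c : C := N.+1%:R; exists N.+1.
pose O : set Zh := [set y' | exists2 a : C, a != 0 & `|a *: (set_val y').1| < c /\ `|a^-1 *: (set_val y').2| < c].
have Oy : O y.
  exists 1; rewrite ?oner_eq0 // invr1 !scale1r; have := NP N (leqnn N) => le.
  by split; apply: le_lt_trans (_ : N%:R < c); rewrite ?ltr_nat //; apply: le_trans le; rewrite ?lerDl ?lerDr.
have Oopen : open O.
  rewrite openE => y' [a a0 [y1 y2]]; rewrite /interior.
  have av0 : a^-1 != 0 by rewrite invr_eq0.
  have h : nbhs (set_val y') [set x : V * V | `|a *: x.1| < c /\ `|a^-1 *: x.2| < c].
    have n1 := @norm_nbhs V (set_val y').1 a c a0 y1.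
    have n2 := @norm_nbhs V (set_val y').2 a^-1 c av0 y2.
    exact: nbhs_pair n1 n2.
  by apply: filterS (set_val_nbhs h) => y'' h''; exists a.
have piO : (@clshat R n s) @^-1` ((@clshat R n s) @` O) = O.
  apply/seteqP; split=> [y' [y'' [a a0 [h1 h2]] e]|y' h]; last by exists y'.
  move: e => /eqquotP /= /asboolP[b b0 e].
  exists (a / b); first by rewrite mulf_neq0 ?invr_eq0.
  have e1 : (a / b) *: (set_val y').1 = a *: (set_val y'').1 by rewrite e scalerA divfK.
  have e2 : (a / b)^-1 *: (set_val y').2 = a^-1 *: (set_val y'').2.
    by rewrite e scalerA invfM invrK -mulrA mulfV // mulr1.
  by rewrite e1 e2.
have : nbhs (clshat y) ((@clshat R n s) @` O).
  apply: open_nbhs_nbhs; split; last by exists y.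
  by rewrite /open /= /quotient_open; move: Oopen; rewrite -{1}piO.
apply: filterS => _ [y' [a a0 [h1 h2]] <-].
have [y'' e] : exists y'' : Zh, set_val y'' = (a *: (set_val y').1, a^-1 *: (set_val y').2).
  by apply: ZhatP; rewrite JhatZ mulfV // mul1r Zhat_JhatP.
exists y''; split; first exact: clshat_eq e.
by rewrite e; split=> k /=; apply: le_trans (rv_coord_le _ _) (ltW _).
Qed.

Lemma compact_sub_KK (K : set (Mhat R n s)) : compact K -> exists N : nat, K `<=` KK N%:R.
Proof.
move=> /compact_near_coveringP Kc.
have [N _ NP] : \forall k \near \oo, K `<=` (fun p => KK (k : nat)%:R p).
  apply: (Kc nat _ (fun k p => KK (k : nat)%:R p)) => p Kp.
  have [N Np] := KK_nbhs p; exists (KK N%:R, [set k | (N <= k)%N]); first by split => //; exists N.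
  by move=> [q k] /= [qN Nk]; apply: KK_le qN; rewrite ler_nat.
by exists N => p Kp; apply: NP => /=.
Qed.

Definition close_on (r e : C) (F G : AM) : Prop :=
  forall x, Jhat x = 1 -> in_K r x -> `|hat F x - hat G x| <= e.

Lemma close_onP r e F G : close_on r e F G <-> forall p, KK r p -> `|hol_ext F p - hol_ext G p| <= e.
Proof.
split=> [h _ [y [-> yK]]|h x J1 xK]; first by rewrite !hat_clshat; apply: h => //; exact: Zhat_JhatP.
by have [y ye] := ZhatP J1; rewrite -ye -!hat_clshat; apply: h; exists y; rewrite ye.
Qed.

(** The sets [KK r] are compact and every compact set lies in one of them. From left to right, the
    filter [Fil] generated by closeness on these sets is shown to converge to [hol_ext F], so each
    open set contains a basic one. *)
Lemma nbhs_AM (F : AM) (A : set AM) : nbhs F A <->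
  exists r e : C, [/\ 0 < r, 0 < e & forall G, close_on r e F G -> A G].
Proof.
pose X := {family compact, Mhat R n s -> C}.
split=> [[_ [[B Bo <-] BF BA]]|[r [e [r0 e0 h]]]].
  pose Fil : set_system X := [set P | exists r e : C, [/\ 0 < r, 0 < e &
     forall g : X, (forall p, KK r p -> `|hol_ext F p - g p| <= e) -> P g]].
  have FilF : Filter Fil.
    split; first by exists 1, 1.
      move=> P Q [r [e [r0 e0 h]]] [r' [e' [r0' e0' h']]].
      have [m [m0 me me']] := common_lt e0 e0'.
      exists (r + r'), m; split=> //; first by rewrite addr_gt0.
      move=> g gP; split; [apply: h|apply: h'] => p pK.
        by apply: le_trans (gP p _) (ltW me); apply: KK_le pK; rewrite lerDl ltW.
      by apply: le_trans (gP p _) (ltW me'); apply: KK_le pK; rewrite lerDr ltW.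
    by move=> P Q PQ [r [e [r0 e0 h]]]; exists r, e; split => // g gP; apply/PQ/h.
  have : Fil --> (hol_ext F : X).
    apply/fam_cvgP => K /compact_sub_KK[N KN] P /uniform_nbhs[E [entE EP]].
    have [e /= e0 eE] := entE.
    exists (N%:R + 1), (e / 2); split; rewrite ?divr_gt0 ?ltr_wpDl //.
    move=> g gP; apply: EP => p Kp; apply: eE => /=.
    apply: le_lt_trans (gP p _) _; last by rewrite ltr_pdivrMr // ltr_pMr // ltr1n.
    by apply: KK_le (KN _ Kp); rewrite lerDl.
  move=> /(_ B) [|r [e [r0 e0 h]]]; first by apply: open_nbhs_nbhs; split.
  exists r, e; split=> // G /close_onP GF; apply: BA; exact: h.
have K1 := compact_KK (ltW r0).
have c1 : nbhs (hol_ext F : X) --> (hol_ext F : X) by [].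
have /fam_cvgP/(_ _ K1) c2 := c1.
have : nbhs (hol_ext F : X) [set g : X | forall p, KK r p -> `|hol_ext F p - g p| <= e].
  apply: c2; apply/uniform_nbhs; exists [set zw : C * C | ball zw.1 e zw.2].
  split; first by exists e.
  by move=> g gP p pK; have := gP p pK; rewrite /= -ball_normE /= => /ltW.
move=> H; have H' := @initial_continuous _ _ (@hol_ext R n s) F _ H.
apply: (@filterS _ (nbhs F) _ _ A _ H') => G GP.
by apply: h; apply/close_onP.
Qed.

Lemma nbhs_PM (f : PM) (A : set PM) : nbhs f A <->
  exists r e : C, [/\ 0 < r, 0 < e & forall g, close_on r e (PMred_AMred f) (PMred_AMred g) -> A g].
Proof.
split=> [[_ [[B Bo <-] BF BA]]|[r [e [r0 e0 h]]]].
  have /nbhs_AM[r [e [r0 e0 h]]] : nbhs (PMred_AMred f) B by apply: open_nbhs_nbhs; split.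
  by exists r, e; split=> // g gP; apply: BA; exact: h.
have : nbhs (PMred_AMred f) [set G | close_on r e (PMred_AMred f) G].
  by apply/nbhs_AM; exists r, e.
move=> H; have := @initial_continuous _ _ (@PMred_AMred R n s) f _ H.
move=> H'; apply: (@filterS _ (nbhs f) _ _ A _ H') => g gP; exact: h.
Qed.
End LocallyUniformTopology.

Lemma near_norm_half (K : numFieldType) (U : normedModType K) (f : U -> K) (x : U) : f x != 0 ->
  {for x, continuous f} -> exists2 d : K, 0 < d & forall y, `|y| < d -> `|f x| / 2 < `|f (x + y)|.
Proof.
move=> f0 fc; have fp : 0 < `|f x| / 2 by rewrite divr_gt0 // normr_gt0.
have fc' : f y @[y --> x] --> f x := fc.
have H : nbhs x [set t | `|f x - f t| < `|f x| / 2] by exact: (proj1 (cvgrPdist_lt _ _) fc' _ fp).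
have [d /= d0 dH] := proj1 (nbhs_ballP _ _) H.
exists d => // y yd; have := dH (x + y).
rewrite -ball_normE /= opprD addNKr normrN => /(_ yd) h.
rewrite -(ltrD2l (`|f x| / 2)) -splitr; apply: le_lt_trans (_ : _ <= `|f x - f (x + y)| + `|f (x + y)|) _.
  by have := ler_normD (f x - f (x + y)) (f (x + y)); rewrite subrK.
by rewrite ltrD2r.
Qed.

(** * Completeness of the analytic functions *)

Section Completeness.
Variables (R : realType) (n s : nat).
Hypothesis s0 : (0 < s)%N.
Local Notation C := (Cplx R).
Local Notation V := 'rV[C]_n.+1.
Local Notation Jhat := (@Jhat R n s).
Local Notation AM := (AMred R n s).
Local Notation PM := (PMred R n s).

Lemma eps_eq (a b : C) : (forall e : C, 0 < e -> `|a - b| <= e) -> a = b.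
Proof.
move=> H; have [//|ab] := eqVneq a b.
have d0 : 0 < `|a - b| by rewrite normr_gt0 subr_eq0.
have := le_lt_trans (H (`|a - b| / 2) _) (small_half d0).
by rewrite ltxx => h; have := h (divr_gt0 d0 (ltr0Sn C 1)).
Qed.

Lemma limit_close (u : nat -> C) (l a e : C) N :
  (forall e', 0 < e' -> exists N, forall m : nat, (N <= m)%N -> `|u m - l| <= e') ->
  (forall k, (N <= k)%N -> `|u k - a| <= e) -> `|l - a| <= e.
Proof.
move=> ul ua; apply: (@cvgn_norm_le R (fun k => u (k + N)%N - a)).
  apply/cvgn_eps => e' e0; have [N' P] := ul e' e0; exists N' => m Nm.
  have -> : u (m + N)%N - a - (l - a) = u (m + N)%N - l by ring.
  by apply: P; apply: leq_trans Nm (leq_addr _ _).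
by move=> k; apply: ua; exact: leq_addl.
Qed.

Lemma close_on_sym (r e : C) (F G : AM) : close_on r e F G -> close_on r e G F.
Proof. by move=> FG x J1 xK; rewrite distrC; exact: FG. Qed.

Lemma close_on_trans (r e e' : C) (F G H : AM) :
  close_on r e F G -> close_on r e' G H -> close_on r (e + e') F H.
Proof.
move=> FG GH x J1 xK; apply: le_trans (lerD (FG x J1 xK) (GH x J1 xK)).
by have := ler_normD (hat F x - hat G x) (hat G x - hat H x); rewrite addrA subrK.
Qed.

Lemma in_K_le (r r' : C) (x : V * V) : r <= r' -> in_K r x -> in_K r' x.
Proof. by move=> rr [x1 x2]; split=> k; apply: le_trans rr. Qed.

Lemma close_on_le (r r' e e' : C) (F G : AM) : r <= r' -> e' <= e ->
  close_on r' e' F G -> close_on r e F G.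
Proof. by move=> rr ee FG x J1 xK; apply: le_trans ee; apply: FG => //; exact: in_K_le xK. Qed.

Lemma close_on_refl (r e : C) (F : AM) : 0 <= e -> close_on r e F F.
Proof. by move=> e0 x _ _; rewrite subrr normr0. Qed.

Lemma close_on_eq (F G : AM) : (forall r e : C, 0 < r -> 0 < e -> close_on r e F G) -> F = G.
Proof.
move=> FG; apply: hat_inj => x J1; apply: eps_eq => e e0.
pose r : C := 1 + `|x.1| + `|x.2|.
have r0 : 0 < r by rewrite /r -addrA ltr_pwDl // addr_ge0.
apply: (FG r e r0 e0) => //; split=> k; apply: le_trans (rv_coord_le _ _) _; rewrite /r.
  by rewrite -addrA addrCA lerDl addr_ge0.
by rewrite lerDr addr_ge0.
Qed.

Lemma hat_bounded (F : AM) (r : C) : 0 <= r ->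
  exists2 B : C, 0 <= B & forall x, Jhat x = 1 -> in_K r x -> `|hat F x| <= B.
Proof.
move=> r0; have [x [J1 _]|B B0 FB] := @compact_bound R _ _ (hat F) (@compact_K R n s r r0).
  by apply: differentiable_continuous; apply: (proj1 (hat_homhol F)); rewrite J1 oner_eq0.
by exists B => // x J1 xK; exact: FB.
Qed.

Lemma PM_dense (F : AM) (r e : C) : 0 < r -> 0 < e ->
  exists u : PM, close_on r e F (PMred_AMred u).
Proof.
move=> r0 e0; have [m [phi [phim Fphi]]] := bev_dense s0 (hat_homhol F) r0 e0.
have [u uE] := bev_PM s0 phim; exists u => x J1 xK; rewrite uE //; exact: Fphi.
Qed.

(** Closeness is measured on [Zhat], differentiability on an open set of the ambient space. Near [x]
    all points normalize into one bounded piece of [Zhat], which transfers the uniform estimates. *)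
Lemma normalize_near (x : V * V) : Jhat x != 0 -> exists d r : C, [/\ 0 < d, 0 < r &
  forall y : V * V, `|y| < d -> Jhat (x + y) != 0 /\
    in_K r ((Jhat (x + y))^-1 *: (x + y).1, (x + y).2)].
Proof.
move=> J0; have Jp : 0 < `|Jhat x| / 2 by rewrite divr_gt0 // normr_gt0.
have [d d0 dJ] := near_norm_half J0 (differentiable_continuous (Jhat_differentiable s x)).
have [e [e0 e1 ed]] := @common_lt R 1 d ltr01 d0.
pose B : C := `|x| + 1; pose r : C := B + B * (`|Jhat x| / 2)^-1.
have B0 : 0 < B by rewrite ltr_wpDl.
have r0 : 0 < r by rewrite addr_gt0 // mulr_gt0 ?invr_gt0.
exists e, r; split=> // y ye.
have Jy : `|Jhat x| / 2 < `|Jhat (x + y)|.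
  by apply: dJ; exact: lt_trans ye ed.
have xyB : `|x + y| <= B.
  by apply: le_trans (ler_normD _ _) _; rewrite /B lerD2l; apply: ltW; exact: lt_trans ye e1.
split; first by rewrite -normr_gt0; exact: lt_trans Jy.
split=> k /=.
  rewrite mxE normrM normfV; apply: le_trans (_ : _ <= B * (`|Jhat x| / 2)^-1) _; last by rewrite /r lerDr ltW.
  rewrite mulrC; apply: ler_pM => //; rewrite ?invr_ge0 //.
    by apply: le_trans (rv_coord_le _ _) _; apply: le_trans xyB; rewrite prod_normE num_le_max lexx.
  by rewrite lef_pV2 ?posrE // ?ltW //; exact: lt_trans Jy.
apply: le_trans (_ : _ <= B) _; last by rewrite /r lerDl mulr_ge0 // ?invr_ge0 ltW.
by apply: le_trans (rv_coord_le _ _) _; apply: le_trans xyB; rewrite prod_normE num_le_max lexx orbT.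
Qed.

Lemma AM_complete (w : nat -> AM) :
  (forall r e : C, 0 < r -> 0 < e -> exists N, forall k l, (N <= k)%N -> (N <= l)%N ->
     close_on r e (w k) (w l)) ->
  exists F : AM, forall r e : C, 0 < r -> 0 < e -> exists N, forall k, (N <= k)%N -> close_on r e (w k) F.
Proof.
move=> wC.
have hn (F : AM) (x : V * V) : Jhat x != 0 -> hat F ((Jhat x)^-1 *: x.1, x.2) = hat F x.
  move=> J0; rewrite -[x.2]scale1r; apply: (proj2 (hat_homhol F)); rewrite ?invr_eq0 ?oner_eq0 //.
have J1 (x : V * V) : Jhat x != 0 -> Jhat ((Jhat x)^-1 *: x.1, x.2) = 1.
  by move=> J0; rewrite -[x.2]scale1r JhatZ mulr1 mulVf.
have inK (x : V * V) : exists2 r : C, 0 < r & in_K r x.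
  exists (1 + `|x.1| + `|x.2|); first by rewrite -addrA ltr_pwDl // addr_ge0.
  split=> k; apply: le_trans (rv_coord_le _ _) _.
    by rewrite -addrA addrCA lerDl addr_ge0.
  by rewrite lerDr addr_ge0.
(* The limit is set to 0 where [Jhat] vanishes, so that it is homogeneous everywhere, as [homhol]
   demands. *)
have cv (x : V * V) : exists l : C, (Jhat x = 0 -> l = 0) /\ (Jhat x != 0 ->
    forall e : C, 0 < e -> exists N, forall m : nat, (N <= m)%N -> `|hat (w m) x - l| <= e).
  have [Jx0|Jx0] := eqVneq (Jhat x) 0; first by exists 0.
  have [r r0 rK] := inK ((Jhat x)^-1 *: x.1, x.2).
  have [e e0|l lP] := @complex_cauchy R (fun k => hat (w k) x); last by exists l; split=> [Jx|//]; rewrite Jx eqxx in Jx0.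
  have [N NP] := wC r e r0 e0; exists N => m k Nm Nk.
  by rewrite -(hn (w m)) // -(hn (w k)) //; apply: NP => //; exact: J1.
have [T TP] := choice cv.
have T1 (x : V * V) (r e : C) N : Jhat x != 0 -> in_K r ((Jhat x)^-1 *: x.1, x.2) ->
    (forall k l, (N <= k)%N -> (N <= l)%N -> close_on r e (w k) (w l)) ->
    forall k, (N <= k)%N -> `|hat (w k) x - T x| <= e.
  move=> J0 xK NP k Nk; rewrite distrC; apply: (@limit_close _ _ _ _ N (proj2 (TP x) J0)) => l Nl.
  by rewrite -(hn (w l)) // -(hn (w k)) //; apply: NP => //; exact: J1.
have Th : homhol s T.
  split=> [x J0|a b x a0 b0].
    have [d [r [d0 r0 xd]]] := normalize_near J0.
    (* From the index [N] on, all functions are within 1 of [w N], which gives the common bound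
       required by [weierstrass]. *)
    have [N NP] := wC r 1 r0 ltr01.
    have [B B0 wB] := hat_bounded (w N) (ltW r0).
    apply: (@weierstrass R _ (fun k => hat (w (k + N)%N)) T x d (1 + B) d0).
    - by move=> k y yd; apply: (proj1 (hat_homhol _)); exact: (proj1 (xd y yd)).
    - move=> k y yd; have [Jy yK] := xd y yd.
      have h1 := NP (k + N)%N N (leq_addl _ _) (leqnn _) _ (J1 _ Jy) yK.
      have h2 := wB _ (J1 _ Jy) yK.
      rewrite -(hn _ _ Jy); apply: le_trans (lerD h1 h2).
      by apply: le_trans (ler_normD _ _); rewrite subrK.
    move=> e e0; have [N' NP'] := wC r e r0 e0; exists N' => k Nk y yd.
    have [Jy yK] := xd y yd.
    by apply: (T1 _ _ _ _ Jy yK NP'); apply: leq_trans Nk (leq_addr _ _).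
  have [J0|J0] := eqVneq (Jhat x) 0.
    by rewrite (proj1 (TP x) J0); apply: (proj1 (TP _)); rewrite JhatZ J0 mulr0.
  have J0' : Jhat (a *: x.1, b *: x.2) != 0 by rewrite JhatZ !mulf_neq0.
  have aux (u : nat -> C) l l' :
    (forall e', 0 < e' -> exists N, forall m : nat, (N <= m)%N -> `|u m - l| <= e') ->
    (forall e', 0 < e' -> exists N, forall m : nat, (N <= m)%N -> `|u m - l'| <= e') -> l = l'.
    move=> ul ul'; apply: eps_eq => e' e0; have [N NP] := ul' e' e0; exact: (limit_close ul NP).
  apply: aux (proj2 (TP _) J0') _ => e' e0; have [N NP] := proj2 (TP _) J0 _ e0; exists N => m Nm.
  by rewrite (proj2 (hat_homhol _) a b x a0 b0); exact: NP.
have [F FT] := hat_exists s0 Th.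
exists F => r e r0 e0; have [N NP] := wC r e r0 e0; exists N => k Nk x Jx xK.
have Jx0 : Jhat x != 0 by rewrite Jx oner_eq0.
by rewrite FT //; apply: (T1 _ _ _ _ Jx0 _ NP) => //=; rewrite Jx invr1 scale1r.
Qed.
End Completeness.

(** * The star product on polynomials *)

Section StarProduct.
Variables (R : realType) (n s : nat).
Hypothesis s0 : (0 < s)%N.
Variable h : Cplx R.
Hypothesis hadm : forall k : nat, (1 <= k)%N -> h <> k%:R^-1.
Local Notation C := (Cplx R).
Local Notation V := 'rV[C]_n.+1.
Local Notation W := 'rV[C]_n.
Local Notation Jhat := (@Jhat R n s).
Local Notation AM := (AMred R n s).
Local Notation PM := (PMred R n s).
Local Notation bev := (@bev R n s).
Local Notation phat f := (hat (PMred_AMred f)).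

Lemma bgenZ r m (t t' : C * V * V) (a b : C) (x : V * V) :
  bgen s r m t t' (a *: x.1, b *: x.2) = (a * b) ^+ (m + m) * bgen s r m t t' x.
Proof.
rewrite /bgen /= !dotZr JhatZ.
have aux (c e A B A' B' bt J : C) : c * e ^+ 2 * ((a * A) ^+ m * (b * B) ^+ (m - r)) *
   ((b * B') ^+ m * (a * A') ^+ (m - r)) * (bt * (a * b * J) - a * A' * (b * B)) ^+ r =
   (a * b) ^+ (m + (m - r) + r) * (c * e ^+ 2 * (A ^+ m * B ^+ (m - r)) *
   (B' ^+ m * A' ^+ (m - r)) * (bt * J - A' * B) ^+ r).
  have -> : bt * (a * b * J) - a * A' * (b * B) = a * b * (bt * J - A' * B) by ring.
  by rewrite !exprMn !exprD; ring.
have [rm|mr] := leqP r m; first by rewrite aux -addnA subnK.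
by rewrite ffact_small // expr0n /= !(mulr0, mul0r).
Qed.

Definition chart_pt (w : W) : V * V :=
  ((sqrtC (rho s w))^-1 *: affine ord0 w, (sqrtC (rho s w))^-1 *: cconj (affine ord0 w)).

Lemma chart_ptE (w : W) : 0 < rho s w -> Jhat (chart_pt w) = 1 /\
  forall F : AM, in_chart (val F) w = hat F (chart_pt w).
Proof.
move=> r0; have [z ze] := chart_point s0 r0; have [q0 qc q2] := sqrt_rho r0.
have yE : chart_pt w = (set_val z, cconj (set_val z)).
  by rewrite ze cconjZ rmorphV ?unitfE //= qc.
split; first by rewrite yE Jhat_diag Z_JP.
by move=> F; rewrite yE hat_diag // (in_chart_cls s0 _ ze).
Qed.

Lemma chart_pt_scale (w : W) : 0 < rho s w ->
  (sqrtC (rho s w))^-1 * (sqrtC (rho s w))^-1 = (rho s w)^-1.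
Proof. by move=> /sqrt_rho[_ _ q2]; rewrite -invfM -expr2 q2. Qed.

Lemma chart_expand m L (F : AM) (w : W) : (forall x, Jhat x = 1 -> hat F x = ev m m L x) ->
  0 < rho s w -> in_chart (val F) w =
  \sum_(t <- L) t.1.1 * fac true t w ^+ m * fac false t w ^+ m / rho s w ^+ m.
Proof.
move=> FL r0; have [J1 ->] := chart_ptE r0; rewrite FL // /chart_pt.
rewrite (evZ m m L _ _ (affine ord0 w, cconj (affine ord0 w))) -exprMn chart_pt_scale //.
rewrite /ev mulr_sumr; apply: eq_bigr => t _; rewrite /gen_ev /fac /= exprVn.
by rewrite mulrC.
Qed.

(** Both sides are sums of [bgen], of bidegree [(m + m, m + m)]: normalizing the chart point to
    [Zhat] divides by exactly the power of [rho] found in [pairing_chart]. *)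
Lemma pairing_Bop m (f g : PM) r (w : W) : bev m m (phat f) -> bev m m (phat g) -> 0 < rho s w ->
  pairing s (@Dsym_iter R n s (in_chart (val f)) r) (@Dsym_iter R n s (in_chart (val g)) r) w =
  Bop s m r (phat f) (phat g) (chart_pt w).
Proof.
move=> [L fL] [L' gL] r0.
rewrite (@pairing_chart R n s m L L') //; first last.
- by move=> w' r0'; exact: (chart_expand gL).
- by move=> w' r0'; exact: (chart_expand fL).
rewrite (@Bop_gen R n s m r L L' _ _ _ fL gL (proj1 (chart_ptE r0))).
apply: eq_bigr => t _; apply: eq_bigr => t' _.
rewrite /chart_pt (bgenZ r m t t' _ _ (affine ord0 w, cconj (affine ord0 w))) chart_pt_scale //.
by rewrite exprVn mulrC.
Qed.

Lemma sum_ord_vanish N M (F : nat -> C) : (N <= M)%N -> (forall r, (N <= r)%N -> F r = 0) ->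
  \sum_(r < M) F r = \sum_(r < N) F r.
Proof.
move=> NM F0; rewrite -!(big_mkord xpredT F) (@big_cat_nat _ _ _ N 0%N M) //= [X in _ + X]big1_seq ?addr0 //.
by move=> r /=; rewrite mem_index_iota => /andP[Nr _]; exact: F0.
Qed.

(** The chart formula fixes the extension only at points of the real chart; [homhol_identity],
    applied to the difference with the polynomial built from [starm], extends the equality to
    [Zhat]. *)
Lemma is_starP m (f g k : PM) : bev m m (phat f) -> bev m m (phat g) ->
  is_star h f g k <-> forall x, Jhat x = 1 -> phat k x = starm s h m (phat f) (phat g) x.
Proof.
move=> fm gm; split=> [[N [BN kN]]|kE]; last first.
  exists m.+1; split=> [r w mr r0|w r0].
    by rewrite (pairing_Bop r fm gm r0); apply: Bop_gt mr fm gm (proj1 (chart_ptE r0)).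
  rewrite -[val k]/(val (PMred_AMred k)).
  have [J1 ->] := chart_ptE r0; rewrite kE // /starm; apply: eq_bigr => r _.
  by rewrite (pairing_Bop r fm gm r0).
have [k' k'E] := bev_PM s0 (starm_bev h fm gm).
suff H x : Jhat x != 0 -> phat k x - phat k' x = 0.
  by move=> x J1; rewrite -k'E //; apply/eqP; rewrite -subr_eq0; apply/eqP/H; rewrite J1 oner_eq0.
apply: (@homhol_identity R n s s0 (fun x => phat k x - phat k' x)).
  by apply: homhol_sub; exact: hat_homhol.
move=> w r0; have [J1 chE] := chart_ptE r0; have [q0 _ _] := sqrt_rho r0.
have qi : (sqrtC (rho s w))^-1 != 0 by rewrite invr_eq0.
have hZ (F : AM) : hat F (affine ord0 w, cconj (affine ord0 w)) = hat F (chart_pt w).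
  by rewrite /chart_pt (proj2 (hat_homhol F) _ _ (affine ord0 w, cconj (affine ord0 w)) qi qi).
rewrite !hZ k'E // -chE [in_chart _ _](kN w r0); apply/eqP; rewrite subr_eq0; apply/eqP.
pose G r : C := star_coef h r * Bop s m r (phat f) (phat g) (chart_pt w).
transitivity (\sum_(r < N) G r); first by apply: eq_bigr => r _; rewrite (pairing_Bop r fm gm r0).
(* The bound [N] of [is_star] and the bound [m.+1] of [starm] are unrelated; both sums equal a
   common longer one. *)
transitivity (\sum_(r < N + m.+1) G r).
  apply/esym/sum_ord_vanish; first exact: leq_addr.
  by move=> r Nr; rewrite /G -(pairing_Bop r fm gm r0) BN // mulr0.
apply: sum_ord_vanish; first exact: leq_addl.
by move=> r mr; rewrite /G (Bop_gt mr fm gm J1) mulr0.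
Qed.

Lemma star_exists : exists star : PM -> PM -> PM,
  (forall f g k, is_star h f g k <-> k = star f g) /\
  (forall m f g, bev m m (phat f) -> bev m m (phat g) ->
     forall x, Jhat x = 1 -> phat (star f g) x = starm s h m (phat f) (phat g) x).
Proof.
have ex (fg : PM * PM) : exists k, is_star h fg.1 fg.2 k.
  have [m fm] := PM_hat_bev s0 fg.1; have [m' gm] := PM_hat_bev s0 fg.2.
  have f1 := fm (m + m')%N (leq_addr _ _); have g1 := gm (m + m')%N (leq_addl _ _).
  by have [k kE] := bev_PM s0 (starm_bev h f1 g1); exists k; apply/(is_starP k f1 g1).
have [st stE] := choice ex.
exists (fun f g => st (f, g)).
have E m f g : bev m m (phat f) -> bev m m (phat g) ->
     forall x, Jhat x = 1 -> phat (st (f, g)) x = starm s h m (phat f) (phat g) x.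
  by move=> fm gm; apply/(is_starP _ fm gm); exact: (stE (f, g)).
split=> // f g k; split=> [kE|->]; last exact: (stE (f, g)).
have [m fm] := PM_hat_bev s0 f; have [m' gm] := PM_hat_bev s0 g.
have f1 := fm (m + m')%N (leq_addr _ _); have g1 := gm (m + m')%N (leq_addl _ _).
apply: PM_inj => x J1; rewrite (E _ f g f1 g1 x J1).
exact: (proj1 (is_starP k f1 g1) kE).
Qed.

End StarProduct.

(** * The extension to analytic functions *)

Section ContinuousExtension.
Variables (R : realType) (n s : nat).
Hypothesis s0 : (0 < s)%N.
Variable h : Cplx R.
Hypothesis hadm : forall k : nat, (1 <= k)%N -> h <> k%:R^-1.
Local Notation C := (Cplx R).
Local Notation V := 'rV[C]_n.+1.
Local Notation Jhat := (@Jhat R n s).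
Local Notation AM := (AMred R n s).
Local Notation PM := (PMred R n s).
Local Notation bev := (@bev R n s).
Local Notation phat f := (hat (PMred_AMred f)).
Variable star : PM -> PM -> PM.
Hypothesis starE : forall m f g, bev m m (phat f) -> bev m m (phat g) ->
  forall x, Jhat x = 1 -> phat (star f g) x = starm s h m (phat f) (phat g) x.

Lemma starm_subE m (F F' G G' : V * V -> C) x : Jhat x = 1 ->
  starm s h m F G x - starm s h m F' G' x =
  starm s h m (fun x => F x - F' x) G x + starm s h m F' (fun x => G x - G' x) x.
Proof.
move=> J1.
have e1 := starm_linl s h m 1 (fun x => F x - F' x) F' G x.
have e2 := starm_linr s h m 1 F' (fun x => G x - G' x) G' x.
rewrite mul1r in e1; rewrite mul1r in e2.
have e3 : starm s h m (fun x => 1 * (F x - F' x) + F' x) G x = starm s h m F G x.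
  by apply: starm_eq => // y _; rewrite mul1r subrK.
have e4 : starm s h m F' (fun x => 1 * (G x - G' x) + G' x) x = starm s h m F' G x.
  by apply: starm_eq => // y _; rewrite mul1r subrK.
rewrite -e3 e1 -e4 e2; move: (starm _ _ _ _ _ _) (starm _ _ _ _ _ _) (starm _ _ _ _ _ _) => a b c.
by ring.
Qed.

Lemma common_bev2 (f g : PM) : exists m, bev m m (phat f) /\ bev m m (phat g).
Proof.
have [m fm] := PM_hat_bev s0 f; have [m' gm] := PM_hat_bev s0 g.
by exists (m + m')%N; split; [apply: fm; exact: leq_addr|apply: gm; exact: leq_addl].
Qed.

Lemma bev_sub m (F G : V * V -> C) : bev m m F -> bev m m G -> bev m m (fun x => F x - G x).
Proof.
move=> Fm Gm; apply: bev_ext (bevD Fm (bevZ (-1) Gm)) => x _.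
by rewrite mulN1r.
Qed.

(* Uniform continuity on bounded sets: the finitely many data on which the
   radius r and the precision d depend are bounds of F and G. *)
Lemma star_est (F G : AM) (r0 e : C) : 0 < r0 -> 0 < e -> exists r d : C, [/\ 0 < r, 0 < d &
  forall u v u' v' : PM,
    close_on r d F (PMred_AMred u) -> close_on r d G (PMred_AMred v) ->
    close_on r d F (PMred_AMred u') -> close_on r d G (PMred_AMred v') ->
    close_on r0 e (PMred_AMred (star u v)) (PMred_AMred (star u' v'))].
Proof.
move=> r00 e0; have [r1 [K [r10 K0 bnd]]] := @starm_bound R n s h hadm r0 r00.
have [B B0 FB] := hat_bounded F (ltW r10); have [B' B'0 GB] := hat_bounded G (ltW r10).
(* By [starm_subE] the difference is bounded by two products: differences of approximants are at
   most [2 * d], and the approximants themselves at most [B + 1] and [B' + 1]. *)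
have K'0 : 0 <= K * (2 * (B' + 1) + (B + 1) * 2) by rewrite mulr_ge0 // addr_ge0 // mulr_ge0 // addr_ge0.
have [e1 e10 e1P] := cvgn_const_le e0 K'0.
have [d [d0 d1 de]] := @common_lt R 1 e1 ltr01 e10.
exists r1, d; split=> // u v u' v' Fu Gv Fu' Gv' x J1 xK.
have [m1 [um vm]] := common_bev2 u v; have [m2 [um' vm']] := common_bev2 u' v'.
pose m := (m1 + m2)%N.
have {}um : bev m m (phat u) := bev_raise (leq_addr _ _) um.
have {}vm : bev m m (phat v) := bev_raise (leq_addr _ _) vm.
have {}um' : bev m m (phat u') := bev_raise (leq_addl _ _) um'.
have {}vm' : bev m m (phat v') := bev_raise (leq_addl _ _) vm'.
rewrite (starE um vm J1) (starE um' vm' J1) starm_subE //.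
have two (H : AM) (w w' : PM) : close_on r1 d H (PMred_AMred w) -> close_on r1 d H (PMred_AMred w') ->
    forall x, Jhat x = 1 -> in_K r1 x -> `|phat w x - phat w' x| <= 2 * d.
  move=> Hw Hw' y y1 yK; rewrite mulr2n mulrDl mul1r.
  exact: (close_on_trans (close_on_sym Hw) Hw') y1 yK.
have near_bd (H : AM) (w : PM) (S : C) : (forall x, Jhat x = 1 -> in_K r1 x -> `|hat H x| <= S) ->
    close_on r1 d H (PMred_AMred w) -> forall x, Jhat x = 1 -> in_K r1 x -> `|phat w x| <= S + 1.
  move=> HS Hw y y1 yK; rewrite -[phat w y](subrK (hat H y)) addrC.
  apply: le_trans (ler_normD _ _) _; apply: lerD; first exact: HS.
  by rewrite distrC; apply: le_trans (Hw y y1 yK) (ltW d1).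
apply: le_trans (ler_normD _ _) _.
have h1 := bnd m _ _ _ _ (bev_sub um um') vm (two F u u' Fu Fu') (near_bd G v B' GB Gv) x J1 xK.
have h2 := bnd m _ _ _ _ um' (bev_sub vm vm') (near_bd F u' B FB Fu') (two G v v' Gv Gv') x J1 xK.
apply: le_trans (lerD h1 h2) _; apply: le_trans e1P.
have -> : K * (2 * d * (B' + 1)) + K * ((B + 1) * (2 * d)) = K * (2 * (B' + 1) + (B + 1) * 2) * d by ring.
by apply: ler_wpM2l => //; exact: ltW.
Qed.

(** [H] is the limit of [star u v] as [u] and [v] approach [F] and [G]. In this form no sequence is
    singled out, and algebraic identities pass to the limit through any sufficiently close
    approximants. *)
Definition is_prod (F G H : AM) : Prop := forall r0 e : C, 0 < r0 -> 0 < e ->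
  exists r d : C, [/\ 0 < r, 0 < d & forall u v : PM,
    close_on r d F (PMred_AMred u) -> close_on r d G (PMred_AMred v) ->
    close_on r0 e H (PMred_AMred (star u v))].

Lemma close_on_weak (r d r' d' : C) (F G : AM) : 0 < r -> 0 < r' -> d < d' ->
  close_on (r + r') d F G -> close_on r d' F G.
Proof. by move=> r0 r0' dd; apply: close_on_le (ltW dd); rewrite lerDl ltW. Qed.

Lemma is_prod_uniq (F G H H' : AM) : is_prod F G H -> is_prod F G H' -> H = H'.
Proof.
move=> FH FH'; apply: close_on_eq => r e r0 e0.
have e2 : 0 < e / 2 by rewrite divr_gt0.
have [r1 [d1 [r10 d10 P1]]] := FH r (e / 2) r0 e2.
have [r2 [d2 [r20 d20 P2]]] := FH' r (e / 2) r0 e2.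
have [d [d0 dd1 dd2]] := common_lt d10 d20.
have [u Fu] := PM_dense s0 F (addr_gt0 r10 r20) d0.
have [v Gv] := PM_dense s0 G (addr_gt0 r10 r20) d0.
have h1 := P1 u v (close_on_weak r10 r20 dd1 Fu) (close_on_weak r10 r20 dd1 Gv).
rewrite addrC in Fu; rewrite addrC in Gv.
have h2 := P2 u v (close_on_weak r20 r10 dd2 Fu) (close_on_weak r20 r10 dd2 Gv).
by rewrite [e]splitr; exact: close_on_trans h1 (close_on_sym h2).
Qed.

Lemma is_prod_PM (f g : PM) : is_prod (PMred_AMred f) (PMred_AMred g) (PMred_AMred (star f g)).
Proof.
move=> r0 e r00 e0; have [r [d [rp dp P]]] := star_est (PMred_AMred f) (PMred_AMred g) r00 e0.
by exists r, d; split=> // u v fu gv; apply: P => //; apply: close_on_refl; exact: ltW.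
Qed.

Lemma natC_inv_le (r d : C) : 0 < r -> 0 < d ->
  exists N, forall k, (N <= k)%N -> r <= k.+1%:R /\ (k.+1%:R)^-1 <= d.
Proof.
move=> r0 d0; have [N NP] := natC_ge (ltW r0).
have di : 0 < d^-1 by rewrite invr_gt0.
have [N' N'P] := natC_ge (ltW di); exists (N + N')%N => k Nk; split.
  by apply: NP; apply: leq_trans (leq_addr N' N) (leqW Nk).
rewrite -[d]invrK lef_pV2 ?posrE ?ltr0Sn //.
by apply: N'P; apply: leq_trans (leq_addl N N') (leqW Nk).
Qed.

Lemma is_prod_exists (F G : AM) : exists H, is_prod F G H.
Proof.
have k0 k : 0 < (k.+1%:R : C) by rewrite ltr0Sn.
have ki k : 0 < (k.+1%:R^-1 : C) by rewrite invr_gt0.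
have [u uP] := choice (fun k => PM_dense s0 F (k0 k) (ki k)).
have [v vP] := choice (fun k => PM_dense s0 G (k0 k) (ki k)).
have uv (r d : C) : 0 < r -> 0 < d -> exists N, forall k, (N <= k)%N ->
    close_on r d F (PMred_AMred (u k)) /\ close_on r d G (PMred_AMred (v k)).
  move=> r0 d0; have [N NP] := natC_inv_le r0 d0; exists N => k Nk; have [rk dk] := NP k Nk.
  by split; apply: close_on_le rk dk _.
have [|H HP] := @AM_complete R n s s0 (fun k => PMred_AMred (star (u k) (v k))).
  move=> r0 e r00 e0; have [r [d [rp dp P]]] := star_est F G r00 e0.
  have [N NP] := uv r d rp dp; exists N => k l Nk Nl.
  by have [? ?] := NP k Nk; have [? ?] := NP l Nl; exact: P.
exists H => r0 e r00 e0; have e2 : 0 < e / 2 by rewrite divr_gt0.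
have [r [d [rp dp P]]] := star_est F G r00 e2.
have [N NP] := uv r d rp dp; have [N' N'P] := HP r0 (e / 2) r00 e2.
exists r, d; split=> // u' v' Fu' Gv'.
have [h1 h2] := NP (N + N')%N (leq_addr _ _); have h3 := N'P (N + N')%N (leq_addl _ _).
rewrite [e]splitr; apply: close_on_trans (close_on_sym h3) _.
exact: P.
Qed.

Lemma PM_lin (a : C) (f g : PM) : exists k : PM,
  forall x, Jhat x = 1 -> phat k x = a * phat f x + phat g x.
Proof.
by have [m [fm gm]] := common_bev2 f g; exact: (bev_PM s0 (bevD (bevZ a fm) gm)).
Qed.

Lemma star_linl (a : C) (f f' g k : PM) :
  (forall x, Jhat x = 1 -> phat k x = a * phat f x + phat f' x) ->
  forall x, Jhat x = 1 -> phat (star k g) x = a * phat (star f g) x + phat (star f' g) x.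
Proof.
move=> kE x J1; have [m1 [fm gm]] := common_bev2 f g; have [m2 [f'm km]] := common_bev2 f' k.
pose m := (m1 + m2)%N.
have {}fm : bev m m (phat f) := bev_raise (leq_addr _ _) fm.
have {}gm : bev m m (phat g) := bev_raise (leq_addr _ _) gm.
have {}f'm : bev m m (phat f') := bev_raise (leq_addl _ _) f'm.
have {}km : bev m m (phat k) := bev_raise (leq_addl _ _) km.
rewrite (starE km gm J1) (starE fm gm J1) (starE f'm gm J1) -starm_linl.
by apply: starm_eq.
Qed.

Lemma star_linr (a : C) (f g g' k : PM) :
  (forall x, Jhat x = 1 -> phat k x = a * phat g x + phat g' x) ->
  forall x, Jhat x = 1 -> phat (star f k) x = a * phat (star f g) x + phat (star f g') x.
Proof.
move=> kE x J1; have [m1 [fm gm]] := common_bev2 f g; have [m2 [g'm km]] := common_bev2 g' k.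
pose m := (m1 + m2)%N.
have {}fm : bev m m (phat f) := bev_raise (leq_addr _ _) fm.
have {}gm : bev m m (phat g) := bev_raise (leq_addr _ _) gm.
have {}g'm : bev m m (phat g') := bev_raise (leq_addl _ _) g'm.
have {}km : bev m m (phat k) := bev_raise (leq_addl _ _) km.
rewrite (starE fm km J1) (starE fm gm J1) (starE fm g'm J1) -starm_linr.
by apply: starm_eq.
Qed.

Lemma star_assoc (f g k : PM) : star f (star g k) = star (star f g) k.
Proof.
have [m1 [fm gm]] := common_bev2 f g; have [m2 [km _]] := common_bev2 k k.
pose m := (m1 + m2)%N.
have {}fm : bev m m (phat f) := bev_raise (leq_addr _ _) fm.
have {}gm : bev m m (phat g) := bev_raise (leq_addr _ _) gm.
have {}km : bev m m (phat k) := bev_raise (leq_addl _ _) km.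
have mm : (m <= m + m)%N := leq_addr _ _.
have fg : bev (m + m) (m + m) (phat (star f g)).
  by apply: bev_ext (starm_bev h fm gm) => x J1; rewrite (starE fm gm J1).
have gk : bev (m + m) (m + m) (phat (star g k)).
  by apply: bev_ext (starm_bev h gm km) => x J1; rewrite (starE gm km J1).
apply: PM_inj => x J1.
rewrite (starE (bev_raise mm fm) gk J1) (starE fg (bev_raise mm km) J1).
have -> : starm s h (m + m) (phat f) (phat (star g k)) x =
    starm s h (m + m) (phat f) (starm s h m (phat g) (phat k)) x.
  by apply: starm_eq => // y y1; exact: starE.
have -> : starm s h (m + m) (phat (star f g)) (phat k) x =
    starm s h (m + m) (starm s h m (phat f) (phat g)) (phat k) x.
  by apply: starm_eq => // y y1; exact: starE.
by rewrite starm_assoc.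
Qed.

Variable starA : AM -> AM -> AM.
Hypothesis starAP : forall F G, is_prod F G (starA F G).

Lemma starA_PM (f g : PM) : starA (PMred_AMred f) (PMred_AMred g) = PMred_AMred (star f g).
Proof. exact: is_prod_uniq (starAP _ _) (is_prod_PM f g). Qed.

(** Polynomials close enough to [F'] and [G'] are also close to [F] and [G], so both products are
    near the same [star u v]. *)
Lemma starA_close (F G : AM) (r0 e : C) : 0 < r0 -> 0 < e -> exists r d : C, [/\ 0 < r, 0 < d &
  forall F' G' : AM, close_on r d F F' -> close_on r d G G' ->
    close_on r0 e (starA F G) (starA F' G')].
Proof.
move=> r00 e0; have e2 : 0 < e / 2 by rewrite divr_gt0.
have [r [d [rp dp P]]] := starAP F G r00 e2.
have d2 : 0 < d / 2 by rewrite divr_gt0.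
exists r, (d / 2); split=> // F' G' FF GG.
have [r' [d' [rp' dp' P']]] := starAP F' G' r00 e2.
have [c [c0 c1 c2]] := common_lt d2 dp'.
have [u Fu] := PM_dense s0 F' (addr_gt0 rp rp') c0.
have [v Gv] := PM_dense s0 G' (addr_gt0 rp rp') c0.
have h1 : close_on r0 (e / 2) (starA F G) (PMred_AMred (star u v)).
  apply: P; rewrite [d]splitr.
    exact: close_on_trans FF (close_on_weak rp rp' c1 Fu).
  exact: close_on_trans GG (close_on_weak rp rp' c1 Gv).
rewrite addrC in Fu; rewrite addrC in Gv.
have h2 := P' u v (close_on_weak rp' rp c2 Fu) (close_on_weak rp' rp c2 Gv).
by rewrite [e]splitr; exact: close_on_trans h1 (close_on_sym h2).
Qed.

Lemma starA_continuous : continuous (fun FG : AM * AM => starA FG.1 FG.2).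
Proof.
move=> [F G] A /nbhs_AM[r0 [e [r00 e0 P]]].
have [r [d [rp dp Q]]] := starA_close F G r00 e0.
have nF : nbhs F [set F' | close_on r d F F'] by apply/nbhs_AM; exists r, d.
have nG : nbhs G [set G' | close_on r d G G'] by apply/nbhs_AM; exists r, d.
apply: (@filterS _ (nbhs (F, G)) _ _ _ _ (@nbhs_pair _ _ (F, G) _ _ nF nG)) => -[F' G'] [FF GG].
by apply: P; exact: Q.
Qed.

Lemma star_continuous : continuous (fun fg : PM * PM => star fg.1 fg.2).
Proof.
move=> [f g] A /nbhs_PM[r0 [e [r00 e0 P]]].
have [r [d [rp dp Q]]] := star_est (PMred_AMred f) (PMred_AMred g) r00 e0.
have nf : nbhs f [set f' | close_on r d (PMred_AMred f) (PMred_AMred f')] by apply/nbhs_PM; exists r, d.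
have ng : nbhs g [set g' | close_on r d (PMred_AMred g) (PMred_AMred g')] by apply/nbhs_PM; exists r, d.
apply: (@filterS _ (nbhs (f, g)) _ _ _ _ (@nbhs_pair _ _ (f, g) _ _ nf ng)) => -[f' g'] [ff gg].
by apply: P; apply: Q => //; apply: close_on_refl; exact: ltW.
Qed.

Lemma starA_uniq (m : AM -> AM -> AM) : continuous (fun FG : AM * AM => m FG.1 FG.2) ->
  (forall f g : PM, m (PMred_AMred f) (PMred_AMred g) = PMred_AMred (star f g)) ->
  starA = m.
Proof.
move=> mc mE; apply/funext => F; apply/funext => G; apply: close_on_eq => r0 e r00 e0.
have e2 : 0 < e / 2 by rewrite divr_gt0.
have [r [d [rp dp P]]] := starAP F G r00 e2.
have nm : nbhs (m F G) [set H | close_on r0 (e / 2) (m F G) H] by apply/nbhs_AM; exists r0, (e / 2).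
have [[A B] /= [nA nB] AB] := mc (F, G) _ nm.
have [r1 [d1 [rp1 dp1 A1]]] := proj1 (nbhs_AM _ _) nA.
have [r2 [d2 [rp2 dp2 B2]]] := proj1 (nbhs_AM _ _) nB.
have [c [c0 c1 cd]] := common_lt dp1 dp2; have [c' [c'0 c'c c'd]] := common_lt c0 dp.
have rr : 0 < r1 + r2 by rewrite addr_gt0.
have [u Fu] := PM_dense s0 F (addr_gt0 rp rr) c'0.
have [v Gv] := PM_dense s0 G (addr_gt0 rp rr) c'0.
have h1 := P u v (close_on_weak rp rr c'd Fu) (close_on_weak rp rr c'd Gv).
have Au : A (PMred_AMred u).
  apply: A1; apply: (close_on_weak rp1 rp2 c1); rewrite addrC in Fu; exact: (close_on_weak rr rp c'c Fu).
have Bv : B (PMred_AMred v).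
  apply: B2; apply: (close_on_weak rp2 rp1 cd); rewrite [r2 + r1]addrC.
  by rewrite addrC in Gv; exact: (close_on_weak rr rp c'c Gv).
have h2 : close_on r0 (e / 2) (m F G) (m (PMred_AMred u) (PMred_AMred v)) := AB (_, _) (conj Au Bv).
rewrite mE in h2; rewrite [e]splitr; exact: close_on_trans h1 (close_on_sym h2).
Qed.

Lemma close_lin (a : C) (r d d' : C) (F F' G G' : AM) : close_on r d F G -> close_on r d' F' G' ->
  close_on r (`|a| * d + d') (a *: F + F') (a *: G + G').
Proof.
move=> FG FG' x J1 xK; have J0 : Jhat x != 0 by rewrite J1 oner_eq0.
rewrite !(hatZD s0) //.
have -> : a * hat F x + hat F' x - (a * hat G x + hat G' x) =
    a * (hat F x - hat G x) + (hat F' x - hat G' x) by ring.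
apply: le_trans (ler_normD _ _) _; apply: lerD; last exact: FG'.
by rewrite normrM; apply: ler_wpM2l => //; exact: FG.
Qed.

Lemma PM_linA (a : C) (f g k : PM) :
  (forall x, Jhat x = 1 -> phat k x = a * phat f x + phat g x) ->
  PMred_AMred k = a *: PMred_AMred f + PMred_AMred g.
Proof.
by move=> kE; apply: hat_inj => x J1; rewrite (hatZD s0) ?J1 ?oner_eq0 // kE.
Qed.

Lemma lin_prec (a e : C) : 0 < e -> exists2 d : C, 0 < d & `|a| * d + d <= e.
Proof.
move=> e0; have a0 : 0 <= `|a| + 1 by rewrite addr_ge0.
have [d d0 dP] := cvgn_const_le e0 a0; exists d => //.
by apply: le_trans dP; rewrite mulrDl mul1r.
Qed.

Lemma starA_linl (a : C) (F F' G : AM) : starA (a *: F + F') G = a *: starA F G + starA F' G.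
Proof.
apply: close_on_eq => r0 e r00 e0; have e2 : 0 < e / 2 by rewrite divr_gt0.
have [c c0 ce] := lin_prec a e2.
have [r1 [d1 [rp1 dp1 P1]]] := starAP (a *: F + F') G r00 e2.
have [r2 [d2 [rp2 dp2 P2]]] := starAP F G r00 c0.
have [r3 [d3 [rp3 dp3 P3]]] := starAP F' G r00 c0.
have [d d0 dd1] := lin_prec a dp1.
have [c1 [c10 c1d c1d1]] := common_lt d0 dp1.
have [c2 [c20 c2d2 c2d3]] := common_lt dp2 dp3.
have [c3 [c30 c31 c32]] := common_lt c10 c20.
pose r := r1 + r2 + r3.
have rp : 0 < r by rewrite !addr_gt0.
have rr1 : r1 <= r by rewrite /r -addrA lerDl ltW // addr_gt0.
have rr2 : r2 <= r by rewrite /r addrAC [r1 + r3 + r2]addrC lerDl ltW // addr_gt0.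
have rr3 : r3 <= r by rewrite /r lerDr ltW // addr_gt0.
have [u Fu] := PM_dense s0 F rp c30; have [u' Fu'] := PM_dense s0 F' rp c30.
have [v Gv] := PM_dense s0 G rp c30; have [k kE] := PM_lin a u u'.
have h1 : close_on r0 (e / 2) (starA (a *: F + F') G) (PMred_AMred (star k v)).
  apply: P1; last by apply: close_on_le Gv => //; apply: ltW; exact: lt_trans c31 c1d1.
  rewrite (PM_linA kE); apply: close_on_le rr1 _ (close_lin a Fu Fu').
  apply: le_trans dd1; have c3d : c3 <= d by apply: ltW; exact: lt_trans c31 c1d.
  by apply: lerD => //; exact: ler_wpM2l.
have c3d2 : c3 <= d2 by apply: ltW; exact: lt_trans c32 c2d2.
have c3d3 : c3 <= d3 by apply: ltW; exact: lt_trans c32 c2d3.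
have h2 := P2 u v (close_on_le rr2 c3d2 Fu) (close_on_le rr2 c3d2 Gv).
have h3 := P3 u' v (close_on_le rr3 c3d3 Fu') (close_on_le rr3 c3d3 Gv).
have h4 := close_on_le (lexx r0) ce (close_lin a h2 h3).
rewrite [e]splitr; apply: close_on_trans h1 _.
by rewrite (PM_linA (star_linl v kE)); exact: close_on_sym.
Qed.

Lemma starA_linr (a : C) (F G G' : AM) : starA F (a *: G + G') = a *: starA F G + starA F G'.
Proof.
apply: close_on_eq => r0 e r00 e0; have e2 : 0 < e / 2 by rewrite divr_gt0.
have [c c0 ce] := lin_prec a e2.
have [r1 [d1 [rp1 dp1 P1]]] := starAP F (a *: G + G') r00 e2.
have [r2 [d2 [rp2 dp2 P2]]] := starAP F G r00 c0.
have [r3 [d3 [rp3 dp3 P3]]] := starAP F G' r00 c0.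
have [d d0 dd1] := lin_prec a dp1.
have [c1 [c10 c1d c1d1]] := common_lt d0 dp1.
have [c2 [c20 c2d2 c2d3]] := common_lt dp2 dp3.
have [c3 [c30 c31 c32]] := common_lt c10 c20.
pose r := r1 + r2 + r3.
have rp : 0 < r by rewrite !addr_gt0.
have rr1 : r1 <= r by rewrite /r -addrA lerDl ltW // addr_gt0.
have rr2 : r2 <= r by rewrite /r addrAC [r1 + r3 + r2]addrC lerDl ltW // addr_gt0.
have rr3 : r3 <= r by rewrite /r lerDr ltW // addr_gt0.
have [u Fu] := PM_dense s0 F rp c30; have [v Gv] := PM_dense s0 G rp c30.
have [v' Gv'] := PM_dense s0 G' rp c30; have [k kE] := PM_lin a v v'.
have h1 : close_on r0 (e / 2) (starA F (a *: G + G')) (PMred_AMred (star u k)).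
  apply: P1; first by apply: close_on_le Fu => //; apply: ltW; exact: lt_trans c31 c1d1.
  rewrite (PM_linA kE); apply: close_on_le rr1 _ (close_lin a Gv Gv').
  apply: le_trans dd1; have c3d : c3 <= d by apply: ltW; exact: lt_trans c31 c1d.
  by apply: lerD => //; exact: ler_wpM2l.
have c3d2 : c3 <= d2 by apply: ltW; exact: lt_trans c32 c2d2.
have c3d3 : c3 <= d3 by apply: ltW; exact: lt_trans c32 c2d3.
have h2 := P2 u v (close_on_le rr2 c3d2 Fu) (close_on_le rr2 c3d2 Gv).
have h3 := P3 u v' (close_on_le rr3 c3d3 Fu) (close_on_le rr3 c3d3 Gv').
have h4 := close_on_le (lexx r0) ce (close_lin a h2 h3).
rewrite [e]splitr; apply: close_on_trans h1 _.
by rewrite (PM_linA (star_linr u kE)); exact: close_on_sym.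
Qed.

(** The precision is chosen backwards: [P3] and [P4] bring the inner products of approximants as
    close as [P1] and [P2] demand, and then [star_assoc] identifies the two approximations. *)
Lemma starA_assoc (F G H : AM) : starA F (starA G H) = starA (starA F G) H.
Proof.
apply: close_on_eq => r0 e r00 e0; have e2 : 0 < e / 2 by rewrite divr_gt0.
have [r1 [d1 [rp1 dp1 P1]]] := starAP F (starA G H) r00 e2.
have [r2 [d2 [rp2 dp2 P2]]] := starAP (starA F G) H r00 e2.
have [r3 [d3 [rp3 dp3 P3]]] := starAP G H rp1 dp1.
have [r4 [d4 [rp4 dp4 P4]]] := starAP F G rp2 dp2.
have [c1 [c10 c11 c12]] := common_lt dp1 dp2.
have [c2 [c20 c23 c24]] := common_lt dp3 dp4.
have [c [c0 cc1 cc2]] := common_lt c10 c20.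
pose r := (r1 + r2) + (r3 + r4).
have q1 : 0 < r1 + r2 by rewrite addr_gt0.
have q2 : 0 < r3 + r4 by rewrite addr_gt0.
have rp : 0 < r by rewrite addr_gt0.
have [u Fu] := PM_dense s0 F rp c0; have [v Gv] := PM_dense s0 G rp c0.
have [w Hw] := PM_dense s0 H rp c0.
have sub (K K' : AM) : close_on r c K K' -> [/\ close_on r1 d1 K K', close_on r2 d2 K K',
    close_on r3 d3 K K' & close_on r4 d4 K K'].
  move=> KK; have l1 := close_on_weak q1 q2 cc1 KK.
  have KK' : close_on ((r3 + r4) + (r1 + r2)) c K K' by rewrite addrC.
  have l2 := close_on_weak q2 q1 cc2 KK'.
  split; first exact: close_on_weak rp1 rp2 c11 l1.
  - by apply: (close_on_weak rp2 rp1 c12); rewrite addrC.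
  - exact: close_on_weak rp3 rp4 c23 l2.
  by apply: (close_on_weak rp4 rp3 c24); rewrite addrC.
have [F1 F2 F3 F4] := sub _ _ Fu; have [G1 G2 G3 G4] := sub _ _ Gv; have [H1 H2 H3 H4] := sub _ _ Hw.
have h1 := P1 u (star v w) F1 (P3 v w G3 H3).
have h2 := P2 (star u v) w (P4 u v F4 G4) H2.
by rewrite -star_assoc in h2; rewrite [e]splitr; exact: close_on_trans h1 (close_on_sym h2).
Qed.

End ContinuousExtension.

Theorem mainTheorem2 (R : realType) (n s : nat) (hbar : Cplx R)
    (hn : (1 <= n)%N) (hs : (1 <= s <= n.+1)%N)
    (hhbar : forall k : nat, (1 <= k)%N -> hbar <> k%:R^-1) :
  exists star : PMred R n s -> PMred R n s -> PMred R n s,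
    [/\ forall f g h : PMred R n s, is_star hbar f g h <-> h = star f g,
        continuous (fun fg : PMred R n s * PMred R n s => star fg.1 fg.2) &
        exists starA : AMred R n s -> AMred R n s -> AMred R n s,
          is_product starA /\
          unique (fun m : AMred R n s -> AMred R n s -> AMred R n s =>
            continuous (fun FG : AMred R n s * AMred R n s => m FG.1 FG.2) /\
            forall f g : PMred R n s,
              m (PMred_AMred f) (PMred_AMred g) = PMred_AMred (star f g))
            starA].
Proof.
have s0 : (0 < s)%N by case/andP: hs.
have [star [starP starE]] := @star_exists R n s s0 hbar.
exists star; split=> //; first exact: (star_continuous s0 hhbar starE).
have ex (FG : AMred R n s * AMred R n s) : exists H, is_prod star FG.1 FG.2 H.
  exact: (is_prod_exists s0 hhbar starE FG.1 FG.2).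
have [stA stAP] := choice ex.
pose starA F G := stA (F, G).
have starAP F G : is_prod star F G (starA F G) := stAP (F, G).
exists starA; split.
  split=> [a F F' G|a F G G'|F G H].
  - exact: (starA_linl s0 starE starAP a F F' G).
  - exact: (starA_linr s0 starE starAP a F G G').
  exact: (starA_assoc s0 hhbar starE starAP F G H).
split=> [|m [mc mE]]; last exact: (starA_uniq s0 starAP mc mE).
by split=> [|f g]; [exact: (starA_continuous s0 starAP)|exact: (starA_PM s0 hhbar starE starAP f g)].
Qed.
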